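(* There exists $\nu_0>1$ such that for any $\nu>\nu_0$ there exist constants $\lambda=\lambda(\nu)>0$ and $C=C(\nu)\ge1$, independent of $\kappa\ge0$, such that any solution $f=f(t,x,y)$, $x\in\mathbb{T}^4$, $y\in\mathbb{T}^2$, of $$\partial_t f+u\cdot\nabla_x f=\kappa\Delta_x f+\nu\Delta_y f,\qquad f(0,\cdot)=f_0,$$ with zero average in $x$ (that is, $\int_{\mathbb{T}^4}f\,dx=0$ for all $y$) satisfies $$\|f(t)\|_{\mathcal H^1(\mathbb{T}^2\times\mathbb{T}^2\times\mathbb{T}^2)}\le Ce^{-\lambda t}\|f_0\|_{\mathcal H^1(\mathbb{T}^2\times\mathbb{T}^2\times\mathbb{T}^2)}\qquad\text{for all }t\ge0 .$$
   Context: $\mathbb{T}=\mathbb{R}/2\pi\mathbb{Z}$, $x=(x_1,x_2,x_3,x_4)\in\mathbb{T}^4=\mathbb{T}^2\times\mathbb{T}^2$, $y=(y_1,y_2)\in\mathbb{T}^2$, $\partial_i=\partial_{x_i}$, and $$u(x,y)=\begin{pmatrix}\sin(x_2-y_2)\\ \sin(x_1-y_1)\\ \sin(x_4-y_2)\\ \sin(x_3-y_1)\end{pmatrix}.$$ The norm is (with $\|\cdot\|$ the $L^2(\mathbb{T}^6)$ norm) $$\|f\|_{\mathcal H^1}=\|f\|+\|\nabla_yf\|+\|\partial_1f+\partial_3f\|+\|\partial_2f+\partial_4f\|+\|d_{\mathbb D}(\partial_3f-\partial_1f)\|+\|d_{\mathbb D}(\partial_4f-\partial_2f)\|+\sqrt\kappa\,\|\nabla_xf\|,$$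 where $$d_{\mathbb D}(x)=\sqrt{\sin^2\left(\tfrac{x_3-x_1}{2}\right)+\sin^2\left(\tfrac{x_4-x_2}{2}\right)} .$$ *)

(* Defs.v *)
From HB Require Import structures.
From mathcomp Require Import all_boot all_order all_algebra.
From mathcomp Require Import all_classical all_reals all_analysis.

Set Implicit Arguments.
Unset Strict Implicit.
Unset Printing Implicit Defensive.
Import Order.TTheory GRing.Theory Num.Theory.
Import numFieldNormedType.Exports.

Local Open Scope classical_set_scope.
Local Open Scope ring_scope.

(* Functions on T^6 = (T^2 * T^2) * T^2 are written on the covering space
   R^6 = (R^2 * R^2) * R^2; a point is (((x1, x2), (x3, x4)), (y1, y2)). *)
Notation point6 R := (((R * R) * (R * R)) * (R * R))%type.

Section Coordinates.
Variable R : realType.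
Implicit Types z : point6 R.

Definition x1 z : R := z.1.1.1.
Definition x2 z : R := z.1.1.2.
Definition x3 z : R := z.1.2.1.
Definition x4 z : R := z.1.2.2.
Definition y1 z : R := z.2.1.
Definition y2 z : R := z.2.2.

Definition ex1 : point6 R := (((1, 0), (0, 0)), (0, 0)).
Definition ex2 : point6 R := (((0, 1), (0, 0)), (0, 0)).
Definition ex3 : point6 R := (((0, 0), (1, 0)), (0, 0)).
Definition ex4 : point6 R := (((0, 0), (0, 1)), (0, 0)).
Definition ey1 : point6 R := (((0, 0), (0, 0)), (1, 0)).
Definition ey2 : point6 R := (((0, 0), (0, 0)), (0, 1)).

Definition xbasis := [:: ex1; ex2; ex3; ex4].
Definition ybasis := [:: ey1; ey2].

Definition u1 z : R := sin (x2 z - y2 z).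
Definition u2 z : R := sin (x1 z - y1 z).
Definition u3 z : R := sin (x4 z - y2 z).
Definition u4 z : R := sin (x3 z - y1 z).

Definition dD z : R :=
  Num.sqrt (sin ((x3 z - x1 z) / 2) ^+ 2 + sin ((x4 z - x2 z) / 2) ^+ 2).

End Coordinates.

Arguments ex1 {R}.
Arguments ex2 {R}.
Arguments ex3 {R}.
Arguments ex4 {R}.
Arguments ey1 {R}.
Arguments ey2 {R}.
Arguments xbasis {R}.
Arguments ybasis {R}.

(* The library's finite-measure instance for m1 \x m2 is only declared for
   pairs of subprobabilities. *)
Section FiniteProductMeasure.
Context d1 d2 (T1 : measurableType d1) (T2 : measurableType d2) (R : realType).
Variables (m1 : {finite_measure set T1 -> \bar R})
          (m2 : {finite_measure set T2 -> \bar R}).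

Definition fin_product : set (T1 * T2) -> \bar R := (m1 \x m2)%E.

HB.instance Definition _ :=
  Measure.copy fin_product ((m1 \x m2)%E : {measure set _ -> \bar R}).

Let fin_product_fin : fin_num_fun fin_product.
Proof.
move=> U mU; rewrite ge0_fin_numE ?measure_ge0//.
rewrite (@le_lt_trans _ _ (fin_product setT))//.
  by rewrite le_measure ?inE.
rewrite -setXTT /fin_product product_measure1E//.
by rewrite lte_mul_pinfty// ?fin_num_measure// ltey_eq fin_num_measure.
Qed.

HB.instance Definition _ :=
  Measure_isFinite.Build _ _ _ fin_product fin_product_fin.

End FiniteProductMeasure.

Section TorusMeasure.
Variable R : realType.

Notation mR := (measurableTypeR R).
Definition lebR : {measure set mR -> \bar R} := lebesgue_measure.

Lemma lebesgue_cell_lty : (lebR `[0%R, (2 * pi)%R]%classic < +oo)%E.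
Proof. by rewrite /lebR /= lebesgue_measure_itv; case: ifP => _; rewrite ltry. Qed.

(* Lebesgue measure on the fundamental cell [0, 2 pi]. L^2(T^6) is thus
   represented as L^2 of the cell: the values of a function off the cell play
   no role, and periodicity is required of the test functions only. *)
Definition muT : {finite_measure set mR -> \bar R} :=
  @mfrestr _ mR R _ lebR
    (measurable_itv `[0%R, (2 * pi)%R]) lebesgue_cell_lty.
Definition muT2 : {finite_measure set (mR * mR)%type -> \bar R} :=
  fin_product muT muT.
Definition muT4 : {finite_measure set ((mR * mR) * (mR * mR))%type -> \bar R} :=
  fin_product muT2 muT2.
Definition muT6 : {finite_measure set (point6 mR) -> \bar R} :=
  fin_product muT4 muT2.

End TorusMeasure.

Section WeakFormulation.
Variable R : realType.
Implicit Types (f g w phi : point6 R -> R) (v : point6 R).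

Definition inL2 f := f \in Lfun (muT6 R) 2%:E.

Definition normL2 f : \bar R := ('N[muT6 R]_2%:E[EFin \o f])%E.

Definition smooth phi := forall (s : seq (point6 R)) (z : point6 R),
  differentiable (foldr (fun v g => 'D_v g) phi s) z.

Definition periodic phi := forall v z,
  v \in xbasis ++ ybasis -> phi (z + (2 * pi) *: v) = phi z.

Definition test_function phi := smooth phi /\ periodic phi.

(* g is the product, in the sense of distributions on T^6, of the bounded
   Lipschitz function w with the directional derivative of f along v, i.e.
   <w D_v f, phi> = - <f, D_v (w phi)>.  For w = dD the derivative on the right
   exists off the null set {dD = 0}; its values there are irrelevant. *)
Definition weak_derivative w v f g := inL2 g /\
  forall phi, test_function phi ->
    \int[muT6 R]_z (g z * phi z) =
    - \int[muT6 R]_z (f z * 'D_v (fun z' => w z' * phi z') z).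

(* ||w D_v f||, equal to +oo when w D_v f is not in L^2: g is unique up to a
   null set, so that the set below has at most one element. *)
Definition normD w v f : \bar R :=
  ereal_inf [set normL2 g | g in [set g | weak_derivative w v f g]].

Definition norm_grad (basis : seq (point6 R)) f : \bar R :=
  sqrte (\sum_(v <- basis) normD (cst 1%R) v f ^+ 2)%E.

Definition normH1 (kappa : R) f : \bar R :=
  (normL2 f + norm_grad ybasis f
   + normD (cst 1%R) (ex1 + ex3)%R f + normD (cst 1%R) (ex2 + ex4)%R f
   + normD (@dD R) (ex3 - ex1)%R f + normD (@dD R) (ex4 - ex2)%R f
   + (Num.sqrt kappa)%:E * norm_grad xbasis f)%E.

(* Formal adjoint of - u . grad_x + kappa Delta_x + nu Delta_y. *)
Definition adjoint (kappa nu : R) phi (z : point6 R) : R :=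
  'D_ex1 (fun z' => u1 z' * phi z') z + 'D_ex2 (fun z' => u2 z' * phi z') z
  + 'D_ex3 (fun z' => u3 z' * phi z') z + 'D_ex4 (fun z' => u4 z' * phi z') z
  + kappa * (\sum_(v <- xbasis) 'D_v ('D_v phi) z)
  + nu * (\sum_(v <- ybasis) 'D_v ('D_v phi) z).

(* Distributional solutions in C([0, +oo); L^2(T^6)); only the times t >= 0
   matter. *)
Definition solution (kappa nu : R) (f0 : point6 R -> R)
    (f : R -> point6 R -> R) :=
  [/\ forall t : R, 0 <= t -> inL2 (f t),
      forall t : R, 0 <= t ->
        normL2 (f s \- f t) @[s --> within [set s | 0 <= s] (nbhs t)] --> 0%E,
      f 0 = f0 &
      forall phi, test_function phi -> forall t : R, 0 < t ->
        is_derive t 1 (fun s => \int[muT6 R]_z (f s z * phi z))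
          (\int[muT6 R]_z (f t z * adjoint kappa nu phi z))].

Definition zero_x_average (f : point6 R -> R) :=
  {ae muT2 R, forall y, \int[muT4 R]_x f (x, y) = 0}.

End WeakFormulation.

(* Main.v *)
(** Write [u . grad_x] through the Hamiltonian fields [L_n], the sum over both
    particles of the fields of [exp (i n . (x - y))].  They satisfy
    [[L_a, L_b] = det (a, b) L_(a + b)], and commuting with [d/dy] changes [L_n] by
    a multiple of itself.  Hence, starting from the dissipated [nabla_y f], brackets
    with the transport operator [T] generate [L_n] for the eight frequencies
    [(1,0), (0,1), (1,1), (1,-1), (2,1), (2,-1), (1,2), (1,-2)].  These eight fields
    control [d_1 + d_3], [d_2 + d_4] and [dD (d_3 - d_1)], [dD (d_4 - d_2)]: two points
    are separated by these frequencies unless they coincide.  For large [nu], a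
    quadratic form [|f|^2 + nu B (|nabla_y f|^2 + sum |L_n f|^2) + kappa |nabla_x f|^2 / K]
    plus small mixed terms [<Z f, [Z, T] f>] decays exponentially; the zero average in
    [x] enters through a Poincare inequality, itself a discrete Hardy inequality.

    The estimate is made for finitely supported sequences on Z^6.  The real cosine
    and sine coefficients of [f] solve the same real system.  Logarithmically
    slowly varying cutoffs in frequency, with commutator [O(1/W)], extend the decay
    to square summable solutions.  The H^1 norm is then compared with its Fourier
    counterpart, the weight [dD = sqrt (sum_e sin^2 (e . z / 2))] being handled by
    half-integer frequencies and the regularization [sqrt (dD^2 + d^2)]. *)

From HB Require Import structures.
From mathcomp Require Import all_boot all_order all_algebra.
From mathcomp Require Import all_classical all_reals all_analysis.
From mathcomp Require Import measurable_realfun.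
From mathcomp Require Import ring lra zify.
Require Import Defs.
Set Implicit Arguments.
Unset Strict Implicit.
Unset Printing Implicit Defensive.
Import Order.TTheory GRing.Theory Num.Theory.
Import numFieldNormedType.Exports.
Local Open Scope classical_set_scope.
Local Open Scope ring_scope.

(** In frequency a sine contributes 1/(2i) and a derivative i, so transport has real coefficients,
    and real sequences without conjugation suffice. The frequencies (1,0), (0,1), (1,1), (1,-1)
    alone do not control the gradient: at x3 = x1, x4 = x2 + pi their fields span three directions
    only, and (1,2), (1,-2) restore d_1 + d_3. Products <L_n f, L_m f> with n <> m have no sign; as
    the y-frequencies of the fields differ, they can be traded for a y-derivative of a field, and
    large nu pays for it. A solution is only square integrable, so its energy at positive times is
    not known to be finite. The commutator with a cutoff is bounded by the energy behind a wider
    cutoff; a geometrically weighted sum over ever wider cutoffs closes this circle, because the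
    weights beat the crude growth of the last term. Constants depending on kappa occur only in
    errors that vanish in the limit of wide cutoffs. The distance dD is not smooth where the two
    particles meet; that set is null, and division by dD is a dominated limit of products with 1 /
    sqrt (dD^2 + d^2). *)

Definition Z6 : Type := ((int * int) * (int * int)) * (int * int).
HB.instance Definition _ := GRing.Zmodule.on Z6.

(** * Finitely supported sequences on Z^6 *)

Section FiniteSequences.
Variable R : realType.

Definition has_finite_support (f : Z6 -> R) := finite_set [set K | f K != 0].

(** The Boolean reflection of the support condition makes its proofs irrelevant, so that equality of
    sequences is pointwise equality ([fseq_ext]). *)
Record fseq := Fseq {
  fseq_fun :> Z6 -> R;
  _ : `[< has_finite_support fseq_fun >] }.

HB.instance Definition _ := [isSub for fseq_fun].
HB.instance Definition _ := gen_eqMixin fseq.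
HB.instance Definition _ := gen_choiceMixin fseq.

Implicit Types f g h : fseq.

Lemma fseqP f : has_finite_support f.
Proof. by apply/asboolP; case: f. Qed.

Lemma fseq_ext f g : (forall K, f K = g K) -> f = g.
Proof. by move=> fg; apply: val_inj; apply/funext. Qed.

Lemma mk_fseq (F : Z6 -> R) : has_finite_support F -> `[< has_finite_support F >].
Proof. by move=> ?; apply/asboolP. Qed.

Lemma hfs_sub (A : set Z6) (F : Z6 -> R) : finite_set A ->
  (forall K, ~ A K -> F K = 0) -> has_finite_support F.
Proof.
move=> fA FA; apply: sub_finite_set fA => K /= FK.
by apply: contrapT => /FA F0; rewrite F0 eqxx in FK.
Qed.

Lemma hfs0 : has_finite_support (fun=> 0).
Proof. by apply: (hfs_sub (A := set0)). Qed.

Lemma fseq_out f K : ~ [set K | f K != 0] K -> f K = 0.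
Proof. by move=> /= /negP; rewrite negbK => /eqP. Qed.

Lemma hfs_add f g : has_finite_support (fun K => f K + g K).
Proof.
apply: (hfs_sub (A := [set K | f K != 0] `|` [set K | g K != 0])).
  by rewrite finite_setU; split; exact: fseqP.
by move=> K /not_orP[/fseq_out -> /fseq_out ->]; rewrite addr0.
Qed.

Lemma hfs_mul (c : Z6 -> R) f : has_finite_support (fun K => c K * f K).
Proof.
by apply: (hfs_sub (fseqP f)) => K /fseq_out ->; rewrite mulr0.
Qed.

Lemma hfs_opp f : has_finite_support (fun K => - f K).
Proof.
by apply: (hfs_sub (fseqP f)) => K /fseq_out ->; rewrite oppr0.
Qed.

Lemma hfs_shift (s : Z6) f : has_finite_support (fun K => f (K - s)).
Proof.
apply: (hfs_sub (A := (fun K => K + s) @` [set K | f K != 0])).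
  by apply: finite_image; exact: fseqP.
move=> K H; apply: fseq_out => /= fK; apply: H; exists (K - s) => //.
by rewrite subrK.
Qed.

Definition fseq0 := Fseq (mk_fseq hfs0).
Definition fseq_add f g := Fseq (mk_fseq (hfs_add f g)).
Definition fseq_opp f := Fseq (mk_fseq (hfs_opp f)).
Definition fseq_scale (c : R) f := Fseq (mk_fseq (hfs_mul (fun=> c) f)).

Lemma fseq_addA : associative fseq_add.
Proof. by move=> f g h; apply: fseq_ext => K /=; rewrite addrA. Qed.
Lemma fseq_addC : commutative fseq_add.
Proof. by move=> f g; apply: fseq_ext => K /=; rewrite addrC. Qed.
Lemma fseq_add0 : left_id fseq0 fseq_add.
Proof. by move=> f; apply: fseq_ext => K /=; rewrite add0r. Qed.
Lemma fseq_addN : left_inverse fseq0 fseq_opp fseq_add.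
Proof. by move=> f; apply: fseq_ext => K /=; rewrite addNr. Qed.

HB.instance Definition _ :=
  GRing.isZmodule.Build fseq fseq_addA fseq_addC fseq_add0 fseq_addN.

Lemma fseq_scaleA a b f : fseq_scale a (fseq_scale b f) = fseq_scale (a * b) f.
Proof. by apply: fseq_ext => K /=; rewrite mulrA. Qed.
Lemma fseq_scale1 : left_id 1 fseq_scale.
Proof. by move=> f; apply: fseq_ext => K /=; rewrite mul1r. Qed.
Lemma fseq_scaleDr : right_distributive fseq_scale +%R.
Proof. by move=> c f g; apply: fseq_ext => K /=; rewrite mulrDr. Qed.
Lemma fseq_scaleDl f : {morph fseq_scale^~ f : a b / a + b}.
Proof. by move=> a b; apply: fseq_ext => K /=; rewrite mulrDl. Qed.

HB.instance Definition _ := GRing.Zmodule_isLmodule.Build R fseq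
  fseq_scaleA fseq_scale1 fseq_scaleDr fseq_scaleDl.

Lemma fseqD f g K : (f + g) K = f K + g K. Proof. by []. Qed.
Lemma fseqN f K : (- f) K = - f K. Proof. by []. Qed.
Lemma fseqZ a f K : (a *: f) K = a * f K. Proof. by []. Qed.
Lemma fseq00 K : (0 : fseq) K = 0. Proof. by []. Qed.
Definition fseqE := (fseqD, fseqN, fseqZ, fseq00).

(* Fourier multipliers, and multiplication by the character of frequency s. *)
Fact fseq_key : unit. Proof. by []. Qed.
Definition mult (c : Z6 -> R) f : fseq :=
  locked_with fseq_key (Fseq (mk_fseq (hfs_mul c f))).
Definition sh (s : Z6) f : fseq :=
  locked_with fseq_key (Fseq (mk_fseq (hfs_shift s f))).

Lemma multE c f K : mult c f K = c K * f K. Proof. by rewrite /mult unlock. Qed.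
Lemma shE s f K : sh s f K = f (K - s). Proof. by rewrite /sh unlock. Qed.

Lemma mult_is_linear c : linear (mult c).
Proof. by move=> a f g; apply: fseq_ext => K; rewrite !(fseqE, multE); ring. Qed.
HB.instance Definition _ c :=
  GRing.isLinear.Build R fseq fseq *:%R (mult c) (mult_is_linear c).

Lemma sh_is_linear s : linear (sh s).
Proof. by move=> a f g; apply: fseq_ext => K; rewrite !(fseqE, shE). Qed.
HB.instance Definition _ s :=
  GRing.isLinear.Build R fseq fseq *:%R (sh s) (sh_is_linear s).

Lemma shD s t f : sh s (sh t f) = sh (s + t) f.
Proof. by apply: fseq_ext => K; rewrite !shE opprD addrA. Qed.
Lemma sh0 f : sh 0 f = f.
Proof. by apply: fseq_ext => K; rewrite !shE subr0. Qed.

(** No conjugate occurs: cosine and sine coefficients are kept as two real sequences. The sum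
    reduces, by [ip_finE], to any list covering the support of one factor. *)
Definition ip f g : R := \sum_(K \in [set: Z6]) f K * g K.

Lemma ip_finE (s : seq Z6) f g : uniq s -> (forall K, K \notin s -> f K = 0) ->
  ip f g = \sum_(K <- s) f K * g K.
Proof.
move=> us fs; rewrite /ip -(fsbig_widen [set` s] setT)//; last first.
  move=> K [_ /= /negP Ks]; rewrite fs ?mul0r//.
by apply/esym; exact: fsbig_seq.
Qed.

Lemma finite_seq_support f : exists2 s : seq Z6, uniq s & forall K, K \notin s -> f K = 0.
Proof.
have /finite_seqP[X XE] := fseqP f.
exists (undup X) => [|K]; first exact: undup_uniq.
rewrite mem_undup => /negP KX; apply: fseq_out => fK; apply: KX.
by have : [set` X] K by rewrite -XE.
Qed.

Lemma ipC f g : ip f g = ip g f.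
Proof. by apply: eq_fsbigr => K _; rewrite mulrC. Qed.

Lemma ipDl f g h : ip (f + g) h = ip f h + ip g h.
Proof.
have [s us fs] := finite_seq_support f; have [t ut gt] := finite_seq_support g.
have H K : K \notin undup (s ++ t) -> f K = 0 /\ g K = 0.
  by rewrite mem_undup mem_cat negb_or => /andP[/fs -> /gt ->].
rewrite !(@ip_finE (undup (s ++ t))) ?undup_uniq//; [|by move=> K /H[]..|].
  by rewrite -big_split/=; apply: eq_bigr => K _; rewrite mulrDl.
by move=> K /H[fK gK]; rewrite fseqD fK gK addr0.
Qed.

Lemma ipZl a f h : ip (a *: f) h = a * ip f h.
Proof.
by rewrite /ip mulr_fsumr; apply: eq_fsbigr => K _; rewrite fseqZ mulrA.
Qed.

Lemma ipNl f h : ip (- f) h = - ip f h.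
Proof. by rewrite -scaleN1r ipZl mulN1r. Qed.
Lemma ipDr f g h : ip h (f + g) = ip h f + ip h g.
Proof. by rewrite ipC ipDl ![ip _ h]ipC. Qed.
Lemma ipZr a f h : ip h (a *: f) = a * ip h f.
Proof. by rewrite ipC ipZl ipC. Qed.
Lemma ipNr f h : ip h (- f) = - ip h f.
Proof. by rewrite ipC ipNl ipC. Qed.
Lemma ip0l f : ip 0 f = 0.
Proof. by rewrite -(scale0r (0 : fseq)) ipZl mul0r. Qed.
Lemma ip0r f : ip f 0 = 0.
Proof. by rewrite ipC ip0l. Qed.
Definition ipE := (ipDl, ipDr, ipNl, ipNr, ipZl, ipZr).

Lemma ip_ge0 f : 0 <= ip f f.
Proof.
have [s us fs] := finite_seq_support f; rewrite (ip_finE _ us fs) sumr_ge0//.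
by move=> K _; rewrite -expr2 sqr_ge0.
Qed.

Lemma ip_mult c f g : ip (mult c f) g = ip f (mult c g).
Proof. by apply: eq_fsbigr => K _; rewrite !multE; ring. Qed.

Lemma ip_sh s f g : ip (sh s f) (sh s g) = ip f g.
Proof.
rewrite /ip [RHS](reindex_fsbigT (fun K : Z6 => K - s))/=.
  by apply: eq_fsbigr => K _; rewrite !shE.
by apply: (@Bijective _ _ _ (fun K => K + s)) => K; rewrite ?subrK ?addrK.
Qed.

Lemma ip_sh_adj s f g : ip (sh s f) g = ip f (sh (- s) g).
Proof. by rewrite -[in RHS](ip_sh s) shD subrr sh0. Qed.

Definition nrm f := Num.sqrt (ip f f).

Lemma nrm_ge0 f : 0 <= nrm f. Proof. exact: sqrtr_ge0. Qed.
Lemma sqr_nrm f : nrm f ^+ 2 = ip f f. Proof. by rewrite sqr_sqrtr// ip_ge0. Qed.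

Lemma ip_quad f g c : ip (f + c *: g) (f + c *: g) = ip f f + 2 * c * ip f g + c ^+ 2 * ip g g.
Proof. by rewrite !(ipDl, ipDr, ipZl, ipZr) (ipC g f); ring. Qed.

Lemma cauchy_schwarz f g : `|ip f g| <= nrm f * nrm g.
Proof.
have H : ip f g ^+ 2 <= ip f f * ip g g.
  have [g0|gn] := eqVneq (ip g g) 0.
    have [->|n0] := eqVneq (ip f g) 0; first by rewrite expr0n mulr_ge0// ip_ge0.
    (* If g has norm zero, this multiple of g would make the squared norm of the sum equal to
       [- ip f f - 2], which is negative. *)
    have := ip_ge0 (f + (- (ip f f + 1) / (ip f g)) *: g); have := ip_ge0 f.
    by rewrite ip_quad g0 mulr0 addr0 -mulrA divfK// => ? ?; lra.
  have gp : 0 < ip g g by rewrite lt_def gn ip_ge0.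
  have := ip_ge0 (f + (- ip f g / ip g g) *: g).
  have -> : ip (f + (- ip f g / ip g g) *: g) (f + (- ip f g / ip g g) *: g) =
     ip f f - ip f g ^+ 2 / ip g g by rewrite ip_quad; field.
  by rewrite subr_ge0 ler_pdivrMr.
rewrite -sqrtrM ?ip_ge0// -sqrtr_sqr ler_wsqrtr//.
Qed.

Lemma ip_le f g : ip f g <= nrm f * nrm g.
Proof. exact: le_trans (ler_norm _) (cauchy_schwarz _ _). Qed.

Lemma nrmD f g : nrm (f + g) <= nrm f + nrm g.
Proof.
rewrite -(@ler_pXn2r _ 2) ?nnegrE ?addr_ge0 ?nrm_ge0//.
rewrite sqr_nrm sqrrD !sqr_nrm !ipE (ipC g f).
have := ip_le f g; lra.
Qed.

Lemma nrmN f : nrm (- f) = nrm f.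
Proof. by rewrite /nrm ipNl ipNr opprK. Qed.
Lemma nrmB f g : nrm (f - g) <= nrm f + nrm g.
Proof. by rewrite -(nrmN g) nrmD. Qed.
Lemma nrmZ a f : nrm (a *: f) = `|a| * nrm f.
Proof. by rewrite /nrm !ipE mulrA -expr2 sqrtrM ?sqr_ge0// sqrtr_sqr. Qed.
Lemma nrm_sh s f : nrm (sh s f) = nrm f.
Proof. by rewrite /nrm ip_sh. Qed.

End FiniteSequences.

(** * Vector fields and commutators *)

Section Monomials.
Variable R : realType.
Notation V := (fseq R).
Implicit Types (f g h : V) (s t K : Z6) (c d : Z6 -> R).

(** The operator exp(i s.z) c(D). Such operators are closed under composition and adjoints, and
    commutation relations reduce to identities between symbols at a shifted frequency. *)
Definition mono s c f : V := sh s (mult c f).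

Lemma monoE s c f K : mono s c f K = c (K - s) * f (K - s).
Proof. by rewrite /mono shE multE. Qed.

Lemma mono_is_linear s c : linear (mono s c).
Proof. by move=> a f g; rewrite /mono !linearP. Qed.
HB.instance Definition _ s c :=
  GRing.isLinear.Build R V V *:%R (mono s c) (mono_is_linear s c).

Lemma monoM s t c d f :
  mono s c (mono t d f) = mono (s + t) (fun K => c (K + t) * d K) f.
Proof.
apply: fseq_ext => K; rewrite !monoE opprD addrA.
by rewrite (_ : K - s - t + t = K - s) ?subrK// mulrA.
Qed.

Lemma mono_adj s c f g :
  ip (mono s c f) g = ip f (mono (- s) (fun K => c (K - s)) g).
Proof.
rewrite /mono ip_sh_adj ip_mult; congr ip; apply: fseq_ext => K.
by rewrite !(multE, shE) opprK addrK.
Qed.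

Definition additive_form (m : Z6 -> R) := forall s t, m (s + t) = m s + m t.

(** [A] raises the frequency [m] by [al], that is [m, A] = al A. For a vector field this measures
    how far it is from commuting with a derivative along a coordinate. *)
Definition has_charge (m : Z6 -> R) (al : R) (A : V -> V) :=
  forall f, A (mult m f) = mult m (A f) - al *: A f.

Lemma additive_formB m s t : additive_form m -> m (s - t) = m s - m t.
Proof. by move=> mD; rewrite -[in RHS](subrK t s) [in RHS]mD addrK. Qed.

Lemma mono_charge m s c : additive_form m -> has_charge m (m s) (mono s c).
Proof.
move=> mD f; apply: fseq_ext => K.
by rewrite !fseqE !(multE, monoE) (additive_formB K s mD); ring.
Qed.

(* [A* B] changes the frequency [m] by [be - al]; these are the first and the
   second commutator of [A* B] with the multiplier [m]. *)
Lemma charge1 m al be (A B : V -> V) f : has_charge m al A -> has_charge m be B ->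
  ip (A (mult m f)) (B f) - ip (A f) (B (mult m f)) = (be - al) * ip (A f) (B f).
Proof.
by move=> cA cB; rewrite cA cB !(ipDl, ipDr, ipNl, ipNr, ipZl, ipZr) ip_mult; ring.
Qed.

Lemma charge2 m al be (A B : V -> V) f : has_charge m al A -> has_charge m be B ->
  ip (A (mult m (mult m f))) (B f) + ip (A f) (B (mult m (mult m f))) =
  2 * ip (A (mult m f)) (B (mult m f)) + (be - al) ^+ 2 * ip (A f) (B f).
Proof.
move=> cA cB; rewrite !(cA, cB) !(linearD, linearN, linearZ)/=.
by rewrite !(ipDl, ipDr, ipNl, ipNr, ipZl, ipZr) !ip_mult; ring.
Qed.

Definition kx1 K : R := K.1.1.1%:~R.
Definition kx2 K : R := K.1.1.2%:~R.
Definition kx3 K : R := K.1.2.1%:~R.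
Definition kx4 K : R := K.1.2.2%:~R.
Definition ky1 K : R := K.2.1%:~R.
Definition ky2 K : R := K.2.2%:~R.

Lemma kx1D : additive_form kx1. Proof. by move=> s t; rewrite /kx1 -intrD. Qed.
Lemma kx2D : additive_form kx2. Proof. by move=> s t; rewrite /kx2 -intrD. Qed.
Lemma kx3D : additive_form kx3. Proof. by move=> s t; rewrite /kx3 -intrD. Qed.
Lemma kx4D : additive_form kx4. Proof. by move=> s t; rewrite /kx4 -intrD. Qed.
Lemma ky1D : additive_form ky1. Proof. by move=> s t; rewrite /ky1 -intrD. Qed.
Lemma ky2D : additive_form ky2. Proof. by move=> s t; rewrite /ky2 -intrD. Qed.

End Monomials.
Arguments kx1 {R}. Arguments kx2 {R}. Arguments kx3 {R}. Arguments kx4 {R}.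
Arguments ky1 {R}. Arguments ky2 {R}.

Section Fields.
Variable R : realType.
Notation V := (fseq R).
Implicit Types (f g h : V) (s t K : Z6) (n a b : int * int).

Definition vu n : Z6 := (((n.1, n.2), (0, 0)), (- n.1, - n.2)).
Definition vp n : Z6 := (((0, 0), (n.1, n.2)), (- n.1, - n.2)).
(** Symbol of n2 d_1 - n1 d_2 divided by i. It vanishes at [vu n], as a Hamiltonian field is
    divergence free; so the order of multiplier and shift in [Lu n] is immaterial. *)
Definition au n K : R := n.2%:~R * kx1 K - n.1%:~R * kx2 K.
Definition ap n K : R := n.2%:~R * kx3 K - n.1%:~R * kx4 K.

(* The Hamiltonian vector field of exp(i (n1 (x1 - y1) + n2 (x2 - y2))) in the
   variables (x1, x2), and its copy in the variables (x3, x4). *)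
Definition Lu n : V -> V := mono (vu n) (au n).
Definition Lp n : V -> V := mono (vp n) (ap n).
Fact L_key : unit. Proof. by []. Qed.
Definition L n f : V := locked_with L_key (Lu n f + Lp n f).
Lemma L_def n f : L n f = Lu n f + Lp n f. Proof. by rewrite /L unlock. Qed.

Lemma Lu_is_linear n : linear (Lu n). Proof. exact: mono_is_linear. Qed.
HB.instance Definition _ n := GRing.isLinear.Build R V V *:%R (Lu n) (Lu_is_linear n).
Lemma Lp_is_linear n : linear (Lp n). Proof. exact: mono_is_linear. Qed.
HB.instance Definition _ n := GRing.isLinear.Build R V V *:%R (Lp n) (Lp_is_linear n).
Lemma L_is_linear n : linear (L n).
Proof. by move=> c f g; rewrite !L_def !linearP scalerDr addrACA. Qed.
HB.instance Definition _ n := GRing.isLinear.Build R V V *:%R (L n) (L_is_linear n).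

Lemma vuD a b : vu (a + b) = vu a + vu b.
Proof. by rewrite /vu/= !opprD; congr (_, _); congr (_, _); rewrite ?addr0. Qed.
Lemma vpD a b : vp (a + b) = vp a + vp b.
Proof. by rewrite /vp/= !opprD; congr (_, _); congr (_, _); rewrite ?addr0. Qed.
Lemma vuN a : vu (- a) = - vu a.
Proof. by rewrite /vu/= ; congr (_, _); congr (_, _); rewrite ?oppr0. Qed.
Lemma vpN a : vp (- a) = - vp a.
Proof. by rewrite /vp/= ; congr (_, _); congr (_, _); rewrite ?oppr0. Qed.

Lemma auD n s t : au n (s + t) = au n s + au n t.
Proof. by rewrite /au kx1D kx2D; ring. Qed.
Lemma apD n s t : ap n (s + t) = ap n s + ap n t.
Proof. by rewrite /ap kx3D kx4D; ring. Qed.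

Definition cross a b : R := (a.2 * b.1 - a.1 * b.2)%:~R.

Lemma au_vu a b : au a (vu b) = cross a b.
Proof. by rewrite /au /cross /kx1 /kx2 /vu/= intrB !intrM. Qed.
Lemma au_vp a b : au a (vp b) = 0.
Proof. by rewrite /au /kx1 /kx2 /vp/= !mulr0 subr0. Qed.
Lemma ap_vp a b : ap a (vp b) = cross a b.
Proof. by rewrite /ap /cross /kx3 /kx4 /vp/= intrB !intrM. Qed.
Lemma ap_vu a b : ap a (vu b) = 0.
Proof. by rewrite /ap /kx3 /kx4 /vu/= !mulr0 subr0. Qed.
Lemma crossC a b : cross b a = - cross a b.
Proof. by rewrite /cross -intrN; congr (_%:~R); ring. Qed.
Lemma au_add a b K : au (a + b) K = au a K + au b K.
Proof. by rewrite /au/= !intrD; ring. Qed.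
Lemma ap_add a b K : ap (a + b) K = ap a K + ap b K.
Proof. by rewrite /ap/= !intrD; ring. Qed.
Lemma au_opp a K : au (- a) K = - au a K.
Proof. by rewrite /au/= !intrN; ring. Qed.
Lemma ap_opp a K : ap (- a) K = - ap a K.
Proof. by rewrite /ap/= !intrN; ring. Qed.

Lemma Lu_comm a b f : Lu a (Lu b f) - Lu b (Lu a f) = cross a b *: Lu (a + b) f.
Proof.
apply: fseq_ext => K; rewrite /Lu !monoM fseqE fseqN fseqZ !monoE (addrC (vu b)) vuD.
by set X := K - _; rewrite au_add !auD !au_vu (crossC a b); ring.
Qed.
Lemma Lp_comm a b f : Lp a (Lp b f) - Lp b (Lp a f) = cross a b *: Lp (a + b) f.
Proof.
apply: fseq_ext => K; rewrite /Lp !monoM fseqE fseqN fseqZ !monoE (addrC (vp b)) vpD.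
by set X := K - _; rewrite ap_add !apD !ap_vp (crossC a b); ring.
Qed.
Lemma LuLp_comm a b f : Lu a (Lp b f) = Lp b (Lu a f).
Proof.
apply: fseq_ext => K; rewrite /Lp /Lu !monoM !monoE (addrC (vp b)).
by set X := K - _; rewrite auD apD au_vp ap_vu; ring.
Qed.

(** Fields of different particles commute ([LuLp_comm]), and each particle satisfies the bracket
    relation of the exponentials, so the sum over both satisfies it with the same constant. *)
Lemma L_comm a b f : L a (L b f) = L b (L a f) + cross a b *: L (a + b) f.
Proof.
rewrite !L_def scalerDr -Lu_comm -Lp_comm !linearD/= !LuLp_comm.
by apply: fseq_ext => K; rewrite !fseqE; ring.
Qed.

Lemma crossnN a : cross a (- a) = 0.
Proof. by rewrite /cross (_ : _ - _ = 0)//=; ring. Qed.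

Lemma Lu_adj n f g : ip (Lu n f) g = - ip f (Lu (- n) g).
Proof.
rewrite /Lu mono_adj -ipNr; congr ip; apply: fseq_ext => K.
rewrite fseqE !monoE -vuN; set X := K - _.
by rewrite au_opp auD au_vu crossnN; ring.
Qed.
Lemma Lp_adj n f g : ip (Lp n f) g = - ip f (Lp (- n) g).
Proof.
rewrite /Lp mono_adj -ipNr; congr ip; apply: fseq_ext => K.
rewrite fseqE !monoE -vpN; set X := K - _.
by rewrite ap_opp apD ap_vp crossnN; ring.
Qed.
Lemma L_adj n f g : ip (L n f) g = - ip f (L (- n) g).
Proof. by rewrite !L_def ipDl Lu_adj Lp_adj ipDr opprD. Qed.

(** [L (- n)] is minus the adjoint of [L n] and commutes with it because det (n, -n) = 0; a normal
    operator and its adjoint have equal norms on each vector. Hence only one of n and -n has to be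
    followed. *)
Lemma nrm_LN n f : nrm (L (- n) f) = nrm (L n f).
Proof.
rewrite /nrm; congr Num.sqrt; rewrite !L_adj opprK L_comm.
by rewrite crossnN scale0r addr0.
Qed.

Lemma Lu_charge (m : Z6 -> R) n : additive_form m -> has_charge m (m (vu n)) (Lu n).
Proof. exact: mono_charge. Qed.
Lemma Lp_charge (m : Z6 -> R) n : additive_form m -> has_charge m (m (vp n)) (Lp n).
Proof. exact: mono_charge. Qed.

Lemma L_chargey1 n : has_charge ky1 (- n.1%:~R) (L n).
Proof.
have Eu : ky1 (vu n) = - n.1%:~R :> R by rewrite /ky1/= intrN.
have Ep : ky1 (vp n) = - n.1%:~R :> R by rewrite /ky1/= intrN.
move=> f; rewrite !L_def (Lu_charge _ (@ky1D R)) (Lp_charge _ (@ky1D R)) Eu Ep.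
by apply: fseq_ext => K; rewrite !fseqE !multE !fseqE; ring.
Qed.
Lemma L_chargey2 n : has_charge ky2 (- n.2%:~R) (L n).
Proof.
have Eu : ky2 (vu n) = - n.2%:~R :> R by rewrite /ky2/= intrN.
have Ep : ky2 (vp n) = - n.2%:~R :> R by rewrite /ky2/= intrN.
move=> f; rewrite !L_def (Lu_charge _ (@ky2D R)) (Lp_charge _ (@ky2D R)) Eu Ep.
by apply: fseq_ext => K; rewrite !fseqE !multE !fseqE; ring.
Qed.

(** This is u . grad_x: each sine gives 1/(2i) and each derivative gives i, so no imaginary unit
    remains. Opposite frequencies have equal coefficients because the symbols [au] and [ap] are odd
    in n. *)
Definition T f : V := locked_with L_key
  (2^-1 *: (L (0, 1) f - L (1, 0) f + L (0, -1) f - L (-1, 0) f)).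
Lemma TE f : T f = 2^-1 *: (L (0, 1) f - L (1, 0) f + L (0, -1) f - L (-1, 0) f).
Proof. by rewrite /T unlock. Qed.
Lemma T_is_linear : linear T.
Proof.
move=> c f g; rewrite !TE !linearP/= scalerA (mulrC c) -scalerA -scalerDr; congr (_ *: _).
by apply: fseq_ext => K; rewrite !fseqE; ring.
Qed.
HB.instance Definition _ := GRing.isLinear.Build R V V *:%R T T_is_linear.

(** The coefficients of [L_n, T] depend on n alone. As an operation on families indexed by
    frequencies it can be iterated, which yields the second commutator [Ldd] from the first one
    [Ld]. *)
Definition diff_op (F : int * int -> V) n : V :=
  locked_with L_key (2^-1 *: (n.1%:~R *: (F (n - (0, 1)) - F (n + (0, 1)))
         + n.2%:~R *: (F (n - (1, 0)) - F (n + (1, 0))))).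
Lemma diff_opE F n : diff_op F n =
  2^-1 *: (n.1%:~R *: (F (n - (0, 1)) - F (n + (0, 1)))
         + n.2%:~R *: (F (n - (1, 0)) - F (n + (1, 0)))).
Proof. by rewrite /diff_op unlock. Qed.
Definition Ld n f := diff_op (fun k => L k f) n.
Definition Ldd n f := diff_op (fun k => Ld k f) n.

Lemma T_adj f g : ip (T f) g = - ip f (T g).
Proof.
rewrite !TE ipZl ipZr !(ipDl, ipDr, ipNl, ipNr). rewrite !L_adj.
rewrite (_ : - (0, 1) = (0, -1) :> (int * int)%type)// (_ : - (0, -1) = (0, 1) :> (int * int)%type)//.
rewrite (_ : - (1, 0) = (-1, 0) :> (int * int)%type)// (_ : - (-1, 0) = (1, 0) :> (int * int)%type)//.
ring.
Qed.

Lemma cross_e n : [/\ cross n (0, 1) = - n.1%:~R, cross n (1, 0) = n.2%:~R,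
  cross n (0, -1) = n.1%:~R & cross n (-1, 0) = - n.2%:~R].
Proof. by rewrite /cross/= -!intrN; split; congr (intmul _ _); ring. Qed.

Lemma LT n f : L n (T f) = T (L n f) + Ld n f.
Proof.
have [e1 e2 e3 e4] := cross_e n.
rewrite !TE /Ld diff_opE linearZ/= -scalerDr; congr (_ *: _).
rewrite !(linearB, linearD)/= (L_comm n (0, 1)) (L_comm n (1, 0)) (L_comm n (0, -1)).
rewrite (L_comm n (-1, 0)) e1 e2 e3 e4.
have E1 : n + (0, -1) = n - (0, 1) by [].
have E2 : n + (-1, 0) = n - (1, 0) by [].
by rewrite E1 E2; apply: fseq_ext => K; rewrite !fseqE; ring.
Qed.

Lemma linear_diff (F : {linear V -> V}) (x y : R) f1 f2 f3 f4 :
  F (2^-1 *: (x *: (f1 - f2) + y *: (f3 - f4))) =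
  2^-1 *: (x *: (F f1 - F f2) + y *: (F f3 - F f4)).
Proof. by rewrite linearZ linearD 2!linearZ 2!linearB. Qed.

Lemma LdT n f : Ld n (T f) = T (Ld n f) + Ldd n f.
Proof.
rewrite /Ldd /Ld 3!diff_opE (linear_diff T) 4!LT; set D := Ld.
by apply: fseq_ext => K; rewrite !fseqE; ring.
Qed.

Lemma Ld_is_linear n : linear (Ld n).
Proof.
move=> c f g; rewrite /Ld !diff_opE !linearP/=.
by apply: fseq_ext => K; rewrite !fseqE; ring.
Qed.
HB.instance Definition _ n := GRing.isLinear.Build R V V *:%R (Ld n) (Ld_is_linear n).

(* Q_j differs from [T, Q_j] by the sign of L_{e_j} - L_{- e_j}. *)
Definition Qd1 f : V := locked_with L_key (2^-1 *: (L (1, 0) f - L (-1, 0) f)).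
Lemma Qd1E f : Qd1 f = 2^-1 *: (L (1, 0) f - L (-1, 0) f).
Proof. by rewrite /Qd1 unlock. Qed.
Definition Qd2 f : V := locked_with L_key (2^-1 *: (L (0, -1) f - L (0, 1) f)).
Lemma Qd2E f : Qd2 f = 2^-1 *: (L (0, -1) f - L (0, 1) f).
Proof. by rewrite /Qd2 unlock. Qed.
Definition Qdd1 f : V := 2^-1 *: (Ld (1, 0) f - Ld (-1, 0) f).
Definition Qdd2 f : V := 2^-1 *: (Ld (0, -1) f - Ld (0, 1) f).

Lemma T_halfB f g : T (2^-1 *: (f - g)) = 2^-1 *: (T f - T g).
Proof. by rewrite linearZ linearB. Qed.

Lemma Q1T f : mult ky1 (T f) = T (mult ky1 f) + Qd1 f.
Proof.
rewrite !TE Qd1E !linearZ/= -scalerDr; congr (_ *: _).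
rewrite !(linearD, linearN)/= !L_chargey1/= oppr0 !scale0r.
by apply: fseq_ext => K; rewrite !fseqE mulrN1z; ring.
Qed.
Lemma Q2T f : mult ky2 (T f) = T (mult ky2 f) + Qd2 f.
Proof.
rewrite !TE Qd2E !linearZ/= -scalerDr; congr (_ *: _).
rewrite !(linearD, linearN)/= !L_chargey2/= oppr0 !scale0r.
by apply: fseq_ext => K; rewrite !fseqE mulrN1z; ring.
Qed.
Lemma Qd1T f : Qd1 (T f) = T (Qd1 f) + Qdd1 f.
Proof.
rewrite /Qdd1 !Qd1E T_halfB !LT.
by apply: fseq_ext => K; rewrite !fseqE; ring.
Qed.
Lemma Qd2T f : Qd2 (T f) = T (Qd2 f) + Qdd2 f.
Proof.
rewrite /Qdd2 !Qd2E T_halfB !LT.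
by apply: fseq_ext => K; rewrite !fseqE; ring.
Qed.

(** [T] is skew, so the terms with [T (A f)] and [T (B f)] cancel. For [A] = [L n] and [B] = [Ld n]
    what remains is |Ld n f|^2 plus a product with the second commutator; the sign of [T] in [gen]
    makes the square a gain. *)
Lemma transport (A B A' B' : V -> V) f :
  A (T f) = T (A f) + A' f -> B (T f) = T (B f) + B' f ->
  ip (A (T f)) (B f) + ip (A f) (B (T f)) = ip (A' f) (B f) + ip (A f) (B' f).
Proof. by move=> -> ->; rewrite ipDl ipDr T_adj; ring. Qed.

End Fields.

(** * Coercivity of the vector fields *)

Section Coercivity.
Variable R : realType.
Notation V := (fseq R).
Implicit Types (f g h p : V) (s t K : Z6) (i j : int).

(* Multiplication by exp(i (i z1 + j z2)), where z = (x3 - x1, x4 - x2). *)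
Definition zv i j : Z6 := (((- i, - j), (i, j)), (0, 0)).
Definition Sz i j : V -> V := sh (zv i j).

HB.instance Definition _ i j := GRing.isLinear.Build R V V *:%R (Sz i j)
  (sh_is_linear (zv i j)).

Lemma zvD i j i' j' : zv (i + i') (j + j') = zv i j + zv i' j'.
Proof. by rewrite /zv/= !opprD; congr (_, _); congr (_, _); rewrite ?addr0. Qed.
Lemma SzD i j i' j' f : Sz i j (Sz i' j' f) = Sz (i + i') (j + j') f.
Proof. by rewrite /Sz shD zvD. Qed.
Lemma Sz0 f : Sz 0 0 f = f. Proof. exact: sh0. Qed.
Lemma nrm_Sz i j f : nrm (Sz i j f) = nrm f. Proof. exact: nrm_sh. Qed.
Lemma zvN i j : zv (- i) (- j) = - zv i j.
Proof. by rewrite /zv/= ; congr (_, _); congr (_, _); rewrite ?opprK ?oppr0. Qed.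
Lemma ip_Szl i j f g : ip (Sz i j f) g = ip f (Sz (- i) (- j) g).
Proof. by rewrite /Sz zvN -ip_sh_adj. Qed.

Lemma SzDr i j f g : Sz i j (f + g) = Sz i j f + Sz i j g.
Proof. exact: linearD. Qed.
Lemma SzN i j f : Sz i j (- f) = - Sz i j f.
Proof. exact: linearN. Qed.
Lemma SzZ i j (c : R) f : Sz i j (c *: f) = c *: Sz i j f.
Proof. exact: linearZ. Qed.

(** Multiplication by 1 - exp(i (i z1 + j z2)). For (1,0) and (0,1) the moduli are 2 |sin (z1 / 2)|
    and 2 |sin (z2 / 2)|, whose squares add up to 4 dD^2. *)
Definition first_difference i j p : V := p - Sz i j p.

(* p times the trigonometric polynomial 1 - exp(i (a + b)) is controlled by p
   times 1 - exp(i a) and p times 1 - exp(i b). *)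
Lemma nrm_first_differenceD i j i' j' p :
  nrm (first_difference (i + i') (j + j') p) <=
  nrm (first_difference i j p) + nrm (first_difference i' j' p).
Proof.
have -> : first_difference (i + i') (j + j') p =
  first_difference i j p + Sz i j (first_difference i' j' p).
  rewrite /first_difference SzDr SzN SzD.
  by apply: fseq_ext => K; rewrite !fseqE; ring.
by apply: le_trans (nrmD _ _) _; rewrite nrm_Sz.
Qed.

Lemma nrm_first_differenceN i j p :
  nrm (first_difference (- i) (- j) p) = nrm (first_difference i j p).
Proof.
rewrite -(nrm_Sz i j) /first_difference SzDr SzN SzD !subrr Sz0.
by rewrite -nrmN opprB.
Qed.

Section TwoShifts.
(* Instantiated with (z1, z2) and with (z2, z1) in this order. *)
Variable S : int -> int -> V -> V.
Hypothesis SD : forall i j i' j' f, S i j (S i' j' f) = S (i + i') (j + j') f.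
Hypothesis S0 : forall f, S 0 0 f = f.
Hypothesis SDr : forall i j f g, S i j (f + g) = S i j f + S i j g.
Hypothesis SN : forall i j f, S i j (- f) = - S i j f.
Hypothesis SZ : forall i j c f, S i j (c *: f) = c *: S i j f.
Hypothesis nrmS : forall i j f, nrm (S i j f) = nrm f.

(** The field [L n f] divided by the character of the first particle, which does not change its norm
    ([L_ell], [nrm_L]); [p1] to [p4] stand for the four x-derivatives of f. *)
Definition ell (n : int * int) p1 p2 p3 p4 : V :=
  n.2%:~R *: p1 - n.1%:~R *: p2 + S n.1 n.2 (n.2%:~R *: p3 - n.1%:~R *: p4).

Ltac norm_S := rewrite ?SD;
  repeat match goal with
  | |- context [S (?a + ?b) ?j ?f] =>
      let c := eval vm_compute in (a + b) in change (S (a + b) j f) with (S c j f)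
  | |- context [S ?j (?a + ?b) ?f] =>
      let c := eval vm_compute in (a + b) in change (S j (a + b) f) with (S j c f)
  end; rewrite ?S0.

Variables (M : R) (p1 p2 p3 p4 : V).
Let l n := ell n p1 p2 p3 p4.
Hypothesis lM : forall n, n \in [:: (1, 0); (0, 1); (0, -1); (1, 1); (1, -1); (1, 2); (1, -2)] ->
  nrm (l n) <= M.

(** Constants stay unevaluated sums, so that the triangle inequality can be applied repeatedly by
    unification. *)
Let bndD a b c d : nrm a <= c * M -> nrm b <= d * M -> nrm (a + b) <= (c + d) * M.
Proof. by move=> ac bd; apply: le_trans (nrmD _ _) _; rewrite mulrDl lerD. Qed.
Let bndB a b c d : nrm a <= c * M -> nrm b <= d * M -> nrm (a - b) <= (c + d) * M.
Proof. by move=> ac bd; apply: bndD; rewrite ?nrmN. Qed.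
Let bndS i j a c : nrm a <= c * M -> nrm (S i j a) <= c * M.
Proof. by rewrite nrmS. Qed.
Let bndZ x a c : nrm a <= c * M -> nrm (x *: a) <= (`|x| * c) * M.
Proof. by move=> ac; rewrite nrmZ -mulrA ler_wpM2l. Qed.

(** Signs make the coefficient of [p1], or of [p2] in [x], positive. Combinations free of [p1] and
    [p2] are then sought: they are [p3] and [p4] times polynomials in z = exp(i z1) and w = exp(i
    z2). *)
Let y := l (0, 1).
Let y' := - l (0, -1).
Let x := - l (1, 0).
Let u := l (1, 1).
Let v := - l (1, -1).
Let s := l (1, 2).
Let t := - l (1, -2).

Let lb n : n \in [:: (1, 0); (0, 1); (0, -1); (1, 1); (1, -1); (1, 2); (1, -2)] ->
  nrm (l n) <= 1 * M.
Proof. by rewrite mul1r; exact: lM. Qed.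
Let yb : nrm y <= 1 * M. Proof. exact: lb. Qed.
Let y'b : nrm y' <= 1 * M. Proof. by rewrite nrmN lb. Qed.
Let xb : nrm x <= 1 * M. Proof. by rewrite nrmN lb. Qed.
Let ub : nrm u <= 1 * M. Proof. exact: lb. Qed.
Let vb : nrm v <= 1 * M. Proof. by rewrite nrmN lb. Qed.
Let sb : nrm s <= 1 * M. Proof. exact: lb. Qed.
Let tb : nrm t <= 1 * M. Proof. by rewrite nrmN lb. Qed.

Ltac expand := rewrite /y /y' /x /u /v /s /t /l /ell /=;
  apply: fseq_ext => K; rewrite ?(SDr, SN, SZ)/=; norm_S;
  rewrite ?fseqE ?mulrN1z ?mulr1z ?mulr0z; ring.

(** With z = exp(i z1) and w = exp(i z2): [c3] is (1 - w^2) p3, [d4] is (1 - w)^2 p4 and [d3] is (1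
    - z)(1 - w) p3. Both [c3] and [d3] vanish at z = 1, w = -1; there [e], built from (1,2) and
    (1,-2), equals 8 p3 and takes over. *)
Let c3 : V := p3 - S 0 2 p3.
Let d4 : V := p4 - 2 *: S 0 1 p4 + S 0 2 p4.
Let d3 : V := p3 - S 1 0 p3 - S 0 1 p3 + S 1 1 p3.
Let e : V := s + t - 4 *: y.

Let c3E : c3 = - S 0 1 (y - y').
Proof. rewrite /c3; expand. Qed.
Let d4E : S 1 0 d4 = u - y + x - S 0 2 (v - y' - x).
Proof. rewrite /d4; expand. Qed.
Let d3E : d3 = u - y + x - S 0 1 (v - y' - x).
Proof. rewrite /d3; expand. Qed.

Let c3b : nrm c3 <= (1 + 1) * M.
Proof. by rewrite c3E nrmN; apply: bndS; apply: bndB. Qed.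
Let d4b : nrm d4 <= (1 + 1 + 1 + (1 + 1 + 1)) * M.
Proof.
by rewrite -(nrmS 1 0) d4E; apply: bndB; [apply: bndD => //; apply: bndB|
  apply: bndS; apply: bndB => //; apply: bndB].
Qed.
Let d3b : nrm d3 <= (1 + 1 + 1 + (1 + 1 + 1)) * M.
Proof.
by rewrite d3E; apply: bndB; [apply: bndD => //; apply: bndB|
  apply: bndS; apply: bndB => //; apply: bndB].
Qed.
Let eb : nrm e <= (1 + 1 + `|4| * 1) * M.
Proof. by apply: bndB; [apply: bndD|apply: bndZ]. Qed.

(* The polynomial identity
   8 (1 - z) = (1 - z) (2 z^4 - 4 z^3 + 2) - (2 z^3 - 6 z^2 + 6 z - 6) (1 - z^2)
   carries the control from z2 near 1 over to z2 near -1. *)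
Let eight : 8 *: (p3 - S 0 1 p3) = S 0 2 (e - S 0 1 e) + 2 *: (d3 + S 0 4 d3)
  - S 1 0 (d4 + S 0 1 d4 + S 0 2 d4 + S 0 3 d4)
  - (2 *: S 0 3 c3 - 6 *: S 0 2 c3 + 6 *: S 0 1 c3 - 6 *: c3).
Proof. rewrite /e /c3 /d3 /d4; expand. Qed.

Lemma nrm_weight : nrm (p3 - S 0 1 p3) <= 13 * M.
Proof.
have M0 : 0 <= M by apply: le_trans (lM (n := (1, 0)) _) => //; exact: nrm_ge0.
have : nrm (8 *: (p3 - S 0 1 p3)) <=
  (1 + 1 + `|4| * 1 + (1 + 1 + `|4| * 1)
   + `|2| * (1 + 1 + 1 + (1 + 1 + 1) + (1 + 1 + 1 + (1 + 1 + 1)))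
   + ((1 + 1 + 1 + (1 + 1 + 1)) + (1 + 1 + 1 + (1 + 1 + 1))
      + (1 + 1 + 1 + (1 + 1 + 1)) + (1 + 1 + 1 + (1 + 1 + 1)))
   + (`|2| * (1 + 1) + `|6| * (1 + 1) + `|6| * (1 + 1) + `|6| * (1 + 1))) * M.
  rewrite eight; apply: bndB.
    apply: bndB.
      apply: bndD; first by apply: bndS; apply: bndB => //; exact: bndS.
      by apply: bndZ; apply: bndD => //; exact: bndS.
    apply: bndS; apply: bndD; last exact: bndS.
    by apply: bndD; [apply: bndD => //; exact: bndS|exact: bndS].
  apply: bndB; last exact: bndZ.
  apply: bndD; last by apply: bndZ; exact: bndS.
  by apply: bndB; apply: bndZ; exact: bndS.
(* The coefficients add up to 12 + 24 + 24 + 40 = 100, and 100 / 8 is less than 13. *)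
rewrite nrmZ !ger0_norm//; move: (nrm _) => N; lra.
Qed.

End TwoShifts.

Section Coercive.
Variables (M : R) (p1 p2 p3 p4 : V).
Notation l n := (ell Sz n p1 p2 p3 p4).
Hypothesis lM : forall n, n \in [:: (1, 0); (0, 1); (0, -1); (1, 1); (1, -1);
  (1, 2); (1, -2); (2, 1); (-2, 1); (-1, 0); (-1, 1)] -> nrm (l n) <= M.

Lemma weight23 : nrm (first_difference 0 1 p3) <= 13 * M.
Proof.
apply: (@nrm_weight Sz SzD Sz0 SzDr SzN SzZ nrm_Sz M p1 p2 p3 p4) => n.
by rewrite !inE => H; apply: lM; rewrite !inE; repeat (case/orP: H => [->|H]; rewrite ?orbT//); rewrite H ?orbT.
Qed.

(** Exchanging the two coordinates turns [ell] into its negative at the exchanged frequency, so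
    [nrm_weight] applies again; the list of frequencies contains (2,1), (-2,1), (-1,0), (-1,1) for
    this purpose. *)
Lemma weight14 : nrm (first_difference 1 0 p4) <= 13 * M.
Proof.
apply: (@nrm_weight (fun i j => Sz j i) _ _ _ _ _ _ M p2 p1 p4 p3) => //.
- by move=> *; exact: SzD.
- by move=> *; exact: Sz0.
- by move=> *; exact: SzDr.
- by move=> *; exact: SzN.
- by move=> *; exact: SzZ.
- by move=> *; exact: nrm_Sz.
move=> n nB.
have -> : ell (fun i j => Sz j i) n p2 p1 p4 p3 = - l (n.2, n.1).
  rewrite /ell/=; apply: fseq_ext => K; rewrite !(SzDr, SzN, SzZ) !fseqE; ring.
rewrite nrmN; apply: lM; move: nB; rewrite !inE.
by do ![case/orP]; move=> /eqP ->.
Qed.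

(** For a = w (1 - z) p3 and b = z (1 - w) p4 the difference b - a is a combination of three fields,
    while <a, b> = <(1 - w) p3, (1 - z) p4> pairs two weights that are already controlled. So |a|^2
    + |b|^2 = |b - a|^2 + 2 <a, b> is at most (9 + 2 . 169) M^2 = 347 M^2, and 347 < 19^2. *)
Lemma weights_other : nrm (first_difference 1 0 p3) <= 19 * M /\
  nrm (first_difference 0 1 p4) <= 19 * M.
Proof.
have M0 : 0 <= M by apply: le_trans (lM (n := (1, 0)) _) => //; exact: nrm_ge0.
pose a := Sz 0 1 (first_difference 1 0 p3).
pose b := Sz 1 0 (first_difference 0 1 p4).
have cross_ab : ip a b = ip (first_difference 0 1 p3) (first_difference 1 0 p4).
  rewrite /a /b /first_difference !(SzDr, SzN) !(ipDl, ipDr, ipNl, ipNr) !ip_Szl.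
  rewrite !SzD !(addr0, add0r, oppr0, subrr, addNr, Sz0); ring.
have ab : ip (b - a) (b - a) <= (3 * M) ^+ 2.
  rewrite -sqr_nrm ler_sqr ?nnegrE ?nrm_ge0 ?mulr_ge0//.
  have -> : b - a = l (1, 1) - l (0, 1) - l (1, 0).
    rewrite /a /b /first_difference /ell/=; apply: fseq_ext => K.
    by rewrite !(SzDr, SzN, SzZ) !SzD !(addr0, add0r) !fseqE; ring.
  rewrite (_ : 3 * M = M + M + M); last by ring.
  apply: le_trans (nrmB _ _) _; apply: lerD; last by apply: lM.
  by apply: le_trans (nrmB _ _) _; apply: lerD; apply: lM.
have cb : ip a b <= 169 * M ^+ 2.
  rewrite cross_ab; apply: le_trans (ip_le _ _) _.
  rewrite (_ : 169 * M ^+ 2 = (13 * M) * (13 * M)); last by ring.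
  by rewrite ler_pM ?nrm_ge0 ?weight23 ?weight14.
have sum_le : nrm a ^+ 2 + nrm b ^+ 2 <= (19 * M) ^+ 2.
  move: ab cb; rewrite !sqr_nrm !(ipDl, ipDr, ipNl, ipNr) (ipC b a) !exprMn.
  rewrite (_ : 3 ^+ 2 = 9); last by ring.
  rewrite (_ : 19 ^+ 2 = 361); last by ring.
  by have := sqr_ge0 M; move: (M ^+ 2) => e; lra.
rewrite -(nrm_Sz 0 1 (first_difference 1 0 p3)) -(nrm_Sz 1 0 (first_difference 0 1 p4)).
rewrite -/a -/b -!(@ler_sqr _ (nrm _)) ?nnegrE ?nrm_ge0 ?mulr_ge0//.
by have := sqr_ge0 (nrm a); have := sqr_ge0 (nrm b); split; lra.
Qed.

Lemma weights_plus : nrm (p1 + p3) <= 14 * M /\ nrm (p2 + p4) <= 14 * M.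
Proof.
have -> : p1 + p3 = l (0, 1) + first_difference 0 1 p3.
  by rewrite /ell/=; apply: fseq_ext => K; rewrite !(SzDr, SzN, SzZ) !fseqE; ring.
have -> : p2 + p4 = - l (1, 0) + first_difference 1 0 p4.
  by rewrite /ell/=; apply: fseq_ext => K; rewrite !(SzDr, SzN, SzZ) !fseqE; ring.
rewrite (_ : 14 * M = M + 13 * M); last by ring.
split; apply: le_trans (nrmD _ _) _; apply: lerD.
- by apply: lM.
- exact: weight23.
- by rewrite nrmN; apply: lM.
- exact: weight14.
Qed.

End Coercive.

Lemma nrm_first_difference_nat (i j : int) (n : nat) p :
  nrm (first_difference (i *+ n) (j *+ n) p) <= n%:R * nrm (first_difference i j p).
Proof.
elim: n => [|n IH].
  by rewrite !mulr0n mul0r /first_difference Sz0 subrr /nrm ip0l sqrtr0.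
rewrite !mulrS mulrDl mul1r; apply: le_trans (nrm_first_differenceD _ _ _ _ _) _.
by rewrite lerD2l.
Qed.

Lemma nrm_first_difference_int (i j k : int) p :
  nrm (first_difference (i * k) (j * k) p) <= `|k|%:~R * nrm (first_difference i j p).
Proof.
have E (x : int) (n : nat) : x * Posz n = x *+ n by rewrite -mulr_natr natz.
case: k => n.
  have := nrm_first_difference_nat i j n p.
  by rewrite !E (_ : `|Posz n| = Posz n)// -(pmulrn 1 n).
have := nrm_first_difference_nat i j n.+1 p.
have N : `|Negz n| = n.+1%:Z by [].
have M x : x * Negz n = - (x *+ n.+1) by rewrite NegzE mulrN E.
by rewrite (M i) (M j) N nrm_first_differenceN -(pmulrn 1 n.+1).
Qed.

Lemma nrm_first_difference_le i j p : nrm (first_difference i j p) <=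
  `|i|%:~R * nrm (first_difference 1 0 p) + `|j|%:~R * nrm (first_difference 0 1 p).
Proof.
rewrite -{1}(addr0 i) -{1}(add0r j); apply: le_trans (nrm_first_differenceD _ _ _ _ _) _.
have := nrm_first_difference_int 1 0 i p; have := nrm_first_difference_int 0 1 j p.
by rewrite !mul1r !mul0r => A B; rewrite lerD.
Qed.

(** Converse of the coercivity: 1 - exp(i n.z) is a sum of |n1| + |n2| translates of elementary
    weights. It serves every n, not only the frequencies that define [w]. *)
Lemma nrm_ell_le (M : R) p1 p2 p3 p4 (n : int * int) :
  nrm (p1 + p3) <= M -> nrm (p2 + p4) <= M ->
  nrm (first_difference 1 0 p3) <= M -> nrm (first_difference 0 1 p3) <= M ->
  nrm (first_difference 1 0 p4) <= M -> nrm (first_difference 0 1 p4) <= M ->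
  nrm (ell Sz n p1 p2 p3 p4) <=
  (`|n.1|%:~R + `|n.2|%:~R) * (1 + `|n.1|%:~R + `|n.2|%:~R) * M.
Proof.
move=> H1 H2 H3 H4 H5 H6.
have E : ell Sz n p1 p2 p3 p4 = n.2%:~R *: (p1 + p3 - first_difference n.1 n.2 p3)
   - n.1%:~R *: (p2 + p4 - first_difference n.1 n.2 p4).
  by rewrite /ell/=; apply: fseq_ext => K; rewrite !(SzDr, SzN, SzZ) !fseqE; ring.
have fd p : nrm (first_difference 1 0 p) <= M -> nrm (first_difference 0 1 p) <= M ->
    nrm (first_difference n.1 n.2 p) <= (`|n.1|%:~R + `|n.2|%:~R) * M.
  move=> A B; apply: le_trans (nrm_first_difference_le _ _ _) _.
  by rewrite mulrDl lerD// ler_wpM2l// ler0z.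
have st c q p : nrm q <= M -> nrm (first_difference n.1 n.2 p) <= (`|n.1|%:~R + `|n.2|%:~R) * M ->
    nrm (c%:~R *: (q - first_difference n.1 n.2 p)) <=
    `|c|%:~R * ((1 + `|n.1|%:~R + `|n.2|%:~R) * M).
  move=> A B; rewrite nrmZ -intr_norm ler_wpM2l ?ler0z//.
  by apply: le_trans (nrmB _ _) _; rewrite -addrA mulrDl mul1r lerD.
rewrite E; apply: le_trans (nrmB _ _) _.
rewrite -mulrA (mulrDl `|n.1|%:~R) addrC.
by apply: lerD; apply: st => //; apply: fd.
Qed.

Notation P1 := (mult (@kx1 R)).
Notation P2 := (mult (@kx2 R)).
Notation P3 := (mult (@kx3 R)).
Notation P4 := (mult (@kx4 R)).

Lemma L_ell n f : L n f = sh (vu n) (ell Sz n (P1 f) (P2 f) (P3 f) (P4 f)).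
Proof.
apply: fseq_ext => K; rewrite L_def /Lu /Lp shE /ell fseqE !monoE.
rewrite !(SzDr, SzN, SzZ) !fseqE.
have E p : Sz n.1 n.2 p (K - vu n) = p (K - vp n).
  rewrite /Sz shE -addrA -opprD; congr (fseq_fun p (K - _)).
  by rewrite /vu /vp /zv/=; congr (_, _); congr (_, _); rewrite ?addr0 ?addrN ?add0r.
by rewrite !E !multE /au /ap; ring.
Qed.

Lemma nrm_L n f : nrm (L n f) = nrm (ell Sz n (P1 f) (P2 f) (P3 f) (P4 f)).
Proof. by rewrite L_ell nrm_sh. Qed.

(** The levels are reached from the y-derivatives by one, two and three brackets with [T]. Only one
    of n and -n is listed, thanks to [nrm_LN]. *)
Definition level1 : seq (int * int) := [:: (1, 0); (0, 1)].
Definition level2 : seq (int * int) := [:: (1, 1); (1, -1)].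
Definition level3 : seq (int * int) := [:: (2, 1); (2, -1); (1, 2); (1, -2)].

Definition vlev (B : seq (int * int)) f : R := \sum_(n <- B) ip (L n f) (L n f).
Definition w f := vlev level1 f + vlev level2 f + vlev level3 f.

Lemma vlev_ge0 B f : 0 <= vlev B f.
Proof. by apply: sumr_ge0 => n _; exact: ip_ge0. Qed.

Lemma nrm_vlev B f n : n \in B -> nrm (L n f) <= Num.sqrt (vlev B f).
Proof.
move=> nB; rewrite /nrm ler_wsqrtr// /vlev (big_rem n)//= lerDl.
by apply: sumr_ge0 => k _; exact: ip_ge0.
Qed.

Lemma w_ge0 f : 0 <= w f.
Proof. by rewrite /w !addr_ge0// vlev_ge0. Qed.

Lemma vlev1_le_w f : vlev level1 f <= w f.
Proof. by rewrite /w; have := vlev_ge0 level2 f; have := vlev_ge0 level3 f; lra. Qed.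
Lemma vlev2_le_w f : vlev level2 f <= w f.
Proof. by rewrite /w; have := vlev_ge0 level1 f; have := vlev_ge0 level3 f; lra. Qed.
Lemma vlev3_le_w f : vlev level3 f <= w f.
Proof. by rewrite /w; have := vlev_ge0 level2 f; have := vlev_ge0 level1 f; lra. Qed.

Lemma nrm_L_B n f : n \in [:: (1, 0); (0, 1); (0, -1); (1, 1); (1, -1);
  (1, 2); (1, -2); (2, 1); (-2, 1); (-1, 0); (-1, 1)] -> nrm (L n f) <= Num.sqrt (w f).
Proof.
have opp a b : nrm (L (a, b) f) = nrm (L (- a, - b) f) by rewrite -[LHS]nrm_LN.
have h1 k : k \in level1 -> nrm (L k f) <= Num.sqrt (w f).
  by move=> /(nrm_vlev f) /le_trans; apply; rewrite ler_wsqrtr// vlev1_le_w.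
have h2 k : k \in level2 -> nrm (L k f) <= Num.sqrt (w f).
  by move=> /(nrm_vlev f) /le_trans; apply; rewrite ler_wsqrtr// vlev2_le_w.
have h3 k : k \in level3 -> nrm (L k f) <= Num.sqrt (w f).
  by move=> /(nrm_vlev f) /le_trans; apply; rewrite ler_wsqrtr// vlev3_le_w.
rewrite !inE; do ![case/orP]; move=> /eqP ->;
  solve [by apply: h1|by apply: h2|by apply: h3
        |by rewrite opp; apply: h1|by rewrite opp; apply: h2|by rewrite opp; apply: h3].
Qed.

Lemma coercive_six f (M := 19 * Num.sqrt (w f)) :
  [/\ nrm (P1 f + P3 f) <= M, nrm (P2 f + P4 f) <= M &
  nrm (first_difference 1 0 (P3 f)) <= M] /\
  [/\ nrm (first_difference 0 1 (P3 f)) <= M,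
  nrm (first_difference 1 0 (P4 f)) <= M & nrm (first_difference 0 1 (P4 f)) <= M].
Proof.
have H n : n \in [:: (1, 0); (0, 1); (0, -1); (1, 1); (1, -1);
  (1, 2); (1, -2); (2, 1); (-2, 1); (-1, 0); (-1, 1)] ->
  nrm (ell Sz n (P1 f) (P2 f) (P3 f) (P4 f)) <= Num.sqrt (w f).
  by rewrite -nrm_L; exact: nrm_L_B.
have s0 := sqrtr_ge0 (w f).
have [? ?] := weights_plus H; have [? ?] := weights_other H.
have := weight23 H; have := weight14 H; rewrite /M.
by do !split; lra.
Qed.

(* Locked, as unification would otherwise compare unary numerals. *)
Definition cL : R := locked_with fseq_key (6 * 7 * 19).
Lemma cLE : cL = 6 * 7 * 19. Proof. by rewrite /cL unlock. Qed.
Lemma cL_ge1 : 1 <= cL. Proof. by rewrite cLE; lra. Qed.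

(** From the eight fields to the six weighted derivatives ([coercive_six]) and back ([nrm_ell_le]).
    This closes the hierarchy: brackets at the last level produce new frequencies, but their fields
    are already bounded by [w]. *)
Lemma nrm_L_le f n : `|n.1| <= 3 -> `|n.2| <= 3 -> nrm (L n f) <= cL * Num.sqrt (w f).
Proof.
rewrite cLE.
move=> n1 n2; rewrite nrm_L; have [[? ? ?] [? ? ?]] := coercive_six f.
apply: le_trans (@nrm_ell_le (19 * Num.sqrt (w f)) _ _ _ _ _ _ _ _ _ _ _) _ => //.
rewrite -[X in _ <= X]mulrA; apply: ler_wpM2r; first by rewrite mulr_ge0// sqrtr_ge0.
have a : (`|n.1|%:~R : R) <= 3 by rewrite (ler_int R `|n.1| 3).
have b : (`|n.2|%:~R : R) <= 3 by rewrite (ler_int R `|n.2| 3).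
have a0 : 0 <= (`|n.1|%:~R : R) by rewrite ler0z.
have b0 : 0 <= (`|n.2|%:~R : R) by rewrite ler0z.
by move: (`|n.1|%:~R) (`|n.2|%:~R) a b a0 b0 => *; apply: ler_pM; lra.
Qed.

End Coercivity.
Arguments cL {R}.

(** * Dissipation of the terms of the functional *)

Section Generator.
Variable R : realType.
Notation V := (fseq R).
Implicit Types (f g h : V) (s t K : Z6) (m : Z6 -> R) (n : int * int).

Definition xforms : seq (Z6 -> R) := [:: kx1; kx2; kx3; kx4].
Definition yforms : seq (Z6 -> R) := [:: ky1; ky2].

(** Minus the Laplacian in the variables of [ms]; therefore it enters [gen] with a minus sign. *)
Definition lap (ms : seq (Z6 -> R)) f : V := \sum_(m <- ms) mult m (mult m f).

Definition gen (kap nu : R) f : V := - T f - kap *: lap xforms f - nu *: lap yforms f.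

(* Derivative of <A f, B f> in the direction h. *)
Definition dip (A B : V -> V) h f : R := ip (A h) (B f) + ip (A f) (B h).

Lemma dip_gen (A B : {linear V -> V}) kap nu f : dip A B (gen kap nu f) f =
  - dip A B (T f) f - kap * dip A B (lap xforms f) f - nu * dip A B (lap yforms f) f.
Proof.
have E (F : {linear V -> V}) : F (gen kap nu f) =
  - F (T f) - kap *: F (lap xforms f) - nu *: F (lap yforms f).
  by rewrite /gen !(linearB F) (linearN F) !(linearZZ F).
by rewrite /dip !E !(ipDl, ipDr, ipNl, ipNr, ipZl, ipZr); ring.
Qed.

(** [charge2], summed over the variables. The second term vanishes for equal charges; for mixed
    terms it is the price of moving operators with different frequency shifts past the Laplacian. *)
Lemma dip_lap (A B : {linear V -> V}) (ms : seq (Z6 -> R)) (al be : (Z6 -> R) -> R) f :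
  (forall i, (i < size ms)%N -> has_charge (nth 0 ms i) (al (nth 0 ms i)) A) ->
  (forall i, (i < size ms)%N -> has_charge (nth 0 ms i) (be (nth 0 ms i)) B) ->
  dip A B (lap ms f) f = 2 * (\sum_(m <- ms) ip (A (mult m f)) (B (mult m f)))
    + (\sum_(m <- ms) (be m - al m) ^+ 2) * ip (A f) (B f).
Proof.
elim: ms => [|m ms IH] cA cB.
  by rewrite /dip /lap !big_nil !linear0 ip0l ip0r; ring.
rewrite /dip /lap !big_cons !linearD/= ipDl ipDr addrACA.
rewrite (charge2 f (cA 0%N isT) (cB 0%N isT))/=.
rewrite -/(lap ms f) -/(dip A B (lap ms f) f) IH; first by ring.
  by move=> i im; exact: (cA i.+1).
by move=> i im; exact: (cB i.+1).
Qed.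

Definition sumsq (ms : seq (Z6 -> R)) f : R := \sum_(m <- ms) ip (mult m f) (mult m f).
Definition sumover (ms : seq (Z6 -> R)) (F : V -> R) f : R := \sum_(m <- ms) F (mult m f).

Lemma multC m m' f : mult m (mult m' f) = mult m' (mult m f).
Proof. by apply: fseq_ext => K; rewrite !multE; ring. Qed.

Lemma mult_charge0 m m' : has_charge m 0 (mult m').
Proof. by move=> f; rewrite scale0r subr0 multC. Qed.

Lemma id_charge0 m : has_charge m 0 idfun.
Proof. by move=> f; rewrite scale0r subr0. Qed.

Lemma Qd1_is_linear : linear (@Qd1 R).
Proof.
move=> c f g; rewrite !Qd1E !linearP/=.
by apply: fseq_ext => K; rewrite !fseqE; ring.
Qed.
HB.instance Definition _ := GRing.isLinear.Build R V V *:%R (@Qd1 R) Qd1_is_linear.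
Lemma Qd2_is_linear : linear (@Qd2 R).
Proof.
move=> c f g; rewrite !Qd2E !linearP/=.
by apply: fseq_ext => K; rewrite !fseqE; ring.
Qed.
HB.instance Definition _ := GRing.isLinear.Build R V V *:%R (@Qd2 R) Qd2_is_linear.

End Generator.

Section Estimates.
Variable R : realType.
Notation V := (fseq R).
Implicit Types (f g h : V) (s t K : Z6) (m : Z6 -> R) (n : int * int).
Notation xforms := (xforms R).
Notation yforms := (yforms R).

Lemma ip_bound f g (x y : R) : nrm f <= x -> nrm g <= y -> `|ip f g| <= x * y.
Proof.
move=> fx gy; apply: le_trans (cauchy_schwarz _ _) _.
by apply: ler_pM => //; exact: nrm_ge0.
Qed.

Lemma sumsq_ge0 ms f : 0 <= sumsq ms f.
Proof. by apply: sumr_ge0 => m _; exact: ip_ge0. Qed.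

Lemma nrm_sumsq (ms : seq (Z6 -> R)) f i : (i < size ms)%N ->
  nrm (mult (nth 0 ms i) f) <= Num.sqrt (sumsq ms f).
Proof.
move=> im; rewrite /nrm ler_wsqrtr// /sumsq; elim: ms i im => // m ms IH [|i] im.
  by rewrite big_cons/= lerDl; exact: sumsq_ge0.
by rewrite big_cons/=; apply: (le_trans (IH i im)); rewrite lerDr ip_ge0.
Qed.

Lemma sumover_ge0 ms (F : V -> R) f : (forall g, 0 <= F g) -> 0 <= sumover ms F f.
Proof. by move=> F0; apply: sumr_ge0. Qed.

Lemma le_sumover (ms : seq (Z6 -> R)) (F : V -> R) f i : (forall g, 0 <= F g) ->
  (i < size ms)%N -> F (mult (nth 0 ms i) f) <= sumover ms F f.
Proof.
move=> F0 im; rewrite /sumover; elim: ms i im => // m ms IH [|i] im.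
  by rewrite big_cons/= lerDl; exact: sumover_ge0.
by rewrite big_cons/=; apply: (le_trans (IH i im)); rewrite lerDr.
Qed.

Definition qf f : R := sumsq yforms f.
Definition pf f : R := sumsq xforms f.

Definition small (k : int) n := (`|n.1| <= k) && (`|n.2| <= k).

Lemma nrm_LuLp n f : small 3 n ->
  nrm (Lu n f) <= 6 * Num.sqrt (pf f) /\ nrm (Lp n f) <= 6 * Num.sqrt (pf f).
Proof.
move=> /andP[n1 n2].
have a : (`|n.1|%:~R : R) <= 3 by rewrite (ler_int R `|n.1| 3).
have b : (`|n.2|%:~R : R) <= 3 by rewrite (ler_int R `|n.2| 3).
have H (x y : V) : nrm x <= Num.sqrt (pf f) -> nrm y <= Num.sqrt (pf f) ->
    nrm (n.2%:~R *: x - n.1%:~R *: y) <= 6 * Num.sqrt (pf f).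
  move=> hx hy; apply: le_trans (nrmB _ _) _; rewrite !nrmZ -!intr_norm.
  rewrite (_ : 6 * _ = 3 * Num.sqrt (pf f) + 3 * Num.sqrt (pf f)); last by ring.
  by apply: lerD; apply: ler_pM; rewrite ?ler0z ?nrm_ge0.
have nP i : (i < 4)%N -> nrm (mult (nth 0 xforms i) f) <= Num.sqrt (pf f).
  by move=> i4; exact: (@nrm_sumsq xforms f i i4).
split.
  have -> : Lu n f = sh (vu n) (n.2%:~R *: mult kx1 f - n.1%:~R *: mult kx2 f).
    rewrite /Lu /mono; congr sh; apply: fseq_ext => K.
    by rewrite !fseqE !multE /au; ring.
  by rewrite nrm_sh; apply: H; [exact: (nP 0%N)|exact: (nP 1%N)].
have -> : Lp n f = sh (vp n) (n.2%:~R *: mult kx3 f - n.1%:~R *: mult kx4 f).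
  rewrite /Lp /mono; congr sh; apply: fseq_ext => K.
  by rewrite !fseqE !multE /ap; ring.
by rewrite nrm_sh; apply: H; [exact: (nP 2%N)|exact: (nP 3%N)].
Qed.

Lemma ky1_v n : ky1 (vu n) = - n.1%:~R :> R /\ ky1 (vp n) = - n.1%:~R :> R.
Proof. by rewrite /ky1/= intrN. Qed.
Lemma ky2_v n : ky2 (vu n) = - n.2%:~R :> R /\ ky2 (vp n) = - n.2%:~R :> R.
Proof. by rewrite /ky2/= intrN. Qed.

Lemma xforms_additive i : (i < 4)%N -> additive_form (nth 0 xforms i).
Proof. by case: i => [|[|[|[|[]]]]]//= _; [exact: kx1D|exact: kx2D|exact: kx3D|exact: kx4D]. Qed.
Lemma yforms_additive i : (i < 2)%N -> additive_form (nth 0 yforms i).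
Proof. by case: i => [|[|[]]]//= _; [exact: ky1D|exact: ky2D]. Qed.

Lemma L_chargey n i : (i < 2)%N ->
  has_charge (nth 0 yforms i) (nth 0 yforms i (vu n)) (L n).
Proof.
case: i => [|[|[]]]//= _; first by rewrite (ky1_v n).1; exact: L_chargey1.
by rewrite (ky2_v n).1; exact: L_chargey2.
Qed.

Definition nsq (a : int * int) : R := a.1%:~R ^+ 2 + a.2%:~R ^+ 2.

Lemma dip_L_y a b f : dip (L a) (L b) (lap yforms f) f =
  2 * (\sum_(m <- yforms) ip (L a (mult m f)) (L b (mult m f)))
  + nsq (b - a) * ip (L a f) (L b f).
Proof.
rewrite (@dip_lap _ (L a) (L b) yforms (fun m => m (vu a)) (fun m => m (vu b))).
- congr (_ + _ * _); rewrite !big_cons big_nil !(ky1_v _).1 !(ky2_v _).1 /nsq/=.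
  by rewrite !intrD !intrN; ring.
- by move=> i; exact: L_chargey.
- by move=> i; exact: L_chargey.
Qed.

Definition chg s t : R := \sum_(m <- xforms) (m t - m s) ^+ 2.

(** In x the two halves of [L n] carry different charges, so that [L n] itself has none and four
    pairs appear; in y both halves have charge -n. The cancellation between the particles is lost,
    but these terms come with the factor [kap], which allows a bound by the full x-gradient. *)
Definition errX a b f : R :=
  chg (vu a) (vu b) * ip (Lu a f) (Lu b f) + chg (vu a) (vp b) * ip (Lu a f) (Lp b f)
  + chg (vp a) (vu b) * ip (Lp a f) (Lu b f) + chg (vp a) (vp b) * ip (Lp a f) (Lp b f).

Lemma dip_L_x a b f : dip (L a) (L b) (lap xforms f) f =
  2 * (\sum_(m <- xforms) ip (L a (mult m f)) (L b (mult m f))) + errX a b f.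
Proof.
have Lu_ch n i : (i < size xforms)%N ->
    has_charge (nth 0 xforms i) (nth 0 xforms i (vu n)) (Lu n).
  by move=> i4; apply: Lu_charge; exact: xforms_additive.
have Lp_ch n i : (i < size xforms)%N ->
    has_charge (nth 0 xforms i) (nth 0 xforms i (vp n)) (Lp n).
  by move=> i4; apply: Lp_charge; exact: xforms_additive.
have -> : dip (L a) (L b) (lap xforms f) f =
  dip (Lu a) (Lu b) (lap xforms f) f + dip (Lu a) (Lp b) (lap xforms f) f +
  dip (Lp a) (Lu b) (lap xforms f) f + dip (Lp a) (Lp b) (lap xforms f) f.
  by rewrite /dip !L_def !(ipDl, ipDr); ring.
rewrite (@dip_lap _ (Lu a) (Lu b) xforms (fun m => m (vu a)) (fun m => m (vu b)) f (Lu_ch a) (Lu_ch b)).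
rewrite (@dip_lap _ (Lu a) (Lp b) xforms (fun m => m (vu a)) (fun m => m (vp b)) f (Lu_ch a) (Lp_ch b)).
rewrite (@dip_lap _ (Lp a) (Lu b) xforms (fun m => m (vp a)) (fun m => m (vu b)) f (Lp_ch a) (Lu_ch b)).
rewrite (@dip_lap _ (Lp a) (Lp b) xforms (fun m => m (vp a)) (fun m => m (vp b)) f (Lp_ch a) (Lp_ch b)).
have -> : \sum_(m <- xforms) ip (L a (mult m f)) (L b (mult m f)) =
  \sum_(m <- xforms) ip (Lu a (mult m f)) (Lu b (mult m f)) +
  \sum_(m <- xforms) ip (Lu a (mult m f)) (Lp b (mult m f)) +
  \sum_(m <- xforms) ip (Lp a (mult m f)) (Lu b (mult m f)) +
  \sum_(m <- xforms) ip (Lp a (mult m f)) (Lp b (mult m f)).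
  rewrite -!big_split/=; apply: eq_bigr => m _.
  by rewrite !L_def !(ipDl, ipDr); ring.
by rewrite /errX /chg; ring.
Qed.

Lemma chg_le s t : (forall i, (i < 4)%N -> `|nth 0 xforms i t| <= 3) ->
  (forall i, (i < 4)%N -> `|nth 0 xforms i s| <= 3) -> 0 <= chg s t <= 144.
Proof.
move=> ht hs.
have H i : (i < 4)%N -> (nth 0 xforms i t - nth 0 xforms i s) ^+ 2 <= 36.
  move=> i4; rewrite -[X in X <= _]ger0_norm ?sqr_ge0// normrX.
  rewrite (_ : 36 = 6 ^+ 2); last by ring.
  rewrite ler_sqr ?nnegrE//; apply: le_trans (ler_normB _ _) _.
  by have := ht i i4; have := hs i i4; lra.
have := H 0%N isT; have := H 1%N isT; have := H 2%N isT; have := H 3%N isT => /=.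
rewrite /chg !big_cons big_nil => *; apply/andP; split; last lra.
by rewrite !addr_ge0 ?sqr_ge0.
Qed.

Lemma xforms_small n i : small 3 n -> (i < 4)%N ->
  `|nth 0 xforms i (vu n)| <= 3 /\ `|nth 0 xforms i (vp n)| <= 3.
Proof.
move=> /andP[n1 n2].
have a : `|n.1%:~R : R| <= 3 by rewrite -intr_norm (ler_int R `|n.1| 3).
have b : `|n.2%:~R : R| <= 3 by rewrite -intr_norm (ler_int R `|n.2| 3).
by case: i => [|[|[|[|[]]]]]//= _; rewrite /kx1 /kx2 /kx3 /kx4/= ?normr0.
Qed.

(** Four pairs, charges at most 4 . (3 + 3)^2 = 144, and each half of a field at most 6 times the
    x-gradient by [nrm_LuLp]. *)
Definition cX : R := locked_with fseq_key (4 * (144 * (6 * 6))).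
Lemma cXE : cX = 4 * (144 * (6 * 6)). Proof. by rewrite /cX unlock. Qed.

Lemma errX_le a b f : small 3 a -> small 3 b -> `|errX a b f| <= cX * pf f.
Proof.
move=> sa sb; have [ua pa] := nrm_LuLp f sa; have [ub pb] := nrm_LuLp f sb.
have p2 : Num.sqrt (pf f) * Num.sqrt (pf f) = pf f by rewrite -expr2 sqr_sqrtr// sumsq_ge0.
have H s t x y : (forall i, (i < 4)%N -> `|nth 0 xforms i t| <= 3) ->
  (forall i, (i < 4)%N -> `|nth 0 xforms i s| <= 3) ->
  nrm x <= 6 * Num.sqrt (pf f) -> nrm y <= 6 * Num.sqrt (pf f) ->
  `|chg s t * ip x y| <= 144 * (6 * 6) * pf f.
  move=> ht hs hx hy; have /andP[c0 c1] := chg_le ht hs.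
  rewrite normrM (ger0_norm c0).
  have -> : 144 * (6 * 6) * pf f = 144 * (6 * Num.sqrt (pf f) * (6 * Num.sqrt (pf f))).
    by rewrite -[in LHS]p2; ring.
  by apply: ler_pM => //; exact: ip_bound.
have ra i (e : (i < 4)%N) := xforms_small sa e.
have rb i (e : (i < 4)%N) := xforms_small sb e.
have B1 := H (vu a) (vu b) (Lu a f) (Lu b f) (fun i e => (rb i e).1) (fun i e => (ra i e).1) ua ub.
have B2 := H (vu a) (vp b) (Lu a f) (Lp b f) (fun i e => (rb i e).2) (fun i e => (ra i e).1) ua pb.
have B3 := H (vp a) (vu b) (Lp a f) (Lu b f) (fun i e => (rb i e).1) (fun i e => (ra i e).2) pa ub.
have B4 := H (vp a) (vp b) (Lp a f) (Lp b f) (fun i e => (rb i e).2) (fun i e => (ra i e).2) pa pb.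
set D := 144 * (6 * 6) * pf f in B1 B2 B3 B4.
rewrite /errX cXE (_ : _ * pf f = D + D + D + D); last by rewrite /D; ring.
by do 3![apply: le_trans (ler_normD _ _) _; apply: lerD => //].
Qed.

End Estimates.
Arguments cX {R}.

Section Derivatives.
Variable R : realType.
Notation V := (fseq R).
Implicit Types (n : int * int).
Notation xforms := (xforms R).
Notation yforms := (yforms R).
Notation Q1 := (mult (@ky1 R)).
Notation Q2 := (mult (@ky2 R)).

(** The second order squares that occur in the dissipation. In [qq], [wq], [wp], [qp] the second
    letter tells whether the additional derivative is in y (q) or in x (p). *)
Definition qqf (f : V) : R := sumover yforms (@qf R) f.
Definition wqf (f : V) : R := sumover yforms (@w R) f.
Definition wpf (f : V) : R := sumover xforms (@w R) f.
Definition qpf (f : V) : R := sumover xforms (@qf R) f.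

Section Fixed.
Variable f : V.

Local Notation a := (Num.sqrt (qf f)).
Local Notation A := (Num.sqrt (qqf f)).
Local Notation b1 := (Num.sqrt (vlev level1 f)).
Local Notation b2 := (Num.sqrt (vlev level2 f)).
Local Notation b := (Num.sqrt (w f)).
Local Notation bq := (Num.sqrt (wqf f)).
Local Notation pp := (Num.sqrt (pf f)).
Local Notation wpp := (Num.sqrt (wpf f)).
Local Notation qpp := (Num.sqrt (qpf f)).

Lemma qf_ge0 g : 0 <= qf g :> R. Proof. exact: sumsq_ge0. Qed.
Lemma pf_ge0 g : 0 <= pf g :> R. Proof. exact: sumsq_ge0. Qed.
Lemma qqf_ge0 g : 0 <= qqf g. Proof. by apply: sumover_ge0; exact: qf_ge0. Qed.
Lemma wqf_ge0 g : 0 <= wqf g. Proof. by apply: sumover_ge0; exact: w_ge0. Qed.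
Lemma wpf_ge0 g : 0 <= wpf g. Proof. by apply: sumover_ge0; exact: w_ge0. Qed.
Lemma qpf_ge0 g : 0 <= qpf g. Proof. by apply: sumover_ge0; exact: qf_ge0. Qed.

Lemma cL_ge0 : 0 <= cL :> R. Proof. by apply: le_trans (@cL_ge1 R). Qed.

Lemma nrm_Q1 : nrm (Q1 f) <= a. Proof. exact: (@nrm_sumsq _ yforms f 0%N). Qed.
Lemma nrm_Q2 : nrm (Q2 f) <= a. Proof. exact: (@nrm_sumsq _ yforms f 1%N). Qed.

Lemma nrm_LQ1 n : small 3 n -> nrm (L n (Q1 f)) <= cL * bq.
Proof.
move=> /andP[n1 n2]; apply: le_trans (nrm_L_le _ n1 n2) _; apply: ler_wpM2l; first exact: cL_ge0.
apply: ler_wsqrtr; exact: (@le_sumover _ yforms (@w R) f 0%N (@w_ge0 R)).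
Qed.
Lemma nrm_LQ2 n : small 3 n -> nrm (L n (Q2 f)) <= cL * bq.
Proof.
move=> /andP[n1 n2]; apply: le_trans (nrm_L_le _ n1 n2) _; apply: ler_wpM2l; first exact: cL_ge0.
apply: ler_wsqrtr; exact: (@le_sumover _ yforms (@w R) f 1%N (@w_ge0 R)).
Qed.
Lemma nrm_Lf n : small 3 n -> nrm (L n f) <= cL * b.
Proof. by move=> /andP[n1 n2]; exact: nrm_L_le. Qed.

Lemma sum_ip_L_y n n' : small 3 n -> small 3 n' ->
  `|\sum_(m <- yforms) ip (L n (mult m f)) (L n' (mult m f))| <= cL ^+ 2 * wqf f.
Proof.
move=> /andP[n1 n2] /andP[n1' n2']; apply: le_trans (ler_norm_sum _ _ _) _.
rewrite /wqf /sumover mulr_sumr; apply: ler_sum => m _.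
rewrite (_ : cL ^+ 2 * w (mult m f) = cL * Num.sqrt (w (mult m f)) * (cL * Num.sqrt (w (mult m f)))).
  by apply: ip_bound; exact: nrm_L_le.
by rewrite -{1}[w _]sqr_sqrtr ?w_ge0//; ring.
Qed.
Lemma sum_ip_L_x n n' : small 3 n -> small 3 n' ->
  `|\sum_(m <- xforms) ip (L n (mult m f)) (L n' (mult m f))| <= cL ^+ 2 * wpf f.
Proof.
move=> /andP[n1 n2] /andP[n1' n2']; apply: le_trans (ler_norm_sum _ _ _) _.
rewrite /wpf /sumover mulr_sumr; apply: ler_sum => m _.
rewrite (_ : cL ^+ 2 * w (mult m f) = cL * Num.sqrt (w (mult m f)) * (cL * Num.sqrt (w (mult m f)))).
  by apply: ip_bound; exact: nrm_L_le.
by rewrite -{1}[w _]sqr_sqrtr ?w_ge0//; ring.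
Qed.

(* Fields of different y-frequencies are almost orthogonal on functions with
   a small y-gradient. *)
Lemma ip_L_cross n n' (x x' : R) : n != n' -> small 3 n -> small 3 n' ->
  nrm (L n f) <= x -> nrm (L n' f) <= x' ->
  `|ip (L n f) (L n' f)| <= cL * bq * (x + x').
Proof.
move=> nn' sn sn' hx hx'.
have gen_ m (d : R) : ip (L n (mult m f)) (L n' f) - ip (L n f) (L n' (mult m f)) =
    d * ip (L n f) (L n' f) -> 1 <= `|d| ->
    nrm (L n (mult m f)) <= cL * bq -> nrm (L n' (mult m f)) <= cL * bq ->
    `|ip (L n f) (L n' f)| <= cL * bq * (x + x').
  move=> E d1 h1 h2; apply: (@le_trans _ _ (`|d * ip (L n f) (L n' f)|)).
    by rewrite normrM ler_peMl.
  rewrite -E; apply: le_trans (ler_normB _ _) _; rewrite mulrDr addrC.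
  by apply: lerD; [rewrite mulrC|]; exact: ip_bound.
have [e1|e1] := eqVneq n.1 n'.1; last first.
  apply: gen_ (charge1 f (@L_chargey1 R n) (@L_chargey1 R n')) _ _ _.
  - by rewrite -!intrN -intrD -intr_norm (ler_int R 1); lia.
  - exact: nrm_LQ1.
  - exact: nrm_LQ1.
have e2 : n.2 != n'.2.
  by apply: contraNneq nn' => e2; rewrite [n]surjective_pairing e1 e2 -surjective_pairing.
apply: gen_ (charge1 f (@L_chargey2 R n) (@L_chargey2 R n')) _ _ _.
- by rewrite -!intrN -intrD -intr_norm (ler_int R 1); lia.
- exact: nrm_LQ2.
- exact: nrm_LQ2.
Qed.

(* Here L_n' is moved to the other factor, so that only the norm of L_n f
   appears at top order. *)
Lemma ip_L_swap n n' (x : R) : n != n' -> small 3 n -> small 3 n' -> small 3 (n' - n) ->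
  nrm (L n f) <= x ->
  `|ip (L n f) (L n' f)| <= 2 * cL * (bq * x) + 18 * cL * (a * b).
Proof.
move=> nn' sn sn' snn hx.
have cr : `|cross R (- n) n'| <= 18.
  rewrite /cross -intr_norm (ler_int R _ 18)/=.
  by move: sn sn'; rewrite /small => /andP[? ?] /andP[? ?]; nia.
have gen_ m (d : R) : ip (L n (mult m f)) (L n' f) - ip (L n f) (L n' (mult m f)) =
    d * ip (L n f) (L n' f) -> 1 <= `|d| ->
    nrm (L n' (mult m f)) <= cL * bq -> nrm (mult m f) <= a ->
    `|ip (L n f) (L n' f)| <= 2 * cL * (bq * x) + 18 * cL * (a * b).
  move=> E d1 h1 h2; apply: (@le_trans _ _ (`|d * ip (L n f) (L n' f)|)).
    by rewrite normrM ler_peMl.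
  rewrite -E.
  have -> : ip (L n (mult m f)) (L n' f) =
      ip (L (- n') (mult m f)) (L (- n) f) - cross R (- n) n' * ip (mult m f) (L (n' - n) f).
    by rewrite !L_adj opprK L_comm ipDr ipZr (addrC (- n)); ring.
  have B1 := ip_bound (f := L (- n') (mult m f)) (g := L (- n) f)
    (x := cL * bq) (y := x).
  have B2 := ip_bound h2 (nrm_Lf snn).
  have B3 := ip_bound hx h1.
  rewrite !nrm_LN in B1; have {}B1 := B1 h1 hx.
  have B4 : `|cross R (- n) n' * ip (mult m f) (L (n' - n) f)| <= 18 * (a * (cL * b)).
    by rewrite normrM; apply: ler_pM.
  move: B1 B3 B4; rewrite !ler_norml => /andP[? ?] /andP[? ?] /andP[? ?].
  by apply/andP; split; lra.
have [e1|e1] := eqVneq n.1 n'.1; last first.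
  apply: gen_ (charge1 f (@L_chargey1 R n) (@L_chargey1 R n')) _ _ _.
  - by rewrite -!intrN -intrD -intr_norm (ler_int R 1); lia.
  - exact: nrm_LQ1.
  - exact: nrm_Q1.
have e2 : n.2 != n'.2.
  by apply: contraNneq nn' => e2; rewrite [n]surjective_pairing e1 e2 -surjective_pairing.
apply: gen_ (charge1 f (@L_chargey2 R n) (@L_chargey2 R n')) _ _ _.
- by rewrite -!intrN -intrD -intr_norm (ler_int R 1); lia.
- exact: nrm_LQ2.
- exact: nrm_Q2.
Qed.

Lemma dip_L_y_le n n' (x : R) : nsq R (n' - n) = 1 -> small 3 n -> small 3 n' ->
  small 3 (n' - n) -> n != n' -> nrm (L n f) <= x ->
  `|dip (L n) (L n') (lap yforms f) f| <=
  2 * cL ^+ 2 * wqf f + 2 * cL * (bq * x) + 18 * cL * (a * b).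
Proof.
move=> e sn sn' snn nn' hx; rewrite dip_L_y e mul1r.
have := sum_ip_L_y sn sn'; have := ip_L_swap nn' sn sn' snn hx.
rewrite !ler_norml => /andP[? ?] /andP[? ?].
by apply/andP; split; lra.
Qed.

Lemma dip_L_x_le n n' : small 3 n -> small 3 n' ->
  `|dip (L n) (L n') (lap xforms f) f| <= 2 * cL ^+ 2 * wpf f + cX * pf f.
Proof.
move=> sn sn'; rewrite dip_L_x.
have := sum_ip_L_x sn sn'; have := errX_le f sn sn'.
rewrite !ler_norml => /andP[? ?] /andP[? ?].
by apply/andP; split; lra.
Qed.

Lemma dip_Ld n h : dip (L n) (Ld n) h f = 2^-1 *
  (n.1%:~R * (dip (L n) (L (n - (0, 1))) h f - dip (L n) (L (n + (0, 1))) h f)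
 + n.2%:~R * (dip (L n) (L (n - (1, 0))) h f - dip (L n) (L (n + (1, 0))) h f)).
Proof. by rewrite /dip /Ld !diff_opE !(ipZr, ipDr, ipNr); ring. Qed.

Lemma diff_bound (u1 u2 u3 u4 c1 c2 k1 k2 M : R) : 0 <= M -> `|c1| <= k1 -> `|c2| <= k2 ->
  `|u1| <= M -> `|u2| <= M -> `|u3| <= M -> `|u4| <= M ->
  `|2^-1 * (c1 * (u1 - u2) + c2 * (u3 - u4))| <= (k1 + k2) * M.
Proof.
move=> M0 c1k c2k h1 h2 h3 h4.
have H u v c k : `|u| <= M -> `|v| <= M -> `|c| <= k -> `|c * (u - v)| <= k * (2 * M).
  move=> hu hv hc; rewrite normrM; apply: ler_pM => //.
  by apply: le_trans (ler_normB _ _) _; lra.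
rewrite normrM ger0_norm ?invr_ge0//.
rewrite (_ : (k1 + k2) * M = 2^-1 * (k1 * (2 * M) + k2 * (2 * M))); last by field.
rewrite ler_wpM2l ?invr_ge0//; apply: le_trans (ler_normD _ _) _.
by apply: lerD; exact: H.
Qed.

Lemma nrm_Ld_le n : small 2 n -> nrm (Ld n f) <= 4 * cL * b.
Proof.
move=> /andP[n1 n2].
have c1 : `|n.1%:~R : R| <= 2 by rewrite -intr_norm (ler_int R _ 2).
have c2 : `|n.2%:~R : R| <= 2 by rewrite -intr_norm (ler_int R _ 2).
have H k k' (c : R) : small 3 k -> small 3 k' -> `|c| <= 2 ->
    nrm (c *: (L k f - L k' f)) <= 4 * cL * b.
  move=> sk sk' hc; rewrite nrmZ.
  rewrite (_ : 4 * cL * b = 2 * (cL * b + cL * b)); last by ring.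
  apply: ler_pM; rewrite ?nrm_ge0//; apply: le_trans (nrmB _ _) _.
  by apply: lerD; exact: nrm_Lf.
rewrite /Ld diff_opE nrmZ ger0_norm ?invr_ge0// mulrC ler_pdivrMr//.
apply: le_trans (nrmD _ _) _; rewrite mulrDr mulr1; apply: lerD; apply: H => //; rewrite /small/=; lia.
Qed.

Lemma nrm_Ldd_le n : small 1 n -> nrm (Ldd n f) <= 8 * cL * b.
Proof.
move=> /andP[n1 n2].
have c1 : `|n.1%:~R : R| <= 1 by rewrite -intr_norm (ler_int R _ 1).
have c2 : `|n.2%:~R : R| <= 1 by rewrite -intr_norm (ler_int R _ 1).
have H k k' (c : R) : small 2 k -> small 2 k' -> `|c| <= 1 ->
    nrm (c *: (Ld k f - Ld k' f)) <= 8 * cL * b.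
  move=> sk sk' hc; rewrite nrmZ.
  rewrite (_ : 8 * cL * b = 1 * (4 * cL * b + 4 * cL * b)); last by ring.
  apply: ler_pM; rewrite ?nrm_ge0//; apply: le_trans (nrmB _ _) _.
  by apply: lerD; exact: nrm_Ld_le.
rewrite /Ldd diff_opE nrmZ ger0_norm ?invr_ge0// mulrC ler_pdivrMr//.
apply: le_trans (nrmD _ _) _; rewrite mulrDr mulr1; apply: lerD; apply: H => //; rewrite /small/=; lia.
Qed.

End Fixed.
End Derivatives.

Section DissipationEstimates.
Variable R : realType.
Notation V := (fseq R).
Implicit Types (n : int * int).
Notation xforms := (xforms R).
Notation yforms := (yforms R).
Notation Q1 := (mult (@ky1 R)).
Notation Q2 := (mult (@ky2 R)).

Variables (f : V) (kap nu : R).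
Hypotheses (kap0 : 0 <= kap) (nu0 : 0 <= nu).
Hypothesis f_off : forall K : Z6, K.1 = 0 -> f K = 0.

Local Notation a := (Num.sqrt (qf f)).
Local Notation A := (Num.sqrt (qqf f)).
Local Notation b1 := (Num.sqrt (vlev level1 f)).
Local Notation b2 := (Num.sqrt (vlev level2 f)).
Local Notation b := (Num.sqrt (w f)).
Local Notation bq := (Num.sqrt (wqf f)).
Local Notation pp := (Num.sqrt (pf f)).
Local Notation wpp := (Num.sqrt (wpf f)).
Local Notation qpp := (Num.sqrt (qpf f)).

(** A single constant that dominates the numerical factors of all error terms below. *)
Definition cC : R := locked_with fseq_key (1000 * cL ^+ 2 + 1000 * cL + 1000 * cX).
Lemma cCE : cC = 1000 * cL ^+ 2 + 1000 * cL + 1000 * cX.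
Proof. by rewrite /cC unlock. Qed.

Lemma cX_ge1 : 1 <= cX :> R. Proof. by rewrite cXE; lra. Qed.

Lemma dip_id : dip idfun idfun (gen kap nu f) f = - 2 * nu * qf f - 2 * kap * pf f.
Proof.
rewrite (dip_gen idfun idfun) (_ : dip idfun idfun (T f) f = 0); last first.
  by rewrite /dip/= T_adj; ring.
have E ms : dip idfun idfun (lap ms f) f = 2 * sumsq ms f.
  rewrite (@dip_lap _ idfun idfun ms (fun=> 0) (fun=> 0)).
  - rewrite [X in _ + X * _](eq_bigr (fun=> 0)) ?big1_eq ?mul0r ?addr0//.
    by move=> m _; rewrite subrr expr0n.
  - by move=> i _; exact: id_charge0.
  - by move=> i _; exact: id_charge0.
by rewrite !E /qf /pf; ring.
Qed.

Lemma dip_mult_lap m ms : dip (mult m) (mult m) (lap ms f) f =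
  2 * \sum_(m' <- ms) ip (mult m (mult m' f)) (mult m (mult m' f)).
Proof.
rewrite (@dip_lap _ (mult m) (mult m) ms (fun=> 0) (fun=> 0)).
- rewrite [X in _ + X * _](eq_bigr (fun=> 0)) ?big1_eq ?mul0r ?addr0//.
  by move=> m' _; rewrite subrr expr0n.
- by move=> i _; exact: mult_charge0.
- by move=> i _; exact: mult_charge0.
Qed.

Lemma nrm_L1 n : n \in level1 -> nrm (L n f) <= b1. Proof. exact: nrm_vlev. Qed.
Lemma nrm_L2 n : n \in level2 -> nrm (L n f) <= b2. Proof. exact: nrm_vlev. Qed.
Lemma nrm_L1N n : n \in level1 -> nrm (L (- n) f) <= b1.
Proof. by rewrite nrm_LN; exact: nrm_vlev. Qed.

Lemma nrm_Qd : nrm (Qd1 f) <= b1 /\ nrm (Qd2 f) <= b1.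
Proof.
have H (x y : V) : nrm x <= b1 -> nrm y <= b1 -> nrm (2^-1 *: (x - y)) <= b1.
  move=> hx hy; rewrite nrmZ ger0_norm ?invr_ge0// mulrC ler_pdivrMr//.
  by apply: le_trans (nrmB _ _) _; move: hx hy; lra.
rewrite Qd1E Qd2E; split; apply: H.
- exact: (nrm_L1 (n := (1, 0))).
- exact: (nrm_L1N (n := (1, 0))).
- exact: (nrm_L1N (n := (0, 1))).
- exact: (nrm_L1 (n := (0, 1))).
Qed.

Lemma sumsq_y g : qf g = ip (Q1 g) (Q1 g) + ip (Q2 g) (Q2 g).
Proof. by rewrite /qf /sumsq !big_cons big_nil addr0. Qed.

Lemma dip_Q : dip Q1 Q1 (gen kap nu f) f + dip Q2 Q2 (gen kap nu f) f <=
  4 * (a * b1) - 2 * nu * qqf f - 2 * kap * qpf f.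
Proof.
rewrite !dip_gen !dip_mult_lap.
have t1 := transport (Q1T f) (Q1T f); have t2 := transport (Q2T f) (Q2T f).
rewrite /dip t1 t2.
have [d1 d2] := nrm_Qd.
have h1 := ip_bound (nrm_Q1 f) d1; have h2 := ip_bound (nrm_Q2 f) d2.
rewrite (ipC (Qd1 f)) (ipC (Qd2 f)).
have Eq : qqf f = \sum_(m' <- yforms) ip (Q1 (mult m' f)) (Q1 (mult m' f))
   + \sum_(m' <- yforms) ip (Q2 (mult m' f)) (Q2 (mult m' f)).
  by rewrite -big_split/=; apply: eq_bigr => m _; rewrite sumsq_y.
have Ep : qpf f = \sum_(m' <- xforms) ip (Q1 (mult m' f)) (Q1 (mult m' f))
   + \sum_(m' <- xforms) ip (Q2 (mult m' f)) (Q2 (mult m' f)).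
  by rewrite -big_split/=; apply: eq_bigr => m _; rewrite sumsq_y.
rewrite Eq Ep; move: h1 h2; rewrite !ler_norml => /andP[+ _] /andP[+ _].
set s1 := bigop _ _ _; set s2 := bigop _ _ _; set s3 := bigop _ _ _; set s4 := bigop _ _ _.
set i1 := ip _ _; set i2 := ip _ _; set ab := _ * b1.
by clearbody s1 s2 s3 s4 i1 i2 ab; lra.
Qed.

Lemma bq_ge0 : 0 <= bq. Proof. exact: sqrtr_ge0. Qed.
Lemma b_ge0 : 0 <= b. Proof. exact: sqrtr_ge0. Qed.

(** [Ld n] involves only neighbours of n, never n itself, so each of its products with [L n f] pairs
    different y-frequencies and is small with the y-gradient. *)
Lemma ip_L_Ld n : small 2 n -> `|ip (L n f) (Ld n f)| <= 8 * cL ^+ 2 * (bq * b).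
Proof.
move=> sn; rewrite /Ld diff_opE !(ipZr, ipDr, ipNr).
have c1 : `|n.1%:~R : R| <= 2 by rewrite -intr_norm (ler_int R _ 2); case/andP: sn.
have c2 : `|n.2%:~R : R| <= 2 by rewrite -intr_norm (ler_int R _ 2); case/andP: sn.
have H k : n != k -> small 3 k -> `|ip (L n f) (L k f)| <= 2 * cL ^+ 2 * (bq * b).
  move=> nk sk; have s3 : small 3 n by move: sn; rewrite /small; lia.
  have -> : 2 * cL ^+ 2 * (bq * b) = cL * bq * (cL * b + cL * b) by ring.
  by apply: ip_L_cross => //; exact: nrm_Lf.
have M0 : 0 <= 2 * cL ^+ 2 * (bq * b).
  apply: mulr_ge0; last by apply: mulr_ge0; [exact: bq_ge0|exact: b_ge0].
  by apply: mulr_ge0 => //; exact: sqr_ge0.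
have -> : 8 * cL ^+ 2 * (bq * b) = (2 + 2) * (2 * cL ^+ 2 * (bq * b)) by ring.
have ne (k : int * int) : k != 0 -> n != n + k.
  by move=> k0; rewrite -[X in X != _]addr0 (inj_eq (addrI n)) eq_sym.
by apply: diff_bound => //; apply: H; rewrite ?ne//; move: sn; rewrite /small/=; lia.
Qed.

Lemma dip_LL n : small 2 n -> dip (L n) (L n) (gen kap nu f) f <=
  16 * cL ^+ 2 * (bq * b) + kap * (cX * pf f)
  - 2 * kap * (\sum_(m <- xforms) ip (L n (mult m f)) (L n (mult m f)))
  - 2 * nu * (\sum_(m <- yforms) ip (L n (mult m f)) (L n (mult m f))).
Proof.
move=> sn; rewrite dip_gen dip_L_x dip_L_y.
have t := transport (LT n f) (LT n f).
rewrite /dip t (ipC (Ld n f)) subrr (_ : nsq R 0 = 0); last by rewrite /nsq/= expr0n/= addr0.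
have s3 : small 3 n by move: sn; rewrite /small; lia.
have := ip_L_Ld sn; have := errX_le f s3 s3; rewrite !ler_norml => /andP[+ _] /andP[+ _].
set s1 := bigop _ _ _; set s2 := bigop _ _ _; set e := errX _ _ _; set i1 := ip _ _.
clearbody s1 s2 e i1; move=> h1 h2; have h3 : kap * - (cX * pf f) <= kap * e by rewrite ler_wpM2l.
lra.
Qed.

Lemma dip_vlev (B : seq (int * int)) : all (small 2) B ->
  \sum_(n <- B) dip (L n) (L n) (gen kap nu f) f <=
  (size B)%:R * (16 * cL ^+ 2 * (bq * b) + kap * (cX * pf f))
  - 2 * kap * sumover xforms (vlev B) f - 2 * nu * sumover yforms (vlev B) f.
Proof.
elim: B => [|n B IH] /=.
  have Z ms : sumover ms (vlev [::]) f = 0.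
    by apply: big1 => m _; rewrite /vlev big_nil.
  by move=> _; rewrite big_nil !Z !mulr0 mul0r !subr0.
move=> /andP[sn sB]; rewrite big_cons.
have E ms : sumover ms (vlev (n :: B)) f =
    \sum_(m <- ms) ip (L n (mult m f)) (L n (mult m f)) + sumover ms (vlev B) f.
  by rewrite /sumover -big_split/=; apply: eq_bigr => m _; rewrite /vlev big_cons.
rewrite !E -natr1; have := IH sB; have := dip_LL sn.
set Z := 16 * _ * _ + _; set D := dip _ _ _ _; set S := bigop _ _ _; set s1 := bigop _ _ _.
set s2 := bigop _ _ _; set v1 := sumover _ _ _; set v2 := sumover _ _ _.
by move: (size B)%:R => N; clearbody Z D S s1 s2 v1 v2; lra.
Qed.

Lemma dip_w : \sum_(n <- level1) dip (L n) (L n) (gen kap nu f) f +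
  \sum_(n <- level2) dip (L n) (L n) (gen kap nu f) f +
  \sum_(n <- level3) dip (L n) (L n) (gen kap nu f) f <=
  cC * (bq * b) + cC * kap * pf f - 2 * kap * wpf f - 2 * nu * wqf f.
Proof.
have E ms : sumover ms (@w R) f = sumover ms (vlev level1) f + sumover ms (vlev level2) f
    + sumover ms (vlev level3) f by rewrite /sumover -!big_split.
have Ep : wpf f = _ := E xforms; have Eq : wqf f = _ := E yforms.
have h1 : 128 * cL ^+ 2 * (bq * b) <= cC * (bq * b).
  rewrite ler_wpM2r ?mulr_ge0 ?bq_ge0 ?b_ge0// cCE.
  by have := cL_ge0 R; have := cX_ge1; have := sqr_ge0 (@cL R); lra.
have h2 : 8 * (kap * (cX * pf f)) <= cC * kap * pf f.
  rewrite (_ : 8 * _ = 8 * cX * (kap * pf f)); last by ring.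
  rewrite -[X in _ <= X]mulrA; apply: ler_wpM2r; first by rewrite mulr_ge0 ?pf_ge0.
  rewrite cCE.
  by have := cL_ge0 R; have := cX_ge1; have := sqr_ge0 (@cL R); lra.
have := dip_vlev (B := level1) isT; have := dip_vlev (B := level2) isT.
have := dip_vlev (B := level3) isT; move: h1 h2.
rewrite (_ : size level1 = 2%N)// (_ : size level2 = 2%N)// (_ : size level3 = 4%N)//.
set x1 := bq * b; set x2 := kap * (cX * _); clearbody x1; rewrite Ep Eq.
set S1 := bigop _ _ _; set S2 := bigop _ _ _; set S3 := bigop _ _ _.
set v1 := sumover _ _ _; set v2 := sumover _ _ _; set v3 := sumover _ _ _.
set v4 := sumover _ _ _; set v5 := sumover _ _ _; set v6 := sumover _ _ _.
by clearbody S1 S2 S3 v1 v2 v3 v4 v5 v6; lra.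
Qed.

(** The commutator of an x-derivative with [L n]. The two halves get different factors, so it is
    controlled by the full x-gradient rather than by [w]. *)
Definition Pd (m : Z6 -> R) n : V := m (vu n) *: Lu n f + m (vp n) *: Lp n f.

Lemma mult_L m n : additive_form m -> mult m (L n f) = L n (mult m f) + Pd m n.
Proof.
move=> mD; rewrite !L_def linearD/= (Lu_charge _ mD) (Lp_charge _ mD) /Pd.
by apply: fseq_ext => K; rewrite !fseqE; ring.
Qed.

(** The transport may stretch the x-gradient, at a bounded rate that carries no factor [kap]. In the
    functional this term has the weight [Kc^-1 * kap], and the dissipation [kap * pf f] of |f|^2
    absorbs the growth. *)
Lemma dip_x i : (i < 4)%N ->
  dip (mult (nth 0 xforms i)) (mult (nth 0 xforms i)) (gen kap nu f) f <= 144 * pf f.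
Proof.
move=> i4; set m := nth 0 xforms i; have mD : additive_form m by exact: xforms_additive.
rewrite dip_gen !dip_mult_lap.
pose D : V := 2^-1 *: (Pd m (0, 1) - Pd m (1, 0) + Pd m (0, -1) - Pd m (-1, 0)).
have mT : mult m (T f) = T (mult m f) + D.
  rewrite !TE linearZ/= -scalerDr; congr (_ *: _).
  have E4 (y1 y2 y3 y4 : V) : mult m (y1 - y2 + y3 - y4) =
    mult m y1 - mult m y2 + mult m y3 - mult m y4 by rewrite linearB linearD linearB.
  rewrite E4 !(mult_L _ mD).
  by move: (Pd m) => P; apply: fseq_ext => K; rewrite !fseqE; ring.
rewrite /dip (transport mT mT) (ipC D).
have hP n : small 3 n -> nrm (Pd m n) <= 36 * pp.
  move=> sn; have [h1 h2] := nrm_LuLp f sn; have [k1 k2] := xforms_small R sn i4.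
  apply: le_trans (nrmD _ _) _; rewrite !nrmZ (_ : 36 * pp = 3 * (6 * pp) + 3 * (6 * pp)); last by ring.
  by apply: lerD; apply: ler_pM => //; exact: nrm_ge0.
have hD : nrm D <= 72 * pp.
  rewrite nrmZ ger0_norm ?invr_ge0// mulrC ler_pdivrMr//.
  have h1 := hP (0, 1) isT; have h2 := hP (1, 0) isT; have h3 := hP (0, -1) isT.
  have h4 := hP (-1, 0) isT.
  apply: le_trans (nrmB _ _) _.
  have := nrmD (Pd m (0, 1) - Pd m (1, 0)) (Pd m (0, -1)).
  have := nrmB (Pd m (0, 1)) (Pd m (1, 0)); lra.
have hm : nrm (mult m f) <= pp by exact: (@nrm_sumsq _ xforms f i i4).
have := ip_bound hm hD; rewrite ler_norml => /andP[+ _].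
have -> : pp * (72 * pp) = 72 * pf f.
  by rewrite -[in RHS](@sqr_sqrtr _ (pf f)) ?pf_ge0//; ring.
have s1_ge0 ms : 0 <= \sum_(m' <- ms) ip (mult m (mult m' f)) (mult m (mult m' f)).
  by apply: sumr_ge0 => k _; exact: ip_ge0.
move: (s1_ge0 xforms) (s1_ge0 yforms).
set s1 := bigop _ _ _; set s2 := bigop _ _ _; set i1 := ip _ _; clearbody s1 s2 i1.
move=> p1 p2; have q1 : 0 <= kap * s1 by rewrite mulr_ge0.
have q2 : 0 <= nu * s2 by rewrite mulr_ge0.
lra.
Qed.

Lemma dip_p : \sum_(m <- xforms) dip (mult m) (mult m) (gen kap nu f) f <= cC * pf f.
Proof.
have h : 576 * pf f <= cC * pf f.
  rewrite ler_wpM2r ?pf_ge0// cCE.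
  by have := cL_ge0 R; have := cX_ge1; have := sqr_ge0 (@cL R); lra.
have := dip_x (i := 0%N) isT; have := dip_x (i := 1%N) isT.
have := dip_x (i := 2%N) isT; have := dip_x (i := 3%N) isT.
by rewrite /xforms !big_cons big_nil addr0/= ; lra.
Qed.

End DissipationEstimates.
Arguments cC {R}.

(** * Mixed terms that pass from one level of fields to the next *)

Section MixedTerms.
Variable R : realType.
Notation V := (fseq R).
Implicit Types (n : int * int).
Notation xforms := (xforms R).
Notation yforms := (yforms R).
Notation Q1 := (mult (@ky1 R)).
Notation Q2 := (mult (@ky2 R)).

Variables (f : V) (kap nu : R).
Hypotheses (kap0 : 0 <= kap) (nu0 : 0 <= nu).
Hypothesis f_off : forall K : Z6, K.1 = 0 -> f K = 0.

Local Notation a := (Num.sqrt (qf f)).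
Local Notation A := (Num.sqrt (qqf f)).
Local Notation b1 := (Num.sqrt (vlev level1 f)).
Local Notation b2 := (Num.sqrt (vlev level2 f)).
Local Notation b := (Num.sqrt (w f)).
Local Notation bq := (Num.sqrt (wqf f)).
Local Notation pp := (Num.sqrt (pf f)).
Local Notation wpp := (Num.sqrt (wpf f)).
Local Notation qpp := (Num.sqrt (qpf f)).

Lemma cX_ge0 : 0 <= cX :> R. Proof. by have := @cX_ge1 R; lra. Qed.

(** The transport part gives - |Ld n f|^2, the gain at the neighbouring frequencies, and a product
    with the second commutator. The rest are errors of the two Laplacians; n and its neighbours
    differ by unit vectors, as [dip_L_y_le] requires. *)
Lemma dip_L_Ld n (x : R) : small 1 n -> nrm (L n f) <= x ->
  dip (L n) (Ld n) (gen kap nu f) f <= - ip (Ld n f) (Ld n f) + 8 * cL * (x * b)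
  + kap * (4 * cL ^+ 2 * wpf f + 2 * (cX * pf f))
  + nu * (4 * cL ^+ 2 * wqf f + 4 * cL * (bq * x) + 36 * cL * (a * b)).
Proof.
move=> sn hx.
have x0 : 0 <= x by apply: le_trans hx; exact: nrm_ge0.
have c1 : `|n.1%:~R : R| <= 1 by rewrite -intr_norm (ler_int R _ 1); case/andP: sn.
have c2 : `|n.2%:~R : R| <= 1 by rewrite -intr_norm (ler_int R _ 1); case/andP: sn.
have hT := transport (LT n f) (LdT n f).
have s3 : small 3 n by move: sn; rewrite /small; lia.
have hk (k : int * int) : k != 0 -> small 1 k ->
    [/\ small 3 (n + k), small 3 (n + k - n) & n != n + k].
  move=> k0 sk; split.
  - by move: sn sk; rewrite /small/=; lia.
  - rewrite addrC addKr; case/andP: sk => s1 s2; apply/andP.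
    by split; [apply: le_trans s1 _|apply: le_trans s2 _].
  - by rewrite -[X in X != _]addr0 (inj_eq (addrI n)) eq_sym.
have nX : 0 <= 2 * cL ^+ 2 * wpf f + cX * pf f.
  apply: addr_ge0; apply: mulr_ge0; [|exact: wpf_ge0|exact: cX_ge0|exact: pf_ge0].
  by apply: mulr_ge0 => //; exact: sqr_ge0.
have nY : 0 <= 2 * cL ^+ 2 * wqf f + 2 * cL * (bq * x) + 18 * cL * (a * b).
  have cc k : 0 <= k%:R * @cL R by apply: mulr_ge0 => //; exact: cL_ge0.
  apply: addr_ge0; [apply: addr_ge0|]; apply: mulr_ge0; rewrite ?cc ?wqf_ge0//.
  - by apply: mulr_ge0 => //; exact: sqr_ge0.
  - by apply: mulr_ge0 => //; exact: sqrtr_ge0.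
  all: try (apply: mulr_ge0; exact: sqrtr_ge0).
all: try exact: (cc 2%N).
all: try exact: (cc 18%N).
have dX (k : int * int) : k != 0 -> small 1 k ->
    `|dip (L n) (L (n + k)) (lap xforms f) f| <= 2 * cL ^+ 2 * wpf f + cX * pf f.
  by move=> k0 sk; have [h1 _ _] := hk k k0 sk; exact: dip_L_x_le.
have dY (k : int * int) : k != 0 -> small 1 k -> nsq R k = 1 ->
    `|dip (L n) (L (n + k)) (lap yforms f) f| <=
    2 * cL ^+ 2 * wqf f + 2 * cL * (bq * x) + 18 * cL * (a * b).
  move=> k0 sk k1; have [h1 h2 h3] := hk k k0 sk; apply: dip_L_y_le => //.
  by rewrite addrC addKr.
have nsq1 : nsq R (0, 1) = 1 by rewrite /nsq/= expr0n/= add0r expr1n.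
have nsq2 : nsq R (1, 0) = 1 by rewrite /nsq/= expr0n/= addr0 expr1n.
have nsqN k : nsq R (- k) = nsq R k by rewrite /nsq/= !intrN !sqrrN.
have DX : `|dip (L n) (Ld n) (lap xforms f) f| <= (1 + 1) * (2 * cL ^+ 2 * wpf f + cX * pf f).
  by rewrite dip_Ld; apply: diff_bound => //; apply: dX.
have DY : `|dip (L n) (Ld n) (lap yforms f) f| <=
    (1 + 1) * (2 * cL ^+ 2 * wqf f + 2 * cL * (bq * x) + 18 * cL * (a * b)).
  by rewrite dip_Ld; apply: diff_bound => //; apply: dY; rewrite ?nsqN.
have hL := ip_bound hx (nrm_Ldd_le f sn).
rewrite dip_gen {1}/dip hT.
move: DX DY hL; rewrite !ler_norml => /andP[+ _] /andP[+ _] /andP[+ _].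
set dx := dip _ _ _ _; set dy := dip _ _ _ _; set i1 := ip _ _; set i2 := ip _ _.
set X := _ + cX * _; set Y := 2 * _ * _ + _ + _.
move=> h1 h2 h3.
have k1 : kap * - dx <= kap * ((1 + 1) * X) by rewrite ler_wpM2l//; move: h1; lra.
have k2 : nu * - dy <= nu * ((1 + 1) * Y) by rewrite ler_wpM2l//; move: h2; lra.
by move: k1 k2 h3; rewrite /X /Y; clearbody dx dy i1 i2; lra.
Qed.

Lemma half_diff_sq (y y' : V) : ip (2^-1 *: (y - y')) (2^-1 *: (y - y')) =
  4^-1 * (ip y y + ip y' y') - 2^-1 * ip y y'.
Proof. by rewrite !(ipDl, ipDr, ipNl, ipNr, ipZl, ipZr) (ipC y' y); field. Qed.

(** The first commutators are half differences of second-level fields. In the square of such a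
    difference the cross product pairs different y-frequencies and is an error by [ip_L_cross], so a
    fixed share of the squares survives. *)
Lemma Ld_level1 : 2^-1 * vlev level2 f - 2 * cL * (bq * b2) <=
  ip (Ld (1, 0) f) (Ld (1, 0) f) + ip (Ld (0, 1) f) (Ld (0, 1) f).
Proof.
have e1 : Ld (1, 0) f = 2^-1 *: (L (1, -1) f - L (1, 1) f).
  by rewrite /Ld diff_opE scale0r addr0 scale1r.
have e2 : Ld (0, 1) f = 2^-1 *: (L (-1, 1) f - L (1, 1) f).
  by rewrite /Ld diff_opE scale0r add0r scale1r.
have hv : vlev level2 f = ip (L (1, 1) f) (L (1, 1) f) + ip (L (1, -1) f) (L (1, -1) f).
  by rewrite /vlev !big_cons big_nil addr0.
have hN : ip (L (-1, 1) f) (L (-1, 1) f) = ip (L (1, -1) f) (L (1, -1) f).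
  by rewrite -!sqr_nrm -(nrm_LN (1, -1)).
have n1 : nrm (L (1, 1) f) <= b2 by exact: nrm_L2.
have n2 : nrm (L (1, -1) f) <= b2 by exact: nrm_L2.
have n3 : nrm (L (-1, 1) f) <= b2 by rewrite (nrm_LN (1, -1)); exact: nrm_L2.
have c1 : `|ip (L (1, -1) f) (L (1, 1) f)| <= cL * bq * (b2 + b2) by exact: ip_L_cross.
have c2 : `|ip (L (-1, 1) f) (L (1, 1) f)| <= cL * bq * (b2 + b2) by exact: ip_L_cross.
move: c1 c2; set y := b2; set x := bq; clearbody x y.
rewrite e1 e2 !half_diff_sq hN hv !ler_norml => /andP[_ +] /andP[_ +].
set i1 := ip _ _; set i2 := ip _ _; set i3 := ip _ _; set i4 := ip _ _.
by clearbody i1 i2 i3 i4; lra.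
Qed.

Lemma half_sum4_sq (y1 y2 y3 y4 : V) (M : R) :
  `|ip y1 y2| <= M -> `|ip y1 y3| <= M -> `|ip y1 y4| <= M ->
  `|ip y2 y3| <= M -> `|ip y2 y4| <= M -> `|ip y3 y4| <= M ->
  4^-1 * (ip y2 y2 + ip y4 y4) - 3 * M <=
  ip (2^-1 *: (y1 - y2 + y3 - y4)) (2^-1 *: (y1 - y2 + y3 - y4)).
Proof.
rewrite !(ipDl, ipDr, ipNl, ipNr, ipZl, ipZr) (ipC y2 y1) (ipC y3 y1) (ipC y4 y1).
rewrite (ipC y3 y2) (ipC y4 y2) (ipC y4 y3) !ler_norml.
move=> /andP[? ?] /andP[? ?] /andP[? ?] /andP[? ?] /andP[? ?] /andP[? ?].
by have := ip_ge0 y1; have := ip_ge0 y3; lra.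
Qed.

(** The mechanism of [Ld_level1]; the squares of first-level fields, which also occur, are
    nonnegative and are dropped by [half_sum4_sq]. *)
Lemma Ld_level2 : 4^-1 * vlev level3 f - 12 * cL ^+ 2 * (bq * b) <=
  ip (Ld (1, 1) f) (Ld (1, 1) f) + ip (Ld (1, -1) f) (Ld (1, -1) f).
Proof.
have e1 : Ld (1, 1) f = 2^-1 *: (L (1, 0) f - L (1, 2) f + L (0, 1) f - L (2, 1) f).
  by rewrite /Ld diff_opE !scale1r addrA.
have e2 : Ld (1, -1) f = 2^-1 *: (L (1, -2) f - L (1, 0) f + L (2, -1) f - L (0, -1) f).
  by rewrite /Ld diff_opE scale1r mulrN1z scaleN1r opprB addrA.
(* Signs and order are changed to put the first-level fields in the positions that [half_sum4_sq]
   drops. *)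
have e2' : Ld (1, -1) f = 2^-1 *: (- L (1, 0) f - - L (1, -2) f + - L (0, -1) f - - L (2, -1) f).
  by rewrite e2; congr (_ *: _); apply: fseq_ext => K; rewrite !fseqE; ring.
have hv : vlev level3 f = ip (L (2, 1) f) (L (2, 1) f) + ip (L (2, -1) f) (L (2, -1) f)
   + ip (L (1, 2) f) (L (1, 2) f) + ip (L (1, -2) f) (L (1, -2) f).
  by rewrite /vlev !big_cons big_nil addr0 !addrA.
have c n k : n != k -> small 3 n -> small 3 k ->
    `|ip (L n f) (L k f)| <= 2 * cL ^+ 2 * (bq * b).
  move=> nk sn sk.
  have -> : 2 * cL ^+ 2 * (bq * b) = cL * bq * (cL * b + cL * b) by ring.
  by apply: ip_L_cross => //; exact: nrm_Lf.
have cN n k : n != k -> small 3 n -> small 3 k ->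
    `|ip (- L n f) (- L k f)| <= 2 * cL ^+ 2 * (bq * b).
  by move=> *; rewrite ipNl ipNr opprK; exact: c.
have h1 : 4^-1 * (ip (L (1, 2) f) (L (1, 2) f) + ip (L (2, 1) f) (L (2, 1) f))
    - 3 * (2 * cL ^+ 2 * (bq * b)) <= ip (Ld (1, 1) f) (Ld (1, 1) f).
  by rewrite e1; apply: half_sum4_sq; apply: c.
have h2 : 4^-1 * (ip (- L (1, -2) f) (- L (1, -2) f) + ip (- L (2, -1) f) (- L (2, -1) f))
    - 3 * (2 * cL ^+ 2 * (bq * b)) <= ip (Ld (1, -1) f) (Ld (1, -1) f).
  by rewrite e2'; apply: half_sum4_sq; apply: cN.
rewrite !(ipNl, ipNr) !opprK in h2.
rewrite hv; move: h1 h2; set x := bq * b; clearbody x.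
set i1 := ip _ _; set i2 := ip _ _; set i3 := ip _ _; set i4 := ip _ _.
set i5 := ip _ _; set i6 := ip _ _.
by clearbody i1 i2 i3 i4 i5 i6; lra.
Qed.

Lemma cC_bounds : [/\ 1 <= cC :> R, 100 * cL <= cC :> R, 100 * cL ^+ 2 <= cC :> R & 100 * cX <= cC :> R].
Proof.
by rewrite cCE; have := @cL_ge1 R; have := @cX_ge1 R; have := sqr_ge0 (@cL R) => *; split; lra.
Qed.

Lemma dip_M1 : dip (L (1, 0)) (Ld (1, 0)) (gen kap nu f) f + dip (L (0, 1)) (Ld (0, 1)) (gen kap nu f) f
  <= - (2^-1 * vlev level2 f) + cC * (b1 * b) + cC * (bq * b2) + cC * kap * wpf f + cC * kap * pf f
  + cC * nu * wqf f + cC * nu * (bq * b1) + cC * nu * (a * b).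
Proof.
have h1 := @dip_L_Ld (1, 0) b1 isT (nrm_L1 f (n := (1, 0)) isT).
have h2 := @dip_L_Ld (0, 1) b1 isT (nrm_L1 f (n := (0, 1)) isT).
have h3 := Ld_level1.
have [C0 C1 C2 C3] := cC_bounds.
have m1 : 100 * cL * (b1 * b) <= cC * (b1 * b) by rewrite ler_wpM2r ?mulr_ge0 ?sqrtr_ge0.
have m2 : 100 * cL * (bq * b2) <= cC * (bq * b2) by rewrite ler_wpM2r ?mulr_ge0 ?sqrtr_ge0.
have m3 : 100 * cL ^+ 2 * (kap * wpf f) <= cC * (kap * wpf f) by rewrite ler_wpM2r ?mulr_ge0 ?wpf_ge0.
have m4 : 100 * cX * (kap * pf f) <= cC * (kap * pf f) by rewrite ler_wpM2r ?mulr_ge0 ?pf_ge0.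
have m5 : 100 * cL ^+ 2 * (nu * wqf f) <= cC * (nu * wqf f) by rewrite ler_wpM2r ?mulr_ge0 ?wqf_ge0.
have m6 : 100 * cL * (nu * (bq * b1)) <= cC * (nu * (bq * b1)) by rewrite ler_wpM2r ?mulr_ge0 ?sqrtr_ge0.
have m7 : 100 * cL * (nu * (a * b)) <= cC * (nu * (a * b)) by rewrite ler_wpM2r ?mulr_ge0 ?sqrtr_ge0.
have p1 : 0 <= cL * (b1 * b) by rewrite !mulr_ge0 ?cL_ge0 ?cX_ge0 ?sqrtr_ge0 ?cL_ge0//.
have p2 : 0 <= cL * (bq * b2) by rewrite !mulr_ge0 ?cL_ge0 ?cX_ge0 ?sqrtr_ge0 ?cL_ge0//.
have p3 : 0 <= cL ^+ 2 * (kap * wpf f) by rewrite !mulr_ge0 ?cL_ge0 ?cX_ge0 ?sqr_ge0 ?wpf_ge0//.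
have p4 : 0 <= cX * (kap * pf f) by rewrite !mulr_ge0 ?cL_ge0 ?cX_ge0 ?pf_ge0//.
have p5 : 0 <= cL ^+ 2 * (nu * wqf f) by rewrite !mulr_ge0 ?cL_ge0 ?cX_ge0 ?sqr_ge0 ?wqf_ge0//.
have p6 : 0 <= cL * (nu * (bq * b1)) by rewrite !mulr_ge0 ?cL_ge0 ?cX_ge0 ?sqrtr_ge0 ?cL_ge0//.
have p7 : 0 <= cL * (nu * (a * b)) by rewrite !mulr_ge0 ?cL_ge0 ?cX_ge0 ?sqrtr_ge0 ?cL_ge0//.
move: h1 h2 h3 m1 m2 m3 m4 m5 m6 m7 p1 p2 p3 p4 p5 p6 p7.
clear C0 C1 C2 C3.
set d1 := dip _ _ _ _; set d2 := dip _ _ _ _; set i1 := ip _ _; set i2 := ip _ _.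
set z1 := wpf f; set z2 := pf f; set z3 := wqf f; set z4 := vlev _ _.
set s1 := Num.sqrt _; set s2 := Num.sqrt _; set s3 := Num.sqrt _; set s4 := Num.sqrt _; set s5 := Num.sqrt _.
by clearbody d1 d2 i1 i2 z1 z2 z3 z4 s1 s2 s3 s4 s5; lra.
Qed.

Lemma dip_M2 : dip (L (1, 1)) (Ld (1, 1)) (gen kap nu f) f + dip (L (1, -1)) (Ld (1, -1)) (gen kap nu f) f
  <= - (4^-1 * vlev level3 f) + cC * (b2 * b) + cC * (bq * b) + cC * kap * wpf f + cC * kap * pf f
  + cC * nu * wqf f + cC * nu * (bq * b2) + cC * nu * (a * b).
Proof.
have h1 := @dip_L_Ld (1, 1) b2 isT (nrm_L2 f (n := (1, 1)) isT).
have h2 := @dip_L_Ld (1, -1) b2 isT (nrm_L2 f (n := (1, -1)) isT).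
have h3 := Ld_level2.
have [C0 C1 C2 C3] := cC_bounds.
have m1 : 100 * cL * (b2 * b) <= cC * (b2 * b) by rewrite ler_wpM2r ?mulr_ge0 ?sqrtr_ge0.
have m2 : 100 * cL ^+ 2 * (bq * b) <= cC * (bq * b) by rewrite ler_wpM2r ?mulr_ge0 ?sqrtr_ge0.
have m3 : 100 * cL ^+ 2 * (kap * wpf f) <= cC * (kap * wpf f) by rewrite ler_wpM2r ?mulr_ge0 ?wpf_ge0.
have m4 : 100 * cX * (kap * pf f) <= cC * (kap * pf f) by rewrite ler_wpM2r ?mulr_ge0 ?pf_ge0.
have m5 : 100 * cL ^+ 2 * (nu * wqf f) <= cC * (nu * wqf f) by rewrite ler_wpM2r ?mulr_ge0 ?wqf_ge0.
have m6 : 100 * cL * (nu * (bq * b2)) <= cC * (nu * (bq * b2)) by rewrite ler_wpM2r ?mulr_ge0 ?sqrtr_ge0.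
have m7 : 100 * cL * (nu * (a * b)) <= cC * (nu * (a * b)) by rewrite ler_wpM2r ?mulr_ge0 ?sqrtr_ge0.
have p1 : 0 <= cL * (b2 * b) by rewrite !mulr_ge0 ?cL_ge0 ?cX_ge0 ?sqrtr_ge0 ?cL_ge0//.
have p2 : 0 <= cL ^+ 2 * (bq * b) by rewrite !mulr_ge0 ?cL_ge0 ?cX_ge0 ?sqrtr_ge0 ?sqr_ge0//.
have p3 : 0 <= cL ^+ 2 * (kap * wpf f) by rewrite !mulr_ge0 ?cL_ge0 ?cX_ge0 ?sqr_ge0 ?wpf_ge0//.
have p4 : 0 <= cX * (kap * pf f) by rewrite !mulr_ge0 ?cL_ge0 ?cX_ge0 ?pf_ge0//.
have p5 : 0 <= cL ^+ 2 * (nu * wqf f) by rewrite !mulr_ge0 ?cL_ge0 ?cX_ge0 ?sqr_ge0 ?wqf_ge0//.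
have p6 : 0 <= cL * (nu * (bq * b2)) by rewrite !mulr_ge0 ?cL_ge0 ?cX_ge0 ?sqrtr_ge0 ?cL_ge0//.
have p7 : 0 <= cL * (nu * (a * b)) by rewrite !mulr_ge0 ?cL_ge0 ?cX_ge0 ?sqrtr_ge0 ?cL_ge0//.
move: h1 h2 h3 m1 m2 m3 m4 m5 m6 m7 p1 p2 p3 p4 p5 p6 p7.
clear C0 C1 C2 C3.
set d1 := dip _ _ _ _; set d2 := dip _ _ _ _; set i1 := ip _ _; set i2 := ip _ _.
set z1 := wpf f; set z2 := pf f; set z3 := wqf f; set z4 := vlev _ _.
set s1 := Num.sqrt _; set s2 := Num.sqrt _; set s3 := Num.sqrt _; set s4 := Num.sqrt _.
by clearbody d1 d2 i1 i2 z1 z2 z3 z4 s1 s2 s3 s4; lra.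
Qed.

End MixedTerms.

(** * Mixed terms between the y-derivatives and the first level of fields *)

Section FirstMixedTerm.
Variable R : realType.
Notation V := (fseq R).
Implicit Types (n : int * int).
Notation xforms := (xforms R).
Notation yforms := (yforms R).
Notation Q1 := (mult (@ky1 R)).
Notation Q2 := (mult (@ky2 R)).

Lemma sumsq_at ms (g : V) (s : seq Z6) : uniq s -> (forall K, K \notin s -> g K = 0) ->
  sumsq ms g = \sum_(K <- s) (\sum_(m <- ms) m K ^+ 2) * g K ^+ 2.
Proof.
move=> us gs; rewrite /sumsq.
under eq_bigr => m _.
  rewrite (ip_finE _ us); last by move=> K Ks; rewrite multE gs// mulr0.
  over.
rewrite exchange_big/=; apply: eq_bigr => K _.
by rewrite mulr_suml; apply: eq_bigr => m _; rewrite multE; ring.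
Qed.

Lemma xforms_ge1 (K : Z6) : K.1 != 0 -> 1 <= \sum_(m <- xforms) m K ^+ 2.
Proof.
move=> K0; rewrite !big_cons big_nil /kx1 /kx2 /kx3 /kx4.
case: K K0 => [[[k1 k2] [k3 k4]] [m1 m2]]/= K0.
rewrite addr0 -!rmorphXn/= -!intrD (ler_int R 1).
have sq (k : int) : 0 <= k ^+ 2 by exact: sqr_ge0.
have sq1 (k : int) : k != 0 -> 1 <= k ^+ 2 by move=> ?; rewrite expr2; nia.
have := sq k1; have := sq k2; have := sq k3; have := sq k4.
have [?|/sq1] := eqVneq k1 0; last by lia.
have [?|/sq1] := eqVneq k2 0; last by lia.
have [?|/sq1] := eqVneq k3 0; last by lia.
have [?|/sq1] := eqVneq k4 0; last by lia.
by subst; rewrite eqxx in K0.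
Qed.

Lemma ip_le_pf (g : V) : (forall K : Z6, K.1 = 0 -> g K = 0) -> ip g g <= pf g.
Proof.
move=> g0; have [s us gs] := finite_seq_support g.
rewrite (ip_finE _ us gs) /pf (sumsq_at _ us gs); apply: ler_sum => K _.
have [K0|K0] := eqVneq K.1 0; first by rewrite g0// expr0n/= !mulr0.
by rewrite expr2 ler_peMl -?expr2 ?sqr_ge0 ?xforms_ge1.
Qed.

Variables (f : V) (kap nu : R).
Hypotheses (kap0 : 0 <= kap) (nu0 : 0 <= nu).
Hypothesis f_off : forall K : Z6, K.1 = 0 -> f K = 0.

Local Notation a := (Num.sqrt (qf f)).
Local Notation A := (Num.sqrt (qqf f)).
Local Notation b1 := (Num.sqrt (vlev level1 f)).
Local Notation b := (Num.sqrt (w f)).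
Local Notation bq := (Num.sqrt (wqf f)).
Local Notation pp := (Num.sqrt (pf f)).
Local Notation wpp := (Num.sqrt (wpf f)).
Local Notation qpp := (Num.sqrt (qpf f)).

(** The elementary Poincare inequality in x, available since f has no frequency with [K.1] = 0. It
    lets the charge error in [dip_QL_x] be expressed through mixed second derivatives. *)
Lemma qf_le_qpf : qf f <= qpf f.
Proof.
have -> : qpf f = \sum_(m <- yforms) pf (mult m f).
  rewrite /qpf /sumover /pf /qf /sumsq exchange_big/=.
  by apply: eq_bigr => m _; apply: eq_bigr => m' _; rewrite multC.
apply: ler_sum => m _; apply: ip_le_pf => K K0; rewrite multE f_off//.
by rewrite mulr0.
Qed.

Definition units : seq (int * int) := [:: (1, 0); (0, 1); (-1, 0); (0, -1)].

(** A y-derivative has charge 0 and both halves of [L n] have the squared charge 1 for a unit vector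
    n, in x as well as in y ([unit_charges]); so the error is exactly one inner product. *)
Lemma dip_QL m0 n ms (Lam := fun s : Z6 => \sum_(m <- ms) m s ^+ 2) :
  (forall i, (i < size ms)%N -> additive_form (nth 0 ms i)) ->
  Lam (vu n) = 1 -> Lam (vp n) = 1 ->
  dip (mult m0) (L n) (lap ms f) f =
  2 * (\sum_(m <- ms) ip (mult m0 (mult m f)) (L n (mult m f))) + ip (mult m0 f) (L n f).
Proof.
move=> ma lu lp.
have -> : dip (mult m0) (L n) (lap ms f) f =
    dip (mult m0) (Lu n) (lap ms f) f + dip (mult m0) (Lp n) (lap ms f) f.
  by rewrite /dip !L_def !ipDr; ring.
have cm i : (i < size ms)%N -> has_charge (nth 0 ms i) 0 (mult m0).
  by move=> _; exact: mult_charge0.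
have cu i : (i < size ms)%N -> has_charge (nth 0 ms i) (nth 0 ms i (vu n)) (Lu n).
  by move=> im; apply: Lu_charge; exact: ma.
have cp i : (i < size ms)%N -> has_charge (nth 0 ms i) (nth 0 ms i (vp n)) (Lp n).
  by move=> im; apply: Lp_charge; exact: ma.
rewrite (@dip_lap _ (mult m0) (Lu n) ms (fun=> 0) (fun m => m (vu n)) f cm cu).
rewrite (@dip_lap _ (mult m0) (Lp n) ms (fun=> 0) (fun m => m (vp n)) f cm cp).
have E s : \sum_(m <- ms) (m s - 0) ^+ 2 = Lam s.
  by apply: eq_bigr => m _; rewrite subr0.
rewrite !E lu lp L_def ipDr.
have -> : \sum_(m <- ms) ip (mult m0 (mult m f)) (L n (mult m f)) =
  \sum_(m <- ms) ip (mult m0 (mult m f)) (Lu n (mult m f)) +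
  \sum_(m <- ms) ip (mult m0 (mult m f)) (Lp n (mult m f)).
  by rewrite -big_split/=; apply: eq_bigr => m _; rewrite L_def ipDr.
by ring.
Qed.

Lemma unit_charges n : n \in units ->
  [/\ \sum_(m <- xforms) m (vu n) ^+ 2 = 1, \sum_(m <- xforms) m (vp n) ^+ 2 = 1,
      \sum_(m <- yforms) m (vu n) ^+ 2 = 1 & \sum_(m <- yforms) m (vp n) ^+ 2 = 1].
Proof.
rewrite !inE !big_cons !big_nil /kx1 /kx2 /kx3 /kx4 /ky1 /ky2.
by do ![case/orP]; move=> /eqP -> /=; split;
  rewrite ?oppr0 ?opprK ?intrN ?sqrrN ?expr0n/= ?expr1n ?addr0 ?add0r.
Qed.

Lemma dip_QL_x m0 n : n \in units ->
  (forall g : V, nrm (mult m0 g) <= Num.sqrt (qf g)) ->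
  `|dip (mult m0) (L n) (lap xforms f) f| <= 8 * cL * (qpp * wpp) + 12 * (qpp * pp).
Proof.
move=> nU hm; have [h1 h2 _ _] := unit_charges nU.
rewrite (@dip_QL m0 n xforms (@xforms_additive R) h1 h2).
have sn : small 3 n by move: nU; rewrite !inE; do ![case/orP]; move=> /eqP ->.
have [/andP[n1 n2] [hu hp]] := (sn, nrm_LuLp f sn).
have hi i : (i < 4)%N -> `|ip (mult m0 (mult (nth 0 xforms i) f)) (L n (mult (nth 0 xforms i) f))|
    <= qpp * (cL * wpp).
  move=> i4; apply: ip_bound.
    apply: le_trans (hm _) _; apply: ler_wsqrtr.
    exact: (@le_sumover _ xforms (@qf R) f i (@qf_ge0 R)).
  apply: le_trans (nrm_L_le _ n1 n2) _; apply: ler_wpM2l; first exact: cL_ge0.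
  by apply: ler_wsqrtr; exact: (@le_sumover _ xforms (@w R) f i (@w_ge0 R)).
have hl : `|ip (mult m0 f) (L n f)| <= qpp * (12 * pp).
  apply: ip_bound; first by apply: le_trans (hm f) _; apply: ler_wsqrtr; exact: qf_le_qpf.
  by rewrite L_def; apply: le_trans (nrmD _ _) _; move: hu hp; lra.
have := hi 0%N isT; have := hi 1%N isT; have := hi 2%N isT; have := hi 3%N isT.
rewrite /= !big_cons big_nil addr0 /=; move: hl; rewrite !ler_norml.
set i1 := ip _ _; set i2 := ip _ _; set i3 := ip _ _; set i4 := ip _ _; set i5 := ip _ _.
set x1 := Num.sqrt _; set x2 := Num.sqrt _; set x3 := Num.sqrt _.
clearbody i1 i2 i3 i4 i5 x1 x2 x3.
move=> /andP[? ?] /andP[? ?] /andP[? ?] /andP[? ?] /andP[? ?].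
by apply/andP; split; lra.
Qed.

Lemma dip_QL_y m0 n : n \in units -> nrm (L n f) <= b1 ->
  (forall g : V, nrm (mult m0 g) <= Num.sqrt (qf g)) ->
  `|dip (mult m0) (L n) (lap yforms f) f| <= 4 * cL * (A * bq) + a * b1.
Proof.
move=> nU nb hm; have [_ _ h1 h2] := unit_charges nU.
rewrite (@dip_QL m0 n yforms (@yforms_additive R) h1 h2).
have sn : small 3 n by move: nU; rewrite !inE; do ![case/orP]; move=> /eqP ->.
have /andP[n1 n2] := sn.
have hi i : (i < 2)%N -> `|ip (mult m0 (mult (nth 0 yforms i) f)) (L n (mult (nth 0 yforms i) f))|
    <= A * (cL * bq).
  move=> i2; apply: ip_bound.
    apply: le_trans (hm _) _; apply: ler_wsqrtr.
    exact: (@le_sumover _ yforms (@qf R) f i (@qf_ge0 R)).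
  apply: le_trans (nrm_L_le _ n1 n2) _; apply: ler_wpM2l; first exact: cL_ge0.
  by apply: ler_wsqrtr; exact: (@le_sumover _ yforms (@w R) f i (@w_ge0 R)).
have hl : `|ip (mult m0 f) (L n f)| <= a * b1 by exact: ip_bound.
have := hi 0%N isT; have := hi 1%N isT.
rewrite /= !big_cons big_nil addr0 /=; move: hl; rewrite !ler_norml.
set i1 := ip _ _; set i2 := ip _ _; set i3 := ip _ _.
set x1 := Num.sqrt _; set x2 := Num.sqrt _; set x3 := Num.sqrt _; set x4 := Num.sqrt _.
clearbody i1 i2 i3 x1 x2 x3 x4.
move=> /andP[? ?] /andP[? ?] /andP[? ?].
by apply/andP; split; lra.
Qed.

(** First rung of the ladder: up to sign the commutator of a y-derivative with [T] is a half
    difference of [L e] and [L (- e)], fields of equal norm and different y-frequency. *)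
Lemma Qd_lower : 2^-1 * vlev level1 f - 2 * cL * (b1 * bq) <=
  ip (Qd1 f) (Qd1 f) + ip (Qd2 f) (Qd2 f).
Proof.
have hv : vlev level1 f = ip (L (1, 0) f) (L (1, 0) f) + ip (L (0, 1) f) (L (0, 1) f).
  by rewrite /vlev !big_cons big_nil addr0.
have N1 : ip (L (-1, 0) f) (L (-1, 0) f) = ip (L (1, 0) f) (L (1, 0) f).
  by rewrite -!sqr_nrm -(nrm_LN (1, 0)).
have N2 : ip (L (0, -1) f) (L (0, -1) f) = ip (L (0, 1) f) (L (0, 1) f).
  by rewrite -!sqr_nrm -(nrm_LN (0, 1)).
have n1 : nrm (L (1, 0) f) <= b1 by exact: nrm_L1.
have n2 : nrm (L (0, 1) f) <= b1 by exact: nrm_L1.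
have n3 : nrm (L (-1, 0) f) <= b1 by rewrite (nrm_LN (1, 0)); exact: nrm_L1.
have n4 : nrm (L (0, -1) f) <= b1 by rewrite (nrm_LN (0, 1)); exact: nrm_L1.
have c1 : `|ip (L (1, 0) f) (L (-1, 0) f)| <= cL * bq * (b1 + b1) by exact: ip_L_cross.
have c2 : `|ip (L (0, -1) f) (L (0, 1) f)| <= cL * bq * (b1 + b1) by exact: ip_L_cross.
move: c1 c2; set y := b1; set x := bq; clearbody x y.
rewrite Qd1E Qd2E !half_diff_sq N1 N2 hv !ler_norml => /andP[_ +] /andP[_ +].
set i1 := ip _ _; set i2 := ip _ _; set i3 := ip _ _; set i4 := ip _ _.
by clearbody i1 i2 i3 i4; lra.
Qed.

Lemma dip_half_diff m0 n n' h : dip (mult m0) (fun g => 2^-1 *: (L n g - L n' g)) h f =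
  2^-1 * (dip (mult m0) (L n) h f - dip (mult m0) (L n') h f).
Proof. by rewrite /dip !(ipZr, ipDr, ipNr); ring. Qed.

Lemma half_diff_le (x y M : R) : `|x| <= M -> `|y| <= M -> `|2^-1 * (x - y)| <= M.
Proof. by rewrite !ler_norml => /andP[? ?] /andP[? ?]; apply/andP; split; lra. Qed.

Lemma nrm_Q1g (g : V) : nrm (Q1 g) <= Num.sqrt (qf g). Proof. exact: nrm_Q1. Qed.
Lemma nrm_Q2g (g : V) : nrm (Q2 g) <= Num.sqrt (qf g). Proof. exact: nrm_Q2. Qed.

Lemma nrm_Qdd : nrm (Qdd1 f) <= 4 * cL * b /\ nrm (Qdd2 f) <= 4 * cL * b.
Proof.
have H (x y : V) (M : R) : nrm x <= M -> nrm y <= M -> nrm (2^-1 *: (x - y)) <= M.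
  move=> hx hy; rewrite nrmZ ger0_norm ?invr_ge0// mulrC ler_pdivrMr//.
  by apply: le_trans (nrmB _ _) _; move: hx hy; lra.
by rewrite /Qdd1 /Qdd2; split; apply: H; exact: nrm_Ld_le.
Qed.

Lemma dip_MQ : dip Q1 (@Qd1 R) (gen kap nu f) f + dip Q2 (@Qd2 R) (gen kap nu f) f <=
  - (2^-1 * vlev level1 f) + cC * (a * b) + cC * (b1 * bq)
  + cC * nu * (A * bq) + cC * nu * (a * b1) + cC * kap * (qpp * wpp) + cC * kap * (qpp * pp).
Proof.
have t1 := transport (Q1T f) (Qd1T f); have t2 := transport (Q2T f) (Qd2T f).
have e1 h : dip Q1 (@Qd1 R) h f = 2^-1 * (dip Q1 (L (1, 0)) h f - dip Q1 (L (-1, 0)) h f).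
  by rewrite -dip_half_diff /dip !Qd1E.
have e2 h : dip Q2 (@Qd2 R) h f = 2^-1 * (dip Q2 (L (0, -1)) h f - dip Q2 (L (0, 1)) h f).
  by rewrite -dip_half_diff /dip !Qd2E.
have x1 : `|dip Q1 (@Qd1 R) (lap xforms f) f| <= 8 * cL * (qpp * wpp) + 12 * (qpp * pp).
  by rewrite e1; apply: half_diff_le; apply: dip_QL_x => //; exact: nrm_Q1g.
have x2 : `|dip Q2 (@Qd2 R) (lap xforms f) f| <= 8 * cL * (qpp * wpp) + 12 * (qpp * pp).
  by rewrite e2; apply: half_diff_le; apply: dip_QL_x => //; exact: nrm_Q2g.
have n1 : nrm (L (1, 0) f) <= b1 by exact: nrm_L1.
have n2 : nrm (L (0, 1) f) <= b1 by exact: nrm_L1.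
have n3 : nrm (L (-1, 0) f) <= b1 by rewrite (nrm_LN (1, 0)); exact: nrm_L1.
have n4 : nrm (L (0, -1) f) <= b1 by rewrite (nrm_LN (0, 1)); exact: nrm_L1.
have y1 : `|dip Q1 (@Qd1 R) (lap yforms f) f| <= 4 * cL * (A * bq) + a * b1.
  by rewrite e1; apply: half_diff_le; apply: dip_QL_y => //; exact: nrm_Q1g.
have y2 : `|dip Q2 (@Qd2 R) (lap yforms f) f| <= 4 * cL * (A * bq) + a * b1.
  by rewrite e2; apply: half_diff_le; apply: dip_QL_y => //; exact: nrm_Q2g.
have [d1 d2] := nrm_Qdd.
have q1 := ip_bound (nrm_Q1 f) d1; have q2 := ip_bound (nrm_Q2 f) d2.
have lo := Qd_lower.
rewrite !dip_gen {1}/dip t1 {3}/dip t2.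
move: x1 x2 y1 y2 q1 q2 lo.
rewrite !ler_norml => /andP[x1 _] /andP[x2 _] /andP[y1 _] /andP[y2 _] /andP[q1 _] /andP[q2 _].
have [C0 C1 C2 C3] := @cC_bounds R.
have m1 : 100 * cL * (a * b) <= cC * (a * b) by rewrite ler_wpM2r ?mulr_ge0 ?sqrtr_ge0.
have m2 : 100 * cL * (b1 * bq) <= cC * (b1 * bq) by rewrite ler_wpM2r ?mulr_ge0 ?sqrtr_ge0.
have m3 : 100 * cL * (nu * (A * bq)) <= cC * (nu * (A * bq)) by rewrite ler_wpM2r ?mulr_ge0 ?sqrtr_ge0.
have C4 : 100 <= cC :> R by have := @cL_ge1 R; lra.
have m4 : 100 * (nu * (a * b1)) <= cC * (nu * (a * b1)) by rewrite ler_wpM2r ?mulr_ge0 ?sqrtr_ge0.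
have m5 : 100 * cL * (kap * (qpp * wpp)) <= cC * (kap * (qpp * wpp)) by rewrite ler_wpM2r ?mulr_ge0 ?sqrtr_ge0.
have m6 : 100 * (kap * (qpp * pp)) <= cC * (kap * (qpp * pp)) by rewrite ler_wpM2r ?mulr_ge0 ?sqrtr_ge0.
have p1 : 0 <= cL * (a * b) by rewrite !mulr_ge0 ?cL_ge0 ?sqrtr_ge0.
have p2 : 0 <= cL * (b1 * bq) by rewrite !mulr_ge0 ?cL_ge0 ?sqrtr_ge0.
have p3 : 0 <= cL * (nu * (A * bq)) by rewrite !mulr_ge0 ?cL_ge0 ?sqrtr_ge0.
have p4 : 0 <= nu * (a * b1) by rewrite !mulr_ge0 ?cL_ge0 ?sqrtr_ge0.
have p5 : 0 <= cL * (kap * (qpp * wpp)) by rewrite !mulr_ge0 ?cL_ge0 ?sqrtr_ge0.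
have p6 : 0 <= kap * (qpp * pp) by rewrite !mulr_ge0 ?cL_ge0 ?sqrtr_ge0.
have K1 := ler_wpM2l kap0 x1; have K2 := ler_wpM2l kap0 x2.
have N1 := ler_wpM2l nu0 y1; have N2 := ler_wpM2l nu0 y2.
clear x1 x2 y1 y2 t1 t2 e1 e2 n1 n2 n3 n4 d1 d2 C0 C1 C2 C3 C4.
move: q1 q2 m1 m2 m3 m4 m5 m6 p1 p2 p3 p4 p5 p6 K1 K2 N1 N2.
set i1 := ip _ _; set i2 := ip _ _; set z := vlev _ _.
set d1 := dip _ _ _ _; set d2 := dip _ _ _ _; set d3 := dip _ _ _ _; set d4 := dip _ _ _ _.
set i3 := ip _ _; set i4 := ip _ _.
set s1 := Num.sqrt _; set s2 := Num.sqrt _; set s3 := Num.sqrt _; set s4 := Num.sqrt _.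
set s5 := Num.sqrt _; set s6 := Num.sqrt _; set s7 := Num.sqrt _; set s8 := Num.sqrt _.
by clearbody i1 i2 z d1 d2 d3 d4 i3 i4 s1 s2 s3 s4 s5 s6 s7 s8; lra.
Qed.

End FirstMixedTerm.

(** * Poincare inequality *)

Section Poincare.
Variable R : realType.
Notation V := (fseq R).
Implicit Types (f g : V) (K e : Z6).

Lemma ip_mult_ge0 (c : Z6 -> R) f : (forall K, 0 <= c K) -> 0 <= ip (mult c f) f.
Proof.
move=> c0; have [s us fs] := finite_seq_support f; rewrite ipC (ip_finE _ us fs).
by apply: sumr_ge0 => K _; rewrite multE mulrCA -expr2 mulr_ge0// sqr_ge0.
Qed.

(* Discrete Hardy inequality along the direction e, in the half space j > 0:
   with r = j f - S (j f) one has f^2 - 2 f r <= (j - 1) (S f)^2 - j f^2, and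
   the right-hand side telescopes. *)
Lemma hardy_half (j : Z6 -> int) e f : (forall s t, j (s + t) = j s + j t) -> j e = 1 ->
  nrm (mult (fun K => (0 < j K)%R%:R) f) <=
  2 * nrm (mult (fun K => (j K)%:~R) f - sh e (mult (fun K => (j K)%:~R) f)).
Proof.
move=> jD je; set jr := fun K => (j K)%:~R : R.
set fp := mult _ f; set r := _ - _.
pose c K : R := (0 < j K)%R%:R; pose S := sh e f.
have rE : r = mult jr f - mult (fun K => jr K - 1) S.
  apply: fseq_ext => K; rewrite /r /S /jr !fseqE !(multE, shE).
  have -> : j (K - e) = j K - 1 by rewrite -[in RHS](subrK e K) [in RHS]jD je addrK.
  by rewrite intrB.
pose d K : R := c K * (jr K - 1).
have d0 K : 0 <= d K.
  rewrite /d /c /jr; have [jK|_] := ltrP 0 (j K); last by rewrite mul0r.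
  by rewrite mul1r subr_ge0 (ler_int R 1); lia.
have key : ip fp fp - 2 * ip fp r =
  - ip (mult (fun K => c K * jr K) f) f + ip (mult d S) S - ip (mult d (f - S)) (f - S).
  have cc K : c K * c K = c K by rewrite /c -natrM mulnb andbb.
  have -> : ip fp fp = ip (mult c f) f.
    by rewrite /fp ip_mult ipC; congr ip; apply: fseq_ext => K; rewrite !multE mulrA cc.
  have -> : ip fp r = ip (mult (fun K => c K * jr K) f) f - ip (mult d S) f.
    rewrite rE ipDr ipNr /fp !ip_mult; congr (_ + - _).
      congr ip; apply: fseq_ext => K; rewrite !multE /c; ring.
    rewrite [RHS]ipC ip_mult; congr ip; apply: fseq_ext => K.
    by rewrite !multE /d /c; ring.
  rewrite linearB/= !(ipDl, ipDr, ipNl, ipNr).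
  have -> : ip (mult d f) S = ip (mult d S) f by rewrite ip_mult ipC.
  have -> : ip (mult d f) f = ip (mult (fun K => c K * jr K) f) f - ip (mult c f) f.
    rewrite -ipNl -ipDl; congr ip; apply: fseq_ext => K.
    by rewrite !fseqE !multE /d; ring.
  by ring.
have tel : ip (mult d S) S = ip (mult (fun K => c K * jr K) f) f.
  rewrite -[RHS](ip_sh e); congr ip; apply: fseq_ext => K; rewrite !(shE, multE) /d /c /jr /S ?shE.
  have E : j (K - e) = j K - 1 by rewrite -[in RHS](subrK e K) [in RHS]jD je addrK.
  rewrite E intrB; congr (_ * _).
  have [->|jK] := eqVneq (j K) 1; first by rewrite subrr !mulr0.
  by congr (_%:R * _); lia.
have dp := ip_mult_ge0 (f - S) d0.
have le1 : nrm fp ^+ 2 <= nrm fp * (2 * nrm r).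
  by have := ip_le fp r; rewrite sqr_nrm; move: key; rewrite tel; move: dp; lra.
have [n0|np] := eqVneq (nrm fp) 0; first by rewrite n0 mulr_ge0 ?nrm_ge0.
by move: le1; rewrite expr2 ler_pM2l// lt_def np nrm_ge0.
Qed.

(** The half space j < 0 is treated with -j and the direction -e, which does not change the norm on
    the right. Frequencies with j = 0 are excluded, since j f vanishes there. *)
Lemma hardy (j : Z6 -> int) e f : (forall s t, j (s + t) = j s + j t) -> j e = 1 ->
  nrm (mult (fun K => (j K != 0)%R%:R) f) <=
  4 * nrm (mult (fun K => (j K)%:~R) f - sh e (mult (fun K => (j K)%:~R) f)).
Proof.
move=> jD je; have jN t : j (- t) = - j t.
  have j0 : j 0 = 0 by apply: (addrI (j 0)); rewrite -jD !addr0.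
  by apply/eqP; rewrite -subr_eq0 opprK -jD addNr j0.
have h1 := hardy_half f jD je.
have jND s t : - j (s + t) = - j s + - j t by rewrite jD opprD.
have jNe : - j (- e) = 1 by rewrite jN opprK.
have h2 := @hardy_half (fun K => - j K) (- e) f jND jNe.
have E : mult (fun K => (j K != 0)%R%:R) f =
  mult (fun K => (0 < j K)%R%:R) f + mult (fun K => (0 < - j K)%R%:R) f.
  apply: fseq_ext => K; rewrite !fseqE !multE -mulrDl -natrD; congr (_%:R * _).
  by lia.
have E2 : mult (fun K => (- j K)%:~R) f - sh (- e) (mult (fun K => (- j K)%:~R) f) =
  sh (- e) (mult (fun K => (j K)%:~R) f - sh e (mult (fun K => (j K)%:~R) f)).
  rewrite linearB/= shD addNr sh0; apply: fseq_ext => K.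
  by rewrite !fseqE !(shE, multE) !intrN; ring.
move: h2; rewrite E2 nrm_sh => h2; rewrite E; apply: le_trans (nrmD _ _) _.
by move: h1 h2; lra.
Qed.

Definition cP : R := locked_with fseq_key ((4 * 19) ^+ 2 + (4 * 19) ^+ 2 + 19 ^+ 2 + 19 ^+ 2).
Lemma cPE : cP = (4 * 19) ^+ 2 + (4 * 19) ^+ 2 + 19 ^+ 2 + 19 ^+ 2.
Proof. by rewrite /cP unlock. Qed.

(** Where k3 or k4 is nonzero, Hardy's inequality in that frequency applies to the weighted
    derivative. Where both vanish, k1 or k2 is a nonzero integer and is the frequency of d_1 + d_3
    or d_2 + d_4, which carries no weight. *)
Lemma poincare f : (forall K : Z6, K.1 = 0 -> f K = 0) -> ip f f <= cP * w f.
Proof.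
rewrite cPE.
move=> f0; have [[hp1 hp2 h13] [h03 h14 h04]] := coercive_six f.
have j3D (s t : Z6) : (s + t).1.2.1 = s.1.2.1 + t.1.2.1 by [].
have j4D (s t : Z6) : (s + t).1.2.2 = s.1.2.2 + t.1.2.2 by [].
have H3 := @hardy (fun K : Z6 => K.1.2.1) (zv 1 0) f j3D erefl.
have H4 := @hardy (fun K : Z6 => K.1.2.2) (zv 0 1) f j4D erefl.
rewrite -/(first_difference 1 0 (mult kx3 f)) in H3.
rewrite -/(first_difference 0 1 (mult kx4 f)) in H4.
pose g3 := mult (fun K : Z6 => (K.1.2.1 != 0)%R%:R : R) f.
pose g4 := mult (fun K : Z6 => (K.1.2.2 != 0)%R%:R : R) f.
have le : ip f f <= ip g3 g3 + ip g4 g4 + ip (mult kx1 f + mult kx3 f) (mult kx1 f + mult kx3 f)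
    + ip (mult kx2 f + mult kx4 f) (mult kx2 f + mult kx4 f).
  have [s us fs] := finite_seq_support f.
  rewrite !(ip_finE _ us)//; try by move=> K Ks; rewrite ?fseqE !multE fs ?mulr0 ?addr0.
  rewrite -!big_split/=; apply: ler_sum => K _; rewrite !multE.
  have sq (x : R) : 0 <= x * x by rewrite -expr2 sqr_ge0.
  have [K0|K0] := eqVneq K.1 0.
    by rewrite f0// !mulr0 !addr0.
  have int1 (k : int) (x : R) : k != 0 -> x * x <= k%:~R * x * (k%:~R * x).
    move=> k0; rewrite mulrACA ler_peMl// -intrM (ler_int R 1).
    by rewrite -gtz0_ge1 -expr2 exprn_even_gt0.
  have [/= k3|k3] := eqVneq K.1.2.1 0; last first.
    rewrite mul1r; have := sq ((K.1.2.2 != 0)%R%:R * f K).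
    have := sq (kx1 K * f K + kx3 K * f K); have := sq (kx2 K * f K + kx4 K * f K).
    by lra.
  have [/= k4|k4] := eqVneq K.1.2.2 0; last first.
    rewrite mul1r mul0r mul0r add0r.
    have := sq (kx1 K * f K + kx3 K * f K); have := sq (kx2 K * f K + kx4 K * f K).
    by lra.
  rewrite /kx3 /kx4 k3 k4 /= !mul0r !add0r !addr0.
  have [k1|k1] := eqVneq K.1.1.1 0; last first.
    have := int1 _ (f K) k1; have := sq (kx2 K * f K); rewrite /kx1 /kx2.
    by lra.
  have k2 : K.1.1.2 != 0.
    apply: contraNneq K0; case: K k1 k3 k4 {fs} => [[[? ?] [? ?]] ?]/= -> -> -> ->.
    by [].
  have := int1 _ (f K) k2; have := sq (kx1 K * f K); rewrite /kx1 /kx2.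
  by lra.
have w0 := w_ge0 f.
have sw : Num.sqrt (w f) ^+ 2 = w f by rewrite sqr_sqrtr.
have bd (g : V) (c : R) : 0 <= c -> nrm g <= c * Num.sqrt (w f) -> ip g g <= c ^+ 2 * w f.
  move=> c0 hg; rewrite -sqr_nrm -sw -exprMn ler_sqr ?nnegrE ?nrm_ge0//.
  by rewrite mulr_ge0// sqrtr_ge0.
have b1 := bd _ _ _ hp1; have b2 := bd _ _ _ hp2.
have b3 : ip g3 g3 <= (4 * 19) ^+ 2 * w f.
  apply: bd => //; apply: le_trans H3 _; rewrite -mulrA.
  by rewrite ler_wpM2l.
have b4 : ip g4 g4 <= (4 * 19) ^+ 2 * w f.
  apply: bd => //; apply: le_trans H4 _; rewrite -mulrA.
  by rewrite ler_wpM2l.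
move: (b1 (ler0n _ _)) (b2 (ler0n _ _)) b3 b4 le; clear b1 b2 bd H3 H4.
move: (ip f f) (ip _ _) (ip _ _) (ip _ _) (ip _ _) (w f) => x1 x2 x3 x4 x5 y.
by lra.
Qed.

End Poincare.
Arguments cP {R}.

(** * The hypocoercive functional *)

Section SmallConstants.
Variable R : realType.
Implicit Types (x y s t c : R).

Lemma young c s t x y : 0 < s -> c ^+ 2 <= 4 * s * t -> c * (x * y) <= s * x ^+ 2 + t * y ^+ 2.
Proof.
move=> s0 cst; rewrite -subr_ge0.
have -> : s * x ^+ 2 + t * y ^+ 2 - c * (x * y) =
  s * (x - c * y / (2 * s)) ^+ 2 + (4 * s * t - c ^+ 2) / (4 * s) * y ^+ 2.
  by field; rewrite lt0r_neq0.
apply: addr_ge0; apply: mulr_ge0; rewrite ?sqr_ge0 ?(ltW s0)//.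
by apply: divr_ge0; rewrite ?subr_ge0// mulr_ge0// ltW.
Qed.

(** Hierarchy of weights: [B * nu] for the fields, [K ^+ 7 * B], [K ^+ 3 * B], [K * B] for the three
    groups of mixed terms, [K^-1 * kap] for the x-gradient. An error c x y is shared by the gains of
    x^2 and y^2, whose weights must have a product above a multiple of c^2; the margins contain a
    power of [K] that absorbs C^2. Where powers of [K] alone do not win, nu >= K^8 or the smallness
    of [B] decides; 15 is the largest power of [K] that [B] has to beat ([hQ6]). *)
Variables (C K B nu kap : R).
Hypotheses (C1 : 1 <= C) (KC : (32 * 32) * C ^+ 2 <= K) (nuK : K ^+ 8 <= nu).
Hypotheses (B0 : 0 < B) (BK : B * nu * K ^+ 15 = 1) (kap0 : 0 <= kap).

Let C2 : 1 <= C ^+ 2. Proof. by rewrite exprn_ege1. Qed.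
Let KBIG : (32 * 32) <= K. Proof. by apply: le_trans KC; move: C2; lra. Qed.
Let K1 : 1 <= K. Proof. by apply: le_trans KBIG; lra. Qed.
Let K0 : 0 < K. Proof. by apply: lt_le_trans K1. Qed.
Let Kp i : 0 < K ^+ i. Proof. exact: exprn_gt0. Qed.
Let Kge0 i : 0 <= K ^+ i. Proof. exact/ltW/Kp. Qed.
Let nu1 : 1 <= nu. Proof. by apply: le_trans nuK; rewrite exprn_ege1. Qed.
Let nup : 0 < nu. Proof. exact: lt_le_trans nu1. Qed.

Let KCi i : K ^+ i * C ^+ 2 <= K ^+ i.+1 / (32 * 32).
Proof.
by rewrite [K ^+ i.+1]exprSr -[X in _ <= X]mulrA ler_wpM2l// ler_pdivlMr// mulrC.
Qed.

Let Kmono i j : (i <= j)%N -> K ^+ i <= K ^+ j.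
Proof. by move=> ij; rewrite ler_weXn2l. Qed.

Let BnuK i : (i <= 15)%N -> B * nu * K ^+ i <= 1.
Proof.
move=> i15; rewrite -[X in _ <= X]BK ler_wpM2l ?Kmono//.
by rewrite mulr_ge0// ltW.
Qed.

Let BKi i : (i <= 15)%N -> B * K ^+ i <= 1.
Proof.
move=> i15; apply: le_trans (BnuK i15); rewrite ler_wpM2r// ler_peMr// ltW//.
Qed.

Let nu2 : nu <= nu ^+ 2. Proof. by rewrite expr2 ler_peMl// ltW. Qed.
Let K8nu i : (i <= 8)%N -> K ^+ i <= nu.
Proof. by move=> i8; apply: le_trans nuK; exact: Kmono. Qed.
Let K16nu i : (i <= 16)%N -> K ^+ i <= nu ^+ 2.
Proof.
move=> i16; apply: (@le_trans _ _ (K ^+ 16)); first exact: Kmono.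
by rewrite (_ : 16 = 8 * 2)%N// exprM ler_sqr ?nnegrE// ltW.
Qed.
Let CC2 : C <= C ^+ 2. Proof. by rewrite expr2 ler_peMl// (le_trans _ C1). Qed.
Let C0 : 0 < C. Proof. by apply: lt_le_trans C1. Qed.

Let c2_le i (M : R) : K ^+ i.+1 <= M -> K ^+ i * C ^+ 2 <= M / (32 * 32).
Proof. by move=> h; apply: le_trans (KCi i) _; rewrite ler_wpM2r ?invr_ge0. Qed.
Let Bc2_le i : (i < 15)%N -> B * (K ^+ i * C ^+ 2) <= 1 / (32 * 32).
Proof.
move=> i15; apply: (@le_trans _ _ (B * (K ^+ i.+1 / (32 * 32)))).
  by rewrite ler_wpM2l// ltW.
by rewrite mulrA ler_wpM2r ?invr_ge0// BKi.
Qed.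
Let Bnuc2_le i : (i < 15)%N -> B * nu * (K ^+ i * C ^+ 2) <= 1 / (32 * 32).
Proof.
move=> i15; apply: (@le_trans _ _ (B * nu * (K ^+ i.+1 / (32 * 32)))).
  by rewrite ler_wpM2l// mulr_ge0// ltW.
by rewrite mulrA ler_wpM2r ?invr_ge0// BnuK.
Qed.

Variables (a A b1 b2 v3 b bq pp wpp qpp : R).
Hypotheses (v30 : 0 <= v3) (bE : b ^+ 2 = b1 ^+ 2 + b2 ^+ 2 + v3).

(** Reduces an inequality to an identity checked by [field] and the signs of two explicit
    factors. *)
Let factor (X Y D P : R) : Y - X = P * D -> 0 <= P -> 0 <= D -> X <= Y.
Proof. by move=> E p d; rewrite -subr_ge0 E mulr_ge0. Qed.

Ltac base_facts := have Bge := ltW B0; have nge := ltW nup;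
  have hKC := KC; have hC2 := C2; have hnu1 := nu1; have hnu2 := nu2; have hK1 := K1;
  have hK0 := ltW K0; have sB := sqr_ge0 B; have sn := sqr_ge0 nu.

Let P x y : 0 <= x -> 0 <= y -> 0 <= x * y.
Proof. exact: mulr_ge0. Qed.

Let Bnu1 : B * nu <= 1.
Proof.
base_facts.
by have := BnuK (i := 0) isT; rewrite expr0 mulr1.
Qed.

Let K7 : 32 * 32 * (32 * 32) <= K ^+ 7.
Proof.
base_facts.
apply: le_trans (Kmono (i := 2) (j := 7) isT).
by rewrite expr2; apply: ler_pM.
Qed.

(** One error term each, bounded by fractions of the gains: [hb] comes from [dip_Q], [hc1] and [hc2]
    from [dip_w], the names starting with [hQ], [h1], [h2] from [dip_MQ], [dip_M1], [dip_M2], and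
    [heta] from [dip_p]. *)
Let hb : 4 * (B * nu) * (a * b1) <= nu / 8 * a ^+ 2 + K ^+ 7 * B / 64 * b1 ^+ 2.
Proof.
base_facts.
apply: young; first by rewrite divr_gt0.
apply: (@factor _ _ (K ^+ 7 / (8 * 16) - 16 * (B * nu)) (nu * B)); [by field|exact: P|].
by move: Bnu1 K7; lra.
Qed.

Let hc1 : B * nu * C * (bq * b) <= B * nu * nu / 16 * bq ^+ 2 + K * B / 64 * b ^+ 2.
Proof.
base_facts.
apply: young; first by rewrite divr_gt0 ?mulr_gt0.
apply: (@factor _ _ (K / (16 * 16) - C ^+ 2) (B ^+ 2 * nu ^+ 2)); [by field|exact: P|].
by move: KC; lra.
Qed.

Let hc2 : B * nu * C <= 8^-1.
Proof.
base_facts.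
apply: (@le_trans _ _ (B * nu * C ^+ 2)); first by rewrite ler_wpM2l// P.
by have := Bnuc2_le (i := 0) isT; rewrite expr0 mul1r; lra.
Qed.

Let hQ1 : K ^+ 7 * B * C * (a * b) <= nu / 8 * a ^+ 2 + K * B / 64 * b ^+ 2.
Proof.
base_facts.
apply: young; first by rewrite divr_gt0.
apply: (@factor _ _ (nu / (8 * 16) - B * (K ^+ 13 * C ^+ 2)) (K * B)); [by field|by apply: P; rewrite // ltW|].
by have := Bc2_le (i := 13) isT; lra.
Qed.

Let hQ2 : K ^+ 7 * B * C * (b1 * bq) <= K ^+ 7 * B / 64 * b1 ^+ 2 + B * nu * nu / 16 * bq ^+ 2.
Proof.
base_facts.
apply: young; first by rewrite divr_gt0 ?mulr_gt0.
apply: (@factor _ _ (nu ^+ 2 / (16 * 16) - K ^+ 7 * C ^+ 2) (K ^+ 7 * B ^+ 2)); [by field|exact: P|].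
by have := c2_le (K8nu (i := 8) isT); move: nu2; lra.
Qed.

Let hQ3 : K ^+ 7 * B * C * nu * (A * bq) <= B * nu * nu / 8 * A ^+ 2 + B * nu * nu / 16 * bq ^+ 2.
Proof.
base_facts.
apply: young; first by rewrite divr_gt0 ?mulr_gt0.
apply: (@factor _ _ (nu ^+ 2 / 32 - K ^+ 14 * C ^+ 2) (B ^+ 2 * nu ^+ 2)); [by field|exact: P|].
by have := c2_le (K16nu (i := 15) isT); lra.
Qed.

Let hQ4 : K ^+ 7 * B * C * nu * (a * b1) <= nu / 8 * a ^+ 2 + K ^+ 7 * B / 64 * b1 ^+ 2.
Proof.
base_facts.
apply: young; first by rewrite divr_gt0.
apply: (@factor _ _ ((8 * 16)^-1 - B * nu * (K ^+ 7 * C ^+ 2)) (nu * (K ^+ 7 * B))); [by field| |].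
  by rewrite !P//.
by have := Bnuc2_le (i := 7) isT; lra.
Qed.

Let hQ5 : K ^+ 7 * B * C * (qpp * wpp) <= B * nu / 8 * qpp ^+ 2 + B * nu / 8 * wpp ^+ 2.
Proof.
base_facts.
apply: young; first by rewrite divr_gt0 ?mulr_gt0.
apply: (@factor _ _ (nu ^+ 2 / 16 - K ^+ 14 * C ^+ 2) (B ^+ 2)); [by field|by []|].
by have := c2_le (K16nu (i := 15) isT); lra.
Qed.

Let hQ6 : K ^+ 7 * B * C * (qpp * pp) <= B * nu / 8 * qpp ^+ 2 + 8^-1 * pp ^+ 2.
Proof.
base_facts.
apply: young; first by rewrite divr_gt0 ?mulr_gt0.
apply: (@factor _ _ (nu / 16 - B * (K ^+ 14 * C ^+ 2)) B); [by field|by []|].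
by have := Bc2_le (i := 14) isT; lra.
Qed.

Let h1a : K ^+ 3 * B * C * (b1 * b) <= K ^+ 7 * B / 64 * b1 ^+ 2 + K * B / 64 * b ^+ 2.
Proof.
base_facts.
apply: young; first by rewrite divr_gt0 ?mulr_gt0.
apply: (@factor _ _ (K ^+ 2 / (32 * 32) - C ^+ 2) (K ^+ 6 * B ^+ 2)); [by field|exact: P|].
by have : K <= K ^+ 2 := Kmono (i := 1) (j := 2) isT; move: KC; lra.
Qed.

Let h1b : K ^+ 3 * B * C * (bq * b2) <= B * nu * nu / 16 * bq ^+ 2 + K ^+ 3 * B / 64 * b2 ^+ 2.
Proof.
base_facts.
apply: young; first by rewrite divr_gt0 ?mulr_gt0.
apply: (@factor _ _ (nu ^+ 2 / (16 * 16) - K ^+ 3 * C ^+ 2) (K ^+ 3 * B ^+ 2)); [by field|exact: P|].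
by have := c2_le (K8nu (i := 4) isT); move: nu2; lra.
Qed.

Let k3C : K ^+ 3 * C <= nu / (32 * 32).
Proof.
base_facts.
apply: le_trans (c2_le (K8nu (i := 4) isT)); exact: ler_wpM2l.
Qed.

Let h1c : K ^+ 3 * B * C * nu <= B * nu * nu / 16.
Proof.
base_facts.
apply: (@factor _ _ (nu / 16 - K ^+ 3 * C) (B * nu)); [by field|exact: P|].
by move: k3C; lra.
Qed.

Let h1d : K ^+ 3 * B * C * nu * (bq * b1) <= B * nu * nu / 16 * bq ^+ 2 + K ^+ 7 * B / 64 * b1 ^+ 2.
Proof.
base_facts.
apply: young; first by rewrite divr_gt0 ?mulr_gt0.
apply: (@factor _ _ (K / (16 * 16) - C ^+ 2) (K ^+ 6 * B ^+ 2 * nu ^+ 2)); [by field|by rewrite !P//|].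
by move: KC; lra.
Qed.

Let h1e : K ^+ 3 * B * C * nu * (a * b) <= nu / 8 * a ^+ 2 + K * B / 64 * b ^+ 2.
Proof.
base_facts.
apply: young; first by rewrite divr_gt0.
apply: (@factor _ _ ((8 * 16)^-1 - B * nu * (K ^+ 5 * C ^+ 2)) (nu * (K * B))); [by field| |].
  by rewrite !P// ltW.
by have := Bnuc2_le (i := 5) isT; lra.
Qed.

Let h1k : K ^+ 3 * B * C <= B * nu / 8.
Proof.
base_facts.
by apply: (@factor _ _ (nu / 8 - K ^+ 3 * C) B); [by field|by []|move: k3C; lra].
Qed.

Let h1p : K ^+ 3 * B * C <= 8^-1.
Proof.
base_facts.
by apply: (le_trans h1k); move: Bnu1; lra.
Qed.

Let h2a : K * B * C * (b2 * b) <= K ^+ 3 * B / 64 * b2 ^+ 2 + K * B / 64 * b ^+ 2.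
Proof.
base_facts.
apply: young; first by rewrite divr_gt0 ?mulr_gt0.
apply: (@factor _ _ (K ^+ 2 / (32 * 32) - C ^+ 2) (K ^+ 2 * B ^+ 2)); [by field|exact: P|].
by have : K <= K ^+ 2 := Kmono (i := 1) (j := 2) isT; move: KC; lra.
Qed.

Let kC : K * C <= nu / (32 * 32).
Proof.
base_facts.
have := c2_le (i := 1) (K8nu (i := 2) isT); apply: le_trans.
by rewrite expr1 ler_wpM2l// ltW.
Qed.

Let h2b : K * B * C * (bq * b) <= B * nu * nu / 16 * bq ^+ 2 + K * B / 64 * b ^+ 2.
Proof.
base_facts.
apply: young; first by rewrite divr_gt0 ?mulr_gt0.
apply: (@factor _ _ (nu ^+ 2 / (16 * 16) - K ^+ 1 * C ^+ 2) (K * B ^+ 2)); [by field|by apply: P; rewrite // ltW|].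
by have := c2_le (i := 1) (K8nu (i := 2) isT); move: nu2; lra.
Qed.

Let h2c : K * B * C * nu <= B * nu * nu / 16.
Proof.
base_facts.
apply: (@factor _ _ (nu / 16 - K * C) (B * nu)); [by field|exact: P|].
by move: kC; lra.
Qed.

Let h2d : K * B * C * nu * (bq * b2) <= B * nu * nu / 16 * bq ^+ 2 + K ^+ 3 * B / 64 * b2 ^+ 2.
Proof.
base_facts.
apply: young; first by rewrite divr_gt0 ?mulr_gt0.
apply: (@factor _ _ (K / (16 * 16) - C ^+ 2) (K ^+ 2 * B ^+ 2 * nu ^+ 2)); [by field|by rewrite !P//|].
by move: KC; lra.
Qed.

Let h2e : K * B * C * nu * (a * b) <= nu / 8 * a ^+ 2 + K * B / 64 * b ^+ 2.
Proof.
base_facts.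
apply: young; first by rewrite divr_gt0.
apply: (@factor _ _ ((8 * 16)^-1 - B * nu * (K ^+ 1 * C ^+ 2)) (nu * (K * B))); [by field| |].
  by rewrite !P// ltW.
by have := Bnuc2_le (i := 1) isT; lra.
Qed.

Let h2k : K * B * C <= B * nu / 8.
Proof.
base_facts.
by apply: (@factor _ _ (nu / 8 - K * C) B); [by field|by []|move: kC; lra].
Qed.

Let h2p : K * B * C <= 8^-1.
Proof.
base_facts.
by apply: (le_trans h2k); move: Bnu1; lra.
Qed.

Let heta : K^-1 * C <= 8^-1.
Proof.
base_facts.
rewrite mulrC ler_pdivrMr//; apply: (le_trans CC2); move: KC; lra.
Qed.

(** On the left are the bounds of [dip_id], [dip_Q], [dip_w], [dip_MQ], [dip_M1], [dip_M2], [dip_p]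
    with their weights. After the preceding inequalities every term is linear in squares; [KB1] and
    [KB2] collect the three levels into [K * B] times the whole of [b ^+ 2]. *)
Lemma dissipation :
  (- 2 * nu * a ^+ 2 - 2 * kap * pp ^+ 2)
  + (B * nu) * (4 * (a * b1) - 2 * nu * A ^+ 2 - 2 * kap * qpp ^+ 2)
  + (B * nu) * (C * (bq * b) + C * kap * pp ^+ 2 - 2 * kap * wpp ^+ 2 - 2 * nu * bq ^+ 2)
  + (K ^+ 7 * B) * (- (2^-1 * b1 ^+ 2) + C * (a * b) + C * (b1 * bq)
      + C * nu * (A * bq) + C * nu * (a * b1) + C * kap * (qpp * wpp) + C * kap * (qpp * pp))
  + (K ^+ 3 * B) * (- (2^-1 * b2 ^+ 2) + C * (b1 * b) + C * (bq * b2) + C * kap * wpp ^+ 2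
      + C * kap * pp ^+ 2 + C * nu * bq ^+ 2 + C * nu * (bq * b1) + C * nu * (a * b))
  + (K * B) * (- (4^-1 * v3) + C * (b2 * b) + C * (bq * b) + C * kap * wpp ^+ 2
      + C * kap * pp ^+ 2 + C * nu * bq ^+ 2 + C * nu * (bq * b2) + C * nu * (a * b))
  + (K^-1 * kap) * (C * pp ^+ 2)
  <= - (nu * a ^+ 2 + kap * pp ^+ 2 + K * B / 8 * b ^+ 2).
Proof.
base_facts.
have s (x : R) := sqr_ge0 x.
have g1 := ler_wpM2r (s pp) hc2; have g2 := ler_wpM2r (s bq) h1c.
have g3 := ler_wpM2r (s wpp) h1k; have g4 := ler_wpM2r (s pp) h1p.
have g5 := ler_wpM2r (s bq) h2c; have g6 := ler_wpM2r (s wpp) h2k.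
have g7 := ler_wpM2r (s pp) h2p; have g8 := ler_wpM2r (s pp) heta.
have e1 := ler_wpM2l kap0 g1; have e3 := ler_wpM2l kap0 g3; have e4 := ler_wpM2l kap0 g4.
have e6 := ler_wpM2l kap0 g6; have e7 := ler_wpM2l kap0 g7; have e8 := ler_wpM2l kap0 g8.
have e9 := ler_wpM2l kap0 hQ5; have e10 := ler_wpM2l kap0 hQ6.
have KB1 : K * B * b1 ^+ 2 <= K ^+ 7 * B * b1 ^+ 2.
  by rewrite ler_wpM2r// ler_wpM2r//; exact: (Kmono (i := 1) (j := 7) isT).
have KB2 : K * B * b2 ^+ 2 <= K ^+ 3 * B * b2 ^+ 2.
  by rewrite ler_wpM2r// ler_wpM2r//; exact: (Kmono (i := 1) (j := 3) isT).
have z1 : 0 <= B * nu * nu * A ^+ 2 by rewrite mulr_ge0 ?sqr_ge0 ?P.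
have z2 : 0 <= B * nu * nu * bq ^+ 2 by rewrite mulr_ge0 ?sqr_ge0 ?P.
have z3 : 0 <= B * nu * kap * qpp ^+ 2 by rewrite mulr_ge0 ?sqr_ge0 ?P.
have z4 : 0 <= B * nu * kap * wpp ^+ 2 by rewrite mulr_ge0 ?sqr_ge0 ?P.
have z5 : 0 <= kap * pp ^+ 2 by rewrite mulr_ge0 ?sqr_ge0 ?P.
have z6 : 0 <= nu * a ^+ 2 by rewrite mulr_ge0 ?sqr_ge0 ?P.
have z7 : 0 <= K ^+ 7 * B * b1 ^+ 2 by rewrite mulr_ge0 ?sqr_ge0 ?P.
have z8 : 0 <= K ^+ 3 * B * b2 ^+ 2 by rewrite mulr_ge0 ?sqr_ge0 ?P.
have z9 : 0 <= K * B * v3 by rewrite !P.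
have bEK : K * B * b ^+ 2 = K * B * b1 ^+ 2 + K * B * b2 ^+ 2 + K * B * v3.
  by rewrite bE; ring.
move: hb hc1 hQ1 hQ2 hQ3 hQ4 h1a h1b h1d h1e h2a h2b h2d h2e g2 g5.
move: e1 e3 e4 e6 e7 e8 e9 e10 KB1 KB2 z1 z2 z3 z4 z5 z6 z7 z8 z9 bEK.

move: (a ^+ 2) (A ^+ 2) (b1 ^+ 2) (b2 ^+ 2) (b ^+ 2) (bq ^+ 2) (pp ^+ 2) (wpp ^+ 2) (qpp ^+ 2).
move=> *; lra.
Qed.
Lemma small_parameters : [/\ K ^+ 7 * B <= B * nu / (32 * 32),
  K ^+ 3 * B * C <= B * nu / 8, K * B * C <= B * nu / 8, B * nu <= 1 & K * B <= 1].
Proof.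
split; [|exact: h1k|exact: h2k|exact: Bnu1|].
- rewrite mulrC -mulrA ler_wpM2l ?(ltW B0)// ler_pdivlMr//.
  apply: le_trans nuK; rewrite [K ^+ 8]exprSr; apply: ler_wpM2l; [exact: Kge0|exact: KBIG].
- by rewrite mulrC; apply: (BKi (i := 1)).
Qed.

End SmallConstants.

Section QuadraticForms.
Variable R : realType.
Notation V := (fseq R).

(** A coefficient and two operators per term. Diagonal and mixed terms are thus treated alike in
    differentiation, continuity and polarization. *)
Definition terms := seq (R * ({linear V -> V} * {linear V -> V})).
Definition quad (ts : terms) (f : V) : R := \sum_(t <- ts) t.1 * ip (t.2.1 f) (t.2.2 f).
Definition dquad (ts : terms) (h f : V) : R := \sum_(t <- ts) t.1 * dip t.2.1 t.2.2 h f.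

Lemma quadD ts (f h : V) (c : R) :
  quad ts (f + c *: h) = quad ts f + c * dquad ts h f + c ^+ 2 * quad ts h.
Proof.
rewrite /quad /dquad !mulr_sumr -!big_split/=; apply: eq_bigr => -[x [A B]] _ /=.
by rewrite /dip !linearD !linearZZ !(ipDl, ipDr, ipZl, ipZr); ring.
Qed.

Lemma dquadD ts (h h' f : V) : dquad ts (h + h') f = dquad ts h f + dquad ts h' f.
Proof.
rewrite /dquad -big_split/=; apply: eq_bigr => -[x [A B]] _ /=.
by rewrite /dip !linearD !(ipDl, ipDr); ring.
Qed.

(** Nonnegativity at f - h / s, expanded. The sign of the whole form is enough, although its mixed
    terms have no sign of their own. *)
Lemma dquad_le ts (h f : V) (s : R) : (forall g, 0 <= quad ts g) -> 0 < s ->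
  dquad ts h f <= s * quad ts f + s^-1 * quad ts h.
Proof.
move=> q0 s0; have := q0 (f + (- s^-1) *: h); rewrite quadD => H.
have sV : 0 < s^-1 by rewrite invr_gt0.
rewrite -(ler_pM2l sV) mulrDr mulrA mulVf ?lt0r_neq0// mul1r mulrA -expr2.
by move: H; rewrite sqrrN; lra.
Qed.

End QuadraticForms.

Section Functional.
Variable R : realType.
Notation V := (fseq R).
Implicit Types (f g h : V) (n : int * int).
Notation xforms := (xforms R).
Notation yforms := (yforms R).
Notation Q1 := (mult (@ky1 R)).
Notation Q2 := (mult (@ky2 R)).

(* Decreasing powers of the large constant [Kc] weigh the three levels of
   mixed terms; the overall small factor is [Bc], and [Bc * nu] weighs the fields. *)
Definition Kc : R := locked_with fseq_key (32 * 32 * cC ^+ 2).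
Lemma KcE : Kc = 32 * 32 * cC ^+ 2. Proof. by rewrite /Kc unlock. Qed.

Lemma Kc_ge1 : 1 <= Kc.
Proof.
rewrite KcE; have [C1 _ _ _] := @cC_bounds R.
have : 1 <= cC ^+ 2 :> R by rewrite exprn_ege1.
by lra.
Qed.

Variables (nu : R).
Hypothesis nuK : Kc ^+ 8 <= nu.

Definition Bc : R := locked_with fseq_key ((nu * Kc ^+ 15)^-1).
Lemma BcE : Bc = (nu * Kc ^+ 15)^-1. Proof. by rewrite /Bc unlock. Qed.

Lemma nu_ge1 : 1 <= nu.
Proof. by apply: le_trans nuK; rewrite exprn_ege1// Kc_ge1. Qed.
Lemma Kc_gt0 : 0 < Kc. Proof. exact: lt_le_trans Kc_ge1. Qed.
Lemma nu_gt0 : 0 < nu. Proof. exact: lt_le_trans nu_ge1. Qed.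
Lemma Bc_gt0 : 0 < Bc.
Proof. by rewrite BcE invr_gt0 mulr_gt0 ?nu_gt0 ?exprn_gt0 ?Kc_gt0. Qed.
Lemma Bc_eq : Bc * nu * Kc ^+ 15 = 1.
Proof. by rewrite BcE -mulrA mulVf// mulf_neq0 ?expf_neq0 ?lt0r_neq0 ?nu_gt0 ?Kc_gt0. Qed.

Definition cCK : 32 * 32 * cC ^+ 2 <= Kc. Proof. by rewrite KcE. Qed.
Definition cC_ge1 : 1 <= cC :> R. Proof. by have [] := @cC_bounds R. Qed.

Definition gam := Bc * nu.

Definition diag (c : R) (A : {linear V -> V}) : R * ({linear V -> V} * {linear V -> V}) := (c, (A, A)).
Definition off (c : R) (A B : {linear V -> V}) : R * ({linear V -> V} * {linear V -> V}) := (c, (A, B)).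

Definition Eterms (kap : R) : terms R :=
  [:: diag 1 idfun; diag gam Q1; diag gam Q2;
      diag gam (L (1, 0)); diag gam (L (0, 1)); diag gam (L (1, 1)); diag gam (L (1, -1));
      diag gam (L (2, 1)); diag gam (L (2, -1)); diag gam (L (1, 2)); diag gam (L (1, -2));
      off (Kc ^+ 7 * Bc) Q1 (@Qd1 R); off (Kc ^+ 7 * Bc) Q2 (@Qd2 R);
      off (Kc ^+ 3 * Bc) (L (1, 0)) (Ld (1, 0)); off (Kc ^+ 3 * Bc) (L (0, 1)) (Ld (0, 1));
      off (Kc * Bc) (L (1, 1)) (Ld (1, 1)); off (Kc * Bc) (L (1, -1)) (Ld (1, -1));
      diag (Kc^-1 * kap) (mult kx1); diag (Kc^-1 * kap) (mult kx2);
      diag (Kc^-1 * kap) (mult kx3); diag (Kc^-1 * kap) (mult kx4)].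

Definition E kap f : R := quad (Eterms kap) f.
Definition dE kap h f : R := dquad (Eterms kap) h f.
Definition E0 kap f : R := ip f f + gam * (qf f + w f) + Kc^-1 * kap * pf f.

Lemma E_expand kap f : E kap f = E0 kap f
  + Kc ^+ 7 * Bc * (ip (Q1 f) (Qd1 f) + ip (Q2 f) (Qd2 f))
  + Kc ^+ 3 * Bc * (ip (L (1, 0) f) (Ld (1, 0) f) + ip (L (0, 1) f) (Ld (0, 1) f))
  + Kc * Bc * (ip (L (1, 1) f) (Ld (1, 1) f) + ip (L (1, -1) f) (Ld (1, -1) f)).
Proof.
rewrite /E /E0 /quad /Eterms !big_cons big_nil /diag /off /=.
rewrite /qf /pf /sumsq /w /vlev !big_cons !big_nil/=.
by ring.
Qed.

Lemma dE_expand kap h f : dE kap h f = dip idfun idfun h f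
  + gam * (dip Q1 Q1 h f + dip Q2 Q2 h f)
  + gam * (\sum_(n <- level1) dip (L n) (L n) h f + \sum_(n <- level2) dip (L n) (L n) h f
     + \sum_(n <- level3) dip (L n) (L n) h f)
  + Kc ^+ 7 * Bc * (dip Q1 (@Qd1 R) h f + dip Q2 (@Qd2 R) h f)
  + Kc ^+ 3 * Bc * (dip (L (1, 0)) (Ld (1, 0)) h f + dip (L (0, 1)) (Ld (0, 1)) h f)
  + Kc * Bc * (dip (L (1, 1)) (Ld (1, 1)) h f + dip (L (1, -1)) (Ld (1, -1)) h f)
  + Kc^-1 * kap * \sum_(m <- xforms) dip (mult m) (mult m) h f.
Proof.
rewrite /dE /dquad /Eterms !big_cons !big_nil /diag /off /=.
by ring.
Qed.

Section Bounds.
Variable kap : R.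
Hypothesis kap0 : 0 <= kap.

(** Each of the three groups of mixed terms is at most an eighth of gam (qf + w), because their
    weights are far below [gam], as [small_parameters] records. *)
Lemma E_equiv f : E0 kap f / 2 <= E kap f <= 2 * E0 kap f.
Proof.
have [s7 s3 s1 Bn1 KB1] := small_parameters cC_ge1 cCK nuK Bc_gt0 Bc_eq.
have B0 := ltW Bc_gt0; have K0 := ltW Kc_gt0.
have [C1 CL _ _] := @cC_bounds R.
have [d1 d2] := nrm_Qd f.
have q1 := ip_bound (nrm_Q1 f) d1; have q2 := ip_bound (nrm_Q2 f) d2.
have a2 : Num.sqrt (qf f) ^+ 2 = qf f by rewrite sqr_sqrtr ?qf_ge0.
have b12 : Num.sqrt (vlev level1 f) ^+ 2 = vlev level1 f by rewrite sqr_sqrtr ?vlev_ge0.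
have b2 : Num.sqrt (w f) ^+ 2 = w f by rewrite sqr_sqrtr ?w_ge0.
have ab : 2 * (Num.sqrt (qf f) * Num.sqrt (vlev level1 f)) <= qf f + w f.
  have := sqr_ge0 (Num.sqrt (qf f) - Num.sqrt (vlev level1 f)).
  rewrite sqrrB a2 b12; have := vlev1_le_w f; lra.
have HL n : small 1 n -> n \in level1 ++ level2 -> `|ip (L n f) (Ld n f)| <= 4 * cL * w f.
  move=> sn nB.
  have hn : nrm (L n f) <= Num.sqrt (w f).
    by apply: nrm_L_B; move: nB; rewrite !inE; do ![case/orP]; move=> /eqP ->.
  have s2 : small 2 n by move: nB; rewrite !inE; do ![case/orP]; move=> /eqP ->.
  have := ip_bound hn (nrm_Ld_le f s2).
  by rewrite -[w f in X in _ -> X]b2 (_ : Num.sqrt (w f) * _ = 4 * cL * Num.sqrt (w f) ^+ 2); last by ring.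
have h1 := HL (1, 0) isT isT; have h2 := HL (0, 1) isT isT.
have h3 := HL (1, 1) isT isT; have h4 := HL (1, -1) isT isT.
have qw : 0 <= qf f + w f by rewrite addr_ge0 ?qf_ge0 ?w_ge0.
have X7 : `|Kc ^+ 7 * Bc * (ip (Q1 f) (Qd1 f) + ip (Q2 f) (Qd2 f))| <= gam / 8 * (qf f + w f).
  rewrite normrM; apply: ler_pM => //.
    rewrite ger0_norm; last by rewrite mulr_ge0// exprn_ge0.
    by apply: (le_trans s7); rewrite ler_wpM2l ?mulr_ge0// ?(ltW nu_gt0)//; lra.
  by apply: le_trans (ler_normD _ _) _; move: q1 q2 ab; lra.
have X3 (M x y : R) : 0 <= M -> M * cC <= Bc * nu / 8 -> `|x| <= 4 * cL * w f ->
    `|y| <= 4 * cL * w f -> `|M * (x + y)| <= gam / 8 * (qf f + w f).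
  move=> M0 MC hx hy; rewrite normrM (ger0_norm M0).
  have hw := w_ge0 f; have hq := qf_ge0 f.
  apply: (@le_trans _ _ (M * (cC * (qf f + w f)))).
    apply: ler_wpM2l => //; apply: le_trans (ler_normD _ _) _.
    have t1 : 100 * cL * w f <= cC * w f by rewrite ler_wpM2r.
    have t2 : 0 <= cL * w f by rewrite mulr_ge0 ?cL_ge0.
    have t3 : 0 <= cC * qf f by rewrite mulr_ge0// (le_trans _ C1).
    by move: hx hy; lra.
  by rewrite mulrA ler_wpM2r.
have Y3 := X3 (Kc ^+ 3 * Bc) _ _ (mulr_ge0 (exprn_ge0 3 K0) B0) s3 h1 h2.
have Y1 := X3 (Kc * Bc) _ _ (mulr_ge0 K0 B0) s1 h3 h4.
have e0 : 0 <= ip f f + Kc^-1 * kap * pf f.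
  by rewrite addr_ge0 ?ip_ge0// mulr_ge0 ?pf_ge0// mulr_ge0// invr_ge0.
have gqw : 0 <= gam * (qf f + w f) by rewrite mulr_ge0// mulr_ge0// ltW// nu_gt0.
move: X7 Y3 Y1 e0; rewrite E_expand /E0 !ler_norml.
set x1 := _ * (_ + ip (Q2 f) _); set x2 := _ * (_ + ip (L (0, 1) f) _).
set x3 := _ * (_ + ip (L (1, -1) f) _).
move: gqw; rewrite (_ : gam / 8 * (qf f + w f) = gam * (qf f + w f) / 8); last by field.
clearbody x1 x2 x3; move: (gam * _) (_ * kap * _) (ip f f) => y1 y2 y3.
by move=> y10 /andP[? ?] /andP[? ?] /andP[? ?] ?; apply/andP; split; lra.
Qed.

Lemma E0_ge0 f : 0 <= E0 kap f.
Proof.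
rewrite /E0; have := ip_ge0 f; have := qf_ge0 f; have := w_ge0 f; have := pf_ge0 f.
move=> *; apply: addr_ge0; [apply: addr_ge0 => //|]; apply: mulr_ge0 => //.
- by rewrite mulr_ge0// ltW// ?Bc_gt0 ?nu_gt0.
- by rewrite addr_ge0.
- by rewrite mulr_ge0// invr_ge0 ltW// Kc_gt0.
Qed.

Lemma E_ge0 f : 0 <= E kap f.
Proof. by have := E0_ge0 f; have /andP[+ _] := E_equiv f; lra. Qed.

Lemma E_diss f : (forall K : Z6, K.1 = 0 -> f K = 0) ->
  dE kap (gen kap nu f) f <= - (nu * qf f + kap * pf f + Kc * Bc / 8 * w f).
Proof.
move=> f0; have nuge := ltW nu_gt0.
have v3E : vlev level3 f = vlev level3 f by [].
have bE : Num.sqrt (w f) ^+ 2 = Num.sqrt (vlev level1 f) ^+ 2 + Num.sqrt (vlev level2 f) ^+ 2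
   + vlev level3 f by rewrite !sqr_sqrtr ?vlev_ge0 ?w_ge0.
have := @dissipation R cC Kc Bc nu kap cC_ge1 cCK nuK Bc_gt0 Bc_eq kap0
  (Num.sqrt (qf f)) (Num.sqrt (qqf f)) (Num.sqrt (vlev level1 f)) (Num.sqrt (vlev level2 f))
  (vlev level3 f) (Num.sqrt (w f)) (Num.sqrt (wqf f)) (Num.sqrt (pf f)) (Num.sqrt (wpf f))
  (Num.sqrt (qpf f)) (vlev_ge0 _ _) bE.
rewrite !(sqr_sqrtr (qf_ge0 f)) !(sqr_sqrtr (qqf_ge0 f)) !(sqr_sqrtr (vlev_ge0 _ f))
  !(sqr_sqrtr (w_ge0 f)) !(sqr_sqrtr (wqf_ge0 f)) !(sqr_sqrtr (pf_ge0 f))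
  !(sqr_sqrtr (wpf_ge0 f)) !(sqr_sqrtr (qpf_ge0 f)).
apply: le_trans; rewrite dE_expand /gam.
have B0 := ltW Bc_gt0; have K0 := ltW Kc_gt0.
have Bn : 0 <= Bc * nu by rewrite mulr_ge0.
have C0 : 0 <= cC :> R by apply: le_trans cC_ge1.
have D := @dip_Q R f kap nu.
apply: lerD; last first.
  by apply: ler_wpM2l; [rewrite mulr_ge0// invr_ge0|exact: dip_p].
apply: lerD; last first.
  by apply: ler_wpM2l; [rewrite mulr_ge0//|exact: dip_M2].
apply: lerD; last first.
  by apply: ler_wpM2l; [rewrite mulr_ge0// exprn_ge0|exact: dip_M1].
apply: lerD; last first.
  by apply: ler_wpM2l; [rewrite mulr_ge0// exprn_ge0|exact: dip_MQ].
apply: lerD; last by apply: ler_wpM2l => //; exact: dip_w.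
apply: lerD; last by apply: ler_wpM2l => //; exact: dip_Q.
by rewrite dip_id.
Qed.

(** The gain [Kc * Bc / 8] times [w] pays for |f|^2, through the Poincare inequality, and for [w]
    itself, whence [cP + 1]; E <= 2 E0 costs another factor 2. Since [kap] does not enter, the rate
    is uniform in it. *)
Definition lam0 := Kc * Bc / (16 * (cP + 1)).

Lemma lam0_gt0 : 0 < lam0.
Proof.
rewrite /lam0 divr_gt0 ?mulr_gt0 ?Kc_gt0 ?Bc_gt0//.
by rewrite cPE; lra.
Qed.

Lemma E_decay f : (forall K : Z6, K.1 = 0 -> f K = 0) ->
  dE kap (gen kap nu f) f <= - lam0 * E kap f.
Proof.
move=> f0; apply: (le_trans (E_diss f0)); rewrite mulNr lerN2.
have [s7 s3 s1 Bn1 KB1] := small_parameters cC_ge1 cCK nuK Bc_gt0 Bc_eq.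
have /andP[_ e2] := E_equiv f; have po := poincare f0.
have cp0 : 1 <= cP :> R by rewrite cPE; lra.
have l0 := lam0_gt0.
apply: (@le_trans _ _ (2 * lam0 * E0 kap f)).
  by rewrite -mulrA mulrCA ler_wpM2l// ltW.
pose l := 2 * lam0; rewrite -/l.
have lE : l * (cP + 1) = Kc * Bc / 8.
  by rewrite /l /lam0; field; move: cp0; lra.
have l1 : l <= 1.
  have : l * 1 <= l * (cP + 1).
    apply: ler_wpM2l; first by apply: mulr_ge0 => //; exact: ltW.
    by rewrite lerDr (le_trans _ cp0).
  rewrite lE mulr1 => /le_trans; apply; apply: le_trans KB1.
  by rewrite ler_piMr ?mulr_ge0 ?(ltW Kc_gt0) ?(ltW Bc_gt0)// invf_le1//; lra.
have lp : 0 <= l by rewrite mulr_ge0// ltW.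
have g0 : 0 <= gam by rewrite mulr_ge0// ltW// ?Bc_gt0 ?nu_gt0.
have h1 : l * ip f f <= l * (cP * w f) by rewrite ler_wpM2l.
have h2 : l * gam * qf f <= nu * qf f.
  rewrite ler_wpM2r ?qf_ge0//; apply: le_trans nu_ge1.
  by rewrite -[1]mulr1 ler_pM.
have h3 : l * gam * w f <= l * w f.
  by rewrite ler_wpM2r ?w_ge0// ler_piMr.
have h4 : l * (Kc^-1 * kap * pf f) <= kap * pf f.
  rewrite mulrA ler_wpM2r ?pf_ge0// mulrA -[X in _ <= X]mul1r ler_wpM2r//.
  by rewrite -[1]mulr1 ler_pM// ?invr_ge0 ?(ltW Kc_gt0)// invf_le1 ?Kc_gt0 ?Kc_ge1.
have h5 : Kc * Bc / 8 * w f = l * (cP * w f) + l * w f by rewrite -lE; ring.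
rewrite /E0 h5; set lhs := l * _; have -> : lhs = l * ip f f + l * gam * qf f + l * gam * w f
    + l * (Kc^-1 * kap * pf f) by rewrite /lhs; ring.
move: h1 h2 h3 h4; move: (l * ip f f) (l * gam * qf f) (l * gam * w f) (l * (Kc^-1 * kap * pf f)).
move: (nu * qf f) (kap * pf f) (l * (cP * w f)) (l * w f) => *; lra.
Qed.

End Bounds.
End Functional.

(** * The Fourier side of the norm, and cutoffs *)

Section Density.
Variable R : realType.
Notation V := (fseq R).
Implicit Types (kap : R) (f g : V) (a : Z6 -> R) (s e K : Z6).
Notation P1 := (mult (@kx1 R)).
Notation P2 := (mult (@kx2 R)).
Notation P3 := (mult (@kx3 R)).
Notation P4 := (mult (@kx4 R)).

Definition directions : seq Z6 := [:: zv 1 0; zv 0 1].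
(** d_3 and d_4 suffice: the relative derivative d_3 - d_1 is 2 d_3 - (d_1 + d_3), where d_1 + d_3
    is controlled without weight, and similarly for d_4 - d_2. *)
Definition momenta : seq (Z6 -> R) := [:: kx3; kx4].

Definition difference e (m : Z6 -> R) a K := m K * a K - m (K - e) * a (K - e).
Definition weight (kap : R) K : R := 1 + (ky1 K ^+ 2 + ky2 K ^+ 2)
  + ((kx1 K + kx3 K) ^+ 2 + (kx2 K + kx4 K) ^+ 2)
  + kap * (kx1 K ^+ 2 + kx2 K ^+ 2 + kx3 K ^+ 2 + kx4 K ^+ 2).

(* The summand of the squared H^1 norm on the Fourier side. *)
Definition dens (kap : R) a K : R := weight kap K * a K ^+ 2
  + \sum_(e <- directions) \sum_(m <- momenta) difference e m a K ^+ 2.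

Definition N (kap : R) f : R := ip f f + qf f
  + (ip (P1 f + P3 f) (P1 f + P3 f) + ip (P2 f + P4 f) (P2 f + P4 f))
  + kap * pf f
  + \sum_(e <- directions) \sum_(m <- momenta)
      ip (mult m f - sh e (mult m f)) (mult m f - sh e (mult m f)).

Lemma weight_ge1 kap K : 0 <= kap -> 1 <= weight kap K.
Proof.
move=> k0; rewrite /weight -!addrA lerDl !addr_ge0 ?sqr_ge0//.
by rewrite mulr_ge0// !addr_ge0 ?sqr_ge0.
Qed.

Lemma dens_diff_ge0 a K : 0 <= \sum_(e <- directions) \sum_(m <- momenta) difference e m a K ^+ 2.
Proof. by apply: sumr_ge0 => e _; apply: sumr_ge0 => m _; exact: sqr_ge0. Qed.

Lemma sqr_le_dens kap a K : 0 <= kap -> a K ^+ 2 <= dens kap a K.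
Proof.
move=> k0; rewrite /dens -[X in X <= _]addr0 lerD ?dens_diff_ge0//.
by rewrite ler_peMl ?sqr_ge0 ?weight_ge1.
Qed.

Lemma dens_ge0 kap a K : 0 <= kap -> 0 <= dens kap a K.
Proof. by move=> k0; apply: le_trans (sqr_le_dens a K k0); exact: sqr_ge0. Qed.

(** The density at K also sees f at K - e, so the list is the support of f enlarged by its
    translates along the two directions. *)
Lemma N_support kap f : exists S : seq Z6, [/\ uniq S,
  (forall K, K \notin S -> dens kap f K = 0) &
  forall S', uniq S' -> {subset S <= S'} -> N kap f = \sum_(K <- S') dens kap f K].
Proof.
have [s us fs] := finite_seq_support f.
pose S := undup (s ++ [seq K + e | K <- s, e <- directions]).
have fS K : K \notin S -> f K = 0.
  by rewrite mem_undup mem_cat negb_or => /andP[/fs].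
have fSe K e : e \in directions -> K \notin S -> f (K - e) = 0.
  move=> eD KS; apply: fs; apply: contra KS => KeS.
  rewrite mem_undup mem_cat; apply/orP; right; apply/allpairsP.
  by exists (K - e, e); rewrite /= KeS eD subrK.
exists S; split; first exact: undup_uniq.
  move=> K KS; rewrite /dens fS// expr0n mulr0 add0r big1_seq// => e /andP[_ eD].
  by rewrite big1_seq// => m _; rewrite /difference fS// fSe// !mulr0 subr0 expr0n.
move=> S' uS' SS'.
have fS' K : K \notin S' -> f K = 0.
  by move=> KS; apply: fS; apply: contra KS => /SS'.
have X g : (forall K, K \notin S' -> g K = 0) -> ip g g = \sum_(K <- S') g K ^+ 2.
  by move=> gS; rewrite (ip_finE _ uS' gS); apply: eq_bigr => K _; rewrite expr2.
have Xm m : ip (mult m f) (mult m f) = \sum_(K <- S') m K ^+ 2 * f K ^+ 2.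
  rewrite X => [|K KS]; last by rewrite multE fS' ?mulr0.
  by apply: eq_bigr => K _; rewrite multE exprMn.
have Xe e m : e \in directions ->
    ip (mult m f - sh e (mult m f)) (mult m f - sh e (mult m f)) =
    \sum_(K <- S') difference e m f K ^+ 2.
  move=> eD; rewrite X => [|K KS]; last first.
    rewrite !fseqE shE !multE fS'// (fSe K e eD) ?mulr0 ?oppr0 ?addr0//.
    by apply: contra KS => /SS'.
  by apply: eq_bigr => K _; rewrite !fseqE shE !multE.
have Xp m m' : ip (mult m f + mult m' f) (mult m f + mult m' f) =
    \sum_(K <- S') (m K + m' K) ^+ 2 * f K ^+ 2.
  rewrite X => [|K KS]; last by rewrite !fseqE !multE fS' ?mulr0 ?addr0.
  by apply: eq_bigr => K _; rewrite !fseqE !multE -mulrDl exprMn.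
rewrite /N /qf /pf /sumsq !big_cons !big_nil !addr0 !Xm !Xp X// !Xe ?inE ?eqxx ?orbT//.
rewrite !mulrDr !mulr_sumr -!big_split/=; apply: eq_bigr => K _.
by rewrite /dens !big_cons !big_nil /weight; ring.
Qed.

Lemma sum_dens_le kap f (S : seq Z6) : 0 <= kap -> uniq S ->
  \sum_(K <- S) dens kap f K <= N kap f.
Proof.
move=> k0 uS; have [S' [uS' _ NE]] := N_support kap f.
rewrite (NE (undup (S ++ S'))) ?undup_uniq//; last first.
  by move=> K KS; rewrite mem_undup mem_cat KS orbT.
have -> : \sum_(K <- S) dens kap f K = \sum_(K <- undup (S ++ S') | K \in S) dens kap f K.
  rewrite -[RHS]big_filter; apply: perm_big; apply: uniq_perm; rewrite ?filter_uniq ?undup_uniq// => K.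
  by rewrite mem_filter mem_undup mem_cat; case: (K \in S).
by rewrite [leRHS](bigID (mem S))/= lerDl sumr_ge0// => K _; exact: dens_ge0.
Qed.

Definition small_shift (b : R) s := [&& `|kx1 s| <= b, `|kx2 s| <= b, `|kx3 s| <= b,
  `|kx4 s| <= b, `|ky1 s| <= b & `|ky2 s| <= b].

Let sqr_bound (x y : R) : `|x| <= y -> x ^+ 2 <= y ^+ 2.
Proof.
by move=> xy; rewrite -(real_normK (num_real x)) ler_pXn2r// nnegrE (le_trans _ xy).
Qed.

Let sqrD_le (x y : R) : (x + y) ^+ 2 <= 2 * x ^+ 2 + 2 * y ^+ 2.
Proof. by rewrite -subr_ge0 (_ : _ - _ = (x - y) ^+ 2) ?sqr_ge0//; ring. Qed.

Lemma weight_shift (kap b : R) s K : 0 <= kap -> 0 <= b <= 1 -> small_shift b s ->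
  weight kap K <= (22 + 8 * kap * b ^+ 2) * weight kap (K - s).
Proof.
move=> k0 /andP[b0 b1] /and5P[/sqr_bound s1 /sqr_bound s2 /sqr_bound s3 /sqr_bound s4].
move=> /andP[/sqr_bound s5 /sqr_bound s6].
have b2 : b ^+ 2 <= 1 by rewrite exprn_ile1.
have H (m : Z6 -> R) : additive_form m -> m K = m (K - s) + m s by move=> <-; rewrite subrK.
have w1 := weight_ge1 (K - s) k0; move: w1 s1 s2 s3 s4 s5 s6.
rewrite /weight (H _ (@kx1D R)) (H _ (@kx2D R)) (H _ (@kx3D R)) (H _ (@kx4D R)).
rewrite (H _ (@ky1D R)) (H _ (@ky2D R)).
move: (kx1 (K - s)) (kx2 (K - s)) (kx3 (K - s)) (kx4 (K - s)) (ky1 (K - s)) (ky2 (K - s)).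
move: (kx1 s) (kx2 s) (kx3 s) (kx4 s) (ky1 s) (ky2 s) => {H K}.
move=> t1 t2 t3 t4 t5 t6 x1 x2 x3 x4 x5 x6.
have h1 := sqrD_le x1 t1; have h2 := sqrD_le x2 t2; have h3 := sqrD_le x3 t3.
have h4 := sqrD_le x4 t4; have h5 := sqrD_le x5 t5; have h6 := sqrD_le x6 t6.
have h13 : (x1 + t1 + (x3 + t3)) ^+ 2 <= 2 * (x1 + x3) ^+ 2 + 4 * t1 ^+ 2 + 4 * t3 ^+ 2.
  by have := sqrD_le (x1 + x3) (t1 + t3); have := sqrD_le t1 t3; rewrite addrACA; lra.
have h24 : (x2 + t2 + (x4 + t4)) ^+ 2 <= 2 * (x2 + x4) ^+ 2 + 4 * t2 ^+ 2 + 4 * t4 ^+ 2.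
  by have := sqrD_le (x2 + x4) (t2 + t4); have := sqrD_le t2 t4; rewrite addrACA; lra.
move: h1 h2 h3 h4 h5 h6 h13 h24.
set X := 1 + (x5 ^+ 2 + _) + _.
set S := x1 ^+ 2 + _ + _ + _.
move=> h1 h2 h3 h4 h5 h6 h13 h24 w1 s1 s2 s3 s4 s5 s6.
have XE : X = 1 + (x5 ^+ 2 + x6 ^+ 2) + ((x1 + x3) ^+ 2 + (x2 + x4) ^+ 2) by [].
have SE : S = x1 ^+ 2 + x2 ^+ 2 + x3 ^+ 2 + x4 ^+ 2 by [].
have X1 : 1 <= X by rewrite XE -!addrA lerDl !addr_ge0 ?sqr_ge0.
have S0 : 0 <= S by rewrite SE !addr_ge0 ?sqr_ge0.
have kS : kap * ((x1 + t1) ^+ 2 + (x2 + t2) ^+ 2 + (x3 + t3) ^+ 2 + (x4 + t4) ^+ 2) <=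
    kap * (2 * S + 8 * b ^+ 2).
  by apply: ler_wpM2l => //; move: h1 h2 h3 h4 s1 s2 s3 s4; rewrite SE; lra.
have kSp : 0 <= kap * S by rewrite mulr_ge0.
have kb : 0 <= kap * b ^+ 2 by rewrite mulr_ge0 ?sqr_ge0.
have kbx : kap * b ^+ 2 <= kap * b ^+ 2 * (X + kap * S).
  by rewrite ler_peMr//; move: X1 kSp; lra.
have l1 : 1 + ((x5 + t5) ^+ 2 + (x6 + t6) ^+ 2) + ((x1 + t1 + (x3 + t3)) ^+ 2 +
    (x2 + t2 + (x4 + t4)) ^+ 2) <= 22 * X.
  move: h5 h6 h13 h24 s1 s2 s3 s4 s5 s6 b2 X1; rewrite XE.
  move: (x5 ^+ 2) (x6 ^+ 2) ((x1 + x3) ^+ 2) ((x2 + x4) ^+ 2) (b ^+ 2).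
  by move=> *; lra.
move: l1 kS kbx kSp; clear; move: (b ^+ 2) => c.
set Y := _ + _ + (_ + _); set Z := _ * (_ + _ + _ + _).
have -> : (22 + 8 * kap * c) * (X + kap * S) = 22 * X + 22 * (kap * S)
  + 8 * (kap * c * (X + kap * S)) by ring.
have -> : kap * (2 * S + 8 * c) = 2 * (kap * S) + 8 * (kap * c) by ring.
by move: (kap * c) (kap * S) => p q *; lra.
Qed.

(* At s = 0 one may take b = 0, and the bound does not depend on kap. *)
Lemma dens_mult (kap eta b : R) (rho : Z6 -> R) s a K :
  0 <= kap -> 0 <= b <= 1 -> small_shift b s -> `|rho K| <= eta ->
  (forall e, e \in directions -> `|kx3 (K - e)| * `|rho K - rho (K - e)| <= eta /\
    `|kx4 (K - e)| * `|rho K - rho (K - e)| <= eta) ->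
  dens kap (fun K => rho K * a (K - s)) K <= (34 + 8 * kap * b ^+ 2) * eta ^+ 2 *
    (dens kap a (K - s) + \sum_(e <- directions) a (K - s - e) ^+ 2).
Proof.
move=> k0 b01 ss rK rD; have /andP[b0 b1] := b01.
have W := weight_shift K k0 b01 ss.
have e0 : 0 <= eta by apply: le_trans rK.
have D e (m : Z6 -> R) : additive_form m -> `|m s| <= b ->
    `|m (K - e)| * `|rho K - rho (K - e)| <= eta ->
    difference e m (fun K => rho K * a (K - s)) K ^+ 2 <=
    eta ^+ 2 * (3 * difference e m a (K - s) ^+ 2 + 3 * a (K - s) ^+ 2 + 12 * a (K - s - e) ^+ 2).
  move=> mD ms mr.
  (* Discrete product rule. The last term sets a full momentum against a difference of [rho], which
     explains the hypothesis on weighted differences; the shift s contributes only [m s], at most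
     b. *)
  have E : difference e m (fun K => rho K * a (K - s)) K =
      rho K * (difference e m a (K - s) + m s * (a (K - s) - a (K - s - e)))
      + m (K - e) * (rho K - rho (K - e)) * a (K - s - e).
    rewrite /difference (_ : K - e - s = K - s - e); last by rewrite addrAC.
    have h1 : m K = m (K - s) + m s by rewrite -mD subrK.
    have h2 : m (K - e) = m (K - s - e) + m s by rewrite -mD addrAC subrK.
    by rewrite h2 h1; ring.
  move: E mr ms; set d := difference e m a _; set x := a (K - s); set y := a (K - s - e).
  move=> E mr ms.
  have B : `|difference e m (fun K => rho K * a (K - s)) K| <= eta * (`|d| + `|x| + 2 * `|y|).
    rewrite E; apply: le_trans (ler_normD _ _) _; rewrite !normrM.
    have -> : eta * (`|d| + `|x| + 2 * `|y|) = eta * (`|d| + (`|x| + `|y|)) + eta * `|y| by ring.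
    apply: lerD; last by rewrite ler_wpM2r.
    apply: ler_pM => //; apply: le_trans (ler_normD _ _) _; rewrite lerD2l normrM.
    apply: (@le_trans _ _ (1 * (`|x| + `|y|))); last by rewrite mul1r.
    by apply: ler_pM => //; [exact: le_trans b1|exact: ler_normB].
  apply: le_trans (sqr_bound B) _; rewrite exprMn ler_wpM2l ?sqr_ge0//.
  rewrite -(real_normK (num_real d)) -(real_normK (num_real x)) -(real_normK (num_real y)).
  move: `|d| `|x| `|y| => p q r; rewrite -subr_ge0.
  have -> : 3 * p ^+ 2 + 3 * q ^+ 2 + 12 * r ^+ 2 - (p + q + 2 * r) ^+ 2 =
    (p - q) ^+ 2 + (p - 2 * r) ^+ 2 + (q - 2 * r) ^+ 2 by ring.
  by rewrite !addr_ge0 ?sqr_ge0.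
have := ss; rewrite /small_shift => /and5P[_ _ s3 s4 _].
have [r13 r14] := rD (zv 1 0) (mem_head _ _).
have [r23 r24] := rD (zv 0 1) isT.
have d1 := D _ _ (@kx3D R) s3 r13; have d2 := D _ _ (@kx4D R) s4 r14.
have d3 := D _ _ (@kx3D R) s3 r23; have d4 := D _ _ (@kx4D R) s4 r24.
have w1 := weight_ge1 (K - s) k0.
have rx : weight kap K * (rho K * a (K - s)) ^+ 2 <=
    (22 + 8 * kap * b ^+ 2) * eta ^+ 2 * (weight kap (K - s) * a (K - s) ^+ 2).
  have h : weight kap K * rho K ^+ 2 <= (22 + 8 * kap * b ^+ 2) * weight kap (K - s) * eta ^+ 2.
    apply: ler_pM; rewrite ?sqr_ge0 ?sqr_bound//.
    by apply: le_trans (weight_ge1 K k0).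
  have -> : weight kap K * (rho K * a (K - s)) ^+ 2 = weight kap K * rho K ^+ 2 * a (K - s) ^+ 2.
    by ring.
  have -> : (22 + 8 * kap * b ^+ 2) * eta ^+ 2 * (weight kap (K - s) * a (K - s) ^+ 2) =
    (22 + 8 * kap * b ^+ 2) * weight kap (K - s) * eta ^+ 2 * a (K - s) ^+ 2 by ring.
  by rewrite ler_wpM2r ?sqr_ge0.
rewrite /dens !big_cons !big_nil !addr0.
move: d1 d2 d3 d4 rx; set A := a (K - s) ^+ 2; set A1 := a _ ^+ 2; set A2 := a _ ^+ 2.
set X1 := difference _ _ a _ ^+ 2; set X2 := difference _ _ a _ ^+ 2.
set X3 := difference _ _ a _ ^+ 2; set X4 := difference _ _ a _ ^+ 2.
set wA := weight kap (K - s) * A.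
have wA1 : A <= wA by rewrite ler_peMl ?sqr_ge0.
have A0 : 0 <= A by exact: sqr_ge0.
have B0 : 0 <= A1 + A2 by rewrite addr_ge0 ?sqr_ge0.
have Z0 : 0 <= X1 + X2 + (X3 + X4) by rewrite !addr_ge0 ?sqr_ge0.
move=> d1 d2 d3 d4 rx.
apply: (@le_trans _ _ (eta ^+ 2 * ((22 + 8 * kap * b ^+ 2) * wA + 3 * (X1 + X2 + (X3 + X4)) + 12 * A
   + 24 * (A1 + A2)))).
  apply: le_trans (lerD rx (lerD (lerD d1 d2) (lerD d3 d4))) _.
  rewrite le_eqVlt; apply/orP; left; apply/eqP; ring.
rewrite [(34 + _) * _]mulrC -[X in _ <= X]mulrA ler_wpM2l ?sqr_ge0//.
have kb : 0 <= kap * b ^+ 2 by rewrite mulr_ge0 ?sqr_ge0.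
have kbz : 0 <= kap * b ^+ 2 * (X1 + X2 + (X3 + X4) + (A1 + A2)) by apply: mulr_ge0 => //; exact: addr_ge0.
have -> : (34 + 8 * kap * b ^+ 2) * (wA + (X1 + X2 + (X3 + X4)) + (A1 + A2)) =
   (22 + 8 * kap * b ^+ 2) * wA + 12 * wA + 34 * (X1 + X2 + (X3 + X4)) + 34 * (A1 + A2) +
   8 * (kap * b ^+ 2 * (X1 + X2 + (X3 + X4) + (A1 + A2))) by ring.
move: kbz wA1 A0 B0 Z0 => {rx d1 d2 d3 d4 D W}.
set U := (22 + 8 * kap * b ^+ 2) * wA; set Y := kap * b ^+ 2 * (_ + (A1 + A2)).
set B := A1 + A2; set X := X1 + X2 + (X3 + X4); clearbody U Y B X wA A.
by move=> *; lra.
Qed.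

Lemma N_ge0 kap f : 0 <= kap -> 0 <= N kap f.
Proof. by move=> k0; have := @sum_dens_le kap f [::] k0 isT; rewrite big_nil. Qed.

Lemma uniq_shift s (S : seq Z6) : uniq S -> uniq [seq K - s | K <- S].
Proof. by move=> uS; rewrite map_inj_uniq// => K K' /addIr. Qed.

(** The density at K - s and the squares at its two neighbours each sum to at most [N kap f]; this
    is the factor 3. *)
Lemma N_mult (kap eta b : R) (rho : Z6 -> R) s f :
  0 <= kap -> 0 <= b <= 1 -> small_shift b s -> (forall K, `|rho K| <= eta) ->
  (forall K e, e \in directions -> `|kx3 (K - e)| * `|rho K - rho (K - e)| <= eta /\
    `|kx4 (K - e)| * `|rho K - rho (K - e)| <= eta) ->
  N kap (mult rho (sh s f)) <= 3 * ((34 + 8 * kap * b ^+ 2) * eta ^+ 2) * N kap f.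
Proof.
move=> k0 b01 ss rK rD; have [S [uS _ /(_ S uS (fun K => id)) ->]] := N_support kap (mult rho (sh s f)).
have E K : dens kap (mult rho (sh s f)) K = dens kap (fun K => rho K * f (K - s)) K.
  by congr (dens kap _ K); apply/funext => L; rewrite multE shE.
have C0 : 0 <= (34 + 8 * kap * b ^+ 2) * eta ^+ 2.
  apply: mulr_ge0; last exact: sqr_ge0.
  by apply: addr_ge0 => //; apply: mulr_ge0; [rewrite mulr_ge0|exact: sqr_ge0].
apply: (@le_trans _ _ (\sum_(K <- S) (34 + 8 * kap * b ^+ 2) * eta ^+ 2 *
    (dens kap f (K - s) + \sum_(e <- directions) f (K - s - e) ^+ 2))).
  by apply: ler_sum => K _; rewrite E; exact: (dens_mult _ k0 b01 ss (rK K) (rD K)).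
rewrite -mulr_sumr [3 * _]mulrC -[X in _ <= X]mulrA ler_wpM2l//.
rewrite (eq_bigr (fun K => dens kap f (K - s) + (f (K - s - zv 1 0) ^+ 2 + f (K - s - zv 0 1) ^+ 2))).
  have F s' : \sum_(K <- S) dens kap f (K - s') <= N kap f.
    by rewrite -(big_map (fun K => K - s') xpredT (dens kap f)) sum_dens_le// uniq_shift.
  have G K : f K ^+ 2 <= dens kap f K by exact: sqr_le_dens.
  move: (dens kap f) F G => D F G; rewrite !big_split/= (_ : 3 * _ = N kap f + (N kap f + N kap f)); last by ring.
  apply: lerD; [exact: F|apply: lerD].
    apply: le_trans (F (s + zv 1 0)); apply: ler_sum => K _.
    by rewrite opprD addrA.
  apply: le_trans (F (s + zv 0 1)); apply: ler_sum => K _.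
  by rewrite opprD addrA.
by move=> K _; rewrite /directions !big_cons big_nil addr0.
Qed.

(** Derivatives cost at most M on frequencies with |K|^2 <= M. The bound is crude, but it starts
    from the l^2 norm alone, the only norm known to be finite for a solution at positive times. *)
Lemma N_le_weight (kap M : R) f : 0 <= kap -> 0 <= M ->
  (forall K, f K != 0 -> kx1 K ^+ 2 + kx2 K ^+ 2 + kx3 K ^+ 2 + kx4 K ^+ 2
     + ky1 K ^+ 2 + ky2 K ^+ 2 <= M) ->
  N kap f <= (1 + (26 + 4 * kap) * M) * ip f f.
Proof.
move=> k0 M0 fM; have [s us fs] := finite_seq_support f.
have Bm (rho : Z6 -> R) c : 0 <= c -> (forall K, f K != 0 -> rho K ^+ 2 <= c) ->
    ip (mult rho f) (mult rho f) <= c * ip f f.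
  move=> c0 rc; rewrite (ip_finE _ us fs) (ip_finE _ us) => [|K Ks]; last first.
    by rewrite multE fs ?mulr0.
  rewrite mulr_sumr ler_sum// => K _; rewrite multE.
  have -> : rho K * f K * (rho K * f K) = rho K ^+ 2 * f K ^+ 2 by ring.
  have [->|fK] := eqVneq (f K) 0; first by rewrite expr0n !mulr0.
  by rewrite -expr2 ler_wpM2r ?sqr_ge0 ?rc.
have D x y : ip (x + y : V) (x + y) <= 2 * ip x x + 2 * ip y y.
  by have := ip_ge0 (x - y); rewrite !ipE (ipC y x); lra.
have De e m : ip (mult m f - sh e (mult m f)) (mult m f - sh e (mult m f)) <= 4 * ip (mult m f) (mult m f).
  by have := D (mult m f) (- sh e (mult m f)); rewrite ipNl ipNr opprK ip_sh; lra.
have q0 (K : Z6) (m : Z6 -> R) : 0 <= m K ^+ 2 by exact: sqr_ge0.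
have B (m : Z6 -> R) : (forall K, m K ^+ 2 <= kx1 K ^+ 2 + kx2 K ^+ 2 + kx3 K ^+ 2 + kx4 K ^+ 2
     + ky1 K ^+ 2 + ky2 K ^+ 2) -> ip (mult m f) (mult m f) <= M * ip f f.
  by move=> mi; apply: Bm => // K fK; apply: le_trans (fM K fK).
have [[b1 b2 b3] [b4 b5 b6]] : [/\ ip (P1 f) (P1 f) <= M * ip f f, ip (P2 f) (P2 f) <= M * ip f f &
    ip (P3 f) (P3 f) <= M * ip f f] /\ [/\ ip (P4 f) (P4 f) <= M * ip f f,
    ip (mult ky1 f) (mult ky1 f) <= M * ip f f & ip (mult ky2 f) (mult ky2 f) <= M * ip f f].
  do 2 split; apply: B => K; have := q0 K kx1; have := q0 K kx2; have := q0 K kx3;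
  have := q0 K kx4; have := q0 K ky1; have := q0 K ky2; lra.
have Hp : kap * pf f <= kap * (4 * (M * ip f f)).
  apply: ler_wpM2l => //; rewrite /pf /sumsq !big_cons big_nil addr0.
  by move: b1 b2 b3 b4; lra.
have s1 := De (zv 1 0) kx3; have s2 := De (zv 1 0) kx4.
have s3 := De (zv 0 1) kx3; have s4 := De (zv 0 1) kx4.
have t1 := D (P1 f) (P3 f); have t2 := D (P2 f) (P4 f).
rewrite /N /qf /sumsq !big_cons !big_nil !addr0.
have -> : (1 + (26 + 4 * kap) * M) * ip f f = ip f f + 26 * (M * ip f f) + kap * (4 * (M * ip f f)).
  by ring.
by move: Hp s1 s2 s3 s4 t1 t2 b1 b2 b3 b4 b5 b6; lra.
Qed.

(** Eight frequencies, each bounded through [nrm_ell_le]. The converse [N_le_w] rests on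
    [coercive_six], whence its six terms with 19^2. *)
Lemma w_le_N kap f : 0 <= kap -> w f <= 8 * cL ^+ 2 * N kap f.
Proof.
move=> k0; pose M := Num.sqrt (N kap f).
have NE := sqr_sqrtr (N_ge0 f k0).
have leM (g : V) : ip g g <= N kap f -> nrm g <= M by exact: ler_wsqrtr.
have c0 : 0 <= \sum_(e <- directions) \sum_(m <- momenta)
      ip (mult m f - sh e (mult m f)) (mult m f - sh e (mult m f)).
  by apply: sumr_ge0 => e _; apply: sumr_ge0 => m _; exact: ip_ge0.
have kp : 0 <= kap * pf f by rewrite mulr_ge0// pf_ge0.
have i0 := @ip_ge0 R; have q0 := qf_ge0 f.
have L2 n : n \in level1 ++ level2 ++ level3 -> ip (L n f) (L n f) <= cL ^+ 2 * N kap f.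
  move=> nB; rewrite -sqr_nrm -[N kap f]NE -exprMn ler_pXn2r ?nnegrE ?nrm_ge0//; last first.
    by rewrite mulr_ge0 ?sqrtr_ge0// (le_trans _ (@cL_ge1 R)).
  rewrite nrm_L.
  apply: le_trans (@nrm_ell_le R M _ _ _ _ _ _ _ _ _ _ _) _.
  - by apply: leM; rewrite /N; have := i0 (P2 f + P4 f); have := i0 f; lra.
  - by apply: leM; rewrite /N; have := i0 (P1 f + P3 f); have := i0 f; lra.
  all: try (apply: leM; rewrite /N /first_difference /Sz !big_cons !big_nil !addr0;
    have := i0 (P1 f + P3 f); have := i0 (P2 f + P4 f); have := i0 f;
    have := i0 (P3 f - sh (zv 1 0) (P3 f)); have := i0 (P3 f - sh (zv 0 1) (P3 f));
    have := i0 (P4 f - sh (zv 1 0) (P4 f)); have := i0 (P4 f - sh (zv 0 1) (P4 f)); lra).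
  rewrite ler_wpM2r ?sqrtr_ge0// cLE.
  have [n1 n2] : `|n.1| <= 3 /\ `|n.2| <= 3.
    by move: nB; rewrite !inE; do ![case/orP]; move=> /eqP ->.
  have a1 : (`|n.1|%:~R : R) <= 3 by rewrite (ler_int R `|n.1| 3).
  have a2 : (`|n.2|%:~R : R) <= 3 by rewrite (ler_int R `|n.2| 3).
  have p1 : 0 <= (`|n.1|%:~R : R) by rewrite ler0z.
  have p2 : 0 <= (`|n.2|%:~R : R) by rewrite ler0z.
  apply: (@le_trans _ _ (6 * 7)); last by lra.
  by apply: ler_pM; lra.
rewrite /w /vlev !big_cons !big_nil !addr0.
have e1 := L2 (1, 0) isT; have e2 := L2 (0, 1) isT; have e3 := L2 (1, 1) isT.
have e4 := L2 (1, -1) isT; have e5 := L2 (2, 1) isT; have e6 := L2 (2, -1) isT.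
have e7 := L2 (1, 2) isT; have e8 := L2 (1, -2) isT.
rewrite -[8 * _ * _]mulrA; move: e1 e2 e3 e4 e5 e6 e7 e8; move: (cL ^+ 2 * _) => X *.
by lra.
Qed.

Lemma N_le_w kap f : 0 <= kap ->
  N kap f <= ip f f + qf f + kap * pf f + 6 * (19 * 19) * w f.
Proof.
move=> k0; have [[a1 a2 a3] [a4 a5 a6]] := coercive_six f.
have H (g : V) : nrm g <= 19 * Num.sqrt (w f) -> ip g g <= 19 * 19 * w f.
  move=> gw; rewrite -sqr_nrm -[w f](sqr_sqrtr (w_ge0 f)) -expr2 -exprMn.
  by rewrite ler_pXn2r ?nnegrE ?nrm_ge0 ?mulr_ge0 ?sqrtr_ge0.
have := H _ a1; have := H _ a2; have := H _ a3; have := H _ a4; have := H _ a5; have := H _ a6.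
rewrite /N /first_difference /Sz !big_cons !big_nil !addr0.
by rewrite -[6 * _ * _]mulrA; move: (19 * 19 * w f) => X *; lra.
Qed.

End Density.

(** * Logarithmically slow cutoffs in frequency *)

Section Cutoffs.
Variable R : realType.
Implicit Types (x y : R) (s e K : Z6).

Definition pos x : R := Num.max x 0.
(** A quadratic spline rising from 0 at x = 0 to 1 at x = 1, with Lipschitz derivative [dchi]. A
    merely Lipschitz profile would not do: the weighted norm takes a difference of a commutator
    multiplier that already contains a difference of the cutoff. *)
Definition chi x : R := 2 * pos x ^+ 2 - 4 * pos (x - 1 / 2) ^+ 2 + 2 * pos (x - 1) ^+ 2.
Definition dchi x : R := 4 * pos x - 8 * pos (x - 1 / 2) + 4 * pos (x - 1).

Let posP x : (x <= 0 /\ pos x = 0) \/ (0 <= x /\ pos x = x).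
Proof.
rewrite /pos; have [x0|x0] := leP x 0; [left|right]; split=> //; exact: ltW.
Qed.

Lemma pos_sqr_taylor x y :
  0 <= pos x ^+ 2 - pos y ^+ 2 - 2 * pos y * (x - y) <= (x - y) ^+ 2.
Proof.
have h0 := sqr_ge0 (x - y); have h1 := sqr_ge0 x; have h2 := sqr_ge0 y.
case: (posP x) => -[x0 ->]; case: (posP y) => -[y0 ->]; apply/andP; split;
rewrite !expr2 in h0 h1 h2 *; rewrite ?mulr0 ?mul0r;
try (have h3 := mulr_le0_ge0 x0 y0); try (have h4 := mulr_ge0_le0 x0 y0); nra.
Qed.

Lemma pos_lip x y : `|pos x - pos y| <= `|x - y|.
Proof.
have H a b : a <= b -> `|pos a - pos b| <= `|a - b|.
  move=> ab; rewrite distrC [leRHS]distrC.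
  case: (posP a) => -[x0 ->]; case: (posP b) => -[y0 ->];
  rewrite !ger0_norm ?subr_ge0//; lra.
have [/H//|/ltW/H] := leP x y; by rewrite distrC [leRHS]distrC.
Qed.

Lemma chi_taylor x y : `|chi x - chi y - dchi y * (x - y)| <= 8 * (x - y) ^+ 2.
Proof.
have /andP[a1 a2] := pos_sqr_taylor x y.
have /andP[b1 b2] := pos_sqr_taylor (x - 1 / 2) (y - 1 / 2).
have /andP[c1 c2] := pos_sqr_taylor (x - 1) (y - 1).
move: b1 b2 c1 c2; rewrite (_ : x - 1 / 2 - (y - 1 / 2) = x - y); last by ring.
rewrite (_ : x - 1 - (y - 1) = x - y); last by ring.
rewrite /chi /dchi ler_norml => b1 b2 c1 c2; apply/andP.
by move: a1 a2 b1 b2 c1 c2; split; lra.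
Qed.

Lemma dchi_bound x : `|dchi x| <= 2.
Proof.
rewrite /dchi ler_norml; case: (posP x) => -[x0 ->];
case: (posP (x - 1 / 2)) => -[y0 ->]; case: (posP (x - 1)) => -[z0 ->];
apply/andP; split; lra.
Qed.

Lemma dchi_lip x y : `|dchi x - dchi y| <= 16 * `|x - y|.
Proof.
have a := pos_lip x y; have b := pos_lip (x - 1 / 2) (y - 1 / 2).
have c := pos_lip (x - 1) (y - 1).
move: a b c; rewrite (_ : x - 1 / 2 - (y - 1 / 2) = x - y); last by ring.
rewrite (_ : x - 1 - (y - 1) = x - y); last by ring.
rewrite /dchi; move: (pos _) (pos (y - 1 / 2)) (pos (y - 1)) (pos x) (pos (x - 1 / 2)) (pos (x - 1)).
move=> y1 y2 y3 x1 x2 x3; move: `|x - y| => d; rewrite !ler_norml.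
by move=> /andP[? ?] /andP[? ?] /andP[? ?]; apply/andP; split; lra.
Qed.

Lemma chi_bounds x : 0 <= chi x <= 1.
Proof.
rewrite /chi; case: (posP x) => -[x0 ->];
case: (posP (x - 1 / 2)) => -[y0 ->]; case: (posP (x - 1)) => -[z0 ->];
have h1 := sqr_ge0 x; have h2 := sqr_ge0 (1 - x); apply/andP; split;
rewrite !expr2 in h1 h2 *; try lra; nra.
Qed.

Lemma chi_eq0 x : x <= 0 -> chi x = 0.
Proof.
move=> x0; have E y : y <= 0 -> pos y = 0.
  by move=> y0; case: (posP y) => -[h ->] //; apply/le_anti; rewrite y0 h.
by rewrite /chi !E//; [ring|lra|lra].
Qed.

Lemma chi_eq1 x : 1 <= x -> chi x = 1.
Proof.
move=> x1; have E y : 0 <= y -> pos y = y.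
  by move=> y0; case: (posP y) => -[h ->] //; apply/le_anti; rewrite y0 h.
by rewrite /chi !E; [field|lra|lra|lra].
Qed.

Lemma chi_diff x y : `|chi x - chi y| <= 2 * `|x - y| + 8 * (x - y) ^+ 2.
Proof.
have -> : chi x - chi y = dchi y * (x - y) + (chi x - chi y - dchi y * (x - y)) by ring.
apply: le_trans (ler_normD _ _) _; apply: lerD; last exact: chi_taylor.
by rewrite normrM ler_wpM2r// dchi_bound.
Qed.

(** Split into the linear part at b, the change of slope between b and d, and two Taylor remainders;
    all but the linear part are of second order in the increments. *)
Lemma chi_diff2 (a b c d : R) : `|chi a - chi b - chi c + chi d| <=
  2 * `|a - b - c + d| + 16 * (`|b - d| * `|c - d|) + (8 * (a - b) ^+ 2 + 8 * (c - d) ^+ 2).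
Proof.
have -> : chi a - chi b - chi c + chi d = dchi b * (a - b - c + d) + (dchi b - dchi d) * (c - d)
   + ((chi a - chi b - dchi b * (a - b)) - (chi c - chi d - dchi d * (c - d))) by ring.
apply: le_trans (ler_normD _ _) _; apply: lerD; last first.
  by apply: le_trans (ler_normB _ _) _; apply: lerD; exact: chi_taylor.
apply: le_trans (ler_normD _ _) _; apply: lerD; rewrite normrM.
  by rewrite ler_wpM2r// dchi_bound.
by rewrite mulrA ler_wpM2r// dchi_lip.
Qed.

Lemma ln_diff x y : 0 < x -> 0 < y -> `|ln x - ln y| <= `|x - y| * (y^-1 + x^-1).
Proof.
have H a b : 0 < a -> 0 < b -> ln a - ln b <= `|a - b| * (b^-1 + a^-1).
  move=> a0 b0; rewrite -ln_div ?posrE//.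
  have -> : a / b = 1 + (a - b) / b by field; rewrite lt0r_neq0.
  apply: (@le_trans _ _ ((a - b) / b)).
    apply: le_ln1Dx; rewrite mulrBl divff ?lt0r_neq0//.
    have : 0 < a / b by exact: divr_gt0.
    by lra.
  rewrite mulrDr -[leLHS]addr0 lerD ?mulr_ge0 ?invr_ge0 ?(ltW a0)//.
  by rewrite ler_wpM2r ?invr_ge0 ?(ltW b0)// ler_norm.
move=> x0 y0; rewrite ler_norml lerNl opprB H//= distrC [y^-1 + _]addrC.
by rewrite H.
Qed.

Definition dotp K s : R := kx1 K * kx1 s + kx2 K * kx2 s + kx3 K * kx3 s + kx4 K * kx4 s
  + ky1 K * ky1 s + ky2 K * ky2 s.
(** This is 1 + |K|^2; its root [nvp] bounds every single frequency and is at least 1. *)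
Definition vpi K : R := 1 + dotp K K.

Lemma dotp_ge0 K : 0 <= dotp K K.
Proof. by rewrite /dotp -!expr2 !addr_ge0 ?sqr_ge0. Qed.

Lemma vpi_ge1 K : 1 <= vpi K. Proof. by rewrite lerDl dotp_ge0. Qed.
Lemma vpi_gt0 K : 0 < vpi K. Proof. exact: lt_le_trans (vpi_ge1 K). Qed.

Lemma dotpBl K K' s : dotp (K - K') s = dotp K s - dotp K' s.
Proof.
rewrite /dotp (additive_formB _ _ (@kx1D R)) (additive_formB _ _ (@kx2D R)).
rewrite (additive_formB _ _ (@kx3D R)) (additive_formB _ _ (@kx4D R)).
by rewrite (additive_formB _ _ (@ky1D R)) (additive_formB _ _ (@ky2D R)); ring.
Qed.
Lemma dotpC K s : dotp K s = dotp s K. Proof. by rewrite /dotp; ring. Qed.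

Definition nvp K : R := Num.sqrt (vpi K).
Lemma sqr_nvp K : nvp K ^+ 2 = vpi K. Proof. by rewrite sqr_sqrtr// ltW// vpi_gt0. Qed.
Lemma nvp_ge1 K : 1 <= nvp K.
Proof. by rewrite -[leLHS]sqrtr1 ler_wsqrtr// vpi_ge1. Qed.
Lemma nvp_gt0 K : 0 < nvp K. Proof. exact: lt_le_trans (nvp_ge1 K). Qed.

Lemma coord_le_nvp K : [&& `|kx1 K| <= nvp K, `|kx2 K| <= nvp K, `|kx3 K| <= nvp K,
  `|kx4 K| <= nvp K, `|ky1 K| <= nvp K & `|ky2 K| <= nvp K].
Proof.
have H (m : Z6 -> R) : m K ^+ 2 <= vpi K -> `|m K| <= nvp K.
  by move=> h; rewrite -sqrtr_sqr ler_wsqrtr.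
have q (m : Z6 -> R) : 0 <= m K ^+ 2 by exact: sqr_ge0.
have := q kx1; have := q kx2; have := q kx3; have := q kx4; have := q ky1; have := q ky2.
move=> *; apply/and5P; split; [..|apply/andP; split]; apply: H; rewrite /vpi /dotp -!expr2; lra.
Qed.

Lemma dotp_small K s : small_shift (1 : R) s -> `|dotp K s| <= 6 * nvp K.
Proof.
move=> /and5P[s1 s2 s3 s4 /andP[s5 s6]]; have := coord_le_nvp K.
move=> /and5P[k1 k2 k3 k4 /andP[k5 k6]].
have H x y : `|x| <= nvp K -> `|y| <= 1 -> `|x * y| <= nvp K.
  by move=> xn y1; rewrite normrM -[leRHS]mulr1 ler_pM.
rewrite (_ : 6 * nvp K = nvp K + nvp K + nvp K + nvp K + nvp K + nvp K); last by ring.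
rewrite /dotp; do 5 (apply: le_trans (ler_normD _ _) _; apply: lerD; last exact: H).
exact: H.
Qed.

Lemma dotp_small2 s : small_shift (1 : R) s -> dotp s s <= 6.
Proof.
move=> /and5P[s1 s2 s3 s4 /andP[s5 s6]].
have H x : `|x| <= 1 -> x * x <= 1.
  by move=> x1; rewrite -expr2 -(real_normK (num_real x)) exprn_ile1.
rewrite /dotp; have := H _ s1; have := H _ s2; have := H _ s3; have := H _ s4; have := H _ s5.
by have := H _ s6; lra.
Qed.

Lemma vpiB K s : vpi (K - s) = vpi K - 2 * dotp K s + dotp s s.
Proof. by rewrite /vpi dotpBl dotpC [dotp s (K - s)]dotpC !dotpBl (dotpC s K); ring. Qed.

Lemma vpi_diff K s : small_shift (1 : R) s -> `|vpi (K - s) - vpi K| <= 18 * nvp K.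
Proof.
move=> ss; rewrite vpiB; have := dotp_small K ss; have := dotp_small2 ss; have := dotp_ge0 s.
have := nvp_ge1 K; rewrite !ler_norml => h1 h2 h3 /andP[h4 h5]; apply/andP; split; lra.
Qed.

Lemma small_shiftN b s : small_shift b (- s) = @small_shift R b s.
Proof. by rewrite /small_shift /kx1 /kx2 /kx3 /kx4 /ky1 /ky2 /= !intrN !normrN. Qed.

Lemma vpi_le K s : small_shift (1 : R) s -> vpi (K - s) <= 13 * vpi K.
Proof.
move=> ss; have := dotp_small2 ss; have := vpi_ge1 K.
have : 0 <= dotp (K + s) (K + s) by exact: dotp_ge0.
have -> : dotp (K + s) (K + s) = dotp K K + 2 * dotp K s + dotp s s.
  by rewrite /dotp (@kx1D R) (@kx2D R) (@kx3D R) (@kx4D R) (@ky1D R) (@ky2D R); ring.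
by rewrite vpiB /vpi; lra.
Qed.

Lemma vpi_ge K s : small_shift (1 : R) s -> vpi K <= 13 * vpi (K - s).
Proof.
move=> ss; rewrite -[K in X in X <= _](subrK s) -[X in _ + X]opprK.
by apply: vpi_le; rewrite small_shiftN.
Qed.

Lemma nvp_shift K s : small_shift (1 : R) s -> nvp (K - s) <= 4 * nvp K /\ nvp K <= 4 * nvp (K - s).
Proof.
have H (a b : R) : 0 < a -> 0 < b -> a <= 13 * b -> Num.sqrt a <= 4 * Num.sqrt b.
  move=> a0 b0 ab; rewrite -(@ler_pXn2r _ 2) ?nnegrE ?mulr_ge0 ?sqrtr_ge0//.
  by rewrite exprMn !sqr_sqrtr ?(ltW a0) ?(ltW b0)//; lra.
by move=> ss; split; apply: H; rewrite ?vpi_gt0 ?vpi_le ?vpi_ge.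
Qed.

Lemma ln_vpi_diff K s : small_shift (1 : R) s ->
  `|ln (vpi K) - ln (vpi (K - s))| <= 18 * 14 / nvp K.
Proof.
move=> ss; have p0 := vpi_gt0 K; have p1 := vpi_gt0 (K - s); have n0 := nvp_gt0 K.
apply: le_trans (ln_diff p0 p1) _.
apply: (@le_trans _ _ (18 * nvp K * (14 / vpi K))); last first.
  by rewrite -sqr_nvp le_eqVlt; apply/orP; left; apply/eqP; field; rewrite lt0r_neq0.
apply: ler_pM => //; first by rewrite addr_ge0 ?invr_ge0 ?(ltW p0) ?(ltW p1).
  by rewrite distrC vpi_diff.
rewrite (_ : 14 / vpi K = 13 / vpi K + (vpi K)^-1); last by field; rewrite lt0r_neq0.
rewrite lerD2r ler_pdivlMr// mulrC ler_pdivrMr// vpi_ge//.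
Qed.

(** The combination is the logarithm of a quotient of products. Numerator and denominator differ by
    2 vpi K <s, e> minus a product of two first differences, each O(nvp K), hence by O(vpi K),
    against a size of order (vpi K)^2. *)
Lemma ln_vpi_diff2 K s e : small_shift (1 : R) s -> small_shift (1 : R) e ->
  `|ln (vpi K) - ln (vpi (K - s)) - ln (vpi (K - e)) + ln (vpi (K - s - e))|
    <= 336 * 338 / vpi K.
Proof.
move=> ss se; have p0 := vpi_gt0 K; have p1 := vpi_gt0 (K - s).
have p2 := vpi_gt0 (K - e); have p3 := vpi_gt0 (K - s - e).
have -> : ln (vpi K) - ln (vpi (K - s)) - ln (vpi (K - e)) + ln (vpi (K - s - e)) =
    ln (vpi K * vpi (K - s - e)) - ln (vpi (K - s) * vpi (K - e)).
  by rewrite !lnM ?posrE//; ring.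
apply: le_trans (ln_diff (mulr_gt0 p0 p3) (mulr_gt0 p1 p2)) _.
have E : vpi K * vpi (K - s - e) - vpi (K - s) * vpi (K - e) = 2 * vpi K * dotp s e
    - (vpi (K - s) - vpi K) * (vpi (K - e) - vpi K).
  by rewrite (vpiB (K - s) e) (vpiB K s) (vpiB K e) dotpBl; ring.
have se6 : `|dotp s e| <= 6.
  move: (ss) (se) => /and5P[s1 s2 s3 s4 /andP[s5 s6]] /and5P[e1 e2 e3 e4 /andP[e5 e6]].
  have H x y : `|x| <= 1 -> `|y| <= 1 -> `|x * y| <= 1 :> R.
    by move=> x1 y1; rewrite normrM mulr_ile1.
  rewrite (_ : 6 = 1 + 1 + 1 + 1 + 1 + 1); last by ring.
  rewrite /dotp; do 5 (apply: le_trans (ler_normD _ _) _; apply: lerD; last exact: H).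
  exact: H.
have A : `|vpi K * vpi (K - s - e) - vpi (K - s) * vpi (K - e)| <= 336 * vpi K.
  rewrite E; apply: le_trans (ler_normB _ _) _.
  rewrite (_ : 336 * vpi K = 2 * vpi K * 6 + (18 * nvp K) * (18 * nvp K)); last first.
    by rewrite -sqr_nvp; ring.
  apply: lerD; rewrite normrM; last by apply: ler_pM => //; exact: vpi_diff.
  by rewrite ger0_norm ?ler_wpM2l// mulr_ge0// ltW.
have i1 : (vpi (K - s) * vpi (K - e))^-1 <= 169 / vpi K ^+ 2.
  rewrite ler_pdivlMr ?exprn_gt0// mulrC ler_pdivrMr ?mulr_gt0//.
  rewrite (_ : 169 * _ = (13 * vpi (K - s)) * (13 * vpi (K - e))); last by ring.
  by rewrite expr2 ler_pM ?(ltW p0)// vpi_ge.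
have i2 : (vpi K * vpi (K - s - e))^-1 <= 169 / vpi K ^+ 2.
  rewrite ler_pdivlMr ?exprn_gt0// mulrC ler_pdivrMr ?mulr_gt0//.
  rewrite (_ : 169 * _ = vpi K * (13 * (13 * vpi (K - s - e)))); last by ring.
  rewrite expr2 ler_wpM2l ?(ltW p0)//; apply: le_trans (vpi_ge K ss) _.
  by rewrite ler_wpM2l// vpi_ge.
apply: (@le_trans _ _ ((336 * vpi K) * (169 / vpi K ^+ 2 + 169 / vpi K ^+ 2))).
  apply: ler_pM => //; last exact: lerD.
  by rewrite addr_ge0// invr_ge0 ltW// mulr_gt0.
by rewrite le_eqVlt; apply/orP; left; apply/eqP; field; rewrite lt0r_neq0.
Qed.

Section Theta.
Variables (J W : R).
Hypothesis W1 : 1 <= W.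

(** Equal to 1 where ln (1 + |K|^2) <= J and to 0 beyond J + W. In the logarithmic variable the
    transition has length W, so a difference of the cutoff times |K| is O(1/W), instead of O(1) for
    a transition over a fixed ratio. *)
Definition theta K : R := chi ((J + W - ln (vpi K)) / W).

Lemma theta_bounds K : 0 <= theta K <= 1. Proof. exact: chi_bounds. Qed.
Lemma norm_theta K : `|theta K| <= 1.
Proof. by have /andP[? ?] := theta_bounds K; rewrite ger0_norm. Qed.

Lemma theta_eq1 K : ln (vpi K) <= J -> theta K = 1.
Proof.
move=> KJ; apply: chi_eq1; rewrite ler_pdivlMr; last by apply: lt_le_trans W1.
by rewrite mul1r; lra.
Qed.

Lemma theta_neq0 K : theta K != 0 -> ln (vpi K) < J + W.
Proof.
apply: contraNT; rewrite -leNgt => h; apply/eqP/chi_eq0.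
by rewrite pmulr_lle0 ?invr_gt0 ?(lt_le_trans _ W1)//; lra.
Qed.

Lemma theta_neq0_vpi K : theta K != 0 -> vpi K <= expR (J + W).
Proof. by move=> /theta_neq0/ltW; rewrite -ler_expR lnK ?posrE ?vpi_gt0. Qed.

End Theta.

Lemma theta_differences : exists2 c : R, 1 <= c & forall J W K s e, 1 <= W ->
  small_shift (1 : R) s -> small_shift (1 : R) e ->
  `|theta J W K - theta J W (K - s)| * nvp K <= c / W /\
  `|theta J W K - theta J W (K - s) - theta J W (K - e) + theta J W (K - s - e)| * vpi K <= c / W.
Proof.
have [c1 [c10 H1]] : exists c1 : R, 1 <= c1 /\ forall K s, small_shift (1 : R) s ->
    `|ln (vpi K) - ln (vpi (K - s))| <= c1 / nvp K.
  by exists (18 * 14); split; [lra|exact: ln_vpi_diff].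
have [c2 [c20 H2]] : exists c2 : R, 1 <= c2 /\ forall K s e, small_shift (1 : R) s -> small_shift (1 : R) e ->
    `|ln (vpi K) - ln (vpi (K - s)) - ln (vpi (K - e)) + ln (vpi (K - s - e))| <= c2 / vpi K.
  by exists (336 * 338); split; [lra|exact: ln_vpi_diff2].
exists (2 * c2 + 2 * c1 + 400 * c1 ^+ 2).
  by have := sqr_ge0 c1; lra.
move=> J W K s e W1 ss se.
have W0 : 0 < W by apply: lt_le_trans W1.
have n0 := nvp_gt0 K; have n1 := nvp_ge1 K; have p0 := vpi_gt0 K.
have WV1 : W^-1 <= 1 by rewrite invf_le1.
have WV0 : 0 < W^-1 by rewrite invr_gt0.
pose phi L := (J + W - ln (vpi L)) / W.
pose d := c1 / nvp K / W.
have d0 : 0 <= d by rewrite !divr_ge0 ?ltW//; lra.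
have sqr_le x y : `|x| <= y -> x ^+ 2 <= y ^+ 2 :> R.
  by move=> xy; rewrite -(real_normK (num_real x)) ler_pXn2r// nnegrE (le_trans _ xy).
have E1 L t : small_shift (1 : R) t -> `|phi L - phi (L - t)| <= c1 / nvp L / W.
  move=> st; rewrite /phi -mulrBl normrM [`|W^-1|]ger0_norm ?(ltW WV0)//.
  rewrite ler_wpM2r ?(ltW WV0)//; apply: le_trans (H1 L t st).
  by rewrite -normrN le_eqVlt; apply/orP; left; apply/eqP; congr (`|_|); ring.
have E4 t : small_shift (1 : R) t -> c1 / nvp (K - t) / W <= 4 * d.
  move=> st; rewrite /d !mulrA ler_wpM2r ?(ltW WV0)//.
  rewrite ler_pdivlMr// mulrAC ler_pdivrMr ?nvp_gt0// [4 * _]mulrC -mulrA.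
  by rewrite ler_wpM2l ?(le_trans _ c10)//; have [] := nvp_shift K st.
have A1 : `|phi K - phi (K - s)| <= d by exact: E1.
have A2 : `|phi (K - e) - phi (K - s - e)| <= 4 * d.
  by apply: le_trans (E4 _ se); rewrite (addrAC K); exact: E1.
have A3 : `|phi (K - s) - phi (K - s - e)| <= 4 * d by apply: le_trans (E4 _ ss); exact: E1.
have A4 : `|phi K - phi (K - s) - phi (K - e) + phi (K - s - e)| <= c2 / vpi K / W.
  have -> : phi K - phi (K - s) - phi (K - e) + phi (K - s - e) = - (ln (vpi K) - ln (vpi (K - s))
      - ln (vpi (K - e)) + ln (vpi (K - s - e))) / W by rewrite /phi; ring.
  rewrite normrM normrN [`|W^-1|]ger0_norm ?(ltW WV0)//.
  by rewrite ler_wpM2r ?(ltW WV0)//; exact: H2.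
have dn : d * nvp K = c1 / W by rewrite /d; field; rewrite !lt0r_neq0.
have c1W : 0 <= c1 / W by rewrite divr_ge0 ?ltW//; lra.
have dp : d ^+ 2 * vpi K <= c1 ^+ 2 / W.
  rewrite -sqr_nvp -exprMn dn expr_div_n ler_wpM2l ?sqr_ge0//.
  by rewrite expr2 invfM ler_piMr// ltW.
have dnn : d ^+ 2 * nvp K <= d ^+ 2 * vpi K.
  by rewrite ler_wpM2l ?sqr_ge0// -sqr_nvp expr2 ler_peMr// ltW.
have c2W : 0 <= c2 / W by rewrite divr_ge0 ?ltW//; lra.
have c12W : 0 <= c1 ^+ 2 / W by rewrite divr_ge0 ?sqr_ge0 ?ltW//; lra.
have EC : (2 * c2 + 2 * c1 + 400 * c1 ^+ 2) / W = 2 * (c2 / W) + 2 * (c1 / W) + 400 * (c1 ^+ 2 / W).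
  by field; rewrite lt0r_neq0.
rewrite EC; split.
  have h : `|theta J W K - theta J W (K - s)| <= 2 * d + 8 * d ^+ 2.
    apply: le_trans (chi_diff _ _) _; apply: lerD; apply: ler_wpM2l => //.
    exact: sqr_le.
  apply: (@le_trans _ _ ((2 * d + 8 * d ^+ 2) * nvp K)); first by rewrite ler_wpM2r// ltW.
  have -> : (2 * d + 8 * d ^+ 2) * nvp K = 2 * (d * nvp K) + 8 * (d ^+ 2 * nvp K) by ring.
  rewrite dn; move: dnn dp c2W c12W c1W.
  move: (d ^+ 2 * nvp K) (d ^+ 2 * vpi K) (c2 / W) (c1 / W) (c1 ^+ 2 / W) => *; lra.
have h : `|theta J W K - theta J W (K - s) - theta J W (K - e) + theta J W (K - s - e)| <=
    2 * (c2 / vpi K / W) + 16 * (4 * d * (4 * d)) + (8 * d ^+ 2 + 8 * (4 * d) ^+ 2).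
  apply: le_trans (chi_diff2 _ _ _ _) _; apply: lerD; [apply: lerD|apply: lerD];
    apply: ler_wpM2l => //; [exact: ler_pM|exact: sqr_le|exact: sqr_le].
apply: le_trans (_ : _ <= (2 * (c2 / vpi K / W) + 16 * (4 * d * (4 * d)) + (8 * d ^+ 2 + 8 * (4 * d) ^+ 2)) * vpi K) _.
  by rewrite ler_wpM2r// ltW.
have -> : (2 * (c2 / vpi K / W) + 16 * (4 * d * (4 * d)) + (8 * d ^+ 2 + 8 * (4 * d) ^+ 2)) * vpi K =
   2 * (c2 / W) + 392 * (d ^+ 2 * vpi K) by field; rewrite !lt0r_neq0.
move: dp c2W c12W c1W.
move: (d ^+ 2 * vpi K) (c2 / W) (c1 / W) (c1 ^+ 2 / W) => *; lra.
Qed.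

(** The commutator of the cutoff with a first order operator of shift s: the momentum grows like nvp
    and the difference of theta decays like 1 / (W nvp), so their product is O(1/W). A further
    difference, weighted by a momentum, needs the second differences of theta with the weight vpi
    from [theta_differences]. *)
Lemma commutator_multiplier : exists2 c : R, 1 <= c & forall J W (m : Z6 -> R) s, 1 <= W ->
  small_shift (1 : R) s -> additive_form m -> (forall K, `|m K| <= 2 * nvp K) ->
  (forall e, e \in directions -> `|m e| <= 2) ->
  forall rho : Z6 -> R, (forall K, rho K = m K * (theta J W K - theta J W (K - s))) ->
  (forall K, `|rho K| <= c / W) /\
  (forall K e, e \in directions -> `|kx3 (K - e)| * `|rho K - rho (K - e)| <= c / W /\
    `|kx4 (K - e)| * `|rho K - rho (K - e)| <= c / W).
Proof.
have [c c1 H] := theta_differences; exists (40 * c); first by lra.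
move=> J W m s W1 ss mD mK me rho rhoE; have W0 : 0 < W by apply: lt_le_trans W1.
have cW : 0 <= c / W by rewrite divr_ge0 ?ltW//; lra.
have EC : 40 * c / W = 40 * (c / W) by rewrite mulrA.
have sd e : e \in directions -> small_shift (1 : R) e.
  by rewrite !inE => /orP[] /eqP ->; rewrite /small_shift /kx1 /kx2 /kx3 /kx4 /ky1 /ky2/=;
  rewrite ?oppr0 ?intrN ?normrN ?normr0 ?normr1 ?lexx ?ler01.
split=> [K|K e eD].
  have [h _] := H J W K s s W1 ss ss; rewrite rhoE normrM EC.
  apply: (@le_trans _ _ (2 * nvp K * `|theta J W K - theta J W (K - s)|)).
    by rewrite ler_wpM2r.
  by rewrite -mulrA [nvp K * _]mulrC; lra.
have se := sd e eD; have [h1 h2] := H J W K s e W1 ss se.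
have n0 := nvp_gt0 K; have n0' := nvp_gt0 (K - e).
have [n4 _] := nvp_shift K se.
have E : rho K - rho (K - e) = m e * (theta J W K - theta J W (K - s)) +
    m (K - e) * (theta J W K - theta J W (K - s) - theta J W (K - e) + theta J W (K - s - e)).
  have -> : m e = m K - m (K - e) by rewrite (additive_formB _ _ mD); ring.
  by rewrite !rhoE (addrAC K (- e)); ring.
have B : `|rho K - rho (K - e)| <= 2 * `|theta J W K - theta J W (K - s)| + 8 * nvp K *
   `|theta J W K - theta J W (K - s) - theta J W (K - e) + theta J W (K - s - e)|.
  rewrite E; apply: le_trans (ler_normD _ _) _; rewrite !normrM.
  apply: lerD; rewrite ler_wpM2r// ?me//; apply: le_trans (mK _) _; move: n4; lra.
have G x : `|x| <= nvp (K - e) -> `|x| * `|rho K - rho (K - e)| <= 40 * c / W.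
  move=> xn; rewrite EC; apply: (@le_trans _ _ (4 * nvp K * (2 * `|theta J W K - theta J W (K - s)| + 8 * nvp K *
   `|theta J W K - theta J W (K - s) - theta J W (K - e) + theta J W (K - s - e)|))).
    by apply: ler_pM => //; apply: le_trans n4.
  move: h1 h2; rewrite -sqr_nvp; set X := `|_ - _|; set Y := `|_ + _| => h1 h2.
  have -> : 4 * nvp K * (2 * X + 8 * nvp K * Y) = 8 * (X * nvp K) + 32 * (Y * nvp K ^+ 2) by ring.
  by move: h1 h2 cW; move: (X * _) (Y * _) (c / W) => *; lra.
by have /and5P[_ _ ? ? _] := coord_le_nvp (K - e); split; apply: G.
Qed.

Lemma theta_multiplier : exists2 c : R, 1 <= c & forall J W, 1 <= W ->
  (forall K, `|theta J W K| <= c) /\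
  (forall K e, e \in directions -> `|kx3 (K - e)| * `|theta J W K - theta J W (K - e)| <= c /\
    `|kx4 (K - e)| * `|theta J W K - theta J W (K - e)| <= c).
Proof.
have [c c1 H] := theta_differences; exists (4 * c); first by lra.
move=> J W W1; have W0 : 0 < W by apply: lt_le_trans W1.
split=> [K|K e eD]; first by apply: le_trans (norm_theta J W K) _; lra.
have se : small_shift (1 : R) e.
  by move: eD; rewrite !inE => /orP[] /eqP ->; rewrite /small_shift /kx1 /kx2 /kx3 /kx4 /ky1 /ky2/=;
  rewrite ?oppr0 ?intrN ?normrN ?normr0 ?normr1 ?lexx ?ler01.
have [h1 _] := H J W K e e W1 se se; have [n4 _] := nvp_shift K se.
have cW : c / W <= c by rewrite ler_pdivrMr// ler_peMr//; lra.
have G x : `|x| <= nvp (K - e) -> `|x| * `|theta J W K - theta J W (K - e)| <= 4 * c.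
  move=> xn; apply: (@le_trans _ _ (4 * nvp K * `|theta J W K - theta J W (K - e)|)).
    by rewrite ler_wpM2r//; apply: le_trans n4.
  by rewrite -mulrA [nvp K * _]mulrC; lra.
by have /and5P[_ _ ? ? _] := coord_le_nvp (K - e); split; apply: G.
Qed.

Lemma ln_vpi_shift K s : small_shift (1 : R) s -> ln (vpi (K - s)) <= ln (vpi K) + 4.
Proof.
move=> ss; rewrite -[4](@expRK R) -lnM ?posrE ?expR_gt0 ?vpi_gt0//.
rewrite ler_ln ?posrE ?mulr_gt0 ?expR_gt0 ?vpi_gt0//.
apply: le_trans (vpi_le K ss) _; rewrite mulrC ler_wpM2l ?(ltW (vpi_gt0 K))//.
(* The constant 4 is explained by 13 <= 2^4 <= exp 4. *)
rewrite -[4]mulr1 expRM_natl; apply: (@le_trans _ _ (2 ^+ 4)); first by rewrite !exprS expr0; lra.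
by rewrite ler_pXn2r ?nnegrE ?expR_ge0//; have := expR_ge1Dx (1 : R); lra.
Qed.

Lemma finite_ball (M : R) : finite_set [set K : Z6 | vpi K <= M].
Proof.
have FI (B : R) : finite_set [set z : int | `|z%:~R| <= B].
  pose n := Num.truncn B.
  apply: (@sub_finite_set _ _ ((fun k : nat => k%:Z - n.+1%:Z) @` `I_(2 * n.+1).+1)).
    move=> z /= zB; have zn : `|z| <= n.+1%:Z.
      rewrite -(ler_int R) intr_norm; apply: le_trans zB _; apply: ltW.
      by have := truncnS_gt B.
    exists (absz (z + n.+1%:Z)) => /=; move: zn; lia.
  exact: finite_image (finite_II _).
have F2 (B : R) : finite_set [set z : int * int | `|z.1%:~R| <= B /\ `|z.2%:~R| <= B].
  exact: (finite_setX (FI B) (FI B)).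
pose B := Num.sqrt M.
apply: (@sub_finite_set _ _ (([set z : int * int | `|z.1%:~R| <= B /\ `|z.2%:~R| <= B] `*`
   [set z : int * int | `|z.1%:~R| <= B /\ `|z.2%:~R| <= B]) `*`
   [set z : int * int | `|z.1%:~R| <= B /\ `|z.2%:~R| <= B])).
  move=> K KM; have nB : nvp K <= B by exact: ler_wsqrtr.
  have /and5P[h1 h2 h3 h4 /andP[h5 h6]] := coord_le_nvp K.
  by split; [split|]; split; apply: le_trans nB.
by apply: finite_setX => //; apply: finite_setX.
Qed.

End Cutoffs.

(** * Finite sums and differential inequalities on the half line *)

Section RealFunctions.
Variable R : realType.

Lemma is_derive_seq (I : eqType) (S : seq I) (F : I -> R -> R) (dF : I -> R) (t : R) :
  (forall i, i \in S -> is_derive t 1 (F i) (dF i)) ->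
  is_derive t 1 (fun s => \sum_(i <- S) F i s) (\sum_(i <- S) dF i).
Proof.
elim: S => [|i S IH] H.
  rewrite big_nil (_ : (fun s => _) = cst 0); first exact: is_derive_cst.
  by apply/funext => s; rewrite big_nil.
rewrite big_cons (_ : (fun s => _) = F i + (fun s => \sum_(i <- S) F i s)); last first.
  by apply/funext => s; rewrite big_cons.
apply: is_deriveD; first by apply: H; rewrite mem_head.
by apply: IH => j jS; apply: H; rewrite inE jS orbT.
Qed.

Lemma cvg_seq (I : eqType) (S : seq I) (F : I -> R -> R) (l : I -> R) (G : set_system R) :
  Filter G -> (forall i, i \in S -> F i s @[s --> G] --> l i) ->
  (\sum_(i <- S) F i s) @[s --> G] --> \sum_(i <- S) l i.
Proof.
move=> FG; elim: S => [|i S IH] H.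
  rewrite big_nil (_ : (fun s => _) = cst 0); first exact: cvg_cst.
  by apply/funext => s; rewrite big_nil.
rewrite big_cons (_ : (fun s => _) = F i \+ (fun s => \sum_(i <- S) F i s)); last first.
  by apply/funext => s; rewrite big_cons.
apply: cvgD; first by apply: H; rewrite mem_head.
by apply: IH => j jS; apply: H; rewrite inE jS orbT.
Qed.

(** The mean value theorem for exp(- c s) Phi s. The factor t exp(|c| t) is crude, which is enough
    because eps tends to 0 in both uses. *)
Lemma gronwall (c eps t : R) (Phi dPhi : R -> R) : 0 <= t -> 0 <= eps ->
  (forall s : R, 0 < s -> is_derive s 1 Phi (dPhi s)) ->
  (forall s : R, 0 <= s -> Phi r @[r --> within [set r : R | 0 <= r] (nbhs s)] --> Phi s) ->
  (forall s : R, 0 < s < t -> dPhi s <= c * Phi s + eps) ->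
  Phi t <= expR (c * t) * (Phi 0 + eps * (t * expR (`|c| * t))).
Proof.
move=> t0 e0 dP cP dle; have [->|tn] := eqVneq t 0.
  by rewrite mulr0 expR0 mul0r mulr0 mul1r addr0.
have tp : 0 < t by rewrite lt_def tn.
pose H := (fun s : R => expR (- c * s) * Phi s).
have eE (s : R) : is_derive s 1 (fun s : R => expR (- c * s)) (- c * expR (- c * s)).
  have d1 : is_derive s 1 (fun s : R => - c * s) (- c).
    by apply: is_derive_eq (is_deriveZ (- c) (is_derive_id s 1)) _; rewrite /GRing.scale/= mulr1.
  by apply: is_derive_eq (is_derive1_comp (is_derive_expR (- c * s)) d1) _; rewrite mulrC.
have dH (s : R) : s \in `]0, t[ -> is_derive s 1 H (expR (- c * s) * (dPhi s - c * Phi s)).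
  rewrite in_itv/= => /andP[s0 st]; have dPs := dP s s0.
  have -> : H = (fun s : R => expR (- c * s)) * Phi by [].
  apply: is_derive_eq (is_deriveM (eE s) dPs) _.
  by rewrite /GRing.scale/=; ring.
have cH : {within `[0, t], continuous H}.
  apply: (@continuous_subspaceW R R _ [set s : R | 0 <= s] H).
    by move=> s /=; rewrite in_itv/= => /andP[].
  apply/subspace_continuousP => s s0; apply: cvgM; last exact: cP.
  have [/derivable1_diffP/differentiable_continuous dE _] := eE s.
  exact: cvg_within_filter dE.
have [x] := MVT tp dH cH; rewrite in_itv/= subr0 => /andP[x0 xt].
rewrite /H mulr0 expR0 mul1r => E.
have D : expR (- c * x) * (dPhi x - c * Phi x) <= expR (`|c| * t) * eps.
  apply: (@le_trans _ _ (expR (- c * x) * eps)).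
    by rewrite ler_wpM2l ?expR_ge0// lerBlDl dle// x0.
  rewrite ler_wpM2r// ler_expR; apply: (@le_trans _ _ (`|c| * x)).
    by rewrite ler_wpM2r ?(ltW x0)// -normrN ler_norm.
  by rewrite ler_wpM2l// ltW.
have : expR (- c * t) * Phi t <= Phi 0 + eps * (t * expR (`|c| * t)).
  rewrite -lerBlDl E (_ : eps * _ = expR (`|c| * t) * eps * t); last by ring.
  by rewrite ler_wpM2r.
by rewrite mulNr expRN mulrC ler_pdivrMr ?expR_gt0// mulrC.
Qed.

End RealFunctions.

(** * Decay of square summable solutions of the Fourier system *)

Section QuadraticEvolution.
Variable R : realType.
Notation V := (fseq R).
Implicit Types (f g h : V) (K : Z6) (ts : terms R).

Lemma hfs_delta K : has_finite_support (fun L : Z6 => (L == K)%:R : R).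
Proof.
apply: (@hfs_sub R [set K]); first exact: finite_set1.
by move=> L /eqP/negbTE ->.
Qed.
Definition delta K : V := Fseq (mk_fseq (hfs_delta K)).

Lemma delta_expand f (S : seq Z6) : uniq S -> (forall K, K \notin S -> f K = 0) ->
  f = \sum_(K <- S) f K *: delta K.
Proof.
move=> uS fS; apply: fseq_ext => L.
have E (X : seq Z6) : (\sum_(K <- X) f K *: delta K : V) L = \sum_(K <- X) f K * (L == K)%:R.
  elim: X => [|K X IH]; first by rewrite !big_nil.
  by rewrite !big_cons -IH.
rewrite E; have [LS|LS] := boolP (L \in S).
  rewrite (bigD1_seq L)//= eqxx mulr1 big1 ?addr0// => K /negbTE KL.
  by rewrite eq_sym KL mulr0.
rewrite fS// big1_seq// => K /andP[_ KS]; case: eqP => [LK|]; last by rewrite mulr0.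
by rewrite LK KS in LS.
Qed.

(** Matrix of the form in the basis [delta]. On sequences supported in one finite list a form is a
    finite double sum, so derivatives and limits in time follow coordinate by coordinate. *)
Definition gram ts K L : R := \sum_(t <- ts) t.1 * ip (t.2.1 (delta K)) (t.2.2 (delta L)).

Lemma bilinear_expand ts f g (S : seq Z6) : uniq S -> (forall K, K \notin S -> f K = 0) ->
  (forall K, K \notin S -> g K = 0) ->
  \sum_(t <- ts) t.1 * ip (t.2.1 f) (t.2.2 g) =
  \sum_(K <- S) \sum_(L <- S) f K * g L * gram ts K L.
Proof.
move=> uS fS gS.
have ipS (X : seq Z6) (F : Z6 -> V) h : ip (\sum_(K <- X) F K) h = \sum_(K <- X) ip (F K) h.
  by elim: X => [|K X IH]; rewrite ?big_nil ?ip0l// !big_cons ipDl IH.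
have E (A B : {linear V -> V}) : ip (A f) (B g) =
    \sum_(K <- S) \sum_(L <- S) f K * g L * ip (A (delta K)) (B (delta L)).
  rewrite {1}(delta_expand uS fS) {1}(delta_expand uS gS) !linear_sum ipS.
  apply: eq_bigr => K _; rewrite ipC ipS; apply: eq_bigr => L _.
  by rewrite !linearZZ ipZl ipZr ipC; ring.
under eq_bigr do rewrite E mulr_sumr.
rewrite exchange_big; apply: eq_bigr => K _ /=.
under eq_bigr do rewrite mulr_sumr.
rewrite exchange_big; apply: eq_bigr => L _ /=.
by rewrite /gram mulr_sumr; apply: eq_bigr => t _; ring.
Qed.

Lemma is_derive_quad ts (g : R -> V) h (S : seq Z6) (t : R) : uniq S ->
  (forall s K, K \notin S -> g s K = 0) -> (forall K, K \notin S -> h K = 0) ->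
  (forall K, is_derive t 1 (fun s : R => g s K) (h K)) ->
  is_derive t 1 (fun s : R => quad ts (g s)) (dquad ts h (g t)).
Proof.
move=> uS gS hS dg.
rewrite (_ : (fun s => _) = (fun s : R => \sum_(K <- S) \sum_(L <- S) g s K * g s L * gram ts K L)); last first.
  by apply/funext => s; exact: (bilinear_expand _ uS (gS s) (gS s)).
have -> : dquad ts h (g t) = \sum_(K <- S) \sum_(L <- S)
    (h K * g t L + g t K * h L) * gram ts K L.
  rewrite /dquad /dip; under eq_bigr do rewrite mulrDr.
  rewrite big_split/= (bilinear_expand _ uS hS (gS t)) (bilinear_expand _ uS (gS t) hS) -big_split; apply: eq_bigr => K _ /=.
  by rewrite -big_split; apply: eq_bigr => L _ /=; ring.
apply: is_derive_seq => K _; apply: is_derive_seq => L _.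
rewrite (_ : (fun s => _) = (fun s : R => g s K) * (fun s : R => g s L) * cst (gram ts K L))//.
apply: is_derive_eq (is_deriveM (is_deriveM (dg K) (dg L)) (is_derive_cst _ _ _)) _.
by rewrite /GRing.scale/=; ring.
Qed.

Lemma cvg_quad ts (g : R -> V) (S : seq Z6) (t : R) (G : set_system R) : Filter G -> uniq S ->
  (forall s K, K \notin S -> g s K = 0) ->
  (forall K, g s K @[s --> G] --> g t K) ->
  quad ts (g s) @[s --> G] --> quad ts (g t).
Proof.
move=> FG uS gS cg.
have E s : quad ts (g s) = \sum_(K <- S) \sum_(L <- S) g s K * g s L * gram ts K L.
  exact: (bilinear_expand _ uS (gS s) (gS s)).
rewrite E (_ : (fun s => quad ts (g s)) =
    (fun s => \sum_(K <- S) \sum_(L <- S) g s K * g s L * gram ts K L)); last exact/funext.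
apply: cvg_seq => K _; apply: cvg_seq => L _.
by apply: cvgM; [apply: cvgM|exact: cvg_cst].
Qed.

Lemma quadZ ts f (c : R) : quad ts (c *: f) = c ^+ 2 * quad ts f.
Proof.
rewrite /quad mulr_sumr; apply: eq_bigr => -[x [A B]] _ /=.
by rewrite !linearZZ ipZl ipZr; ring.
Qed.

Lemma quadD_le ts f g : (forall f, 0 <= quad ts f) -> quad ts (f + g) <= 2 * quad ts f + 2 * quad ts g.
Proof.
move=> q0; have := dquad_le g f q0 ltr01; rewrite invr1 !mul1r.
by have := quadD ts f g 1; rewrite scale1r mul1r expr1n mul1r => ->; lra.
Qed.

End QuadraticEvolution.

(** * The truncated Fourier system and its commutator *)

Section Equation.
Variable R : realType.
Notation V := (fseq R).
Implicit Types (f g h : V) (a : Z6 -> R) (K s : Z6) (n : int * int).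

(** Coordinates of [L], [T] and [gen] for sequences of unrestricted support, on which the operators
    on [fseq] are not defined; [gen_coord] is the link. *)
Definition Lc n a K : R := au R n (K - vu n) * a (K - vu n) + ap R n (K - vp n) * a (K - vp n).
Definition Tc a K : R :=
  2^-1 * (Lc (0, 1) a K - Lc (1, 0) a K + Lc (0, -1) a K - Lc (-1, 0) a K).
Definition genc (kap nu : R) a K : R := - Tc a K
  - (kap * (kx1 K ^+ 2 + kx2 K ^+ 2 + kx3 K ^+ 2 + kx4 K ^+ 2)
     + nu * (ky1 K ^+ 2 + ky2 K ^+ 2)) * a K.

Lemma gen_coord kap nu f K : gen kap nu f K = genc kap nu f K.
Proof.
rewrite /gen /genc /lap !big_cons !big_nil !fseqE !multE TE !fseqE !L_def !fseqE.
by rewrite /Lu /Lp !monoE /Tc /Lc; ring.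
Qed.

Section Truncation.
Variables J W : R.
Hypothesis W1 : 1 <= W.

Lemma hfs_theta a : has_finite_support (fun K => theta J W K * a K).
Proof.
apply: (hfs_sub (finite_ball (expR (J + W)))) => K /= KJ.
have [->|/(theta_neq0_vpi W1)//] := eqVneq (theta J W K) 0; by rewrite mul0r.
Qed.
Definition cut a : V := locked_with fseq_key (Fseq (mk_fseq (hfs_theta a))).
Lemma cutE a K : cut a K = theta J W K * a K. Proof. by rewrite /cut unlock. Qed.

Lemma cut_support : exists2 S : seq Z6, uniq S & forall K, K \notin S -> theta J W K = 0.
Proof.
have [S uS cS] := finite_seq_support (cut (fun=> 1)).
by exists S => // K /cS; rewrite cutE mulr1.
Qed.

End Truncation.

Lemma au_shift n K : au R n (K - vu n) = au R n K.
Proof. by rewrite -[in RHS](subrK (vu n) K) [RHS]auD au_vu /cross mulrC subrr addr0. Qed.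
Lemma ap_shift n K : ap R n (K - vp n) = ap R n K.
Proof. by rewrite -[in RHS](subrK (vp n) K) [RHS]apD ap_vp /cross mulrC subrr addr0. Qed.

Definition units4 : seq (int * int) := [:: (0, 1); (1, 0); (0, -1); (-1, 0)].

Lemma small_vu n : n \in units4 -> small_shift (1 : R) (vu n) /\ small_shift (1 : R) (vp n).
Proof.
by rewrite !inE; do ![case/orP]; move=> /eqP ->; rewrite /small_shift /kx1 /kx2 /kx3 /kx4 /ky1 /ky2/=;
  rewrite ?oppr0 ?opprK ?intrN ?normrN ?normr0 ?normr1 ?lexx ?ler01.
Qed.

Lemma au_bound n K : n \in units4 -> `|au R n  K| <= 2 * nvp R K /\ `|ap R n  K| <= 2 * nvp R K.
Proof.
have /and5P[k1 k2 k3 k4 _] := @coord_le_nvp R K; have n0 := ltW (@nvp_gt0 R K).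
rewrite !inE; do ![case/orP]; move=> /eqP ->; rewrite /au /ap/= ?intrN;
by rewrite ?mul0r ?mul1r ?mulN1r ?subr0 ?sub0r ?oppr0 ?opprK ?normrN; split; lra.
Qed.

Lemma au_direction n e : n \in units4 -> e \in directions ->
  `|au R n e| <= 2 /\ `|ap R n e| <= 2.
Proof.
rewrite !inE; do ![case/orP]; move=> /eqP -> /orP[] /eqP ->; rewrite /au /ap /kx1 /kx2 /kx3 /kx4 /=;
by rewrite ?oppr0 ?intrN ?mul0r ?mulr0 ?mul1r ?mulN1r ?mulr1 ?subr0 ?sub0r ?oppr0 ?opprK ?normrN ?normr0 ?normr1; split; lra.
Qed.

Section Remainder.
Variables (J W : R).
Hypothesis W1 : 1 <= W.
Notation cutJ := (@cut J W W1).
Notation cut' := (@cut (J + W + 4) 1 (lexx 1)).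

(** Multipliers of the commutator of the cutoff with the two halves of [L n]. In [commutator] the
    wider cutoff can be inserted because of [theta_difference_cut]. *)
Definition rho_u n K : R := au R n K * (theta J W K - theta J W (K - vu n)).
Definition rho_p n K : R := ap R n K * (theta J W K - theta J W (K - vp n)).
Definition commutator n a : V :=
  mult (rho_u n) (sh (vu n) (cut' a)) + mult (rho_p n) (sh (vp n) (cut' a)).

(* The cutoff of larger radius is 1 wherever the differences of the smaller one
   do not vanish. *)
Lemma theta_difference_cut s a K : small_shift (1 : R) s ->
  (theta J W K - theta J W (K - s)) * a (K - s) =
  (theta J W K - theta J W (K - s)) * cut' a (K - s).
Proof.
move=> ss; rewrite cutE.
have [->|ne] := eqVneq (theta J W K) (theta J W (K - s)); first by rewrite subrr !mul0r.
rewrite [theta (J + W + 4) _ _]theta_eq1 ?mul1r//.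
have h := ln_vpi_shift K ss.
have [k0|kn] := eqVneq (theta J W K) 0.
  have : theta J W (K - s) != 0 by rewrite -k0 eq_sym.
  by move=> /(theta_neq0 W1)/ltW/le_trans; apply; rewrite lerDl.
apply: (le_trans h); rewrite lerD2r; exact: ltW (theta_neq0 W1 kn).
Qed.

(** The diffusive part of the generator is diagonal in frequency and commutes with the cutoff; only
    the shifts of the transport term leave a commutator. *)
Lemma gen_cut kap nu a :
  cutJ (genc kap nu a) = gen kap nu (cutJ a) -
  2^-1 *: (commutator (0, 1) a - commutator (1, 0) a + commutator (0, -1) a - commutator (-1, 0) a).
Proof.
have E n K : n \in units4 -> Lc n (cutJ a) K = theta J W K * Lc n a K - commutator n a K.
  move=> n4; have [su sp] := small_vu n4.
  have := theta_difference_cut a K su; have := theta_difference_cut a K sp.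
  rewrite /commutator; move: (cut' a) => G hp hu.
  have eu : mult (rho_u n) (sh (vu n) G) K =
      au R n K * ((theta J W K - theta J W (K - vu n)) * a (K - vu n)).
    by rewrite multE shE hu mulrA.
  have ep : mult (rho_p n) (sh (vp n) G) K =
      ap R n K * ((theta J W K - theta J W (K - vp n)) * a (K - vp n)).
    by rewrite multE shE hp mulrA.
  rewrite fseqD eu ep /Lc !cutE.
  have := au_shift n K; have := ap_shift n K.
  move: (K - vu n) (K - vp n) => X Y -> ->.
  by move: (theta J W K) (theta J W X) (theta J W Y) => *; ring.
apply: fseq_ext => K; have := E (0, 1) K isT; have := E (1, 0) K isT.
have := E (0, -1) K isT; have := E (-1, 0) K isT.
move: (commutator (0, 1) a) (commutator (1, 0) a) (commutator (0, -1) a) (commutator (-1, 0) a).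
move=> c1 c2 c3 c4 E4 E3 E2 E1; rewrite (fseqD (gen kap nu (cutJ a))) gen_coord !fseqE.
by rewrite cutE /genc /Tc E1 E2 E3 E4 cutE; field.
Qed.

End Remainder.

(** The two halves have different shifts and are bounded separately. The constant depends on [kap],
    since a shift changes the weight; this is harmless, as it multiplies W^-2. *)
Lemma commutator_bound kap : 0 <= kap -> exists2 C : R, 1 <= C &
  forall J W (W1 : 1 <= W) n a, n \in units4 ->
  exists u p : V, [/\ commutator J W n a = u + p,
    N kap u <= C / W ^+ 2 * N kap (@cut (J + W + 4) 1 (lexx 1) a) &
    N kap p <= C / W ^+ 2 * N kap (@cut (J + W + 4) 1 (lexx 1) a)].
Proof.
move=> k0; have [c c1 H] := @commutator_multiplier R.
exists (3 * (34 + 8 * kap * 1 ^+ 2) * c ^+ 2).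
  have : 1 <= c ^+ 2 by rewrite exprn_ege1.
  have h : 3 <= 3 * (34 + 8 * kap * 1 ^+ 2) by rewrite expr1n; lra.
  by move=> h2; rewrite -[1]mulr1 ler_pM//; lra.
move=> J W W1 n a n4; have [su sp] := small_vu n4.
have W0 : 0 < W by apply: lt_le_trans W1.
have E : 3 * (34 + 8 * kap * 1 ^+ 2) * c ^+ 2 / W ^+ 2 =
    3 * ((34 + 8 * kap * 1 ^+ 2) * (c / W) ^+ 2).
  by rewrite expr_div_n; field; rewrite lt0r_neq0.
exists (mult (rho_u J W n) (sh (vu n) (@cut (J + W + 4) 1 (lexx 1) a))).
exists (mult (rho_p J W n) (sh (vp n) (@cut (J + W + 4) 1 (lexx 1) a))).
have b01 : 0 <= (1 : R) <= 1 by rewrite ler01 lexx.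
split => //; rewrite E.
- have [h1 h2] := H J W (au R n) (vu n) W1 su (auD R n) (fun K => (au_bound K n4).1)
    (fun e eD => (au_direction n4 eD).1) (rho_u J W n) (fun K => erefl).
  exact: N_mult.
- have [h1 h2] := H J W (ap R n) (vp n) W1 sp (apD R n) (fun K => (au_bound K n4).2)
    (fun e eD => (au_direction n4 eD).2) (rho_p J W n) (fun K => erefl).
  exact: N_mult.
Qed.

End Equation.

Lemma sum_geometric (R : realType) (q : R) (I : nat) : 0 <= q <= 1 / 2 -> \sum_(i < I) q ^+ i <= 2.
Proof.
move=> /andP[q0 q1].
have E0 : (\sum_(i < I) q ^+ i) * (1 - q) = 1 - q ^+ I.
  elim: I => [|I IH]; first by rewrite big_ord0 mul0r expr0 subrr.
  by rewrite big_ord_recr/= mulrDl IH exprS; ring.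
have h : (\sum_(i < I) q ^+ i) * (1 / 2) <= (\sum_(i < I) q ^+ i) * (1 - q).
  by apply: ler_wpM2l; [apply: sumr_ge0 => i _; exact: exprn_ge0|lra].
by have := exprn_ge0 I q0; move: h; rewrite E0; lra.
Qed.

Lemma le_of_inv (R : realType) (x y c : R) : 0 <= c -> (forall n : nat, x <= y + c / n.+1%:R) -> x <= y.
Proof.
move=> c0 H; rewrite leNgt; apply/negP => yx.
have xy : 0 < x - y by rewrite subr_gt0.
pose n := Num.truncn (c / (x - y)).
have : c / (x - y) < n.+1%:R by exact: truncnS_gt.
rewrite ltr_pdivrMr// mulrC -ltr_pdivrMr ?ltr0Sn//.
by have := H n; move: (c / n.+1%:R) => X *; lra.
Qed.

(** * Energy estimates for truncated solutions *)

Section Decay.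
Variables (R : realType) (nu : R).
Hypothesis nuK : Kc R ^+ 8 <= nu.
Notation V := (fseq R).
Notation E := (@E R nu).

(** The constant depends on [nu], through [gam], but not on [kap]: the term [kap * pf f] occurs on
    both sides with weights free of [kap]. *)
Lemma E_N : exists2 C : R, 1 <= C & forall kap f, 0 <= kap ->
  E kap f <= C * N kap f /\ N kap f <= C * E kap f.
Proof.
have g0 : 0 < gam nu by rewrite mulr_gt0 ?Bc_gt0 ?nu_gt0.
have K1 := @Kc_ge1 R; have K0 := @Kc_gt0 R.
have cL1 := @cL_ge1 R.
have KV : (Kc R)^-1 <= 1 :> R by rewrite invf_le1.
have KV0 : 0 <= (Kc R)^-1 :> R by rewrite invr_ge0 ltW.
pose G := (gam nu)^-1; have G0 : 0 < G by rewrite invr_gt0.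
have gG : gam nu * G = 1 by rewrite divff// lt0r_neq0.
pose c1 : R := 2 * (2 + gam nu * (1 + 8 * cL ^+ 2)).
pose c2 : R := 2 * (1 + G * (1 + 6 * (19 * 19)) + Kc R).
have cL2 : 0 <= cL ^+ 2 :> R by exact: sqr_ge0.
have c10 : 1 <= c1.
  have : 0 <= gam nu * (1 + 8 * cL ^+ 2).
    by apply: mulr_ge0; [exact: ltW|lra].
  by rewrite /c1; lra.
have c20 : 1 <= c2.
  have : 0 <= G * (1 + 6 * (19 * 19)) by apply: mulr_ge0; [exact: ltW|lra].
  by rewrite /c2; lra.
exists (c1 + c2); first by lra.
move=> kap f k0; have /andP[e1 e2] := E_equiv nuK k0 f.
have wN := w_le_N f k0; have Nw := N_le_w f k0.
have N0 := N_ge0 f k0; have i0 := ip_ge0 f; have q0 := qf_ge0 f; have w0 := w_ge0 f.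
have p0 : 0 <= kap * pf f by rewrite mulr_ge0// pf_ge0.
have E0' := E_ge0 nuK k0 f.
have d0 : 0 <= \sum_(e <- directions) \sum_(m <- momenta R)
      ip (mult m f - sh e (mult m f)) (mult m f - sh e (mult m f)).
  by apply: sumr_ge0 => e _; apply: sumr_ge0 => m _; exact: ip_ge0.
have x1 := ip_ge0 (mult kx1 f + mult kx3 f); have x2 := ip_ge0 (mult kx2 f + mult kx4 f).
have hN : ip f f + qf f + kap * pf f <= N kap f by rewrite /N; lra.
split.
  apply: (@le_trans _ _ (c1 * N kap f)); last by rewrite ler_wpM2r//; lra.
  apply: le_trans e2 _; rewrite /c1 -mulrA ler_wpM2l// /E0.
  have h1 : gam nu * (qf f + w f) <= gam nu * ((1 + 8 * cL ^+ 2) * N kap f).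
    by apply: ler_wpM2l; [exact: ltW|move: hN wN; lra].
  have h2 : (Kc R)^-1 * kap * pf f <= kap * pf f by rewrite -mulrA ler_piMl.
  by rewrite mulrDl -mulrA; move: h1 h2 hN; lra.
apply: (@le_trans _ _ (c2 * E kap f)); last by rewrite ler_wpM2r//; lra.
have e1' : E0 nu kap f <= 2 * E kap f by move: e1; lra.
apply: (@le_trans _ _ ((1 + G * (1 + 6 * (19 * 19)) + Kc R) * E0 nu kap f)); last first.
  rewrite /c2 [2 * _]mulrC -mulrA ler_wpM2l//.
  have : 0 <= G * (1 + 6 * (19 * 19)) by apply: mulr_ge0; [exact: ltW|lra].
  by lra.
apply: le_trans Nw _.
have a1 : 0 <= gam nu * (qf f + w f) by rewrite mulr_ge0 ?(ltW g0)// addr_ge0.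
have a2 : 0 <= (Kc R)^-1 * kap * pf f by rewrite -mulrA mulr_ge0.
have b1 : ip f f <= E0 nu kap f by rewrite /E0; move: a1 a2; lra.
have b2 : qf f + w f <= G * E0 nu kap f.
  have -> : qf f + w f = G * (gam nu * (qf f + w f)) by rewrite mulrA [G * _]mulrC gG mul1r.
  by rewrite ler_wpM2l ?(ltW G0)// /E0; move: a2 i0; lra.
have b3 : kap * pf f <= Kc R * E0 nu kap f.
  have -> : kap * pf f = Kc R * ((Kc R)^-1 * kap * pf f) by rewrite !mulrA divff ?mul1r ?lt0r_neq0.
  by rewrite ler_wpM2l ?(ltW K0)// /E0; move: a1 i0; lra.
have -> : (1 + G * (1 + 6 * (19 * 19)) + Kc R) * E0 nu kap f = E0 nu kap f +
  (G * E0 nu kap f + 6 * (19 * 19) * (G * E0 nu kap f)) + Kc R * E0 nu kap f by ring.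
have b4 : 6 * (19 * 19) * w f <= 6 * (19 * 19) * (G * E0 nu kap f).
  by apply: ler_wpM2l => //; move: b2; lra.
by move: b1 b2 b3 b4; lra.
Qed.

Section Evolution.
Variables (kap : R).
Hypothesis kap0 : 0 <= kap.

Lemma remainder_bound : exists2 C : R, 1 <= C & forall J W (W1 : 1 <= W) a,
  E kap (2^-1 *: (commutator J W (0, 1) a - commutator J W (1, 0) a
    + commutator J W (0, -1) a - commutator J W (-1, 0) a)) <=
  C / W ^+ 2 * E kap (cut (J + W + 4) (lexx 1) a).
Proof.
have [c1 c11 H1] := E_N; have [c c_1 H] := commutator_bound kap0.
have E0 f : 0 <= E kap f by exact: E_ge0.
exists (24 * (c1 * (c * c1))).
  have : 1 <= c1 * (c * c1) by rewrite !mulr_ege1.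
  by lra.
move=> J W W1 a; have W0 : 0 < W by apply: lt_le_trans W1.
set G := cut (J + W + 4) (lexx 1) a.
pose m := c1 * (c * c1) / W ^+ 2 * E kap G.
have m0 : 0 <= m by rewrite mulr_ge0// divr_ge0 ?sqr_ge0// !mulr_ge0//; lra.
have ED x y : E kap (x + y) <= 2 * E kap x + 2 * E kap y by exact: quadD_le.
have EN x : E kap (- x) = E kap x.
  by rewrite -scaleN1r /E quadZ sqrrN expr1n mul1r.
have Hm n : n \in units4 -> E kap (commutator J W n a) <= 4 * m.
  move=> n4; have [u [p [-> hu hp]]] := H J W W1 n a n4.
  have X x : N kap x <= c / W ^+ 2 * N kap G -> E kap x <= m.
    move=> h; have [e1 _] := H1 kap x kap0; have [_ e2] := H1 kap G kap0.
    apply: (le_trans e1); rewrite (_ : m = c1 * (c / W ^+ 2 * (c1 * E kap G))); last first.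
      by rewrite /m; ring.
    apply: ler_wpM2l; first by lra.
    by apply: (le_trans h); apply: ler_wpM2l => //; rewrite divr_ge0 ?sqr_ge0//; lra.
  by apply: le_trans (ED u p) _; have := X u hu; have := X p hp; lra.
have h1 := Hm (0, 1) isT; have h2 := Hm (1, 0) isT.
have h3 := Hm (0, -1) isT; have h4 := Hm (-1, 0) isT.
rewrite /E quadZ -/(E kap _).
have -> : 24 * (c1 * (c * c1)) / W ^+ 2 * E kap G = 24 * m by rewrite /m !mulrA.
move: h1 h2 h3 h4; move: (commutator J W (0, 1) a) (commutator J W (1, 0) a).
move: (commutator J W (0, -1) a) (commutator J W (-1, 0) a) => x4 x3 x2 x1 h1 h2 h3 h4.
have e3 := ED (x2 - x1 + x4) (- x3); have e2 := ED (x2 - x1) x4; have e1 := ED x2 (- x1).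
rewrite !EN in e1 e2 e3.
have -> : 2^-1 ^+ 2 = 1 / 4 :> R by field.
by move: h1 h2 h3 h4 e1 e2 e3 m0; lra.
Qed.

(** The multiplier is [theta] without a shift, so [dens_mult] applies with b = 0 and the constant
    does not depend on [kap]. Unlike the constant of [remainder_bound], it survives in the final
    estimate. *)
Lemma initial_bound : exists2 C : R, 1 <= C & forall kap, 0 <= kap -> forall J W (W1 : 1 <= W) a A,
  (forall S, uniq S -> \sum_(K <- S) dens kap a K <= A) -> E kap (cut J W1 a) <= C * A.
Proof.
have [c1 c11 H1] := E_N; have [c c_1 H] := @theta_multiplier R.
exists (c1 * (34 * c ^+ 2 * 3)).
  have : 1 <= c ^+ 2 by rewrite exprn_ege1.
  by move=> h; rewrite mulr_ege1//; lra.
move=> k k0 J W W1 a A hA; have [t1 t2] := H J W W1.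
have [e1 _] := H1 k (cut J W1 a) k0; apply: (le_trans e1).
rewrite -[X in _ <= X]mulrA; apply: ler_wpM2l; first by lra.
have [S [uS _ /(_ S uS (fun K => id)) ->]] := N_support k (cut J W1 a).
have b0 : 0 <= (0 : R) <= 1 by rewrite lexx ler01.
have s0 : small_shift (0 : R) (0 : Z6).
  by rewrite /small_shift /kx1 /kx2 /kx3 /kx4 /ky1 /ky2/= !normr0 lexx.
apply: (@le_trans _ _ (\sum_(K <- S) 34 * c ^+ 2 *
    (dens k a K + (a (K - zv 1 0) ^+ 2 + a (K - zv 0 1) ^+ 2)))).
  apply: ler_sum => K _.
  have := dens_mult a k0 b0 s0 (t1 K) (t2 K).
  rewrite expr0n mulr0 addr0 subr0 /directions !big_cons big_nil addr0.
  apply: le_trans; rewrite le_eqVlt; apply/orP; left; apply/eqP.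
  by congr (dens k _ K); apply/funext => L; rewrite subr0 cutE.
rewrite -mulr_sumr -[X in _ <= X]mulrA; apply: ler_wpM2l; first by rewrite mulr_ge0 ?sqr_ge0.
have F s' : \sum_(K <- S) dens k a (K - s') <= A.
  by rewrite -(big_map (fun K => K - s') xpredT (dens k a)) hA// uniq_shift.
have G K : a K ^+ 2 <= dens k a K by exact: sqr_le_dens.
have F0 := hA S uS.
move: (dens k a) F G F0 => D F G F0; rewrite !big_split/= (_ : 3 * A = A + (A + A)); last by ring.
apply: lerD => //; apply: lerD.
  by apply: le_trans (F (zv 1 0)); apply: ler_sum.
by apply: le_trans (F (zv 0 1)); apply: ler_sum.
Qed.

Variables (a : R -> Z6 -> R).
Hypothesis a_zero : forall t : R, 0 <= t -> forall K : Z6, K.1 = 0 -> a t K = 0.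
Hypothesis a_cts : forall K (t : R), 0 <= t ->
  a s K @[s --> within [set s : R | 0 <= s] (nbhs t)] --> a t K.
Hypothesis a_ode : forall K (t : R), 0 < t ->
  is_derive t 1 (fun s : R => a s K) (genc kap nu (a t) K).
Hypothesis a_bdd : forall t : R, 0 <= t -> exists M : R, forall (s : R) (S : seq Z6),
  0 <= s <= t -> uniq S -> \sum_(K <- S) a s K ^+ 2 <= M.

Definition energy J W (W1 : 1 <= W) s := E kap (cut J W1 (a s)).
Local Notation lam := (lam0 nu / 2).

Lemma energy_ge0 J W (W1 : 1 <= W) s : 0 <= energy J W1 s.
Proof. exact: E_ge0. Qed.

Lemma energy_cts J W (W1 : 1 <= W) (t : R) : 0 <= t ->
  energy J W1 s @[s --> within [set s : R | 0 <= s] (nbhs t)] --> energy J W1 t.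
Proof.
move=> t0; have [S uS tS] := cut_support J W1.
apply: (@cvg_quad R (Eterms nu kap) (fun s => cut J W1 (a s)) S t _ _ uS) => [s K KS|K]; first by rewrite cutE tS ?mul0r.
rewrite cutE (_ : (fun s => _) = (fun s : R => theta J W K * a s K)); last first.
  by apply/funext => s; rewrite cutE.
by apply: cvgMl_tmp; exact: a_cts.
Qed.

Definition denergy J W (W1 : 1 <= W) s := dE nu kap (cut J W1 (genc kap nu (a s))) (cut J W1 (a s)).

Lemma energy_derive J W (W1 : 1 <= W) (t : R) : 0 < t ->
  is_derive t 1 (energy J W1) (denergy J W1 t).
Proof.
move=> t0; have [S uS tS] := cut_support J W1.
apply: (@is_derive_quad R (Eterms nu kap) (fun s => cut J W1 (a s)) _ S t uS) => [s K KS|K KS|K]; try by rewrite cutE tS ?mul0r.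
have aK := a_ode K t0.
rewrite cutE (_ : (fun s => _) = theta J W K \*: (fun s : R => a s K)); last first.
  by apply/funext => s; rewrite cutE.
exact: is_deriveZ.
Qed.

(** Half of the rate [lam0] absorbs the commutator, through [dquad_le]. What is left is the energy
    behind a wider cutoff with a factor W^-2, so the inequality does not close by itself. *)
Lemma energy_ineq : exists2 C : R, 1 <= C & forall J W (W1 : 1 <= W) s, 0 < s ->
  denergy J W1 s <= - lam * energy J W1 s + C / W ^+ 2 * energy (J + W + 4) (lexx 1) s.
Proof.
have [c c1 H] := remainder_bound; have l0 := lam0_gt0 nuK.
have lV : 0 < (lam0 nu)^-1 by rewrite invr_gt0.
exists (1 + 2 * (lam0 nu)^-1 * c).
  by rewrite lerDl !mulr_ge0 ?ltW//; lra.
move=> J W W1 s s0; have W0 : 0 < W by apply: lt_le_trans W1.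
rewrite /denergy gen_cut /energy; set r := 2^-1 *: _; set g := cut J W1 _.
have -> : dE nu kap (gen kap nu g - r) g = dE nu kap (gen kap nu g) g + dE nu kap (- r) g.
  exact: dquadD.
have h1 : dE nu kap (gen kap nu g) g <= - lam0 nu * E kap g.
  by apply: E_decay => // K K0; rewrite cutE a_zero ?mulr0// ltW.
have h2 : dE nu kap (- r) g <= lam * E kap g + lam^-1 * E kap (- r).
  by apply: dquad_le; [move=> f; exact: E_ge0|rewrite divr_gt0].
have h3 : E kap (- r) = E kap r by rewrite -scaleN1r /E quadZ sqrrN expr1n mul1r.
have h4 := H J W W1 (a s); rewrite -/r in h4.
have h5 : lam^-1 * E kap r <= lam^-1 * (c / W ^+ 2 * E kap (cut (J + W + 4) (lexx 1) (a s))).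
  by apply: ler_wpM2l => //; rewrite invr_ge0 divr_ge0// ltW.
have E0 : 0 <= E kap (cut (J + W + 4) (lexx 1) (a s)) by exact: E_ge0.
have h6 : 0 <= (W ^+ 2)^-1 * E kap (cut (J + W + 4) (lexx 1) (a s)).
  by rewrite mulr_ge0// invr_ge0 sqr_ge0.
have -> : (1 + 2 * (lam0 nu)^-1 * c) / W ^+ 2 * E kap (cut (J + W + 4) (lexx 1) (a s)) =
   (W ^+ 2)^-1 * E kap (cut (J + W + 4) (lexx 1) (a s)) +
   lam^-1 * (c / W ^+ 2 * E kap (cut (J + W + 4) (lexx 1) (a s))).
  have -> : lam^-1 = 2 * (lam0 nu)^-1 by rewrite invfM invrK mulrC.
  by move: (W ^+ 2)^-1 => X; ring.
by rewrite h3 in h2; move: h1 h2 h5 h6; lra.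
Qed.

Lemma energy_crude J (t M : R) : 0 <= J -> 0 <= t ->
  (forall (s : R) (S : seq Z6), 0 <= s <= t -> uniq S -> \sum_(K <- S) a s K ^+ 2 <= M) ->
  forall s, 0 <= s <= t -> forall C, 1 <= C -> (forall f, E kap f <= C * N kap f) ->
  energy J (lexx 1) s <= C * ((27 + 4 * kap) * expR (J + 1)) * M.
Proof.
move=> J0 t0 hM s st C C1 H; have C0 : 0 <= C by lra.
have k0 := kap0.
have e1 : 1 <= expR (J + 1) by rewrite -expR0 ler_expR addr_ge0.
apply: le_trans (H _) _; rewrite -[X in _ <= X]mulrA ler_wpM2l//.
apply: (@le_trans _ _ ((1 + (26 + 4 * kap) * expR (J + 1)) * ip (cut J (lexx 1) (a s)) (cut J (lexx 1) (a s)))).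
  apply: (N_le_weight kap0 (expR_ge0 _)) => K; rewrite cutE mulf_eq0 => /norP[/(theta_neq0_vpi (lexx 1)) + _].
  by rewrite /vpi /dotp -!expr2; lra.
have [S uS tS] := cut_support J (lexx (1 : R)).
have M0 : ip (cut J (lexx 1) (a s)) (cut J (lexx 1) (a s)) <= M.
  rewrite (ip_finE _ uS) => [|K KS]; last by rewrite cutE tS ?mul0r.
  apply: le_trans (hM s S st uS); apply: ler_sum => K _; rewrite cutE -expr2 exprMn.
  have /andP[h0 h1] := theta_bounds J 1 K.
  by rewrite ler_piMl ?sqr_ge0// exprn_ile1.
apply: ler_pM => //; rewrite ?ip_ge0//.
  by apply: addr_ge0 => //; apply: mulr_ge0; [lra|exact: expR_ge0].
have -> : (27 + 4 * kap) * expR (J + 1) = expR (J + 1) + (26 + 4 * kap) * expR (J + 1) by ring.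
by rewrite lerD2r.
Qed.

(** The derivative of the energy behind one cutoff is at most C times the energy behind the next, J
    being raised by W + 4 = 5. A sum with weights q^i satisfies a closed inequality up to its last
    term, which [energy_crude] bounds; Gronwall's lemma and longer and longer sums leave a bound
    independent of J. *)
Lemma energy_uniform (A : R) : (forall J W (W1 : 1 <= W), energy J W1 0 <= A) ->
  forall t, 0 <= t -> exists B : R, forall J s, 0 <= J -> 0 <= s <= t -> energy J (lexx 1) s <= B.
Proof.
move=> hA t t0; have [C C1 HC] := energy_ineq; have [C2 C21 HN] := E_N.
have [M hM] := a_bdd t0; have C0 : 0 <= C by lra.
have k0 := kap0.
have A0 : 0 <= A by apply: le_trans (hA 0 1 (lexx 1)); exact: energy_ge0.
have M0 : 0 <= M by have := hM 0 [::]; rewrite big_nil; apply; rewrite ?lexx.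
(* The crude bound grows by the factor exp 5 at each step of the chain; with this ratio the weighted
   last term still decays like exp(- I). *)
pose q : R := expR (- 6).
have q0 : 0 < q by exact: expR_gt0.
have q2 : q <= 1 / 2.
  rewrite /q expRN div1r lef_pV2 ?posrE ?expR_gt0//.
  by apply: le_trans (expR_ge1Dx _); lra.
(* Raising the index of the weight by one costs 1 / q. *)
pose c := C / q.
have c0 : 0 <= c by rewrite divr_ge0// ltW.
exists (expR (c * t) * (2 * A)) => J s J0 /andP[s0 st].
pose f i := energy (J + i%:R * 5) (lexx 1).
pose D := c * (C2 * ((27 + 4 * kap) * expR (J + 1)) * M).
have D0 : 0 <= D.
  rewrite mulr_ge0// mulr_ge0// mulr_ge0//; first by lra.
  by rewrite mulr_ge0 ?expR_ge0//; lra.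
have st' : 0 <= s <= t by rewrite s0 st.
have fD i r : 0 < r -> denergy (J + i%:R * 5) (lexx 1) r <= C * f i.+1 r.
  move=> r0; apply: (le_trans (HC _ _ (lexx 1) r r0)).
  rewrite expr1n divr1 (_ : J + i%:R * 5 + 1 + 4 = J + i.+1%:R * 5); last by rewrite -natr1; ring.
  rewrite gerDr mulNr oppr_le0 mulr_ge0 ?energy_ge0// divr_ge0// ltW// lam0_gt0//.
have fI I r : 0 <= r <= t -> q ^+ I * f I r <= expR (- I%:R) * (C2 * ((27 + 4 * kap) * expR (J + 1)) * M).
  move=> rt; have J5 : 0 <= J + I%:R * 5 by rewrite addr_ge0// mulr_ge0.
  have := energy_crude J5 t0 hM rt C21 (fun f => (HN kap f kap0).1).
  move=> h; apply: (le_trans (ler_wpM2l (exprn_ge0 I (ltW q0)) h)).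
  rewrite (_ : J + I%:R * 5 + 1 = I%:R * 5 + (J + 1)); last by ring.
  rewrite expRD /q -expRM_natl le_eqVlt; apply/orP; left; apply/eqP.
  have -> : expR (- I%:R) = expR (I%:R * - 6) * expR (I%:R * 5) :> R.
    by rewrite -expRD; congr expR; ring.
  by ring.
have main I : f 0%N s <= expR (c * s) * (2 * A + D * expR (- I.+1%:R) * (s * expR (`|c| * s))).
  have G : \sum_(i < I.+1) q ^+ i * f i s <=
      expR (c * s) * (\sum_(i < I.+1) q ^+ i * f i 0 + D * expR (- I.+1%:R) * (s * expR (`|c| * s))).
    apply: (@gronwall R c (D * expR (- I.+1%:R)) s (fun r => \sum_(i < I.+1) q ^+ i * f i r)
      (fun r => \sum_(i < I.+1) q ^+ i * denergy (J + (i : nat)%:R * 5) (lexx 1) r)) => //.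
    - by rewrite mulr_ge0 ?expR_ge0.
    - move=> r r0; apply: is_derive_seq => i _.
      exact: (is_deriveZ (q ^+ i) (energy_derive _ (lexx 1) r0)).
    - move=> r r0; apply: cvg_seq => i _; apply: cvgMl_tmp; exact: energy_cts.
    move=> r /andP[r0 rs]; have rt : 0 <= r <= t by rewrite (ltW r0)/= (le_trans (ltW rs)).
    apply: (@le_trans _ _ (\sum_(i < I.+1) c * (q ^+ i.+1 * f i.+1 r))).
      apply: ler_sum => i _; rewrite /c exprS.
      have -> : C / q * (q * q ^+ i * f i.+1 r) = q ^+ i * (C * f i.+1 r).
        by field; rewrite lt0r_neq0.
      by rewrite ler_wpM2l ?exprn_ge0 ?(ltW q0)// fD.
    rewrite -mulr_sumr /D -mulrA -mulrDr ler_wpM2l//.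
    rewrite [X in _ <= X + _]big_ord_recl big_ord_recr/=.
    apply: (@le_trans _ _ (\sum_(i < I) q ^+ i.+1 * f i.+1 r + expR (- I.+1%:R) * (C2 * ((27 + 4 * kap) * expR (J + 1)) * M))).
      by rewrite lerD2l fI.
    rewrite [X in _ <= _ + X]mulrC lerD2r -[X in X <= _]add0r lerD//.
    by rewrite mulr_ge0 ?exprn_ge0 ?energy_ge0 ?(ltW q0).
  apply: le_trans (le_trans _ G) _.
    rewrite big_ord_recl expr0 mul1r lerDl sumr_ge0// => i _.
    by rewrite mulr_ge0 ?exprn_ge0 ?energy_ge0 ?(ltW q0).
  rewrite ler_wpM2l ?expR_ge0// lerD2r.
  apply: (@le_trans _ _ (\sum_(i < I.+1) q ^+ i * A)).
    by apply: ler_sum => i _; rewrite ler_wpM2l ?exprn_ge0 ?(ltW q0)//; exact: hA.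
  by rewrite -mulr_suml ler_wpM2r// sum_geometric// (ltW q0).
have F0 : f 0%N s <= expR (c * s) * (2 * A).
  apply: (@le_of_inv _ _ _ (expR (c * s) * (D * (s * expR (`|c| * s))))).
    apply: mulr_ge0; [exact: expR_ge0|apply: mulr_ge0 => //].
    by apply: mulr_ge0 => //; exact: expR_ge0.
  move=> I; apply: (le_trans (main I)); rewrite mulrDr lerD2l.
  rewrite -[X in _ <= X]mulrA ler_wpM2l ?expR_ge0//.
  rewrite -[X in _ <= X]mulrA -[X in X <= _]mulrA ler_wpM2l//.
  rewrite mulrC ler_wpM2l ?mulr_ge0 ?expR_ge0//.
  rewrite expRN lef_pV2 ?posrE ?expR_gt0 ?ltr0Sn//.
  by apply: le_trans (expR_ge1Dx _); rewrite lerDr.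
move: F0; rewrite /f mul0r addr0 => /le_trans; apply.
by rewrite ler_wpM2r ?mulr_ge0// ler_expR ler_wpM2l.
Qed.

(** Once the energies are bounded uniformly in J, the error in [energy_ineq] is O(W^-2) and
    disappears for large W at fixed t. *)
Lemma energy_decay (A : R) : (forall J W (W1 : 1 <= W), energy J W1 0 <= A) ->
  forall t, 0 <= t -> exists2 D : R, 0 <= D & forall J W (W1 : 1 <= W), 0 <= J ->
    energy J W1 t <= expR (- lam * t) * A + D / W.
Proof.
move=> hA t t0; have [C C1 HC] := energy_ineq; have C0 : 0 <= C by lra.
have [B hB] := energy_uniform hA t0.
have B0 : 0 <= B.
  by apply: le_trans (hB 0 0 (lexx _) _); rewrite ?energy_ge0 ?lexx.
have l0 : 0 < lam by rewrite divr_gt0// lam0_gt0.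
exists (C * B * (t * expR (`|- lam| * t))).
  by apply: mulr_ge0; [exact: mulr_ge0|rewrite mulr_ge0 ?expR_ge0].
move=> J W W1 J0; have W0 : 0 < W by apply: lt_le_trans W1.
have e0 : 0 <= C / W ^+ 2 * B by rewrite mulr_ge0// divr_ge0// sqr_ge0.
apply: (le_trans (@gronwall R (- lam) (C / W ^+ 2 * B) t (energy J W1) (denergy J W1) t0 e0 _ _ _)).
- by move=> s; exact: energy_derive.
- by move=> s; exact: energy_cts.
- move=> s /andP[s0 st]; apply: (le_trans (HC J W W1 s s0)); rewrite lerD2l.
  apply: ler_wpM2l; first by rewrite divr_ge0// sqr_ge0.
  apply: hB; last by rewrite (ltW s0) (ltW st).
  by rewrite !addr_ge0// ltW.
rewrite mulrDr; apply: lerD; first by rewrite ler_wpM2l ?expR_ge0.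
have Y0 : 0 <= t * expR (`|- lam| * t) by rewrite mulr_ge0 ?expR_ge0.
have X0 : 0 <= C / W ^+ 2 * B * (t * expR (`|- lam| * t)).
  by rewrite mulr_ge0// mulr_ge0// divr_ge0// sqr_ge0.
apply: (@le_trans _ _ (C / W ^+ 2 * B * (t * expR (`|- lam| * t)))).
  rewrite ler_piMl// -[X in _ <= X]expR0 ler_expR mulNr oppr_le0 mulr_ge0// ltW//.
move: Y0; move: (t * expR _) => Y Y0.
have -> : C / W ^+ 2 * B * Y = C * B * Y / W * W^-1 by rewrite expr2 invfM; move: W^-1 => X; ring.
by apply: ler_piMr; [rewrite divr_ge0 ?(ltW W0)// !mulr_ge0|rewrite invf_le1].
Qed.

End Evolution.

(** On a finite set of frequencies the cutoff is 1 as soon as J is large; then W is sent to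
    infinity. *)
Lemma sequence_decay : exists2 C : R, 1 <= C & forall kap, 0 <= kap ->
  forall a : R -> Z6 -> R,
  (forall t : R, 0 <= t -> forall K : Z6, K.1 = 0 -> a t K = 0) ->
  (forall K (t : R), 0 <= t ->
    a s K @[s --> within [set s : R | 0 <= s] (nbhs t)] --> a t K) ->
  (forall K (t : R), 0 < t -> is_derive t 1 (fun s : R => a s K) (genc kap nu (a t) K)) ->
  (forall t : R, 0 <= t -> exists M : R, forall (s : R) (S : seq Z6),
    0 <= s <= t -> uniq S -> \sum_(K <- S) a s K ^+ 2 <= M) ->
  forall A : R, (forall S, uniq S -> \sum_(K <- S) dens kap (a 0) K <= A) ->
  forall t : R, 0 <= t -> forall S, uniq S ->
  \sum_(K <- S) dens kap (a t) K <= C * expR (- (lam0 nu / 2) * t) * A.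
Proof.
have [C1 C11 HN] := E_N; have [C2 C21 HI] := initial_bound.
exists (C1 * C2); first by rewrite mulr_ege1.
move=> kap k0 a a0 ac ao ab A hA t t0 S uS.
have hE J W (W1 : 1 <= W) : energy kap a J W1 0 <= C2 * A by exact: HI.
have [D D0 HD] := energy_decay k0 a0 ac ao ab hE t0.
(* Large enough for the cutoff to be 1 on S; the summand 4 also covers the neighbours K - e seen by
   the density ([ln_vpi_shift]). *)
pose J := \sum_(K <- S) (ln (vpi R K) + 4).
have lv K : 0 <= ln (vpi R K) by rewrite ln_ge0// vpi_ge1.
have J0 : 0 <= J by apply: sumr_ge0 => K _; rewrite addr_ge0.
have KJ K : K \in S -> ln (vpi R K) + 4 <= J.
  move=> KS; rewrite /J (bigD1_seq K)//= lerDl sumr_ge0// => L _.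
  by rewrite addr_ge0.
apply: (@le_of_inv _ _ _ (C1 * D)); first by rewrite mulr_ge0//; lra.
move=> n; have W1 : 1 <= n.+1%:R :> R by rewrite ler1n.
have E1 : \sum_(K <- S) dens kap (a t) K <= N kap (cut J W1 (a t)).
  apply: le_trans (sum_dens_le (cut J W1 (a t)) k0 uS).
  rewrite le_eqVlt; apply/orP; left; apply/eqP; apply: eq_big_seq => K KS.
  have t1 : theta J n.+1%:R K = 1.
    by apply: theta_eq1 => //; apply: le_trans (KJ K KS); rewrite lerDl.
  have t2 e : e \in directions -> theta J n.+1%:R (K - e) = 1.
    move=> eD; apply: theta_eq1 => //; apply: le_trans (KJ K KS).
    apply: ln_vpi_shift; move: eD.
    rewrite !inE => /orP[] /eqP ->; rewrite /small_shift /kx1 /kx2 /kx3 /kx4 /ky1 /ky2/=;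
    by rewrite ?oppr0 ?intrN ?normrN ?normr0 ?normr1 ?lexx ?ler01.
  rewrite /dens cutE t1 mul1r; congr (_ + _); apply: eq_big_seq => e eD.
  by apply: eq_bigr => m _; rewrite /difference !cutE t1 t2// !mul1r.
apply: (le_trans E1); have [_ h] := HN kap (cut J W1 (a t)) k0.
apply: (le_trans h); have := HD J _ W1 J0; rewrite /energy => h2.
rewrite (_ : C1 * C2 * _ * A + _ = C1 * (expR (- (lam0 nu / 2) * t) * (C2 * A) + D / n.+1%:R)).
  by rewrite ler_wpM2l//; lra.
by move: (n.+1%:R)^-1 => X; ring.
Qed.

End Decay.

(** * Trigonometric functions and the regularized distance *)

Section Characters.
Variable R : realType.
Notation P := (point6 R).
Implicit Types (K : Z6) (z v : P).

Definition ph K z : R := kx1 K * x1 z + kx2 K * x2 z + kx3 K * x3 z + kx4 K * x4 z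
  + ky1 K * y1 z + ky2 K * y2 z.

Lemma ph_is_linear K : linear (ph K).
Proof. by move=> a z z'; rewrite /ph /x1 /x2 /x3 /x4 /y1 /y2 /= /GRing.scale /=; ring. Qed.
HB.instance Definition _ K := GRing.isLinear.Build R P R *:%R (ph K) (ph_is_linear K).

Lemma phD K L z : ph (K + L) z = ph K z + ph L z.
Proof. by rewrite /ph kx1D kx2D kx3D kx4D ky1D ky2D; ring. Qed.
Lemma phB K L z : ph (K - L) z = ph K z - ph L z.
Proof. by have := phD (K - L) L z; rewrite subrK => ->; rewrite addrK. Qed.
Lemma phN K z : ph (- K) z = - ph K z.
Proof. by rewrite -[in LHS]sub0r phB; rewrite (_ : ph 0 z = 0) ?sub0r// /ph /kx1 /kx2 /kx3 /kx4 /ky1 /ky2/=; ring. Qed.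
Lemma ph0 z : ph 0 z = 0.
Proof. by rewrite /ph /kx1 /kx2 /kx3 /kx4 /ky1 /ky2/=; ring. Qed.

Let cts_fst (A B C : normedModType R) (f : A -> B * C) : continuous f -> continuous (fun a => (f a).1).
Proof. by move=> cf a; apply: (cvg_comp _ _ (cf a)); exact: cvg_fst. Qed.
Let cts_snd (A B C : normedModType R) (f : A -> B * C) : continuous f -> continuous (fun a => (f a).2).
Proof. by move=> cf a; apply: (cvg_comp _ _ (cf a)); exact: cvg_snd. Qed.

Lemma continuous_coordinates : [/\ continuous (@x1 R), continuous (@x2 R), continuous (@x3 R)
  & continuous (@x4 R)] /\ continuous (@y1 R) /\ continuous (@y2 R).
Proof.
have ci : continuous (@id P) by move=> z; exact: cvg_id.
split; [split|split].
- exact: (cts_fst (cts_fst (cts_fst ci))).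
- exact: (cts_snd (cts_fst (cts_fst ci))).
- exact: (cts_fst (cts_snd (cts_fst ci))).
- exact: (cts_snd (cts_snd (cts_fst ci))).
- exact: (cts_fst (cts_snd ci)).
- exact: (cts_snd (cts_snd ci)).
Qed.

Lemma continuous_ph K : continuous (ph K).
Proof.
have [[c1 c2 c3 c4] [c5 c6]] := continuous_coordinates.
have cm (c : R) (f : P -> R) : continuous f -> continuous (fun z => c * f z).
  by move=> cf z; apply: cvgMl_tmp; exact: cf.
have cd (f g : P -> R) : continuous f -> continuous g -> continuous (fun z => f z + g z).
  by move=> cf cg z; apply: cvgD; [exact: cf|exact: cg].
by do 5 (apply: (cd _ _); last exact: cm); exact: cm.
Qed.

Lemma differentiable_ph K z : differentiable (ph K) z.
Proof. exact: linear_differentiable (@continuous_ph K). Qed.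

Lemma is_derive_ph K z v : is_derive z v (ph K) (ph K v).
Proof.
apply: DeriveDef; first exact/diff_derivable/differentiable_ph.
rewrite deriveE; last exact: differentiable_ph.
by rewrite diff_lin//; exact: continuous_ph.
Qed.

Lemma is_derive_comp1 (g : R -> R) (f : P -> R) z v (dg df : R) :
  is_derive (f z) 1 g dg -> differentiable f z -> is_derive z v f df ->
  is_derive z v (g \o f) (dg * df).
Proof.
move=> [gd gE] fd [_ fE]; have gd' : differentiable g (f z) by apply/derivable1_diffP.
have cd : differentiable (g \o f) z by exact: differentiable_comp.
apply: DeriveDef; first exact: diff_derivable.
rewrite deriveE// diff_comp//=.
by rewrite deriv1E// -(deriveE _ fd) fE derive1E gE /GRing.scale/= mulrC.
Qed.

Definition cosK K z : R := cos (ph K z).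
Definition sinK K z : R := sin (ph K z).

Lemma is_derive_cosK K z v : is_derive z v (cosK K) (- ph K v * sinK K z).
Proof.
have := is_derive_comp1 (is_derive_cos (ph K z)) (differentiable_ph K z) (is_derive_ph K z v).
by move=> H; apply: (is_derive_eq H); rewrite mulNr mulrC mulNr.
Qed.
Lemma is_derive_sinK K z v : is_derive z v (sinK K) (ph K v * cosK K z).
Proof.
have := is_derive_comp1 (is_derive_sin (ph K z)) (differentiable_ph K z) (is_derive_ph K z v).
by move=> H; apply: (is_derive_eq H); rewrite mulrC.
Qed.
Lemma differentiable_cosK K z : differentiable (cosK K) z.
Proof.
apply: (@differentiable_comp _ _ _ _ (ph K) cos); first exact: differentiable_ph.
by apply/derivable1_diffP; exact: derivable_cos.
Qed.
Lemma differentiable_sinK K z : differentiable (sinK K) z.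
Proof.
apply: (@differentiable_comp _ _ _ _ (ph K) sin); first exact: differentiable_ph.
by apply/derivable1_diffP; exact: derivable_sin.
Qed.

Definition e13 : Z6 := zv 1 0.
Definition e24 : Z6 := zv 0 1.
(** dD^2 as a trigonometric polynomial, by 2 sin^2 (t / 2) = 1 - cos t. It is smooth, while [dD] is
    not differentiable at its zeros. *)
Definition sqD z : R := 1 - 1 / 2 * cosK e13 z - 1 / 2 * cosK e24 z.

Lemma ph_e13 z : ph e13 z = x3 z - x1 z.
Proof. by rewrite /ph /e13 /zv /kx1 /kx2 /kx3 /kx4 /ky1 /ky2/=; ring. Qed.
Lemma ph_e24 z : ph e24 z = x4 z - x2 z.
Proof. by rewrite /ph /e24 /zv /kx1 /kx2 /kx3 /kx4 /ky1 /ky2/=; ring. Qed.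

Lemma cos_half (x : R) : cos x = 1 - 2 * sin (x / 2) ^+ 2.
Proof.
have -> : cos x = cos (x / 2 + x / 2) by congr cos; field.
by rewrite cosD -!expr2 cos2sin2; ring.
Qed.

Lemma sqD_sin z : sqD z = sin ((x3 z - x1 z) / 2) ^+ 2 + sin ((x4 z - x2 z) / 2) ^+ 2.
Proof. by rewrite /sqD /cosK ph_e13 ph_e24 !cos_half; field. Qed.
Lemma sqD_ge0 z : 0 <= sqD z. Proof. by rewrite sqD_sin addr_ge0 ?sqr_ge0. Qed.
Lemma dD_sqrt z : dD z = Num.sqrt (sqD z). Proof. by rewrite /dD sqD_sin. Qed.
Lemma sqr_dD z : dD z ^+ 2 = sqD z. Proof. by rewrite dD_sqrt sqr_sqrtr// sqD_ge0. Qed.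

Definition dsqD v z : R := 1 / 2 * (ph e13 v * sinK e13 z) + 1 / 2 * (ph e24 v * sinK e24 z).

Lemma is_derive_sqD z v : is_derive z v sqD (dsqD v z).
Proof.
have h K := is_derive_cosK K z v.
have := is_deriveB (is_deriveB (is_derive_cst (1 : R) z v) (is_deriveZ (1 / 2) (h e13)))
  (is_deriveZ (1 / 2) (h e24)).
by move=> H; apply: (is_derive_eq H); rewrite /dsqD /GRing.scale/=; ring.
Qed.
Lemma differentiable_sqD z : differentiable sqD z.
Proof.
by apply: differentiableB; [apply: differentiableB; [exact: differentiable_cst|
  exact/differentiableZ/differentiable_cosK]|exact/differentiableZ/differentiable_cosK].
Qed.

Lemma periodic_int (g : R -> R) (n : int) (x : R) : trigo.periodic g (pi *+ 2) ->
  g (x + n%:~R * (2 * pi)) = g x.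
Proof.
move=> gP; have H (m : nat) y : g (y + m%:R * (2 * pi)) = g y.
  rewrite -(periodicn gP m y); congr g; congr (_ + _).
  by rewrite -[RHS]mulr_natl -[pi *+ 2]mulr_natl.
case: n => m; first exact: H.
rewrite NegzE mulrNz mulNr -(H m.+1 (x - _)); congr g.
by rewrite (_ : m.+1%:~R = m.+1%:R) ?subrK.
Qed.

Section Algebra.
Variable d : R.
Hypothesis d0 : 0 < d.

(** A positive regularization of dD^2: its inverse root [rhoD] is smooth and periodic, hence may
    enter test functions. *)
Definition regD z : R := sqD z + d ^+ 2.
Lemma regD_gt0 z : 0 < regD z.
Proof. by rewrite ltr_wpDl ?sqD_ge0 ?exprn_gt0. Qed.
Definition rhoD z : R := (Num.sqrt (regD z))^-1.

Lemma sqrt_regD_gt0 z : 0 < Num.sqrt (regD z). Proof. by rewrite sqrtr_gt0 regD_gt0. Qed.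

Lemma differentiable_regD z : differentiable regD z.
Proof. by apply: differentiableD; [exact: differentiable_sqD|exact: differentiable_cst]. Qed.
Lemma is_derive_regD z v : is_derive z v regD (dsqD v z).
Proof.
have H := is_deriveD (is_derive_sqD z v) (is_derive_cst (d ^+ 2) z v).
by apply: (is_derive_eq H); rewrite addr0.
Qed.

Lemma is_derive_sqrt_regD z v :
  is_derive z v (fun z => Num.sqrt (regD z)) (dsqD v z * rhoD z / 2).
Proof.
have H := is_derive_comp1 (is_derive1_sqrt (regD_gt0 z)) (differentiable_regD z) (is_derive_regD z v).
by apply: (is_derive_eq H); rewrite /rhoD; field; rewrite lt0r_neq0// sqrt_regD_gt0.
Qed.
Lemma differentiable_sqrt_regD z : differentiable (fun z => Num.sqrt (regD z)) z.
Proof.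
apply: (@differentiable_comp _ _ _ _ regD Num.sqrt); first exact: differentiable_regD.
have [h _] := is_derive1_sqrt (regD_gt0 z); exact/derivable1_diffP.
Qed.
Lemma is_derive_rhoD z v : is_derive z v rhoD (- 1 / 2 * dsqD v z * (rhoD z * (rhoD z * rhoD z))).
Proof.
have n0 : Num.sqrt (regD z) != 0 by rewrite lt0r_neq0// sqrt_regD_gt0.
have Hg : is_derive (Num.sqrt (regD z)) 1 (fun y : R => y^-1) (- (Num.sqrt (regD z)) ^- 2).
  have dV : derivable (@id R) (Num.sqrt (regD z)) 1 by exact: derivable_id.
  apply: DeriveDef; first exact: derivableV.
  by rewrite deriveV// derive_id /GRing.scale/= mulr1.
have H := is_derive_comp1 Hg (differentiable_sqrt_regD z) (is_derive_sqrt_regD z v).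
by apply: (is_derive_eq H); rewrite /rhoD /GRing.scale/=; field.
Qed.
Lemma differentiable_rhoD z : differentiable rhoD z.
Proof.
have n0 : Num.sqrt (regD z) != 0 by rewrite lt0r_neq0// sqrt_regD_gt0.
apply: (@differentiable_comp _ _ _ _ (fun z => Num.sqrt (regD z)) GRing.inv).
  exact: differentiable_sqrt_regD.
by apply: differentiable_Rinv.
Qed.

(* Functions that are stable under all directional derivatives. *)
Inductive alg : (P -> R) -> Prop :=
| alg_cst c : alg (cst c)
| alg_cos K : alg (cosK K)
| alg_sin K : alg (sinK K)
| alg_rho : alg rhoD
| algD f g : alg f -> alg g -> alg (fun z => f z + g z)
| algM f g : alg f -> alg g -> alg (fun z => f z * g z).

Lemma eq_alg f g : (forall z, f z = g z) -> alg f -> alg g.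
Proof. by move=> /funext ->. Qed.

Lemma algZ c f : alg f -> alg (fun z => c * f z).
Proof. exact: (algM (alg_cst c)). Qed.

Lemma alg_dsqD v : alg (dsqD v).
Proof. by apply: algD; do 2 apply: algZ; exact: alg_sin. Qed.

Lemma alg_derive f : alg f -> (forall z, differentiable f z) /\ forall v, alg ('D_v f).
Proof.
elim => [c|K|K||f1 f2 _ [d1 a1] _ [d2 a2]|f1 f2 h1 [d1 a1] h2 [d2 a2]].
- split=> [z|v]; first exact: differentiable_cst.
  by apply: (eq_alg _ (alg_cst 0)) => z; rewrite derive_cst.
- split=> [z|v]; first exact: differentiable_cosK.
  apply: (eq_alg _ (algZ (- ph K v) (alg_sin K))) => z.
  by rewrite (@derive_val _ _ _ _ _ _ _ (is_derive_cosK K z v)).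
- split=> [z|v]; first exact: differentiable_sinK.
  apply: (eq_alg _ (algZ (ph K v) (alg_cos K))) => z.
  by rewrite (@derive_val _ _ _ _ _ _ _ (is_derive_sinK K z v)).
- split=> [z|v]; first exact: differentiable_rhoD.
  apply: (eq_alg _ (algM (algZ (- 1 / 2) (alg_dsqD v)) (algM alg_rho (algM alg_rho alg_rho)))) => z.
  by rewrite (@derive_val _ _ _ _ _ _ _ (is_derive_rhoD z v)).
- split=> [z|v]; first exact: (differentiableD (d1 z) (d2 z)).
  apply: (eq_alg _ (algD (a1 v) (a2 v))) => z.
  by rewrite (deriveD (diff_derivable (d1 z)) (diff_derivable (d2 z))).
- split=> [z|v]; first exact: (differentiableM (d1 z) (d2 z)).
  apply: (eq_alg _ (algD (algM h1 (a2 v)) (algM h2 (a1 v)))) => z.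
  by rewrite (deriveM (diff_derivable (d1 z)) (diff_derivable (d2 z))).
Qed.

Lemma alg_smooth f : alg f -> smooth f.
Proof.
move=> af s z; suff : alg (foldr (fun v g => 'D_v g) f s) by case/alg_derive.
by elim: s => [//|v s /alg_derive[_ H]]; exact: H.
Qed.

Lemma alg_periodic f : alg f -> periodic f.
Proof.
have C K v z : v \in xbasis ++ ybasis -> exists n : int, ph K (z + (2 * pi) *: v) = ph K z + n%:~R * (2 * pi).
  rewrite linearD linearZ/= => vb.
  suff [n ->] : exists n : int, ph K v = n%:~R by exists n; rewrite /GRing.scale/= mulrC.
  move: vb; rewrite !inE; do ![case/orP]; move=> /eqP ->.
  - by exists K.1.1.1; rewrite /ph /kx1 /x1 /x2 /x3 /x4 /y1 /y2 /=; ring.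
  - by exists K.1.1.2; rewrite /ph /kx2 /x1 /x2 /x3 /x4 /y1 /y2 /=; ring.
  - by exists K.1.2.1; rewrite /ph /kx3 /x1 /x2 /x3 /x4 /y1 /y2 /=; ring.
  - by exists K.1.2.2; rewrite /ph /kx4 /x1 /x2 /x3 /x4 /y1 /y2 /=; ring.
  - by exists K.2.1; rewrite /ph /ky1 /x1 /x2 /x3 /x4 /y1 /y2 /=; ring.
  - by exists K.2.2; rewrite /ph /ky2 /x1 /x2 /x3 /x4 /y1 /y2 /=; ring.
have Cc K v z : v \in xbasis ++ ybasis -> cosK K (z + (2 * pi) *: v) = cosK K z.
  by move=> vb; have [n E] := C K v z vb; rewrite /cosK E periodic_int//; exact: cosD2pi.
have Cs K v z : v \in xbasis ++ ybasis -> sinK K (z + (2 * pi) *: v) = sinK K z.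
  by move=> vb; have [n E] := C K v z vb; rewrite /sinK E periodic_int//; exact: sinD2pi.
move=> af; elim: af => [c|K|K||f1 f2 _ h1 _ h2|f1 f2 _ h1 _ h2] v z vb //=.
- exact: Cc.
- exact: Cs.
- by rewrite /rhoD /regD /sqD !Cc.
- by rewrite h1// h2.
- by rewrite h1// h2.
Qed.

Lemma alg_test f : alg f -> test_function f.
Proof. by move=> af; split; [exact: alg_smooth|exact: alg_periodic]. Qed.

End Algebra.
End Characters.

Import HBNNSimple.

(** * Square integrable functions *)

Section SquareIntegrable.
Context d (T : measurableType d) (R : realType) (mu : {finite_measure set T -> \bar R}).
Implicit Types (f g h : T -> R).

Definition intg f := mu.-integrable setT (EFin \o f).
Definition I f : R := \int[mu]_x f x.
Definition sqi f := measurable_fun setT f /\ intg (fun x => f x ^+ 2).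
Definition n2 f : R := I (fun x => f x ^+ 2).
Definition bmf f := measurable_fun setT f /\ exists M : R, forall x, `|f x| <= M.

Lemma intg_measurable f : intg f -> measurable_fun setT f.
Proof. by move=> /measurable_int/measurable_EFinP. Qed.

Lemma intg_le f g : measurable_fun setT f -> intg g -> (forall x, `|f x| <= g x) -> intg f.
Proof.
move=> mf ig fg; apply: (le_integrable measurableT _ _ ig); first exact/measurable_EFinP.
by move=> x _; rewrite /= lee_fin (le_trans (fg x))// ler_norm.
Qed.

Lemma intgD f g : intg f -> intg g -> intg (fun x => f x + g x).
Proof. by move=> fi gi; have := integrableD measurableT fi gi. Qed.
Lemma intgZ c f : intg f -> intg (fun x => c * f x).
Proof. by move=> fi; have := integrableZl measurableT c fi. Qed.
Lemma intgN f : intg f -> intg (fun x => - f x).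
Proof. by move=> /(intgZ (-1)); congr intg; apply/funext => x; rewrite mulN1r. Qed.
Lemma intgB f g : intg f -> intg g -> intg (fun x => f x - g x).
Proof. by move=> fi /intgN; exact: intgD. Qed.

Lemma ID f g : intg f -> intg g -> I (fun x => f x + g x) = I f + I g.
Proof. by move=> fi gi; rewrite /I RintegralD. Qed.
Lemma IZ c f : intg f -> I (fun x => c * f x) = c * I f.
Proof. by move=> fi; rewrite /I RintegralZl. Qed.
Lemma IN f : intg f -> I (fun x => - f x) = - I f.
Proof.
by move=> fi; rewrite -mulN1r -IZ//; congr I; apply/funext => x; rewrite mulN1r.
Qed.
Lemma IB f g : intg f -> intg g -> I (fun x => f x - g x) = I f - I g.
Proof. by move=> fi gi; rewrite ID ?IN//; exact: intgN. Qed.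
Lemma I_ge0 f : (forall x, 0 <= f x) -> 0 <= I f.
Proof. by move=> f0; apply: Rintegral_ge0. Qed.
Lemma I_le f g : intg f -> intg g -> (forall x, f x <= g x) -> I f <= I g.
Proof. by move=> fi gi fg; apply: le_Rintegral. Qed.
Lemma eq_I f g : (forall x, f x = g x) -> I f = I g.
Proof. by move=> fg; congr I; apply/funext. Qed.
Lemma bmf_cst c : bmf (cst c).
Proof. by split; [exact: measurable_cst|exists `|c|]. Qed.

Lemma bmf_intg f : bmf f -> intg f.
Proof.
move=> [mf [M fM]]; apply: measurable_bounded_integrable => //.
  exact: fin_num_fun_lty (fin_num_measure mu).
exists M; split; first exact: num_real.
by move=> N MN x _; exact: le_trans (fM x) (ltW MN).
Qed.

Lemma bmfD f g : bmf f -> bmf g -> bmf (fun x => f x + g x).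
Proof.
move=> [mf [M fM]] [mg [N gN]]; split; first exact: measurable_funD.
by exists (M + N) => x; apply: le_trans (ler_normD _ _) _; exact: lerD.
Qed.
Lemma bmfM f g : bmf f -> bmf g -> bmf (fun x => f x * g x).
Proof.
move=> [mf [M fM]] [mg [N gN]]; split; first exact: measurable_funM.
by exists (M * N) => x; rewrite normrM; apply: ler_pM.
Qed.
Lemma bmf_measurable f : bmf f -> measurable_fun setT f. Proof. by case. Qed.

Lemma intg_bmf f g : intg f -> bmf g -> intg (fun x => f x * g x).
Proof.
move=> fi [mg [M gM]]; have mf := intg_measurable fi.
have ai : intg (fun x => `|f x|).
  have := integrable_abse fi; congr (mu.-integrable _ _).
have M0 : 0 <= M by apply: le_trans (gM point).
apply: (intg_le (g := fun x => M * `|f x|)); first exact: measurable_funM.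
  exact: intgZ.
by move=> x; rewrite normrM mulrC ler_wpM2r.
Qed.

Lemma bmf_sqi f : bmf f -> sqi f.
Proof.
move=> bf; split; first exact: bmf_measurable.
by apply: bmf_intg; exact: (bmfM bf bf).
Qed.

Lemma sqiM f g : sqi f -> sqi g -> intg (fun x => f x * g x).
Proof.
move=> [mf fi] [mg gi]; apply: (intg_le (measurable_funM mf mg) (intgD fi gi)) => x.
rewrite normrM -(real_normK (num_real (f x))) -(real_normK (num_real (g x))).
have := sqr_ge0 (`|f x| - `|g x|); have := normr_ge0 (f x); have := normr_ge0 (g x); nra.
Qed.

Lemma sqi_intg f : sqi f -> intg f.
Proof.
move=> fs; have := sqiM fs (bmf_sqi (bmf_cst 1)).
by congr intg; apply/funext => x; rewrite /= mulr1.
Qed.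

Lemma sqi_bmf f g : sqi f -> bmf g -> sqi (fun x => f x * g x).
Proof.
move=> [mf fi] bg; split; first by apply: measurable_funM => //; case: bg.
have := intg_bmf fi (bmfM bg bg); congr intg; apply/funext => x; ring.
Qed.

Lemma sqiD f g : sqi f -> sqi g -> sqi (fun x => f x + g x).
Proof.
move=> fs gs; have [mf fi] := fs; have [mg gi] := gs; split; first exact: measurable_funD.
have := intgD (intgD fi gi) (intgZ 2 (sqiM fs gs)); congr intg; apply/funext => x; ring.
Qed.
Lemma sqiZ c f : sqi f -> sqi (fun x => c * f x).
Proof.
by move=> fs; have := sqi_bmf fs (bmf_cst c); congr sqi; apply/funext => x; rewrite mulrC.
Qed.
Lemma sqiB f g : sqi f -> sqi g -> sqi (fun x => f x - g x).
Proof.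
by move=> fs /(sqiZ (-1)) gs; have := sqiD fs gs; congr sqi; apply/funext => x; rewrite mulN1r.
Qed.

Lemma n2_ge0 f : 0 <= n2 f. Proof. by apply: I_ge0 => x; exact: sqr_ge0. Qed.

Lemma n2D f g : sqi f -> sqi g -> n2 (fun x => f x + g x) = n2 f + 2 * I (fun x => f x * g x) + n2 g.
Proof.
move=> fs gs; rewrite /n2 -IZ; last exact: sqiM.
rewrite -ID; [|by case: fs|exact/intgZ/sqiM].
rewrite -ID; [|apply: intgD; [by case: fs|exact/intgZ/sqiM]|by case: gs].
by apply: eq_I => x; ring.
Qed.
Lemma n2Z c f : sqi f -> n2 (fun x => c * f x) = c ^+ 2 * n2 f.
Proof. by move=> [_ fs]; rewrite /n2 -IZ//; apply: eq_I => x; ring. Qed.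

Lemma n2D_le f g : sqi f -> sqi g -> n2 (fun x => f x + g x) <= 2 * n2 f + 2 * n2 g.
Proof.
move=> fs gs; have := n2_ge0 (fun x => f x + (-1) * g x).
rewrite !n2D//; last exact: sqiZ.
rewrite n2Z// (_ : I (fun x => f x * (-1 * g x)) = - I (fun x => f x * g x)); first by lra.
by rewrite -IN; [apply: eq_I => x; ring|exact: sqiM].
Qed.

Lemma CS f g : sqi f -> sqi g -> I (fun x => f x * g x) ^+ 2 <= n2 f * n2 g.
Proof.
move=> fs gs; set c := I _.
have H t : 0 <= n2 f + 2 * (t * c) + t ^+ 2 * n2 g.
  have := n2_ge0 (fun x => f x + t * g x); rewrite n2D//; last exact: sqiZ.
  rewrite n2Z// (_ : I (fun x => f x * (t * g x)) = t * c)//.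
  by rewrite -IZ; [apply: eq_I => x; ring|exact: sqiM].
have f0 := n2_ge0 f; have := n2_ge0 g; rewrite le_eqVlt => /predU1P[g0|g0].
  have [->|cn] := eqVneq c 0; first by rewrite expr0n mulr_ge0// n2_ge0.
  have := H (- (n2 f + 1) / (2 * c)); rewrite -g0 mulr0 addr0.
  by rewrite (_ : 2 * (_ * c) = - (n2 f + 1)); [lra|field].
have := H (- c / n2 g).
rewrite (_ : _ + _ = n2 f - c ^+ 2 / n2 g); last by field; rewrite lt0r_neq0.
by rewrite subr_ge0 ler_pdivrMr.
Qed.

(* As [g] may be non-measurable, the junk values of a derivative of [dD * phi] on
   the null set {dD = 0} can be ignored. *)
Lemma I_ae (N : set T) f g : measurable N -> mu N = 0%E -> measurable_fun setT f ->
  (forall x, ~ N x -> f x = g x) -> I f = I g.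
Proof.
move=> mN N0 mf fg.
pose nnint (F : T -> \bar R) := ereal_sup [set sintegral mu h |
    h in [set h : {nnsfun T >-> R} | forall x, ((h x)%:E <= F x)%E]].
have nn (F G : T -> \bar R) : (forall x, ~ N x -> F x = G x) -> (forall x, 0 <= F x)%E ->
    (forall x, 0 <= G x)%E -> (nnint F <= nnint G)%E.
  move=> FG F0 G0; apply: ge_ereal_sup => _ [h hF <-].
  (* A simple function below F is set to 0 on N; its integral does not change, and it now lies below
     G. *)
  pose k := proj_nnsfun h (measurableC mN).
  have kE x : k x = h x * (x \in ~` N)%:R by rewrite /k /proj_nnsfun/= mindicE.
  have -> : sintegral mu h = sintegral mu k.
    rewrite -!integralT_nnsfun.
    have hk (l : {nnsfun T >-> R}) : (\int[mu]_x (l x)%:E = \int[mu]_(x in setT `\` N) (l x)%:E)%E.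
      apply: ge0_negligible_integral => //; first exact/measurable_EFinP.
      by move=> x _; rewrite lee_fin.
    rewrite (hk h) (hk k).
    apply: eq_integral => x; rewrite inE => -[_ Nx].
    by rewrite kE mem_set// mulr1.
  apply: ereal_sup_ubound; exists k => // x.
  rewrite kE; have [Nx|Nx] := pselect (N x).
    by rewrite memNset ?mulr0//; exact: G0.
  by rewrite mem_set// mulr1 -FG.
rewrite /I /Rintegral; congr fine.
have E (F : T -> \bar R) : (\int[mu]_x F x)%E = (nnint (F ^\+)%E - nnint (F ^\-)%E)%E.
  by rewrite /integral /nnint !patch_setT.
rewrite !E; congr (_ - _)%E; apply/le_anti/andP; split; apply: nn => // x Nx;
by rewrite ?funeposE ?funenegE fg.
Qed.

Lemma EFin_I f : intg f -> ((I f)%:E = \int[mu]_x (f x)%:E)%E.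
Proof. by move=> fi; rewrite /I /Rintegral fineK//; exact: integrable_fin_num. Qed.

Lemma normL2E f : sqi f -> ('N[mu]_2%:E[EFin \o f] = (Num.sqrt (n2 f))%:E)%E.
Proof.
move=> [mf fi].
have E : ('N[mu]_2%:E[EFin \o f] `^ 2 = (n2 f)%:E)%E.
  rewrite powR_Lnorm ?pnatr_eq0// /n2 EFin_I//; apply: eq_integral => x _ /=.
  by rewrite powR_mulrn ?normr_ge0// real_normK ?num_real.
have <- : (('N[mu]_2%:E[EFin \o f] `^ 2) `^ 2^-1 = 'N[mu]_2%:E[EFin \o f])%E.
  by rewrite -poweRrM divff ?pnatr_eq0// poweRe1// Lnorm_ge0.
by rewrite E poweR12_sqrt ?lee_fin ?n2_ge0.
Qed.

Lemma Lfun_sqi f : f \in Lfun mu 2%:E <-> sqi f.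
Proof.
split=> [fL|fs].
  split; last exact: Lfun2_integrable_sqr.
  by have := sub_Lfun_mfun fL; rewrite inE.
rewrite inE; apply/andP; split; rewrite inE /=; first by case: fs.
by rewrite /finite_norm normL2E// ltry.
Qed.

(** With the rate 8^-n the series of 4^n |p_(n+1) - p_n|^2 is integrable, hence finite off a null
    set N. Its sum [fh] bounds the increments by sqrt(fh) / 2^n, so the sequence converges pointwise
    off N, and integrating the tail gives the rate 4^-n. *)
Lemma riesz_fischer (p : nat -> T -> R) (A : R) : (forall n, sqi (p n)) -> 0 <= A ->
  (forall n, n2 (fun x => p n.+1 x - p n x) <= A / 8 ^+ n) ->
  exists2 g, sqi g & forall n, n2 (fun x => p n x - g x) <= 8 * A / 4 ^+ n.
Proof.
move=> ps A0 pA; pose dp n x := p n.+1 x - p n x.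
have ds n : sqi (dp n) by exact: sqiB.
pose H n x := (4 ^+ n * dp n x ^+ 2)%:E.
have H0 n x : (0 <= H n x)%E.
  by rewrite lee_fin; apply: mulr_ge0; [exact: exprn_ge0|exact: sqr_ge0].
have Hi n : mu.-integrable setT (H n) by have := intgZ (4 ^+ n) (ds n).2.
have mH n : measurable_fun setT (H n) by exact: measurable_int (Hi n).
pose h x := (\sum_(n <oo) H n x)%E.
have mh : measurable_fun setT h by apply: ge0_emeasurable_sum => // n x _ _; exact: H0.
have h0 x : (0 <= h x)%E by apply: nneseries_ge0 => n _ _; exact: H0.
have hA : (\int[mu]_x h x <= (2 * A)%:E)%E.
  rewrite /h integral_nneseries//.
  have le n : (\int[mu]_x H n x <= (A / 2 ^+ n)%:E)%E.
    rewrite -EFin_I; last by have := intgZ (4 ^+ n) (ds n).2.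
    rewrite lee_fin IZ; last exact: (ds n).2.
    apply: (le_trans (ler_wpM2l _ (pA n))); first exact: exprn_ge0.
    rewrite mulrCA ler_wpM2l// (_ : (8 : R) = 4 * 2) ?exprMn; last by ring.
    by rewrite invfM mulrA divff ?mul1r// expf_neq0.
  apply: (le_trans (lee_nneseries _ (fun n _ => le n))) => [n _ _|]; first exact: integral_ge0.
  rewrite le_eqVlt; apply/orP; left; apply/eqP; apply/cvg_lim => //.
  have E : (fun n => (\sum_(0 <= k < n) (A / 2 ^+ k)%:E)%E) = EFin \o series (geometric A 2^-1).
    apply/funext => n; rewrite /series /= -sumEFin; apply: eq_bigr => k _.
    by rewrite exprVn.
  have -> : 2 * A = A * (1 - 2^-1)^-1 by field.
  rewrite E; apply: cvg_EFin; first by apply: nearW.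
  by apply: cvg_geometric_series; rewrite ger0_norm ?invf_lt1//; lra.
have hi : mu.-integrable setT h.
  apply/integrableP; split=> //; under eq_integral do rewrite gee0_abs//.
  exact: le_lt_trans hA (ltry _).
have [N [mN N0 Nh]] := integrable_ae measurableT hi.
have hfin x : ~ N x -> h x \is a fin_num.
  by move=> Nx; apply: contrapT => hx; apply: Nx; apply: Nh => /(_ Logic.I).
pose fh x := fine (h x).
have fh0 x : 0 <= fh x by exact: fine_ge0.
have mfh : measurable_fun setT fh by exact: measurableT_comp.
have fhh x : ((fh x)%:E <= h x)%E.
  by rewrite /fh; move: (h0 x); case: (h x) => //=; rewrite ?lexx.
have fhi : intg fh.
  apply/integrableP; split; first exact/measurable_EFinP.
  apply: le_lt_trans (le_lt_trans hA (ltry _)); apply: ge0_le_integral => //.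
    by apply/measurable_EFinP; exact: measurableT_comp.
  by move=> x _; rewrite /= ger0_norm.
have fhA : I fh <= 2 * A.
  rewrite -lee_fin EFin_I//; apply: le_trans hA; apply: ge0_le_integral => //.
  - by move=> x _; rewrite lee_fin.
  - exact/measurable_EFinP.
pose s x := Num.sqrt (fh x).
have ddp n x : ~ N x -> `|dp n x| <= s x / 2 ^+ n.
  move=> Nx; rewrite -(@ler_pXn2r _ 2) ?nnegrE//; last by rewrite divr_ge0 ?sqrtr_ge0 ?exprn_ge0.
  rewrite real_normK ?num_real// expr_div_n sqr_sqrtr// ler_pdivlMr ?exprn_gt0// -exprM mulnC exprM.
  rewrite (_ : 2 ^+ 2 = 4 :> R); last by ring.
  rewrite -lee_fin /fh fineK ?hfin// mulrC.
  rewrite /h (@nneseriesD1 R (fun n => H n x) n xpredT)//=.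
  by rewrite leeDl// nneseries_ge0.
have tail n k x : ~ N x -> `|p (n + k)%N x - p n x| <= s x * (2 / 2 ^+ n - 2 / 2 ^+ (n + k)).
  move=> Nx; elim: k => [|k IH]; first by rewrite addn0 !subrr normr0 mulr0.
  rewrite addnS (_ : p (n + k).+1 x - p n x = dp (n + k)%N x + (p (n + k)%N x - p n x)); last first.
    by rewrite /dp; ring.
  apply: le_trans (ler_normD _ _) _; apply: le_trans (lerD (ddp _ _ Nx) IH) _.
  rewrite le_eqVlt; apply/orP; left; apply/eqP; rewrite [2 ^+ (n + k).+1]exprS.
  by field; rewrite !expf_neq0.
have s0 x : 0 <= s x by exact: sqrtr_ge0.
have tail2 n k x : ~ N x -> `|p (n + k)%N x - p n x| <= 2 * s x / 2 ^+ n.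
  move=> Nx; apply: (le_trans (tail n k x Nx)); rewrite mulrBr [2 * s x]mulrC mulrA gerBl.
  by rewrite mulr_ge0// divr_ge0// exprn_ge0.
(* Set to 0 on N, the sequence converges everywhere, which makes the limit measurable. *)
pose q n x := p n x * \1_(~` N) x.
have qN n x : N x -> q n x = 0 by move=> Nx; rewrite /q indicE memNset ?mulr0// => /(_ Nx).
have qE n x : ~ N x -> q n x = p n x by move=> Nx; rewrite /q indicE mem_set ?mulr1.
have cq x : cvgn (q ^~ x).
  have [Nx|Nx] := pselect (N x).
    by rewrite (_ : q ^~ x = cst 0); [exact: is_cvg_cst|apply/funext => n; exact: qN].
  rewrite (_ : q ^~ x = (fun n => p 0%N x + series (dp ^~ x) n)); last first.
    apply/funext => n; rewrite qE//; elim: n => [|n IH].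
      by rewrite /series /= big_geq// addr0.
    by rewrite /series /= big_nat_recr//= addrA -/(series (dp ^~ x) n) -IH /dp; ring.
  apply: is_cvgD; first exact: is_cvg_cst.
  apply: normed_cvg; apply: nondecreasing_is_cvgn.
    by apply: nondecreasing_series => n _ _; exact: normr_ge0.
  exists (2 * s x) => _ [n _ <-]; rewrite /series /=.
  apply: (@le_trans _ _ (s x * (2 - 2 / 2 ^+ n))); last first.
    by rewrite mulrC ler_wpM2r// gerBl divr_ge0// exprn_ge0.
  rewrite /series/=; elim: n => [|n IH]; first by rewrite big_geq// expr0 divr1 subrr mulr0.
  rewrite big_nat_recr//=; apply: le_trans (lerD IH (ddp n x Nx)) _.
  rewrite le_eqVlt; apply/orP; left; apply/eqP; rewrite [2 ^+ n.+1]exprS.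
  by field; rewrite !expf_neq0.
pose g x := limn (q ^~ x).
have mq n : measurable_fun setT (q n).
  apply: measurable_funM; first by case: (ps n).
  by apply: measurable_indic; exact: measurableC.
have mg : measurable_fun setT g by apply: (measurable_fun_cvg mq) => x _; exact: cq.
have gN x : N x -> g x = 0.
  move=> Nx; rewrite /g (_ : q ^~ x = cst 0); first by apply/cvg_lim => //; exact: cvg_cst.
  by apply/funext => n; exact: qN.
have pg n x : ~ N x -> `|p n x - g x| <= 2 * s x / 2 ^+ n.
  move=> Nx; have c1 : (fun k => `|p n x - q (k + n)%N x|) @ \oo --> `|p n x - g x|.
    have c0 : (fun k => q (k + n)%N x) @ \oo --> g x.
      by move: (cq x); rewrite -(cvg_shiftn n).
    exact: (cvg_norm (cvgB (cvg_cst (p n x)) c0)).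
  apply: (ler_cvg_to c1 (cvg_cst (2 * s x / 2 ^+ n))); apply: nearW => k.
  by rewrite qE// distrC addnC; exact: tail2.
have sq_s n x : (2 * s x / 2 ^+ n) ^+ 2 = 4 / 4 ^+ n * fh x.
  rewrite expr_div_n exprMn sqr_sqrtr// -exprM mulnC exprM.
  by rewrite (_ : 2 ^+ 2 = 4 :> R); [field; rewrite expf_neq0|ring].
have sqle (x y : R) : `|x| <= y -> x ^+ 2 <= y ^+ 2.
  by move=> xy; rewrite -(real_normK (num_real x)) ler_pXn2r// nnegrE (le_trans _ xy).
have gs : sqi g.
  split=> //; apply: (intg_le (g := fun x => 2 * p 0%N x ^+ 2 + 8 * fh x)).
  - exact: measurable_funX.
  - by apply: intgD; apply: intgZ => //; case: (ps 0%N).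
  move=> x; rewrite ger0_norm ?sqr_ge0//; have [Nx|Nx] := pselect (N x).
    by rewrite gN// expr0n/= addr_ge0// mulr_ge0// sqr_ge0.
  have := sqle _ _ (pg 0%N x Nx); rewrite sq_s expr0 divr1.
  by have := sqr_ge0 (2 * p 0%N x - g x); rewrite !expr2; nra.
exists g => // n.
have Gi : intg (fun x => (p n x - g x) ^+ 2) by case: (sqiB (ps n) gs).
have mI : measurable_fun setT (fun x => (p n x - g x) ^+ 2 * \1_(~` N) x).
  by apply: measurable_funM; [exact: intg_measurable Gi|exact: measurable_indic (measurableC mN)].
have le4 x : (p n x - g x) ^+ 2 * \1_(~` N) x <= 4 / 4 ^+ n * fh x.
  rewrite indicE; have [Nx|Nx] := pselect (N x).
    by rewrite memNset ?mulr0// ?mulr_ge0 ?divr_ge0 ?exprn_ge0// => /(_ Nx).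
  by rewrite mem_set// mulr1 -sq_s; apply: sqle; exact: pg.
rewrite /n2 (@I_ae N _ (fun x => (p n x - g x) ^+ 2 * \1_(~` N) x) mN N0); last 2 first.
- exact: intg_measurable Gi.
- by move=> x Nx; rewrite indicE mem_set// mulr1.
apply: (@le_trans _ _ (I (fun x => 4 / 4 ^+ n * fh x))).
  apply: I_le => //; last exact: intgZ.
  apply: (intg_le mI (intgZ (4 / 4 ^+ n) fhi)) => x.
  by rewrite ger0_norm ?le4// mulr_ge0 ?sqr_ge0// indicE.
rewrite IZ// (_ : 8 * A / 4 ^+ n = 4 / 4 ^+ n * (2 * A)); last by ring.
by rewrite ler_wpM2l// divr_ge0// exprn_ge0.
Qed.

End SquareIntegrable.

(** * Measurability of functions of several variables *)

Section CaratheodoryFunctions.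
Context d (T : measurableType d) (R : realType).

(* F (c t) t is the limit of F (floor (n c t) / n) t. *)
Lemma measurable_caratheodory (c : T -> R) (F : R -> T -> R) : measurable_fun setT c ->
  (forall x, measurable_fun setT (F x)) -> (forall t, continuous (F ^~ t)) ->
  measurable_fun setT (fun t => F (c t) t).
Proof.
move=> mc mF cF.
pose q (n : nat) (x : R) : R := (Num.floor (n.+1%:R * x))%:~R / n.+1%:R.
have qx x : q n x @[n --> \oo] --> x.
  apply/cvgrPdist_le => e e0.
  have H : \forall n \near \oo, n.+1%:R^-1 <= e.
    have /cvgrPdist_le /(_ e e0) := @cvg_harmonic R.
    apply: filterS => n; rewrite sub0r normrN /harmonic /=.
    by rewrite ger0_norm ?invr_ge0.
  apply: filterS H => n He; apply: le_trans He; rewrite /q.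
  have n0 : 0 < n.+1%:R :> R by rewrite ltr0n.
  rewrite (_ : x - _ = (n.+1%:R * x - (Num.floor (n.+1%:R * x))%:~R) / n.+1%:R); last first.
    by field; rewrite lt0r_neq0.
  have /andP[h1 h2] := floor_itv (n.+1%:R * x).
  rewrite normrM normfV [`|n.+1%:R|]ger0_norm// ger0_norm ?subr_ge0//.
  by rewrite ler_piMl ?invr_ge0// lerBlDl; move: h2; rewrite intrD; lra.
apply: (@measurable_fun_cvg _ _ _ setT (fun n t => F (q n (c t)) t)) => [n|t _]; last first.
  exact: (cvg_comp _ _ (qx (c t)) (cF t (c t))).
move=> _ Y mY; rewrite setTI.
have -> : (fun t => F (q n (c t)) t) @^-1` Y = \bigcup_(k in [set: int])
    ([set t | k%:~R <= n.+1%:R * c t < (k + 1)%:~R] `&` F (k%:~R / n.+1%:R) @^-1` Y).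
  apply/seteqP; split=> [t Yt|t [k _ [/= kt Yt]]].
    exists (Num.floor (n.+1%:R * c t)) => //; split => //=.
    exact: floor_itv _.
  by rewrite /preimage /= /q (floor_def kt).
apply: countable_bigcupT_measurable => [|k]; first exact: countableP.
apply: measurableI; last by rewrite -[X in measurable X]setTI; exact: mF.
have mnc : measurable_fun setT (fun t => n.+1%:R * c t) by exact: measurable_funM.
have := mnc measurableT `[k%:~R, (k + 1)%:~R[%classic (measurable_itv _).
rewrite setTI; congr measurable; apply/seteqP; split=> t /=; by rewrite in_itv.
Qed.

End CaratheodoryFunctions.

(** * Periodic functions and integration by parts on the torus *)

Section Torus.
Variable R : realType.
Notation P := (point6 R).
Notation mR := (measurableTypeR R).
Notation mP := (point6 mR).
Notation mu := (muT6 R).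
Implicit Types (F G : P -> R) (v z : P).

Lemma point_eq z w : x1 z = x1 w -> x2 z = x2 w -> x3 z = x3 w -> x4 z = x4 w ->
  y1 z = y1 w -> y2 z = y2 w -> z = w.
Proof.
case: z w => -[[a b] [c e]] [g h] [[[a' b'] [c' e']] [g' h']].
by rewrite /x1 /x2 /x3 /x4 /y1 /y2 /= => -> -> -> -> -> ->.
Qed.

Lemma coordD z w : (x1 (z + w) = x1 z + x1 w) * (x2 (z + w) = x2 z + x2 w) *
  (x3 (z + w) = x3 z + x3 w) * (x4 (z + w) = x4 z + x4 w) *
  (y1 (z + w) = y1 z + y1 w) * (y2 (z + w) = y2 z + y2 w).
Proof. by []. Qed.
Lemma coordZ (c : R) w : (x1 (c *: w) = c * x1 w) * (x2 (c *: w) = c * x2 w) *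
  (x3 (c *: w) = c * x3 w) * (x4 (c *: w) = c * x4 w) *
  (y1 (c *: w) = c * y1 w) * (y2 (c *: w) = c * y2 w).
Proof. by []. Qed.

Lemma measurable_coordinates : [/\ measurable_fun setT (@x1 R : mP -> mR),
  measurable_fun setT (@x2 R : mP -> mR), measurable_fun setT (@x3 R : mP -> mR) &
  measurable_fun setT (@x4 R : mP -> mR)] /\ measurable_fun setT (@y1 R : mP -> mR) /\
  measurable_fun setT (@y2 R : mP -> mR).
Proof.
have f1 d d1 d2 (T : measurableType d) (T1 : measurableType d1) (T2 : measurableType d2)
    (f : T -> T1 * T2) : measurable_fun setT f ->
    measurable_fun setT (fun t => (f t).1) /\ measurable_fun setT (fun t => (f t).2).
  by move=> mf; split; [exact: (measurableT_comp measurable_fst)|exact: (measurableT_comp measurable_snd)].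
have [a b] := f1 _ _ _ _ _ _ (@id mP) (@measurable_id _ mP setT).
have [c e] := f1 _ _ _ _ _ _ _ a; have [h1 h2] := f1 _ _ _ _ _ _ _ c.
have [h3 h4] := f1 _ _ _ _ _ _ _ e; have [h5 h6] := f1 _ _ _ _ _ _ _ b.
by split; [split|split].
Qed.

(** The domain carries the product sigma-algebra. Coordinates are released one at a time, from y2
    back to x1, each by [measurable_caratheodory]. *)
Lemma continuous_measurable6 F : continuous F -> measurable_fun setT (F : mP -> mR).
Proof.
move=> cF; pose M (a1 a2 a3 a4 a5 a6 : R) := F (((a1, a2), (a3, a4)), (a5, a6)).
have [[m1 m2 m3 m4] [m5 m6]] := measurable_coordinates.
have cc (A B C : normedModType R) (f : A -> B) (g : A -> C) a :
    {for a, continuous f} -> {for a, continuous g} -> {for a, continuous (fun t => (f t, g t))}.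
  by move=> cf cg; exact: cvg_pair.
have ck (A B : normedModType R) (b : B) (a : A) : {for a, continuous (fun _ : A => b)}.
  exact: cvg_cst.
have ci (a : R) : {for a, continuous (fun x : R => x)} by exact: cvg_id.
have co (f : R -> P) : (forall a, {for a, continuous f}) -> continuous (fun x => F (f x)).
  by move=> cf a; apply: (cvg_comp _ _ (cf a) (cF (f a))).
have s6 a1 a2 a3 a4 a5 : measurable_fun setT (fun z : mP => M a1 a2 a3 a4 a5 (y2 z)).
  apply: (measurable_caratheodory m6 (F := fun x _ => M a1 a2 a3 a4 a5 x)) => [x|t].
    exact: measurable_cst.
  by apply: co => a; apply: (cc _ _ _ _ _ _); [exact: ck|apply: (cc _ _ _ _ _ _); [exact: ck|exact: ci]].
have s5 a1 a2 a3 a4 : measurable_fun setT (fun z : mP => M a1 a2 a3 a4 (y1 z) (y2 z)).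
  apply: (measurable_caratheodory m5 (F := fun x z => M a1 a2 a3 a4 x (y2 z))) => [x|t]; first exact: s6.
  by apply: co => a; apply: (cc _ _ _ _ _ _); [exact: ck|apply: (cc _ _ _ _ _ _); [exact: ci|exact: ck]].
have s4 a1 a2 a3 : measurable_fun setT (fun z : mP => M a1 a2 a3 (x4 z) (y1 z) (y2 z)).
  apply: (measurable_caratheodory m4 (F := fun x z => M a1 a2 a3 x (y1 z) (y2 z))) => [x|t]; first exact: s5.
  by apply: co => a; apply: (cc _ _ _ _ _ _); [apply: (cc _ _ _ _ _ _); [exact: ck|apply: (cc _ _ _ _ _ _); [exact: ck|exact: ci]]|exact: ck].
have s3 a1 a2 : measurable_fun setT (fun z : mP => M a1 a2 (x3 z) (x4 z) (y1 z) (y2 z)).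
  apply: (measurable_caratheodory m3 (F := fun x z => M a1 a2 x (x4 z) (y1 z) (y2 z))) => [x|t]; first exact: s4.
  by apply: co => a; apply: (cc _ _ _ _ _ _); [apply: (cc _ _ _ _ _ _); [exact: ck|apply: (cc _ _ _ _ _ _); [exact: ci|exact: ck]]|exact: ck].
have s2 a1 : measurable_fun setT (fun z : mP => M a1 (x2 z) (x3 z) (x4 z) (y1 z) (y2 z)).
  apply: (measurable_caratheodory m2 (F := fun x z => M a1 x (x3 z) (x4 z) (y1 z) (y2 z))) => [x|t]; first exact: s3.
  by apply: co => a; apply: (cc _ _ _ _ _ _); [apply: (cc _ _ _ _ _ _); [apply: (cc _ _ _ _ _ _); [exact: ck|exact: ci]|exact: ck]|exact: ck].
have s1 : measurable_fun setT (fun z : mP => M (x1 z) (x2 z) (x3 z) (x4 z) (y1 z) (y2 z)).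
  apply: (measurable_caratheodory m1 (F := fun x z => M x (x2 z) (x3 z) (x4 z) (y1 z) (y2 z))) => [x|t]; first exact: s2.
  by apply: co => a; apply: (cc _ _ _ _ _ _); [apply: (cc _ _ _ _ _ _); [apply: (cc _ _ _ _ _ _); [exact: ci|exact: ck]|exact: ck]|exact: ck].
by move: s1; congr measurable_fun; apply/funext => -[[[? ?] [? ?]] [? ?]].
Qed.

Lemma periodic_intmul F v z (n : int) : periodic F -> v \in xbasis ++ ybasis ->
  F (z + (n%:~R * (2 * pi)) *: v) = F z.
Proof.
move=> pF vb; have H (m : nat) w : F (w + (m%:R * (2 * pi)) *: v) = F w.
  elim: m w => [|m IH] w; first by rewrite mul0r scale0r addr0.
  by rewrite -natr1 mulrDl mul1r scalerDl addrA pF// IH.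
case: n => m; first exact: H.
rewrite NegzE mulrNz mulNr scaleNr -(H m.+1 (z - _)); congr F.
by rewrite (_ : m.+1%:~R = m.+1%:R :> R)// subrK.
Qed.

(** Every point is moved into the compact cell by integer multiples of the periods. *)
Lemma periodic_bounded F : continuous F -> periodic F -> exists M : R, forall z, `|F z| <= M.
Proof.
move=> cF pF; pose J : set R := `[0, 2 * pi]%classic.
have cJ : compact J by exact: segment_compact.
pose C : set P := ((J `*` J) `*` (J `*` J)) `*` (J `*` J).
have cC : compact C by do 3?apply: compact_setX => //; apply: compact_setX => //; apply: compact_setX.
have : bounded_set (F @` C).
  by apply: compact_bounded; apply: continuous_compact => //; exact: continuous_subspaceT.
move=> [M [_ HM]]; exists (M + 1) => z.
have pi0 : 0 < 2 * pi :> R by rewrite mulr_gt0// pi_gt0.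
pose fl (x : R) : int := - Num.floor (x / (2 * pi)).
have red (x : R) : J (x + (fl x)%:~R * (2 * pi)).
  rewrite /J /= in_itv/= /fl intrN mulNr.
  have /andP[h1 h2] := floor_itv (x / (2 * pi)).
  move: h1 h2; rewrite ler_pdivlMr// ltr_pdivrMr// intrD mulrDl mul1r => h1 h2.
  by apply/andP; split; lra.
pose z' := z + ((fl (x1 z))%:~R * (2 * pi)) *: ex1 + ((fl (x2 z))%:~R * (2 * pi)) *: ex2
  + ((fl (x3 z))%:~R * (2 * pi)) *: ex3 + ((fl (x4 z))%:~R * (2 * pi)) *: ex4
  + ((fl (y1 z))%:~R * (2 * pi)) *: ey1 + ((fl (y2 z))%:~R * (2 * pi)) *: ey2.
have -> : F z = F z' by rewrite /z' !periodic_intmul// !inE ?eqxx ?orbT.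
apply: (HM (M + 1)); first by rewrite ltrDl.
exists z' => //.
have E (w : P) (n1 n2 n3 n4 n5 n6 : R) : w + n1 *: ex1 + n2 *: ex2 + n3 *: ex3 + n4 *: ex4
    + n5 *: ey1 + n6 *: ey2 = (((x1 w + n1, x2 w + n2), (x3 w + n3, x4 w + n4)), (y1 w + n5, y2 w + n6)).
  by apply: point_eq; rewrite !(coordD, coordZ) /x1 /x2 /x3 /x4 /y1 /y2 /=; ring.
by rewrite /z' E; split; [split; split|split]; exact: red.
Qed.

Lemma periodic_bmf F : continuous F -> periodic F -> bmf (F : mP -> R).
Proof.
by move=> cF pF; split; [exact: continuous_measurable6|exact: periodic_bounded].
Qed.

Lemma integral_muT (g : mR -> R) : intg (muT R) g ->
  (\int[muT R]_x (g x)%:E = \int[lebesgue_measure]_(x in `[0%R, (2 * pi)%R]) (g x)%:E)%E.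
Proof.
move=> gi; pose N : set mR := ~` `[0, 2 * pi]%classic.
have mN : measurable N by apply: measurableC; exact: measurable_itv.
have N0 : muT R N = 0%E.
  by rewrite [LHS](_ : _ = lebR R (N `&` `[0, 2 * pi]%classic))// /N setICl measure0.
rewrite (negligible_integral mN measurableT gi N0) setTD /N setCK.
apply: eq_measure_integral => A mA AJ.
by rewrite [LHS](_ : _ = lebR R (A `&` `[0, 2 * pi]%classic))// (setIidl AJ).
Qed.

Lemma I_derive1 (g dg : R -> R) : (forall t : R, is_derive t 1 g (dg t)) -> continuous dg ->
  g (2 * pi) = g 0 -> intg (muT R) dg -> I (muT R) dg = 0.
Proof.
move=> gd cdg g0 gi; have pi0 : 0 < 2 * pi :> R by rewrite mulr_gt0// pi_gt0.
have cg : continuous g.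
  by move=> t; have [/derivable1_diffP/differentiable_continuous] := gd t.
rewrite /I /Rintegral integral_muT// (@continuous_FTC2 _ dg g)//.
- by rewrite g0 -EFinB subrr.
- exact: continuous_subspaceT.
- split; first by move=> t _; have [] := gd t.
    exact/cvg_at_right_filter/cg.
  exact/cvg_at_left_filter/cg.
- by move=> t _; rewrite derive1E (@derive_val _ _ _ _ _ _ _ (gd t)).
Qed.

Section Vanish.
Context d1 d2 (T1 : measurableType d1) (T2 : measurableType d2).
Variables (m1 : {finite_measure set T1 -> \bar R}) (m2 : {finite_measure set T2 -> \bar R}).
Variable G : T1 * T2 -> R.
Hypothesis bG : bmf G.

Lemma bmf_section1 y : bmf (fun x => G (x, y)).
Proof.
have [mG [M GM]] := bG; split; last by exists M => x; exact: GM.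
by apply: (measurableT_comp mG); exact: pair2_measurable.
Qed.
Lemma bmf_section2 x : bmf (fun y => G (x, y)).
Proof.
have [mG [M GM]] := bG; split; last by exists M => y; exact: GM.
by apply: (measurableT_comp mG); exact: pair1_measurable.
Qed.

Let Gi : (m1 \x m2)%E.-integrable setT (EFin \o G).
Proof. exact: (bmf_intg (fin_product m1 m2) bG). Qed.

Lemma I_vanish1 : (forall y, I m1 (fun x => G (x, y)) = 0) -> I (fin_product m1 m2) G = 0.
Proof.
move=> H; rewrite /I /Rintegral -[X in fine X](@integral21_prod_meas1 _ _ _ _ _ m1 m2 _ Gi).
rewrite integral0_eq// => y _.
by rewrite -[LHS]EFin_I ?H//; exact/bmf_intg/bmf_section1.
Qed.
Lemma I_vanish2 : (forall x, I m2 (fun y => G (x, y)) = 0) -> I (fin_product m1 m2) G = 0.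
Proof.
move=> H; rewrite /I /Rintegral -[X in fine X](@integral12_prod_meas1 _ _ _ _ _ m1 m2 _ Gi).
rewrite integral0_eq// => x _.
by rewrite -[LHS]EFin_I ?H//; exact/bmf_intg/bmf_section2.
Qed.

End Vanish.

Definition C1 F := [/\ forall z, differentiable F z, forall v, continuous ('D_v F) & periodic F].

Lemma derive_periodic F v : periodic F -> periodic ('D_v F).
Proof.
move=> pF w z wb.
have E : (fun h : R => h^-1 *: ((F \o shift (z + (2 * pi) *: w)) (h *: v) - F (z + (2 * pi) *: w))) =
    (fun h : R => h^-1 *: ((F \o shift z) (h *: v) - F z)).
  by apply/funext => h /=; rewrite addrA !pF.
by rewrite /derive E.
Qed.

Lemma C1_continuous F : C1 F -> continuous F.
Proof. by move=> [dF _ _] z; exact: differentiable_continuous. Qed.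
Lemma C1_bmf F : C1 F -> bmf (F : mP -> R).
Proof. by move=> cF; apply: periodic_bmf; [exact: C1_continuous|case: cF]. Qed.
Lemma C1_derive_bmf F v : C1 F -> bmf ('D_v F : mP -> R).
Proof. by move=> [_ cd pF]; apply: periodic_bmf => //; exact: derive_periodic. Qed.

Lemma C1_line F v z0 (t : R) : C1 F -> is_derive t 1 (fun s : R => F (s *: v + z0)) ('D_v F (t *: v + z0)).
Proof.
move=> [dF _ _]; have dv : derivable F (t *: v + z0) v by exact: diff_derivable.
have E : (fun h : R => h^-1 *: (((fun s : R => F (s *: v + z0)) \o shift t) (h *: 1) - F (t *: v + z0))) =
    (fun h => h^-1 *: ((F \o shift (t *: v + z0)) (h *: v) - F (t *: v + z0))).
  apply/funext => h /=; congr (_ *: (F _ - _)).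
  by rewrite scalerDl -addrA /GRing.scale/= mulr1.
by apply: DeriveDef; rewrite ?/derivable ?/derive E.
Qed.

Lemma C1_vanish_line F v z0 : v \in xbasis ++ ybasis -> C1 F ->
  bmf (fun t : mR => 'D_v F ((t : R) *: v + z0)) ->
  I (muT R) (fun t => 'D_v F (t *: v + z0)) = 0.
Proof.
move=> vb cF bF; apply: (@I_derive1 (fun s : R => F (s *: v + z0))).
- by move=> t; exact: (C1_line v z0 t cF).
- move=> t; have [_ cd _] := cF.
  apply: (cvg_comp (fun s : R => s *: v + z0) _ _ (cd v (t *: v + z0))).
  by apply: cvgD; [apply: cvgZr_tmp; exact: cvg_id|exact: cvg_cst].
- have [_ _ pF] := cF; rewrite scale0r add0r addrC; exact: pF.
- exact: bmf_intg.
Qed.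

(** Fubini's theorem with the variable of the direction v innermost: the integral of the derivative
    along a line over one period is zero. Each of the six cases selects the matching factor of the
    product measure. *)
Lemma I_derive F v : v \in xbasis ++ ybasis -> C1 F -> I mu ('D_v F) = 0.
Proof.
move=> vb cF; have bG := C1_derive_bmf v cF.
have L (p : mR -> mP) z0 : bmf (fun t => 'D_v F (p t)) -> (forall t : R, p t = t *: v + z0) ->
    I (muT R) (fun t => 'D_v F (p t)) = 0.
  move=> bp pE; have E : (fun t => 'D_v F (p t)) = (fun t : mR => 'D_v F ((t : R) *: v + z0)).
    by apply/funext => t; rewrite pE.
  by rewrite E; apply: C1_vanish_line => //; rewrite -E.
move: L bG; set G := 'D_v F => L bG.
have b1 y := bmf_section1 bG y; have b2 x := bmf_section2 bG x.
have V1 : (forall y, I (muT4 R) (fun x => G (x, y)) = 0) -> I mu G = 0.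
  exact: (@I_vanish1 _ _ _ _ (muT4 R) (muT2 R) G bG).
have V2 : (forall x, I (muT2 R) (fun y => G (x, y)) = 0) -> I mu G = 0.
  exact: (@I_vanish2 _ _ _ _ (muT4 R) (muT2 R) G bG).
have W1 (H : (mR * mR) * (mR * mR) -> R) (bH : bmf H) :
    (forall y, I (muT2 R) (fun x => H (x, y)) = 0) -> I (muT4 R) H = 0.
  exact: (@I_vanish1 _ _ _ _ (muT2 R) (muT2 R) H bH).
have W2 (H : (mR * mR) * (mR * mR) -> R) (bH : bmf H) :
    (forall x, I (muT2 R) (fun y => H (x, y)) = 0) -> I (muT4 R) H = 0.
  exact: (@I_vanish2 _ _ _ _ (muT2 R) (muT2 R) H bH).
have X1 (H : mR * mR -> R) (bH : bmf H) :
    (forall y, I (muT R) (fun x => H (x, y)) = 0) -> I (muT2 R) H = 0.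
  exact: (@I_vanish1 _ _ _ _ (muT R) (muT R) H bH).
have X2 (H : mR * mR -> R) (bH : bmf H) :
    (forall x, I (muT R) (fun y => H (x, y)) = 0) -> I (muT2 R) H = 0.
  exact: (@I_vanish2 _ _ _ _ (muT R) (muT R) H bH).
move: vb L; rewrite !inE => vb L.
do ![case/orP: vb => vb]; move/eqP: vb => vE; subst v.
- apply: V1 => y; apply: (W1 _ (b1 y)) => x34.
  have b3 := bmf_section1 (b1 y) x34; apply: (X1 _ b3) => a.
  case: x34 y b3 => [c e] [g h] b3.
  apply: (L _ (((0, a), (c, e)), (g, h))); first exact: (bmf_section1 b3 a).
  by move=> t; apply: point_eq; rewrite !(coordD, coordZ) /x1 /x2 /x3 /x4 /y1 /y2 /=; ring.
- apply: V1 => y; apply: (W1 _ (b1 y)) => x34.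
  have b3 := bmf_section1 (b1 y) x34; apply: (X2 _ b3) => a.
  case: x34 y b3 => [c e] [g h] b3.
  apply: (L _ (((a, 0), (c, e)), (g, h))); first exact: (bmf_section2 b3 a).
  by move=> t; apply: point_eq; rewrite !(coordD, coordZ) /x1 /x2 /x3 /x4 /y1 /y2 /=; ring.
- apply: V1 => y; apply: (W2 _ (b1 y)) => x12.
  have b3 := bmf_section2 (b1 y) x12; apply: (X1 _ b3) => a.
  case: x12 y b3 => [c e] [g h] b3.
  apply: (L _ (((c, e), (0, a)), (g, h))); first exact: (bmf_section1 b3 a).
  by move=> t; apply: point_eq; rewrite !(coordD, coordZ) /x1 /x2 /x3 /x4 /y1 /y2 /=; ring.
- apply: V1 => y; apply: (W2 _ (b1 y)) => x12.
  have b3 := bmf_section2 (b1 y) x12; apply: (X2 _ b3) => a.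
  case: x12 y b3 => [c e] [g h] b3.
  apply: (L _ (((c, e), (a, 0)), (g, h))); first exact: (bmf_section2 b3 a).
  by move=> t; apply: point_eq; rewrite !(coordD, coordZ) /x1 /x2 /x3 /x4 /y1 /y2 /=; ring.
- apply: V2 => x; apply: (X1 _ (b2 x)) => a.
  have b3 := bmf_section1 (b2 x) a; case: x b3 => [[c e] [g h]] b3.
  apply: (L _ (((c, e), (g, h)), (0, a))) => // t.
  by apply: point_eq; rewrite !(coordD, coordZ) /x1 /x2 /x3 /x4 /y1 /y2 /=; ring.
- apply: V2 => x; apply: (X2 _ (b2 x)) => a.
  have b3 := bmf_section2 (b2 x) a; case: x b3 => [[c e] [g h]] b3.
  apply: (L _ (((c, e), (g, h)), (a, 0))) => // t.
  by apply: point_eq; rewrite !(coordD, coordZ) /x1 /x2 /x3 /x4 /y1 /y2 /=; ring.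
Qed.

Lemma C1_alg d F : 0 < d -> alg d F -> C1 F.
Proof.
move=> d0 aF; split; [by case: (alg_derive d0 aF)| |exact: alg_periodic aF].
move=> v z; apply: differentiable_continuous.
by have [_ /(_ v)/(alg_derive d0)[]] := alg_derive d0 aF.
Qed.

Lemma C1_test F : test_function F -> C1 F.
Proof.
move=> [sF pF]; split=> // [z|v z]; first exact: (sF [::] z).
by apply: differentiable_continuous; exact: (sF [:: v] z).
Qed.

Lemma C1M F G : C1 F -> C1 G -> C1 (fun z => F z * G z).
Proof.
move=> cF cG; have [dF cdF pF] := cF; have [dG cdG pG] := cG; split.
- by move=> z; exact: (differentiableM (dF z) (dG z)).
- move=> v; have -> : 'D_v (fun z => F z * G z) = (fun z => F z * 'D_v G z + G z * 'D_v F z).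
    by apply/funext => z; rewrite (deriveM (diff_derivable (dF z)) (diff_derivable (dG z))).
  move=> z; apply: cvgD; apply: cvgM; [exact: C1_continuous|exact: cdG|exact: C1_continuous|exact: cdF].
- by move=> w z wb; rewrite pF// pG.
Qed.

Lemma C1_deriveB F v w z : C1 F -> 'D_(v - w) F z = 'D_v F z - 'D_w F z.
Proof. by move=> [dF _ _]; rewrite !deriveE// linearB. Qed.
Lemma C1_deriveD F v w z : C1 F -> 'D_(v + w) F z = 'D_v F z + 'D_w F z.
Proof. by move=> [dF _ _]; rewrite !deriveE// linearD. Qed.

End Torus.

(** * Fourier coefficients *)

Section Fourier.
Variable R : realType.
Notation P := (point6 R).
Notation mR := (measurableTypeR R).
Notation mP := (point6 mR).
Notation mu := (muT6 R).
Implicit Types (K L e : Z6) (z v : P) (f g : mP -> R).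

Lemma eqIg f g : (forall z, f z = g z) -> I mu f = I mu g.
Proof. by move=> fg; congr (I mu _); apply/funext. Qed.

Lemma ph_basis K : [/\ ph K ex1 = kx1 K :> R, ph K ex2 = kx2 K :> R, ph K ex3 = kx3 K :> R &
  ph K ex4 = kx4 K :> R] /\ ph K ey1 = ky1 K :> R /\ ph K ey2 = ky2 K :> R.
Proof.
rewrite /ph /x1 /x2 /x3 /x4 /y1 /y2 /=.
by split; [split|split]; ring.
Qed.

Lemma ph_neq0 K : K != 0 -> exists2 v, v \in xbasis ++ ybasis & ph K v != 0 :> R.
Proof.
move=> K0; have [[b1 b2 b3 b4] [b5 b6]] := ph_basis K.
have [h1|h1] := eqVneq (kx1 K : R) 0; last by exists ex1; rewrite ?b1// !inE eqxx.
have [h2|h2] := eqVneq (kx2 K : R) 0; last by exists ex2; rewrite ?b2// !inE eqxx ?orbT.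
have [h3|h3] := eqVneq (kx3 K : R) 0; last by exists ex3; rewrite ?b3// !inE eqxx ?orbT.
have [h4|h4] := eqVneq (kx4 K : R) 0; last by exists ex4; rewrite ?b4// !inE eqxx ?orbT.
have [h5|h5] := eqVneq (ky1 K : R) 0; last by exists ey1; rewrite ?b5// !inE eqxx ?orbT.
have [h6|h6] := eqVneq (ky2 K : R) 0; last by exists ey2; rewrite ?b6// !inE eqxx ?orbT.
move: h1 h2 h3 h4 h5 h6; rewrite /kx1 /kx2 /kx3 /kx4 /ky1 /ky2.
move=> /eqP; rewrite intr_eq0 => /eqP h1 /eqP; rewrite intr_eq0 => /eqP h2 /eqP.
rewrite intr_eq0 => /eqP h3 /eqP; rewrite intr_eq0 => /eqP h4 /eqP.
rewrite intr_eq0 => /eqP h5 /eqP; rewrite intr_eq0 => /eqP h6.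
case/negP: K0; apply/eqP; move: h1 h2 h3 h4 h5 h6; clear.
by case: K => -[[a b] [c d]] [g h] /= -> -> -> -> -> ->.
Qed.

Definition vol : R := I mu (cst 1).

Lemma vol_gt0 : 0 < vol.
Proof.
have pi0 : 0 < 2 * pi :> R by rewrite mulr_gt0// pi_gt0.
have m1 : muT R setT = (2 * pi)%:E.
  rewrite [LHS](_ : _ = lebR R (setT `&` `[0, 2 * pi]%classic))// setTI.
  by rewrite /lebR/= lebesgue_measure_itv/= lte_fin pi0 sube0.
have H d1 d2 (T1 : measurableType d1) (T2 : measurableType d2)
    (n1 : {finite_measure set T1 -> \bar R}) (n2 : {finite_measure set T2 -> \bar R}) :
    fin_product n1 n2 setT = (n1 setT * n2 setT)%E.
  by rewrite -setXTT /fin_product product_measure1E.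
have m2 : muT2 R setT = (2 * pi * (2 * pi))%:E by rewrite [LHS]H m1.
have m4 : muT4 R setT = (2 * pi * (2 * pi) * (2 * pi * (2 * pi)))%:E by rewrite [LHS]H m2.
have m6 : muT6 R setT = (2 * pi * (2 * pi) * (2 * pi * (2 * pi)) * (2 * pi * (2 * pi)))%:E.
  by rewrite [LHS]H m2 m4.
have -> : vol = fine (muT6 R setT) by rewrite /vol /I (Rintegral_cst _ measurableT) mul1r.
rewrite m6/=; by rewrite !mulr_gt0// pi_gt0.
Qed.

Lemma alg_bmf (F : P -> R) : alg 1 F -> bmf (F : mP -> R).
Proof. by move=> aF; apply: C1_bmf; exact: C1_alg aF. Qed.

(** For K <> 0 the function is, up to a nonzero factor, the derivative of [sinK K] along a basis
    vector. *)
Lemma I_cosK K : I mu (cosK K) = (K == 0)%:R * vol.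
Proof.
have [->|K0] := eqVneq K 0.
  by rewrite mul1r /vol; congr (I mu _); apply/funext => z; rewrite /cosK ph0 cos0.
rewrite mul0r; have [v vb pv] := ph_neq0 K0.
have cs : C1 (@sinK R K) by exact: C1_alg (alg_sin _ _).
have := I_derive vb cs.
have -> : 'D_v (sinK K) = (fun z => ph K v * cosK K z).
  by apply/funext => z; rewrite (@derive_val _ _ _ _ _ _ _ (is_derive_sinK K z v)).
rewrite IZ; last exact/bmf_intg/alg_bmf/alg_cos.
by move/eqP; rewrite mulf_eq0 (negbTE pv)/= => /eqP.
Qed.

Lemma I_sinK K : I mu (sinK K) = 0.
Proof.
have [->|K0] := eqVneq K 0.
  have -> : @sinK R 0 = cst 0 by apply/funext => z; rewrite /sinK ph0 sin0.
  have := IZ (mu := mu) 0 (bmf_intg mu (@bmf_cst _ mP R 1)); rewrite mul0r => E.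
  by rewrite -[RHS]E; apply: eqIg => z; rewrite mul0r.
have [v vb pv] := ph_neq0 K0.
have cs : C1 (@cosK R K) by exact: C1_alg (alg_cos _ _).
have := I_derive vb cs.
have -> : 'D_v (cosK K) = (fun z => (- ph K v) * sinK K z).
  by apply/funext => z; rewrite (@derive_val _ _ _ _ _ _ _ (is_derive_cosK K z v)).
rewrite IZ; last exact/bmf_intg/alg_bmf/alg_sin.
by move/eqP; rewrite mulf_eq0 oppr_eq0 (negbTE pv)/= => /eqP.
Qed.

(* Half-integer frequencies: the characters of frequency K - e/2. *)
Definition cosH e K z : R := cos (ph K z - ph e z / 2).
Definition sinH e K z : R := sin (ph K z - ph e z / 2).

Lemma cosH0 K z : cosH 0 K z = cosK K z.
Proof. by rewrite /cosH ph0 mul0r subr0. Qed.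
Lemma sinH0 K z : sinH 0 K z = sinK K z.
Proof. by rewrite /sinH ph0 mul0r subr0. Qed.

Lemma bmf_cosH e K : bmf (cosH e K : mP -> R).
Proof.
split; last by exists 1 => z; rewrite ler_norml cos_geN1 cos_le1.
apply: continuous_measurable6 => z; apply: (cvg_comp (fun z => ph K z - ph e z / 2) cos).
  by apply: cvgB; [exact: continuous_ph|apply: cvgMr_tmp; exact: continuous_ph].
exact: continuous_cos.
Qed.
Lemma bmf_sinH e K : bmf (sinH e K : mP -> R).
Proof.
split; last by exists 1 => z; rewrite ler_norml sin_geN1 sin_le1.
apply: continuous_measurable6 => z; apply: (cvg_comp (fun z => ph K z - ph e z / 2) sin).
  by apply: cvgB; [exact: continuous_ph|apply: cvgMr_tmp; exact: continuous_ph].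
exact: continuous_sin.
Qed.

Lemma I_lin2 (c1 c2 : R) f g : bmf f -> bmf g -> I mu (fun z => c1 * f z + c2 * g z) = c1 * I mu f + c2 * I mu g.
Proof.
move=> bf bg; rewrite ID; [|exact/intgZ/bmf_intg|exact/intgZ/bmf_intg].
by rewrite !IZ//; exact: bmf_intg.
Qed.

(** The phases of K and of e - K are opposite, so they give the same cosine and opposite sines;
    hence the second Kronecker symbol here and in [I_ssH]. *)
Lemma I_ccH e K L : I mu (fun z => cosH e K z * cosH e L z) =
  vol / 2 * ((K == L)%:R + (K == e - L)%:R).
Proof.
rewrite (@eqIg _ (fun z => 1 / 2 * cosK (K - L) z + 1 / 2 * cosK (K + L - e) z)).
  rewrite I_lin2 ?I_cosK ?subr_eq0; [|exact/alg_bmf/alg_cos|exact/alg_bmf/alg_cos].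
  by rewrite [K == e - L]eq_sym subr_eq (eq_sym e); ring.
move=> z; rewrite /cosH /cosK !phB phD.
have -> : ph K z + ph L z - ph e z = (ph K z - ph e z / 2) + (ph L z - ph e z / 2) by field.
have -> : ph K z - ph L z = (ph K z - ph e z / 2) - (ph L z - ph e z / 2) by ring.
by move: (ph K z - _) (ph L z - _) => x y; rewrite cosB cosD; field.
Qed.
Lemma I_ssH e K L : I mu (fun z => sinH e K z * sinH e L z) =
  vol / 2 * ((K == L)%:R - (K == e - L)%:R).
Proof.
rewrite (@eqIg _ (fun z => 1 / 2 * cosK (K - L) z + (- 1 / 2) * cosK (K + L - e) z)).
  rewrite I_lin2 ?I_cosK ?subr_eq0; [|exact/alg_bmf/alg_cos|exact/alg_bmf/alg_cos].
  by rewrite [K == e - L]eq_sym subr_eq (eq_sym e); ring.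
move=> z; rewrite /sinH /cosK !phB phD.
have -> : ph K z + ph L z - ph e z = (ph K z - ph e z / 2) + (ph L z - ph e z / 2) by field.
have -> : ph K z - ph L z = (ph K z - ph e z / 2) - (ph L z - ph e z / 2) by ring.
by move: (ph K z - _) (ph L z - _) => x y; rewrite cosB cosD; field.
Qed.
Lemma I_csH e K L : I mu (fun z => cosH e K z * sinH e L z) = 0.
Proof.
rewrite (@eqIg _ (fun z => 1 / 2 * sinK (K + L - e) z + (- 1 / 2) * sinK (K - L) z)).
  by rewrite I_lin2 ?I_sinK ?mulr0 ?addr0//; exact/alg_bmf/alg_sin.
move=> z; rewrite /sinH /cosH /sinK !phB phD.
have -> : ph K z + ph L z - ph e z = (ph K z - ph e z / 2) + (ph L z - ph e z / 2) by field.
have -> : ph K z - ph L z = (ph K z - ph e z / 2) - (ph L z - ph e z / 2) by ring.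
by move: (ph K z - _) (ph L z - _) => x y; rewrite sinB sinD; field.
Qed.

Lemma I_sum (J : Type) (S : seq J) (F : J -> mP -> R) : (forall j, intg mu (F j)) ->
  intg mu (fun z => \sum_(j <- S) F j z) /\
  I mu (fun z => \sum_(j <- S) F j z) = \sum_(j <- S) I mu (F j).
Proof.
move=> Fi; elim: S => [|j S [IH1 IH2]].
  have E : (fun z : mP => \sum_(j <- [::]) F j z) = (fun z => 0 * (cst 1 : mP -> R) z).
    by apply/funext => z; rewrite big_nil mul0r.
  have b1 := bmf_intg mu (@bmf_cst _ mP R 1).
  by rewrite E IZ// big_nil mul0r; split=> //; exact: intgZ.
have E : (fun z : mP => \sum_(j <- j :: S) F j z) = (fun z => F j z + \sum_(j <- S) F j z).
  by apply/funext => z; rewrite big_cons.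
by rewrite E big_cons ID// IH2; split=> //; exact: intgD.
Qed.

Lemma bmf_sum (J : Type) (S : seq J) (F : J -> mP -> R) : (forall j, bmf (F j)) ->
  bmf (fun z => \sum_(j <- S) F j z).
Proof.
move=> bF; elim: S => [|j S IH].
  by rewrite (_ : (fun z => _) = cst 0); [exact: bmf_cst|apply/funext => z; rewrite big_nil].
rewrite (_ : (fun z => _) = (fun z => F j z + \sum_(j <- S) F j z)); first exact: (bmfD (bF j) IH).
by apply/funext => z; rewrite big_cons.
Qed.

Definition TP e (S : seq Z6) (al be : Z6 -> R) z : R :=
  \sum_(K <- S) (al K * cosH e K z + be K * sinH e K z).

Lemma bmf_TP e S al be : bmf (TP e S al be : mP -> R).
Proof.
apply: bmf_sum => K; apply: bmfD.
  exact: (bmfM (@bmf_cst _ mP R (al K)) (bmf_cosH e K)).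
exact: (bmfM (@bmf_cst _ mP R (be K)) (bmf_sinH e K)).
Qed.

Lemma I_mul_TP f e S al be : sqi mu f -> I mu (fun z => f z * TP e S al be z) =
  \sum_(K <- S) (al K * I mu (fun z => f z * cosH e K z) + be K * I mu (fun z => f z * sinH e K z)).
Proof.
move=> fs; have fi := sqi_intg fs.
have ic K : intg mu (fun z => f z * cosH e K z) by exact: intg_bmf (bmf_cosH e K).
have is_ K : intg mu (fun z => f z * sinH e K z) by exact: intg_bmf (bmf_sinH e K).
rewrite (@eqIg _ (fun z => \sum_(K <- S) (al K * (f z * cosH e K z) + be K * (f z * sinH e K z)))).
  have [_ ->] := I_sum S (fun K => intgD (intgZ (al K) (ic K)) (intgZ (be K) (is_ K))).
  by apply: eq_bigr => K _; rewrite ID ?IZ//; exact: intgZ.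
by move=> z; rewrite /TP mulr_sumr; apply: eq_bigr => K _; ring.
Qed.

Lemma sum_pick (S : seq Z6) c (F : Z6 -> R) : uniq S ->
  \sum_(L <- S) (L == c)%:R * F L = (c \in S)%:R * F c.
Proof.
move=> uS; have [cS|cS] := boolP (c \in S).
  rewrite (bigD1_seq c)//= eqxx big1 ?addr0// => L /negbTE ->.
  by rewrite mul0r.
rewrite mul0r big_seq big1// => L LS; case: eqP => [E|_]; last by rewrite mul0r.
by rewrite -E LS in cS.
Qed.

Lemma eqZ6_subC (K L e : Z6) : (K == e - L) = (L == e - K).
Proof. by apply/eqP/eqP => ->; rewrite opprB addrC subrK. Qed.

Lemma I_TP_cosH e S al be K : uniq S -> I mu (fun z => TP e S al be z * cosH e K z) =
  vol / 2 * ((K \in S)%:R * al K + (e - K \in S)%:R * al (e - K)).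
Proof.
move=> uS; rewrite (@eqIg _ (fun z => cosH e K z * TP e S al be z)); last by move=> z; rewrite mulrC.
rewrite (I_mul_TP _ _ _ _ (bmf_sqi mu (bmf_cosH e K))).
rewrite -!(sum_pick _ al uS) -big_split/= mulr_sumr; apply: eq_bigr => L _.
by rewrite I_csH mulr0 addr0 I_ccH (eq_sym K) (eqZ6_subC K L); ring.
Qed.
Lemma I_TP_sinH e S al be K : uniq S -> I mu (fun z => TP e S al be z * sinH e K z) =
  vol / 2 * ((K \in S)%:R * be K - (e - K \in S)%:R * be (e - K)).
Proof.
move=> uS; rewrite (@eqIg _ (fun z => sinH e K z * TP e S al be z)); last by move=> z; rewrite mulrC.
rewrite (I_mul_TP _ _ _ _ (bmf_sqi mu (bmf_sinH e K))).
rewrite -!(sum_pick _ be uS) -sumrB mulr_sumr; apply: eq_bigr => L _.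
rewrite I_ssH (@eqIg _ (fun z => cosH e L z * sinH e K z)); last by move=> z; rewrite mulrC.
by rewrite I_csH mulr0 add0r (eq_sym K) (eqZ6_subC K L); ring.
Qed.

Lemma sum_reflect e S (x : Z6 -> R) : uniq S -> (forall K, 0 <= x K) ->
  \sum_(K <- S) (e - K \in S)%:R * x (e - K) <= \sum_(K <- S) x K.
Proof.
move=> uS x0; under eq_bigr do rewrite -(sum_pick _ _ uS).
rewrite exchange_big/=; apply: ler_sum => L _.
rewrite (eq_bigr (fun K => (K == e - L)%:R * x L)); last by move=> K _; rewrite eqZ6_subC.
rewrite (sum_pick _ (fun=> x L) uS); case: (_ \in _); rewrite ?mul1r ?mul0r//.
Qed.

(** K and e - K carry the same functions up to sign, so the family is not orthogonal; Young's
    inequality between the two costs a factor 2. *)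
Lemma n2_TP e S al be : uniq S ->
  n2 mu (TP e S al be) <= vol * \sum_(K <- S) (al K ^+ 2 + be K ^+ 2).
Proof.
move=> uS; have V0 := ltW vol_gt0.
rewrite (_ : n2 mu _ = I mu (fun z => TP e S al be z * TP e S al be z)); last first.
  by apply: eq_I => z; rewrite expr2.
rewrite (I_mul_TP _ _ _ _ (bmf_sqi mu (bmf_TP e S al be))).
under eq_bigr => K _ do rewrite I_TP_cosH// I_TP_sinH//.
pose r K := (e - K \in S)%:R * (al (e - K) ^+ 2 + be (e - K) ^+ 2).
have H : \sum_(K <- S) r K <= \sum_(K <- S) (al K ^+ 2 + be K ^+ 2).
  by apply: (sum_reflect (x := fun K => al K ^+ 2 + be K ^+ 2) e uS) => K; rewrite addr_ge0 ?sqr_ge0.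
apply: (@le_trans _ _ (\sum_(K <- S) vol / 2 * (3 / 2 * (al K ^+ 2 + be K ^+ 2) + r K / 2))).
  rewrite big_seq [leRHS]big_seq; apply: ler_sum => K KS; rewrite KS /r.
  rewrite (_ : _ * _ + _ * (_ * _) = vol / 2 * (al K * (al K + (e - K \in S)%:R * al (e - K)) +
    be K * (be K - (e - K \in S)%:R * be (e - K)))); last by rewrite mulr1n; ring.
  rewrite ler_wpM2l ?divr_ge0//.
  have := sqr_ge0 (al K - al (e - K)); have := sqr_ge0 (be K + be (e - K)).
  have := sqr_ge0 (al K); have := sqr_ge0 (be K).
  by case: (_ \in _); rewrite ?mulr1n ?mulr0n !expr2; nra.
rewrite -mulr_sumr big_split/= -!mulr_sumr -mulr_suml.
move: H V0; move: (\sum_(K <- S) r K) (\sum_(K <- S) _) => x y; nra.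
Qed.

(** f is tested against the polynomial whose coefficients are its own; [n2_TP] replaces
    orthogonality. *)
Lemma bessel f e S : sqi mu f -> uniq S ->
  \sum_(K <- S) (I mu (fun z => f z * cosH e K z) ^+ 2 + I mu (fun z => f z * sinH e K z) ^+ 2)
  <= vol * n2 mu f.
Proof.
move=> fs uS; set X := \sum_(K <- S) _.
pose al K := I mu (fun z => f z * cosH e K z); pose be K := I mu (fun z => f z * sinH e K z).
have X0 : 0 <= X by apply: sumr_ge0 => K _; rewrite addr_ge0 ?sqr_ge0.
have E : I mu (fun z => f z * TP e S al be z) = X.
  by rewrite I_mul_TP//; apply: eq_bigr => K _; rewrite !expr2.
have H := CS fs (bmf_sqi mu (bmf_TP e S al be)); rewrite E in H.
have H2 : X ^+ 2 <= n2 mu f * (vol * X).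
  by apply: le_trans H _; rewrite ler_wpM2l ?n2_ge0// n2_TP.
move: X0; rewrite le_eqVlt => /predU1P[<-|X0]; first by rewrite mulr_ge0 ?n2_ge0// ltW ?vol_gt0.
by rewrite -(ler_pM2r X0) -expr2 (le_trans H2)// mulrA (mulrC vol).
Qed.

Definition ca f K : R := I mu (fun z => f z * cosK K z).
Definition cb f K : R := I mu (fun z => f z * sinK K z).

Lemma bessel0 f S : sqi mu f -> uniq S ->
  \sum_(K <- S) (ca f K ^+ 2 + cb f K ^+ 2) <= vol * n2 mu f.
Proof.
move=> fs uS; have := bessel 0 fs uS; congr (_ <= _); apply: eq_bigr => K _.
by rewrite /ca /cb; congr (I mu _ ^+ 2 + I mu _ ^+ 2); apply/funext => z; rewrite ?cosH0 ?sinH0.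
Qed.

Lemma caN f K : ca f (- K) = ca f K.
Proof. by apply: eq_I => z; rewrite /cosK phN cosN. Qed.
Lemma cbN f K : sqi mu f -> cb f (- K) = - cb f K.
Proof.
move=> fs; rewrite /cb -IN; last exact: intg_bmf (sqi_intg fs) (alg_bmf (alg_sin _ K)).
by apply: eq_I => z; rewrite /sinK phN sinN mulrN.
Qed.

End Fourier.

(** * Limits at a geometric rate and dominated convergence *)

Section Limits.
Variable R : realType.

Lemma le_geom (x y B : R) : (forall n, x <= y + B / 4 ^+ n) -> x <= y.
Proof.
move=> H; have c1 : (fun n => y + geometric B (4^-1 : R) n) @ \oo --> y + 0.
  by apply: cvgD; [exact: cvg_cst|apply: cvg_geometric; rewrite ger0_norm ?invf_lt1//; lra].
rewrite addr0 in c1; apply: (ler_cvg_to (cvg_cst x) c1); apply: nearW => n.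
by rewrite /= exprVn.
Qed.

Lemma eq0_geom (x B : R) : (forall n, x ^+ 2 <= B / 4 ^+ n) -> x = 0.
Proof.
move=> H; have := @le_geom (x ^+ 2) 0 B; rewrite le_eqVlt ltNge sqr_ge0 orbF.
by move/(_ _)/eqP => E; apply/eqP; rewrite -sqrf_eq0 E// => n; rewrite add0r.
Qed.

Lemma bernoulli (h : R) n : -1 <= h -> 1 + n%:R * h <= (1 + h) ^+ n.
Proof.
move=> h1; elim: n => [|n IH]; first by rewrite mul0r addr0 expr0.
rewrite exprS -natr1; have h2 : 0 <= 1 + h by lra.
apply: le_trans (ler_wpM2l h2 IH).
by have := sqr_ge0 h; have : 0 <= n%:R :> R by []; move: (n%:R : R) => N; rewrite expr2; nra.
Qed.

Context d (T : measurableType d) (mu : {finite_measure set T -> \bar R}).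

Lemma dct (N : set T) (F : nat -> T -> R) (G h : T -> R) : measurable N -> mu N = 0%E ->
  (forall n, measurable_fun setT (F n)) -> measurable_fun setT G -> intg mu h ->
  (forall n x, `|F n x| <= h x) -> (forall x, ~ N x -> F n x @[n --> \oo] --> G x) ->
  I mu (F n) @[n --> \oo] --> I mu G.
Proof.
move=> mN N0 mF mG ih Fh FG.
have iF n : intg mu (F n) by exact: intg_le (mF n) ih (Fh n).
have [||||iG _ H] := @dominated_convergence _ _ _ mu setT measurableT (fun n x => (F n x)%:E)
  (fun x => (G x)%:E) (fun x => (h x)%:E) _ _ _ ih.
- by move=> n; exact/measurable_EFinP.
- exact/measurable_EFinP.
- exists N; split=> // x /= nH; apply: contrapT => Nx; apply: nH => _.
  by apply: cvg_EFin; [exact: nearW|exact: FG].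
- by apply: aeW => x n _; rewrite /= lee_fin.
by rewrite -EFin_I// in H; exact: (fine_cvg H).
Qed.
End Limits.

(** * Functions with prescribed Fourier coefficients *)

Section Synthesis.
Variable R : realType.
Notation P := (point6 R).
Notation mR := (measurableTypeR R).
Notation mP := (point6 mR).
Notation mu := (muT6 R).
Implicit Types (K L e : Z6) (z v : P) (f g : mP -> R).

(** The tail bound 8^-n is the rate that [riesz_fischer] requires. *)
Definition exhausts (c : Z6 -> R) (S : nat -> seq Z6) := forall n, uniq (S n) /\
  forall T : seq Z6, uniq T -> {in T, forall K, K \notin S n} -> \sum_(K <- T) c K <= (8 ^+ n)^-1.

(** S n attains the supremum of the finite sums up to 8^-n. The lists need not be nested, so two
    partial sums are compared on a symmetric difference ([sum_symdiff]). *)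
Lemma exhaustion (c : Z6 -> R) (A : R) : (forall S : seq Z6, uniq S -> \sum_(K <- S) c K <= A) ->
  exists S, exhausts c S.
Proof.
move=> cA; pose E : set R := [set x | exists2 S : seq Z6, uniq S & x = \sum_(K <- S) c K].
have hE : has_sup E.
  by split; [exists 0, [::] => //; rewrite big_nil|exists A => _ [S uS ->]; exact: cA].
have H n : exists S : seq Z6, uniq S /\ forall T : seq Z6, uniq T -> {in T, forall K, K \notin S} ->
    \sum_(K <- T) c K <= (8 ^+ n)^-1.
  have e0 : 0 < (8 ^+ n)^-1 :> R by rewrite invr_gt0 exprn_gt0.
  have [_ [S uS ->] lS] := sup_adherent e0 hE.
  exists S; split=> // T uT dT.
  have : E (\sum_(K <- S ++ T) c K).
    exists (S ++ T) => //; rewrite cat_uniq uS uT andbT/=.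
    by apply/hasPn => K /dT.
  move=> /(sup_upper_bound hE); rewrite big_cat/=.
  by move: lS; move: (\sum_(K <- S) c K) (\sum_(K <- T) c K) (sup E) => a b e; lra.
by have [S HS] := boolp.choice H; exists S => n; exact: HS.
Qed.

Lemma exhausts_tail c S n T : (forall K, 0 <= c K) -> exhausts c S -> uniq T ->
  \sum_(K <- T | K \notin S n) c K <= (8 ^+ n)^-1.
Proof.
move=> c0 /(_ n)[_ H] uT; rewrite -big_filter; apply: H; first exact: filter_uniq.
by move=> K; rewrite mem_filter => /andP[].
Qed.

Lemma exhausts_pt c S n K : (forall K, 0 <= c K) -> exhausts c S -> K \notin S n -> c K <= (8 ^+ n)^-1.
Proof. by move=> c0 /(_ n)[_ H] KS; have := H [:: K]; rewrite big_seq1; apply=> // L; rewrite inE => /eqP ->. Qed.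

Lemma sum_symdiff (F : Z6 -> R) (S S' : seq Z6) : uniq S -> uniq S' ->
  \sum_(K <- S) F K - \sum_(K <- S') F K =
  \sum_(K <- [seq K <- S | K \notin S']) F K - \sum_(K <- [seq K <- S' | K \notin S]) F K.
Proof.
move=> uS uS'; rewrite !big_filter (bigID [in S'] xpredT)/= (bigID [in S] xpredT F)/=.
have -> : \sum_(K <- S | K \in S') F K = \sum_(K <- S' | K \in S) F K.
  rewrite -[LHS]big_filter -[RHS]big_filter; apply: perm_big; apply: uniq_perm; try exact: filter_uniq.
  by move=> K; rewrite !mem_filter andbC.
by rewrite opprD addrACA subrr add0r.
Qed.

Lemma TP_sub e (S S' : seq Z6) (al be : Z6 -> R) z : uniq S -> uniq S' ->
  TP e S al be z - TP e S' al be z =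
  TP e [seq K <- S | K \notin S'] al be z + (-1) * TP e [seq K <- S' | K \notin S] al be z.
Proof.
by move=> uS uS'; rewrite /TP (sum_symdiff (fun K => al K * cosH e K z + be K * sinH e K z) uS uS') mulN1r.
Qed.

Lemma le8_4 n : (8 ^+ n)^-1 <= (4 ^+ n)^-1 :> R.
Proof. by rewrite lef_pV2 ?posrE ?exprn_gt0// lerXn2r ?nnegrE//; lra. Qed.

Lemma half_sum (V x y q : R) : x ^+ 2 <= q -> y ^+ 2 <= q ->
  (V / 2 * (x + y)) ^+ 2 <= V ^+ 2 * q /\ (V / 2 * (x - y)) ^+ 2 <= V ^+ 2 * q.
Proof.
move=> h1 h2; have h3 := sqr_ge0 (x - y); have h4 := sqr_ge0 (x + y).
have E (t : R) : (V / 2 * t) ^+ 2 = V ^+ 2 * (t ^+ 2 / 4) by field.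
rewrite !E; split; rewrite ler_wpM2l ?sqr_ge0//; move: h1 h2 h3 h4; rewrite !expr2; lra.
Qed.

Section Series.
Variables (c : Z6 -> R) (S : nat -> seq Z6) (e : Z6) (al be : Z6 -> R) (A : R).
Hypotheses (exS : exhausts c S) (abc : forall K, al K ^+ 2 + be K ^+ 2 <= c K).
Hypothesis abA : forall T, uniq T -> \sum_(K <- T) (al K ^+ 2 + be K ^+ 2) <= A.

Let c0 K : 0 <= c K. Proof. by apply: le_trans (abc K); rewrite addr_ge0 ?sqr_ge0. Qed.
Let uS n : uniq (S n). Proof. by case: (exS n). Qed.

Lemma series_cvg : exists2 g, sqi mu g &
  forall n, n2 mu (fun z => TP e (S n) al be z - g z) <= 32 * vol R / 4 ^+ n.
Proof.
have V0 := ltW (vol_gt0 R).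
have sp n : sqi mu (TP e (S n) al be) by exact/bmf_sqi/bmf_TP.
have dl n m : n2 mu (TP e [seq K <- S n | K \notin S m] al be) <= vol R * (8 ^+ m)^-1.
  apply: (le_trans (n2_TP _ _ _ (filter_uniq _ (uS n)))); rewrite ler_wpM2l// big_filter.
  by apply: le_trans (exhausts_tail m c0 exS (uS n)); apply: ler_sum => K _; exact: abc.
have [|n|g gs H] := @riesz_fischer _ _ _ mu (fun n => TP e (S n) al be) (4 * vol R) sp.
- by rewrite mulr_ge0.
- rewrite (_ : (fun z => _) = fun z => TP e [seq K <- S n.+1 | K \notin S n] al be z +
      (-1) * TP e [seq K <- S n | K \notin S n.+1] al be z); last first.
    by apply/funext => z; exact: TP_sub.
  apply: le_trans (n2D_le _ _) _; [exact/bmf_sqi/bmf_TP|exact/sqiZ/bmf_sqi/bmf_TP|].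
  rewrite n2Z; last exact/bmf_sqi/bmf_TP.
  have h1 := dl n.+1 n; have h2 := dl n n.+1.
  have h3 : (8 ^+ n.+1)^-1 <= (8 ^+ n)^-1 :> R.
    rewrite lef_pV2 ?posrE ?exprn_gt0// exprS ler_peMl ?exprn_ge0//; lra.
  have h4 := ler_wpM2l V0 h3.
  rewrite sqrrN expr1n mul1r (_ : 4 * vol R / 8 ^+ n = 4 * (vol R * (8 ^+ n)^-1)); last by ring.
  move: h1 h2 h4; move: (vol R / 8 ^+ n) (vol R / 8 ^+ n.+1) => x y.
  by move: (n2 mu _) (n2 mu _) => a b; lra.
exists g => // n; apply: le_trans (H n) _; rewrite le_eqVlt; apply/orP; left; apply/eqP; ring.
Qed.

Lemma series_n2 g : sqi mu g ->
  (forall n, n2 mu (fun z => TP e (S n) al be z - g z) <= 32 * vol R / 4 ^+ n) ->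
  n2 mu g <= 2 * vol R * A.
Proof.
move=> gs H; apply: (@le_geom _ _ _ (64 * vol R)) => n; have V0 := ltW (vol_gt0 R).
have sp : sqi mu (TP e (S n) al be) by exact/bmf_sqi/bmf_TP.
have := n2D_le sp (sqiZ (-1) (sqiB sp gs)).
rewrite (_ : (fun x => _ + _) = g); last by apply/funext => z; ring.
rewrite n2Z ?sqrrN ?expr1n ?mul1r; last exact: sqiB.
have := H n; have := le_trans (n2_TP e al be (uS n)) (ler_wpM2l V0 (abA (uS n))).
rewrite (_ : 64 * vol R / 4 ^+ n = 2 * (32 * vol R / 4 ^+ n)); last by ring.
by move: (n2 mu _) (n2 mu _) (n2 mu _) (32 * _ / _) => a b x y; nra.
Qed.

Let lim_coef g (phi : mP -> R) (x : R) (s : nat -> R) (B : R) : sqi mu g -> bmf phi ->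
  (forall n, n2 mu (fun z => TP e (S n) al be z - g z) <= 32 * vol R / 4 ^+ n) ->
  (forall n, I mu (fun z => TP e (S n) al be z * phi z) = s n) ->
  (forall n, (s n - x) ^+ 2 <= B / 4 ^+ n) -> I mu (fun z => g z * phi z) = x.
Proof.
move=> gs bp H sE sx; apply/eqP; rewrite -subr_eq0; apply/eqP.
apply: (@eq0_geom _ _ (2 * (32 * vol R) * n2 mu phi + 2 * B)) => n.
have sp : sqi mu (TP e (S n) al be) by exact/bmf_sqi/bmf_TP.
have E : I mu (fun z => (TP e (S n) al be z - g z) * phi z) = s n - I mu (fun z => g z * phi z).
  rewrite -sE -IB; [|exact: intg_bmf (sqi_intg sp) bp|exact: intg_bmf (sqi_intg gs) bp].
  by apply: eqIg => z; ring.
have := CS (sqiB sp gs) (bmf_sqi mu bp); rewrite E => h1.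
have h2 := ler_wpM2r (n2_ge0 mu phi) (H n).
have h3 := le_trans h1 h2; have := sx n.
rewrite mulrDl (_ : 2 * (32 * vol R) * n2 mu phi / 4 ^+ n = 2 * (32 * vol R / 4 ^+ n * n2 mu phi)); last by ring.
rewrite (_ : 2 * B / 4 ^+ n = 2 * (B / 4 ^+ n)); last by ring.
move: h3; move: (_ / _ * _) (B / _) (I mu _) (s n) => p q a b.
by have := sqr_ge0 (b - a + (b - x)); rewrite !expr2; nra.
Qed.

Let mem_small n K (x : R) : x ^+ 2 <= c K -> ((K \in S n)%:R * x - x) ^+ 2 <= (4 ^+ n)^-1.
Proof.
move=> xc; have [KS|KS] := boolP (K \in S n).
  by rewrite mul1r subrr expr0n/= invr_ge0 exprn_ge0.
rewrite mul0r sub0r sqrrN (le_trans xc)// (le_trans _ (le8_4 n))//.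
exact: exhausts_pt c0 exS KS.
Qed.

Let sq_le K : al K ^+ 2 <= c K /\ be K ^+ 2 <= c K.
Proof.
have := abc K; have := sqr_ge0 (al K); have := sqr_ge0 (be K).
by move: (al K ^+ 2) (be K ^+ 2) => x y; lra.
Qed.

(** Coefficients pass to the L^2 limit by the Cauchy-Schwarz inequality. Both K and e - K
    contribute, as they carry the same functions up to sign. *)
Lemma series_coef g K : sqi mu g ->
  (forall n, n2 mu (fun z => TP e (S n) al be z - g z) <= 32 * vol R / 4 ^+ n) ->
  I mu (fun z => g z * cosH e K z) = vol R / 2 * (al K + al (e - K)) /\
  I mu (fun z => g z * sinH e K z) = vol R / 2 * (be K - be (e - K)).
Proof.
move=> gs H; have V0 := vol_gt0 R; split.
- refine (lim_coef (s := (fun n => vol R / 2 * ((K \in S n)%:R * al K + (e - K \in S n)%:R * al (e - K)))) (B := vol R ^+ 2) gs (bmf_cosH _ e K) H _ _); first by move=> n; exact: I_TP_cosH.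
  move=> n; have h1 := mem_small n (sq_le K).1; have h2 := mem_small n (sq_le (e - K)).1.
  rewrite (_ : _ - _ = vol R / 2 * (((K \in S n)%:R * al K - al K) + ((e - K \in S n)%:R * al (e - K) - al (e - K)))); last by ring.
  exact: (half_sum _ h1 h2).1.
- refine (lim_coef (s := (fun n => vol R / 2 * ((K \in S n)%:R * be K - (e - K \in S n)%:R * be (e - K)))) (B := vol R ^+ 2) gs (bmf_sinH _ e K) H _ _); first by move=> n; exact: I_TP_sinH.
  move=> n; have h1 := mem_small n (sq_le K).2; have h2 := mem_small n (sq_le (e - K)).2.
  rewrite (_ : _ - _ = vol R / 2 * (((K \in S n)%:R * be K - be K) - ((e - K \in S n)%:R * be (e - K) - be (e - K)))); last by ring.
  exact: (half_sum _ h1 h2).2.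
Qed.
End Series.
End Synthesis.

(** * Completeness of the trigonometric system *)

Section Uniqueness.
Variable R : realType.
Notation P := (point6 R).
Notation mR := (measurableTypeR R).
Notation mP := (point6 mR).
Notation mu := (muT6 R).
Implicit Types (K L e : Z6) (z v : P) (f g q : mP -> R) (A B N : set mP).

Definition orthogonal f := sqi mu f /\ forall K, ca f K = 0 /\ cb f K = 0.
(** Completeness is proved through multipliers that preserve orthogonality to all characters: they
    form an algebra closed under bounded pointwise limits, which contains the characters and, in the
    end, every measurable indicator. *)
Definition admissible q := bmf q /\ forall f, orthogonal f -> orthogonal (fun z => f z * q z).

Lemma admissible_cst (c : R) : admissible (fun=> c).
Proof.
split; first exact: (@bmf_cst _ mP R c).
move=> f [fs H]; split; first by exact: (sqi_bmf fs (@bmf_cst _ mP R c)).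
move=> K; have fi := sqi_intg fs; have [h1 h2] := H K; rewrite /ca /cb; split.
- rewrite (@eqIg _ _ (fun z => c * (f z * cosK K z))); last by move=> z; ring.
  by rewrite IZ; [rewrite [X in c * X]h1 mulr0|exact: intg_bmf fi (alg_bmf (alg_cos _ K))].
- rewrite (@eqIg _ _ (fun z => c * (f z * sinK K z))); last by move=> z; ring.
  by rewrite IZ; [rewrite [X in c * X]h2 mulr0|exact: intg_bmf fi (alg_bmf (alg_sin _ K))].
Qed.

Lemma admissibleD q1 q2 : admissible q1 -> admissible q2 -> admissible (fun z => q1 z + q2 z).
Proof.
move=> [b1 a1] [b2 a2]; split; first exact: bmfD.
move=> f of_; have [fs1 H1] := a1 _ of_; have [fs2 H2] := a2 _ of_; have [fs _] := of_.
split; first exact: (sqi_bmf fs (bmfD b1 b2)).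
move=> K; have [h1 h2] := H1 K; have [h3 h4] := H2 K; rewrite /ca /cb; split.
- rewrite (@eqIg _ _ (fun z => f z * q1 z * cosK K z + f z * q2 z * cosK K z)); last by move=> z; ring.
  rewrite ID; first by rewrite [X in X + _]h1 [X in _ + X]h3 addr0.
  + exact: intg_bmf (sqi_intg fs1) (alg_bmf (alg_cos _ K)).
  + exact: intg_bmf (sqi_intg fs2) (alg_bmf (alg_cos _ K)).
- rewrite (@eqIg _ _ (fun z => f z * q1 z * sinK K z + f z * q2 z * sinK K z)); last by move=> z; ring.
  rewrite ID; first by rewrite [X in X + _]h2 [X in _ + X]h4 addr0.
  + exact: intg_bmf (sqi_intg fs1) (alg_bmf (alg_sin _ K)).
  + exact: intg_bmf (sqi_intg fs2) (alg_bmf (alg_sin _ K)).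
Qed.

Lemma admissibleM q1 q2 : admissible q1 -> admissible q2 -> admissible (fun z => q1 z * q2 z).
Proof.
move=> [b1 a1] [b2 a2]; split; first exact: bmfM.
move=> f /a1/a2; rewrite (_ : (fun z => f z * q1 z * q2 z) = fun z => f z * (q1 z * q2 z))//.
by apply/funext => z; rewrite mulrA.
Qed.

Lemma admissibleX q n : admissible q -> admissible (fun z => q z ^+ n).
Proof.
move=> aq; elim: n => [|n IH]; first exact: (admissible_cst 1).
by have := admissibleM aq IH; congr admissible; apply/funext => z; rewrite exprS.
Qed.

Lemma admissible_trig K : admissible (cosK K) /\ admissible (sinK K).
Proof.
have I2 f (F G H : mP -> R) (s : R) : orthogonal f -> bmf G -> bmf H ->
    (forall z, F z = 1 / 2 * G z + s * H z) -> I mu (fun z => f z * G z) = 0 ->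
    I mu (fun z => f z * H z) = 0 -> I mu (fun z => f z * F z) = 0.
  move=> [fs _] bG bH FE G0 H0; have fi := sqi_intg fs.
  rewrite (@eqIg _ _ (fun z => 1 / 2 * (f z * G z) + s * (f z * H z))); last by move=> z; rewrite FE; ring.
  have i1 := intg_bmf fi bG; have i2 := intg_bmf fi bH.
  by rewrite ID ?IZ ?G0 ?H0 ?mulr0 ?addr0//; exact: intgZ.
have bc L : bmf (cosK L : mP -> R) by exact/alg_bmf/alg_cos.
have bs L : bmf (sinK L : mP -> R) by exact/alg_bmf/alg_sin.
split; split=> // f of_; have [fs fz] := of_.
- split=> [|L]; first exact: sqi_bmf.
  split.
  + rewrite /ca (@eqIg _ _ (fun z => f z * (cosK K z * cosK L z))); last by move=> z; rewrite mulrA.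
    apply: (I2 _ _ (cosK (K + L)) (cosK (K - L)) (1 / 2) of_) => //; [|exact: (fz _).1|exact: (fz _).1].
    by move=> z; rewrite /cosK phB phD cosB cosD; field.
  + rewrite /cb (@eqIg _ _ (fun z => f z * (cosK K z * sinK L z))); last by move=> z; rewrite mulrA.
    apply: (I2 _ _ (sinK (K + L)) (sinK (K - L)) (- 1 / 2) of_) => //; [|exact: (fz _).2|exact: (fz _).2].
    by move=> z; rewrite /cosK /sinK phB phD sinB sinD; field.
- split=> [|L]; first exact: sqi_bmf.
  split.
  + rewrite /ca (@eqIg _ _ (fun z => f z * (sinK K z * cosK L z))); last by move=> z; rewrite mulrA.
    apply: (I2 _ _ (sinK (K + L)) (sinK (K - L)) (1 / 2) of_) => //; [|exact: (fz _).2|exact: (fz _).2].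
    by move=> z; rewrite /cosK /sinK phB phD sinB sinD; field.
  + rewrite /cb (@eqIg _ _ (fun z => f z * (sinK K z * sinK L z))); last by move=> z; rewrite mulrA.
    have E z : sinK K z * sinK L z = 1 / 2 * (- cosK (K + L) z) + 1 / 2 * cosK (K - L) z.
      by rewrite /cosK /sinK phB phD cosB cosD; field.
    apply: (I2 _ _ (fun z => - cosK (K + L) z) (cosK (K - L)) (1 / 2) of_) => //; last exact: (fz _).1.
      by have := bmfM (@bmf_cst _ mP R (-1)) (bc (K + L)); congr bmf; apply/funext => z; rewrite mulN1r.
    rewrite (@eqIg _ _ (fun z => (-1) * (f z * cosK (K + L) z))); last by move=> z; ring.
    rewrite IZ; last exact: intg_bmf (sqi_intg fs) (bc _).
    by rewrite [X in _ * X](fz _).1 mulr0.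
Qed.

(** This closure leads from trigonometric polynomials to discontinuous functions; the integrals
    converge, dominated by a multiple of |f phi|. *)
Lemma admissible_lim (q : nat -> mP -> R) q' (M : R) : (forall n, admissible (q n)) ->
  (forall n z, `|q n z| <= M) -> (forall z, q n z @[n --> \oo] --> q' z) -> admissible q'.
Proof.
move=> aq qM qq'.
have mq' : measurable_fun setT q'.
  by apply: (measurable_fun_cvg (h := q)) => [n|z _]; [case: (aq n) => -[]|exact: qq'].
have q'M z : `|q' z| <= M.
  by apply: (ler_cvg_to (cvg_norm (qq' z)) (cvg_cst M)); apply: nearW => n; exact: qM.
have bq' : bmf q' by split=> //; exists M.
split=> // f of_; have [fs _] := of_; split=> [|K]; first exact: sqi_bmf.
have lim0 (phi : mP -> R) : bmf phi -> (forall n, I mu (fun z => f z * q n z * phi z) = 0) ->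
    I mu (fun z => f z * q' z * phi z) = 0.
  move=> bp H; have [mf _] := fs; have [mp _] := bp; have fi := sqi_intg (sqi_bmf fs bp).
  have ai : intg mu (fun z => M * `|f z * phi z|).
    by apply: intgZ; have := integrable_abse fi; congr (_.-integrable _ _).
  have cv : I mu (fun z => f z * q n z * phi z) @[n --> \oo] --> I mu (fun z => f z * q' z * phi z).
    apply: (@dct _ _ _ mu set0 (fun n z => f z * q n z * phi z) _ _ measurable0 (measure0 _) _ _ ai).
    - by move=> n; apply: measurable_funM => //; apply: measurable_funM => //; case: (aq n) => -[].
    - by apply: measurable_funM => //; exact: measurable_funM.
    - by move=> n z; rewrite mulrAC normrM mulrC ler_wpM2r.
    - by move=> z _; apply: cvgM; [apply: cvgM; [exact: cvg_cst|exact: qq']|exact: cvg_cst].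
  have cv0 : I mu (fun z => f z * q n z * phi z) @[n --> \oo] --> (0 : R).
    by rewrite (_ : (fun n => _) = cst 0); [exact: cvg_cst|apply/funext => n; exact: H].
  by rewrite -(cvg_lim (@norm_hausdorff _ R) cv); exact: (cvg_lim (@norm_hausdorff _ R) cv0).
have H n := (aq n).2 _ of_.
split.
- by apply: lim0; [exact/alg_bmf/alg_cos|move=> n; exact: ((H n).2 K).1].
- by apply: lim0; [exact/alg_bmf/alg_sin|move=> n; exact: ((H n).2 K).2].
Qed.

(* For 0 <= x <= 1 the sequence (1 - x ^ 2n) ^ (n 4 ^ n) tends to 1 if x < 1/2 and to 0 if
   1/2 <= x, by Bernoulli's inequality. *)
Let step (n : nat) (x : R) := (1 - x ^+ (2 * n)) ^+ (n * 4 ^ n).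

Lemma step_bounds n x : 0 <= x <= 1 -> 0 <= step n x <= 1.
Proof.
move=> /andP[x0 x1]; have h0 : 0 <= x ^+ (2 * n) by exact: exprn_ge0.
have h1 : x ^+ (2 * n) <= 1 by exact: exprn_ile1.
by rewrite /step exprn_ge0 ?exprn_ile1//; lra.
Qed.

Lemma step_cvg1 x : 0 <= x -> x < 1 / 2 -> step n x @[n --> \oo] --> (1 : R).
Proof.
move=> x0 x2; pose a := 2 * x; have a1 : a < 1 by rewrite /a; lra.
have a0 : 0 <= a by rewrite /a mulr_ge0.
have xx n : x ^+ (2 * n) <= 1 by apply: exprn_ile1 => //; lra.
pose D := (1 - a)^-1; have D0 : 0 < D by rewrite invr_gt0; lra.
have na n : n%:R * a ^+ n <= D.
  have := bernoulli (h := a^-1 - 1) n; have [->|an] := eqVneq a 0.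
    by case: n => [|n] _; rewrite ?mul0r ?expr0n ?mulr0 ltW.
  have ap : 0 < a by rewrite lt0r an.
  have i1 : 1 < a^-1 by rewrite -[1]invr1 ltf_pV2 ?posrE.
  rewrite (_ : 1 + (a^-1 - 1) = a^-1) ?exprVn => [H|]; last by ring.
  have {}H : 1 + n%:R * (a^-1 - 1) <= (a ^+ n)^-1 by apply: H; lra.
  have an0 : 0 < a ^+ n by exact: exprn_gt0.
  have := ler_wpM2l (ltW an0) H; rewrite divff ?lt0r_neq0// => {}H.
  have h4 : a ^+ n * (n%:R * (a^-1 - 1)) <= 1 by move: H; rewrite mulrDr mulr1; have := ltW an0; lra.
  rewrite /D -[leRHS]mul1r ler_pdivlMr; last lra.
  have h5 : 0 <= n%:R * a ^+ n by rewrite mulr_ge0// ltW.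
  have h6 : 1 - a <= a^-1 - 1 by have := sqr_ge0 (a - 1); have := mulfV an; rewrite expr2; nra.
  have := ler_wpM2l h5 h6; nra.
have lo n : 1 - D * a ^+ n <= step n x.
  have := bernoulli (h := - x ^+ (2 * n)) (n * 4 ^ n); rewrite lerN2 => /(_ (xx n)).
  apply: le_trans; rewrite mulrN lerD2l lerN2 natrM natrX exprM.
  rewrite (_ : n%:R * 4 ^+ n * _ = (n%:R * a ^+ n) * a ^+ n).
    by rewrite ler_wpM2r ?exprn_ge0// na.
  by rewrite /a exprMn -mulrA -mulrA; congr (_ * _); rewrite (_ : (4 : R) = 2 * 2) ?exprMn ?expr2; ring.
have up n : step n x <= 1 by have /andP[] := @step_bounds n x ltac:(lra).
apply: (@squeeze_cvgr _ _ _ _ (fun n => 1 - D * a ^+ n) (fun=> 1)); last 2 first.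
- have : 1 - geometric D a n @[n --> \oo] --> (1 : R) - 0.
    by apply: cvgB; [exact: cvg_cst|apply: cvg_geometric; rewrite ger0_norm].
  by rewrite subr0.
- exact: cvg_cst.
by apply: nearW => n; rewrite lo up.
Qed.

Lemma step_cvg0 x : 1 / 2 <= x <= 1 -> step n x @[n --> \oo] --> (0 : R).
Proof.
move=> /andP[x2 x1]; have x0 : 0 <= x by lra.
have up n : step n x <= n.+1%:R^-1.
  set h := x ^+ (2 * n); have h0 : 0 <= h by exact: exprn_ge0.
  have h1 : h <= 1 by exact: exprn_ile1.
  have : (1 + h) ^+ (n * 4 ^ n) * step n x <= 1.
    by rewrite /step -exprMn exprn_ile1// -/h; have := sqr_ge0 h; rewrite expr2; nra.
  have b : n.+1%:R <= (1 + h) ^+ (n * 4 ^ n).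
    have hm1 : -1 <= h by lra.
    apply: le_trans (bernoulli (n * 4 ^ n) hm1); rewrite -natr1 addrC lerD2l natrM natrX -mulrA.
    rewrite -[leLHS]mulr1 ler_wpM2l// /h exprM -exprMn exprn_ege1//.
    by rewrite expr2; nra.
  have s0 : 0 <= step n x by have /andP[] := @step_bounds n x ltac:(lra).
  have := ler_wpM2r s0 b => h2 h3; have := le_trans h2 h3.
  by rewrite mulrC -ler_pdivlMr ?mul1r.
apply: (@squeeze_cvgr _ _ _ _ (fun=> 0) (fun n => n.+1%:R^-1)); last 2 first.
- exact: cvg_cst.
- exact: cvg_harmonic.
apply: nearW => n; rewrite up andbT.
by have /andP[] := @step_bounds n x ltac:(lra).
Qed.

Lemma admissible_gt q (r : R) : admissible q -> admissible (\1_[set z | r < q z] : mP -> R).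
Proof.
move=> aq; have [[mq [M qM]] _] := aq; pose M' := `|M| + `|r| + 1.
have M'0 : 0 < M' by rewrite /M' ltr_wpDl// addr_ge0.
(* An affine image of q with values in [0, 1] that lies below 1/2 exactly where q > r, as needed for
   [step]. *)
pose x z := 1 / 2 + (- (4 * M')^-1) * (q z + - r).
have xE z : x z = 1 / 2 - (q z - r) / (4 * M') by rewrite /x; ring.
have qr z : `|(q z - r) / (4 * M')| <= 1 / 4.
  rewrite normrM (ger0_norm (_ : 0 <= _^-1)); last by rewrite invr_ge0 mulr_ge0// ltW.
  rewrite ler_pdivrMr ?mulr_gt0//; apply: le_trans (ler_normB _ _) _.
  have := le_trans (qM z) (ler_norm M); rewrite /M'; lra.
have x01 z : 0 <= x z <= 1.
  by have := qr z; rewrite xE ler_norml => /andP[h1 h2]; apply/andP; split; lra.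
have ax : admissible x.
  by apply: admissibleD; [exact: admissible_cst|apply: admissibleM; [exact: admissible_cst|
    apply: admissibleD => //; exact: admissible_cst]].
apply: (@admissible_lim (fun n z => step n (x z)) _ 1).
- move=> n; apply: admissibleX.
  have := admissibleD (admissible_cst 1) (admissibleM (admissible_cst (-1)) (admissibleX (2 * n) ax)).
  by congr admissible; apply/funext => z; rewrite mulN1r.
- by move=> n z; have /andP[h1 h2] := step_bounds n (x01 z); rewrite ger0_norm.
- move=> z; rewrite indicE; case: (ltP r (q z)) => h.
    rewrite mem_set//; apply: step_cvg1; first by have /andP[] := x01 z.
    rewrite xE; have : 0 < (q z - r) / (4 * M') by rewrite divr_gt0 ?mulr_gt0// subr_gt0.
    by lra.
  rewrite memNset/=; last by rewrite ltNge h.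
  apply: step_cvg0; have /andP[_ ->] := x01 z; rewrite andbT xE.
  have : (q z - r) / (4 * M') <= 0 by rewrite mulr_le0_ge0 ?invr_ge0 ?mulr_ge0 ?(ltW M'0)// subr_le0.
  by lra.
Qed.

Definition adm_set : set (set mP) := [set A | measurable A /\ admissible (\1_A : mP -> R)].

Lemma adm_set_sigma : sigma_algebra setT adm_set.
Proof.
split.
- split=> //; have := admissible_cst 0; congr admissible; apply/funext => z.
  by rewrite indicE in_set0.
- move=> A [mA aA]; rewrite setTD; split; first exact: measurableC.
  have := admissibleD (admissible_cst 1) (admissibleM (admissible_cst (-1)) aA).
  congr admissible; apply/funext => z; rewrite !indicE in_setC.
  by case: (z \in A); rewrite ?mulr1n ?mulr0n; ring.
- move=> F HF; split; first by apply: bigcup_measurable => k _; case: (HF k).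
  (* The indicator of the complement of the first n sets; one minus it increases to the indicator of
     the union. *)
  pose pr n z : R := \prod_(k < n) (1 + (-1) * \1_(F k) z).
  have pr01 n z : pr n z = 0 \/ pr n z = 1.
    rewrite /pr; elim: n => [|n IH]; first by right; rewrite big_ord0.
    rewrite big_ord_recr/= indicE; case: (z \in F n) => /=; rewrite ?mulr1 ?mulr0 ?addr0 ?mulr1.
      by left; rewrite subrr mulr0.
    exact: IH.
  apply: (@admissible_lim (fun n z => 1 + (-1) * pr n z) _ 1).
  + move=> n; apply: admissibleD; first exact: admissible_cst.
    apply: admissibleM; first exact: admissible_cst.
    elim: n => [|n IH].
      by have := admissible_cst 1; congr admissible; apply/funext => z; rewrite /pr big_ord0.
    have := admissibleM IH (admissibleD (admissible_cst 1) (admissibleM (admissible_cst (-1)) (HF n).2)).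
    by congr admissible; apply/funext => z; rewrite /pr big_ord_recr.
  + move=> n z; case: (pr01 n z) => ->; rewrite ?mulr0 ?mulr1 ?addr0 ?subrr ?normr0 ?normr1//.
  + move=> z; rewrite indicE; have [[k _ Fk]|nF] := pselect ((\bigcup_k F k) z).
      rewrite mem_set; last by exists k.
      apply: (@cvg_near_cst _ _ _ _ _ _); exists k.+1 => // n /= kn.
      by rewrite /pr (bigD1 (Ordinal kn))//= indicE mem_set// mulr1 subrr mul0r mulr0 addr0.
    rewrite memNset//.
    rewrite (_ : (fun n => _) = cst 0); first exact: cvg_cst.
    apply/funext => n; rewrite /pr big1 ?mulr1 ?subrr// => k _.
    by rewrite indicE memNset ?mulr0 ?addr0// => Fk; apply: nF; exists k.
Qed.

Lemma adm_set_ae A B N : measurable A -> measurable N -> mu N = 0%E ->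
  (forall z, ~ N z -> A z <-> B z) -> adm_set B -> adm_set A.
Proof.
move=> mA mN N0 AB [mB [bB aB]]; split=> //.
have bA : bmf (\1_A : mP -> R).
  split; first exact: measurable_indic.
  by exists 1 => z; rewrite indicE; case: (_ \in _); rewrite ?normr1 ?normr0.
have E z : ~ N z -> \1_A z = \1_B z :> R.
  move=> Nz; rewrite !indicE; have [Az|Az] := pselect (A z).
    by rewrite !mem_set//; apply/AB.
  by rewrite !memNset// => /(AB _ Nz).
split=> // f of_; have [fs _] := of_; have [_ H] := aB _ of_.
split=> [|K]; first exact: sqi_bmf.
have X (phi : mP -> R) : bmf phi -> I mu (fun z => f z * \1_A z * phi z) = I mu (fun z => f z * \1_B z * phi z).
  move=> bp; apply: (I_ae mN N0) => [|z Nz]; last by rewrite E.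
  exact: intg_measurable (intg_bmf (sqi_intg (sqi_bmf fs bA)) bp).
rewrite /ca /cb !X; [exact: H|exact/alg_bmf/alg_sin|exact/alg_bmf/alg_cos].
Qed.

(* On the interior of the cell the ray c < a is the arc |c - a/2| < a/2. *)
Lemma adm_ray (c : mP -> mR) (w : Z6) (a : R) : measurable_fun setT c -> (forall z, ph w z = c z) ->
  mu (c @^-1` (~` `]0, 2 * pi[%classic)) = 0%E -> adm_set (c @^-1` `]-oo, a[%classic).
Proof.
move=> mc wc N0; pose N : set mP := c @^-1` (~` `]0, 2 * pi[%classic).
have mN : measurable N by rewrite -[N]setTI; apply: mc => //; apply: measurableC; exact: measurable_itv.
have mA : measurable (c @^-1` `]-oo, a[%classic) by rewrite -[X in measurable X]setTI; apply: mc => //; exact: measurable_itv.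
have cN z : ~ N z -> 0 < c z < 2 * pi.
  move=> Nz; have : `]0, 2 * pi[%classic (c z) by apply: contrapT => h; exact: (Nz h).
  by rewrite /= in_itv.
have [s0 sC _] := adm_set_sigma.
have sT : adm_set setT by have := sC _ s0; rewrite setD0.
have [a0|a0] := leP a 0.
  apply: (adm_set_ae mA mN N0 _ s0) => z /cN/andP[h _]; split=> //=.
  by rewrite in_itv/=; lra.
have [a2|a2] := leP (2 * pi) a.
  apply: (adm_set_ae mA mN N0 _ sT) => z /cN/andP[_ h]; split=> //= _.
  by rewrite in_itv/=; lra.
pose q z := cosK w z * cos (a / 2) + sinK w z * sin (a / 2).
have aq : admissible q.
  by apply: admissibleD; apply: admissibleM; [exact: (admissible_trig w).1|exact: admissible_cst|
    exact: (admissible_trig w).2|exact: admissible_cst].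
pose B := [set z | cos (a / 2) < q z].
have mB : measurable B.
  have [[mq _] _] := aq; rewrite (_ : B = setT `&` q @^-1` `]cos (a / 2), +oo[%classic).
    by apply: mq => //; exact: measurable_itv.
  by rewrite setTI; apply/seteqP; split=> z /=; rewrite /B/= in_itv/= andbT.
apply: (@adm_set_ae _ B N) => //; last by split=> //; exact: admissible_gt.
move=> z /cN/andP[c0 c2]; rewrite /B /= in_itv/=.
have -> : q z = cos (c z - a / 2) by rewrite /q /cosK /sinK wc cosB.
have ha : a / 2 \in `[0, pi] by rewrite in_itv/=; apply/andP; split; lra.
have [h|h] := leP (c z) (a / 2).
  have -> : cos (c z - a / 2) = cos (a / 2 - c z) by rewrite -cosN opprB.
  rewrite ltr_cos ?in_itv//=; last by apply/andP; split; lra.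
  by split=> _; lra.
have [h2|h2] := leP (c z - a / 2) pi.
  rewrite ltr_cos ?in_itv//=; last by apply/andP; split; lra.
  by split=> ?; lra.
have -> : cos (c z - a / 2) = cos (2 * pi - (c z - a / 2)).
  rewrite -cosN opprB -[LHS]cosD2pi; congr cos.
  by rewrite -mulr_natl; ring.
rewrite ltr_cos ?in_itv//=; last by apply/andP; split; lra.
by split=> ?; lra.
Qed.

Lemma muT_ends : muT R (~` `]0, 2 * pi[%classic) = 0%E.
Proof.
rewrite [LHS](_ : _ = lebR R (~` `]0, 2 * pi[%classic `&` `[0, 2 * pi]%classic))//.
have m0 (x : R) : lebR R [set x] = 0%E by rewrite /lebR /= lebesgue_measure_set1.
have mm (x : R) : measurable ([set x] : set mR) by exact: measurable_set1.
have h0 : lebR R ([set 0] `|` [set 2 * pi]) = 0%E by rewrite measureU0 ?m0.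
have mA : measurable (~` `]0, 2 * pi[%classic `&` `[0, 2 * pi]%classic : set mR).
  by apply: measurableI; [apply: measurableC; exact: measurable_itv|exact: measurable_itv].
apply: (subset_measure0 mA (measurableU _ _ (mm 0) (mm (2 * pi))) _ h0).
move=> x [] /=; rewrite !in_itv/= => /negP; rewrite negb_and -!leNgt => /orP[h|h] /andP[h1 h2]; [left|right];
by apply/eqP; rewrite eq_le ?h ?h1 ?h2.
Qed.

Lemma null_fst d1 d2 (T1 : measurableType d1) (T2 : measurableType d2)
    (n1 : {finite_measure set T1 -> \bar R}) (n2 : {finite_measure set T2 -> \bar R}) (A : set T1) :
  measurable A -> n1 A = 0%E -> fin_product n1 n2 (fst @^-1` A) = 0%E.
Proof.
move=> mA A0; rewrite (_ : fst @^-1` A = A `*` setT); last by apply/seteqP; split=> z //= -[].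
by rewrite /fin_product product_measure1E// [X in (X * _)%E]A0 mul0e.
Qed.
Lemma null_snd d1 d2 (T1 : measurableType d1) (T2 : measurableType d2)
    (n1 : {finite_measure set T1 -> \bar R}) (n2 : {finite_measure set T2 -> \bar R}) (A : set T2) :
  measurable A -> n2 A = 0%E -> fin_product n1 n2 (snd @^-1` A) = 0%E.
Proof.
move=> mA A0; rewrite (_ : snd @^-1` A = setT `*` A); last by apply/seteqP; split=> z //= -[].
by rewrite /fin_product product_measure1E// [X in (_ * X)%E]A0 mule0.
Qed.

Lemma adm_coordinates (a : R) :
  [/\ adm_set (@x1 R @^-1` `]-oo, a[%classic), adm_set (@x2 R @^-1` `]-oo, a[%classic),
      adm_set (@x3 R @^-1` `]-oo, a[%classic) & adm_set (@x4 R @^-1` `]-oo, a[%classic)] /\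
  adm_set (@y1 R @^-1` `]-oo, a[%classic) /\ adm_set (@y2 R @^-1` `]-oo, a[%classic).
Proof.
have [[m1 m2 m3 m4] [m5 m6]] := measurable_coordinates R.
pose B : set mR := ~` `]0, 2 * pi[%classic.
have mB : measurable B by apply: measurableC; exact: measurable_itv.
have B0 : muT R B = 0%E by exact: muT_ends.
have mf d1 d2 (T1 : measurableType d1) (T2 : measurableType d2) (A : set T1) :
    measurable A -> measurable ((fst : T1 * T2 -> T1) @^-1` A).
  by move=> mA; rewrite -[X in measurable X]setTI; apply: measurable_fst.
have ms d1 d2 (T1 : measurableType d1) (T2 : measurableType d2) (A : set T2) :
    measurable A -> measurable ((snd : T1 * T2 -> T2) @^-1` A).
  by move=> mA; rewrite -[X in measurable X]setTI; apply: measurable_snd.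
have f2 : muT2 R (fst @^-1` B) = 0%E := null_fst (muT R) mB B0.
have s2 : muT2 R (snd @^-1` B) = 0%E := null_snd (muT R) mB B0.
have mf2 : measurable ((fst : mR * mR -> mR) @^-1` B) := mf _ _ _ mR _ mB.
have ms2 : measurable ((snd : mR * mR -> mR) @^-1` B) := ms _ _ mR _ _ mB.
have ff4 := null_fst (muT2 R) mf2 f2; have fs4 := null_fst (muT2 R) ms2 s2.
have sf4 := null_snd (muT2 R) mf2 f2; have ss4 := null_snd (muT2 R) ms2 s2.
have mff := mf _ _ _ (mR * mR)%type _ mf2; have mfs := mf _ _ _ (mR * mR)%type _ ms2.
have msf := ms _ _ (mR * mR)%type _ _ mf2; have mss := ms _ _ (mR * mR)%type _ _ ms2.
pose w (i1 i2 i3 i4 i5 i6 : int) : Z6 := (((i1, i2), (i3, i4)), (i5, i6)).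
have wE i1 i2 i3 i4 i5 i6 z : ph (w i1 i2 i3 i4 i5 i6) z =
    i1%:~R * x1 z + i2%:~R * x2 z + i3%:~R * x3 z + i4%:~R * x4 z + i5%:~R * y1 z + i6%:~R * y2 z.
  by [].
split; [split|split].
- have N0 : mu (@x1 R @^-1` B) = 0%E := null_fst (muT2 R) mff ff4.
  by apply: (adm_ray (w := w 1 0 0 0 0 0) _ m1 _ N0) => z; rewrite wE; ring.
- have N0 : mu (@x2 R @^-1` B) = 0%E := null_fst (muT2 R) mfs fs4.
  by apply: (adm_ray (w := w 0 1 0 0 0 0) _ m2 _ N0) => z; rewrite wE; ring.
- have N0 : mu (@x3 R @^-1` B) = 0%E := null_fst (muT2 R) msf sf4.
  by apply: (adm_ray (w := w 0 0 1 0 0 0) _ m3 _ N0) => z; rewrite wE; ring.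
- have N0 : mu (@x4 R @^-1` B) = 0%E := null_fst (muT2 R) mss ss4.
  by apply: (adm_ray (w := w 0 0 0 1 0 0) _ m4 _ N0) => z; rewrite wE; ring.
- have N0 : mu (@y1 R @^-1` B) = 0%E := null_snd (muT4 R) mf2 f2.
  by apply: (adm_ray (w := w 0 0 0 0 1 0) _ m5 _ N0) => z; rewrite wE; ring.
- have N0 : mu (@y2 R @^-1` B) = 0%E := null_snd (muT4 R) ms2 s2.
  by apply: (adm_ray (w := w 0 0 0 0 0 1) _ m6 _ N0) => z; rewrite wE; ring.
Qed.

(** On the same points with sigma-algebra [adm_set] the coordinates are measurable, by
    [adm_coordinates]; so the identity map into the product space is measurable, and preimages under
    it are the sets themselves. *)
Lemma measurable_adm A : measurable A -> adm_set A.
Proof.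
pose T' := g_sigma_algebraType adm_set.
have sE : <<s adm_set >> = adm_set by exact: sigma_algebra_id adm_set_sigma.
have cm (c : mP -> mR) : (forall a, adm_set (c @^-1` `]-oo, a[%classic)) ->
    measurable_fun setT (c : T' -> mR).
  move=> H; apply: (@measurability _ _ T' mR setT c (@RGenInftyO.G R)).
    exact: RGenInftyO.measurableE.
  move=> _ [_ [a ->] <-]; rewrite setTI; apply: sub_sigma_algebra; exact: H.
have H a := adm_coordinates a.
have mid : measurable_fun setT (id : T' -> mP).
  rewrite (_ : id = fun z : T' => ((((x1 z, x2 z), (x3 z, x4 z)), (y1 z, y2 z)) : mP)); last first.
    by apply/funext => -[[[? ?] [? ?]] [? ?]].
  apply: measurable_fun_pair; apply: measurable_fun_pair; try apply: measurable_fun_pair; apply: cm => a;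
  have [[h1 h2 h3 h4] [h5 h6]] := H a.
  - exact: h1.
  - exact: h2.
  - exact: h3.
  - exact: h4.
  - exact: h5.
  - exact: h6.
move=> mA; have := mid measurableT A mA; rewrite setTI.
by rewrite /measurable/= sE.
Qed.

(** The coefficient at K = 0 of f times the indicator of E is the integral of f over E. It vanishes
    for every measurable E, so f = 0 almost everywhere. *)
Lemma orthogonal_eq0 f : orthogonal f -> n2 mu f = 0.
Proof.
move=> of_; have [fs _] := of_; have fi := sqi_intg fs.
have [N [mN N0 HN]] : ae_eq mu setT (EFin \o f) (EFin \o (cst 0 : mP -> R)).
  apply: (integral_ae_eq measurableT fi _ _) => [|E _ mE]; first by apply/measurable_EFinP; exact: measurable_cst.
  have [_ [_ aE]] := measurable_adm mE; have [gs /(_ 0)[H _]] := aE _ of_.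
  rewrite [RHS]integral0_eq// integral_mkcond.
  have gi := sqi_intg gs.
  transitivity ((I mu (fun z => f z * \1_E z))%:E); last first.
    congr (_%:E); rewrite -[RHS]H; apply: eqIg => z; by rewrite /cosK ph0 cos0 mulr1.
  rewrite EFin_I//; apply: eq_integral => z _; rewrite /patch indicE /=.
  by case: (z \in E); rewrite ?mulr1 ?mulr0.
transitivity (I mu (cst 0 : mP -> R)); last first.
  have := IZ (mu := mu) 0 (bmf_intg mu (@bmf_cst _ mP R 1)); rewrite mul0r => E.
  by rewrite -[RHS]E; apply: eqIg => z; rewrite mul0r.
apply: (I_ae mN N0) => [|z Nz]; first by case: fs => _ /intg_measurable.
have fz : f z = 0.
  apply: contrapT => h; apply: Nz; apply: HN => /= /(_ Logic.I) [E]; exact: h.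
by rewrite fz expr0n.
Qed.

(** On the zero set of dD the cosines of all multiples of [e13] equal 1, so the indicator of this
    set has infinitely many coefficients equal to its measure; Bessel's inequality forces the
    measure to be 0. *)
Lemma dD_null : measurable [set z : mP | sqD z = 0] /\ mu [set z : mP | sqD z = 0] = 0%E.
Proof.
pose N : set mP := [set z | sqD z = 0].
have bc K : bmf (cosK K : mP -> R) by exact/alg_bmf/alg_cos.
have bs : bmf (@sqD R : mP -> R).
  apply: (@alg_bmf R (@sqD R)).
  apply: (eq_alg (f := fun z => (1 + (- (1 / 2)) * cosK e13 z) + (- (1 / 2)) * cosK e24 z)).
    by move=> z; rewrite /sqD; ring.
  by apply: algD; [apply: algD; [exact: alg_cst|apply: algZ; exact: alg_cos]|apply: algZ; exact: alg_cos].
have mN : measurable N.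
  rewrite (_ : N = setT `&` (@sqD R : mP -> mR) @^-1` [set 0]); first by apply: bs.1 => //; exact: measurable_set1.
  by rewrite setTI.
split=> //.
have bN : bmf (\1_N : mP -> R).
  split; first exact: measurable_indic.
  by exists 1 => z; rewrite indicE; case: (_ \in _); rewrite ?normr1 ?normr0.
pose x := I mu (\1_N : mP -> R).
have xE n : ca (\1_N) (e13 *+ n) = x.
  apply: eqIg => z; rewrite indicE; have [Nz|Nz] := boolP (z \in N); last by rewrite mul0r.
  move: Nz; rewrite inE /N /= sqD_sin => /eqP; rewrite paddr_eq0 ?sqr_ge0// => /andP[/eqP h _].
  have c1 : cosK e13 z = 1 by rewrite /cosK ph_e13 cos_half h mulr0 subr0.
  have s1 : sinK e13 z = 0.
    have := cos2Dsin2 (ph e13 z); rewrite -/(cosK _ _) -/(sinK _ _) c1 expr1n => E.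
    by apply/eqP; rewrite -sqrf_eq0; apply/eqP; lra.
  have [cn _] : cosK (e13 *+ n) z = 1 /\ sinK (e13 *+ n) z = 0.
    elim: n => [|n [IH1 IH2]]; first by rewrite /cosK /sinK ph0 cos0 sin0.
    rewrite /cosK /sinK mulrS phD cosD sinD -!/(cosK _ _) -!/(sinK _ _) c1 s1 IH1 IH2.
    by split; ring.
  by rewrite cn mulr1.
have inj : injective (fun n : nat => e13 *+ n : Z6).
  have k3 n : (e13 *+ n : Z6).1.2.1 = n%:Z.
    elim: n => // n IH; rewrite mulrSr /= IH; rewrite /e13 /zv /=; lia.
  by move=> n m E; have := k3 n; rewrite E k3 => -[].
have H (n : nat) : n%:R * x ^+ 2 <= vol R * n2 mu (\1_N : mP -> R).
  have uS : uniq [seq (e13 *+ k : Z6) | k <- iota 0 n] by rewrite map_inj_uniq ?iota_uniq.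
  apply: le_trans (bessel0 (bmf_sqi mu bN) uS); rewrite big_map.
  apply: (@le_trans _ _ (\sum_(k <- iota 0 n) x ^+ 2)).
    by rewrite big_const_seq count_predT size_iota iter_addr_0 mulr_natl.
  by apply: ler_sum => k _; rewrite xE lerDl sqr_ge0.
have x0 : x = 0.
  apply: contrapT => /eqP; rewrite -sqrf_eq0 => xn; have xp : 0 < x ^+ 2 by rewrite lt0r xn sqr_ge0.
  pose V := vol R * n2 mu (\1_N : mP -> R).
  have [k hk] : exists k : nat, V / x ^+ 2 < k%:R by exists (Num.truncn (V / x ^+ 2)).+1; exact: truncnS_gt.
  by have := H k; rewrite -ler_pdivlMr// leNgt hk.
have E := integral_indic mu measurableT mN; rewrite setIT in E.
have E2 := EFin_I (bmf_intg mu bN); rewrite -/x x0 in E2.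
by rewrite -[LHS]E -[LHS]E2.
Qed.
End Uniqueness.

(** * Fourier approximation and unweighted weak derivatives *)

Section Parseval.
Variable R : realType.
Notation P := (point6 R).
Notation mR := (measurableTypeR R).
Notation mP := (point6 mR).
Notation mu := (muT6 R).
Implicit Types (K L e : Z6) (z v : P) (f g q : mP -> R).

Let bc K : bmf (cosK K : mP -> R). Proof. exact/alg_bmf/alg_cos. Qed.
Let bs K : bmf (sinK K : mP -> R). Proof. exact/alg_bmf/alg_sin. Qed.

Lemma n2_add0 f g : sqi mu f -> sqi mu g -> n2 mu g = 0 -> n2 mu (fun z => f z + g z) = n2 mu f.
Proof.
move=> fs gs g0; rewrite n2D// g0 addr0; have := CS fs gs; rewrite g0 mulr0 => H.
have -> : I mu (fun z => f z * g z) = 0.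
  by apply/eqP; rewrite -sqrf_eq0 eq_le H sqr_ge0.
by rewrite mulr0 addr0.
Qed.

Lemma caB f g K : sqi mu f -> sqi mu g -> ca (fun z => f z - g z) K = ca f K - ca g K.
Proof.
move=> /sqi_intg fi /sqi_intg gi; rewrite /ca -IB; [|exact: intg_bmf (bc K)|exact: intg_bmf (bc K)].
by apply: eqIg => z; rewrite mulrBl.
Qed.
Lemma cbB f g K : sqi mu f -> sqi mu g -> cb (fun z => f z - g z) K = cb f K - cb g K.
Proof.
move=> /sqi_intg fi /sqi_intg gi; rewrite /cb -IB; [|exact: intg_bmf (bs K)|exact: intg_bmf (bs K)].
by apply: eqIg => z; rewrite mulrBl.
Qed.

Lemma I_cosH0 g K : I mu (fun z => g z * cosH 0 K z) = ca g K.
Proof. by apply: eqIg => z; rewrite cosH0. Qed.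
Lemma I_sinH0 g K : I mu (fun z => g z * sinH 0 K z) = cb g K.
Proof. by apply: eqIg => z; rewrite sinH0. Qed.

(** The factor is 1 / vol and not 2 / vol, since K and -K both occur in a full sum. *)
Definition partial_sum f (S : seq Z6) : mP -> R :=
  TP 0 S (fun K => (vol R)^-1 * ca f K) (fun K => (vol R)^-1 * cb f K).

Let energy f K := ((vol R)^-1 * ca f K) ^+ 2 + ((vol R)^-1 * cb f K) ^+ 2.

Let energyE f (T : seq Z6) : \sum_(K <- T) energy f K = (vol R)^-2 * \sum_(K <- T) (ca f K ^+ 2 + cb f K ^+ 2).
Proof. by rewrite mulr_sumr; apply: eq_bigr => K _; rewrite /energy !exprMn exprVn mulrDr. Qed.

(** The sum of the series has the same coefficients as f ([series_coef]), so the difference is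
    orthogonal to all characters and has norm 0. *)
Lemma parseval f (c : Z6 -> R) S : sqi mu f -> exhausts c S -> (forall K, energy f K <= c K) ->
  forall n, n2 mu (fun z => partial_sum f (S n) z - f z) <= 32 * vol R / 4 ^+ n.
Proof.
move=> fs ex ec; have [g gs H] := series_cvg 0 ex ec.
have V0 := lt0r_neq0 (vol_gt0 R).
have og : orthogonal (fun z => g z - f z).
  split=> [|K]; first exact: sqiB.
  have [h1 h2] := series_coef ex ec K gs H; rewrite caB// cbB//.
  move: h1 h2; rewrite I_cosH0 I_sinH0 sub0r caN cbN// => -> ->.
  by split; field.
move=> n; have sp : sqi mu (partial_sum f (S n)) by exact/bmf_sqi/bmf_TP.
have := H n; rewrite -(n2_add0 (sqiB sp gs) (sqiB gs fs) (orthogonal_eq0 og)).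
by congr (n2 mu _ <= _); apply/funext => z; rewrite /partial_sum; ring.
Qed.

Lemma parseval_le f (A : R) : sqi mu f ->
  (forall S : seq Z6, uniq S -> \sum_(K <- S) (ca f K ^+ 2 + cb f K ^+ 2) <= A) ->
  n2 mu f <= 2 * A / vol R.
Proof.
move=> fs fA; have V0 := vol_gt0 R.
have eA S : uniq S -> \sum_(K <- S) energy f K <= (vol R)^-2 * A.
  by move=> uS; rewrite energyE ler_wpM2l ?fA// invr_ge0 sqr_ge0.
have [S ex] := exhaustion eA.
have := series_n2 ex eA fs (parseval fs ex (fun K => lexx _)).
rewrite (_ : 2 * vol R * ((vol R)^-2 * A) = 2 * A / vol R)//.
by field; rewrite lt0r_neq0.
Qed.

(** One sequence of lists serves both functions because it exhausts the sum of their energies. It is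
    applied to a function and its derivative. *)
Lemma parseval2 f g : sqi mu f -> sqi mu g -> exists S : nat -> seq Z6, forall n,
  n2 mu (fun z => partial_sum f (S n) z - f z) <= 32 * vol R / 4 ^+ n /\
  n2 mu (fun z => partial_sum g (S n) z - g z) <= 32 * vol R / 4 ^+ n.
Proof.
move=> fs gs; pose c K := energy f K + energy g K.
have e0 h K : 0 <= energy h K by rewrite addr_ge0 ?sqr_ge0.
have V0 := vol_gt0 R; have V2 : 0 <= (vol R)^-2 by rewrite invr_ge0 sqr_ge0.
have [|S ex] := @exhaustion _ c ((vol R)^-2 * (vol R * n2 mu f) + (vol R)^-2 * (vol R * n2 mu g)).
  move=> S uS; rewrite /c big_split/= !energyE.
  by apply: lerD; rewrite ler_wpM2l//; exact: bessel0.
exists S => n; split.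
- by apply: (parseval fs ex) => K; rewrite lerDl.
- by apply: (parseval gs ex) => K; rewrite lerDr.
Qed.

(** Directions along which integration by parts leaves no boundary term; sums and differences of
    coordinate directions inherit this. *)
Definition balanced v := forall F : P -> R, C1 F -> I mu ('D_v F) = 0.

Lemma derive_cosK K v z : 'D_v (cosK K) z = - ph K v * sinK K z.
Proof. by rewrite (@derive_val _ _ _ _ _ _ _ (is_derive_cosK K z v)). Qed.
Lemma derive_sinK K v z : 'D_v (sinK K) z = ph K v * cosK K z.
Proof. by rewrite (@derive_val _ _ _ _ _ _ _ (is_derive_sinK K z v)). Qed.

Lemma C1_derivableM (F G : P -> R) v z : C1 F -> C1 G ->
  'D_v (fun z => F z * G z) z = F z * 'D_v G z + G z * 'D_v F z.
Proof.
by move=> [dF _ _] [dG _ _]; rewrite (deriveM (diff_derivable (dF z)) (diff_derivable (dG z))).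
Qed.

Lemma ca_derive v (F : P -> R) K : balanced v -> C1 F ->
  ca ('D_v F) K = ph K v * cb F K /\ cb ('D_v F) K = - (ph K v * ca F K).
Proof.
move=> bv cF; have cc : C1 (@cosK R K) by exact: C1_alg ltr01 (alg_cos _ K).
have cs : C1 (@sinK R K) by exact: C1_alg ltr01 (alg_sin _ K).
have bF := C1_bmf cF; have bD := C1_derive_bmf v cF.
split.
- have := bv _ (C1M cF cc).
  rewrite (@eqIg _ _ (fun z => 'D_v F z * cosK K z - ph K v * (F z * sinK K z))); last first.
    by move=> z; rewrite C1_derivableM// derive_cosK; ring.
  have i1 := bmf_intg mu (bmfM bD (bc K)); have i2 := bmf_intg mu (bmfM bF (bs K)).
  rewrite IB//; last exact: intgZ.
  by rewrite IZ// /ca /cb => /eqP; rewrite subr_eq0 => /eqP.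
- have := bv _ (C1M cF cs).
  rewrite (@eqIg _ _ (fun z => 'D_v F z * sinK K z + ph K v * (F z * cosK K z))); last first.
    by move=> z; rewrite C1_derivableM// derive_sinK; ring.
  have i1 := bmf_intg mu (bmfM bD (bs K)); have i2 := bmf_intg mu (bmfM bF (bc K)).
  rewrite ID//; last exact: intgZ.
  by rewrite IZ// /ca /cb => /eqP; rewrite addr_eq0 => /eqP.
Qed.

Let sq3 (a1 a2 a3 b1 b2 b3 e1 e2 e3 y1 y2 y3 : R) : b1 + b2 + b3 = 0 ->
  a1 - b1 = - e1 -> a2 - b2 = - e2 -> a3 - b3 = - e3 ->
  e1 ^+ 2 <= y1 -> e2 ^+ 2 <= y2 -> e3 ^+ 2 <= y3 -> (a1 + a2 + a3) ^+ 2 <= 3 * (y1 + y2 + y3).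
Proof.
move=> Z d1 d2 d3 c1 c2 c3; rewrite (_ : a1 + a2 + a3 = - (e1 + e2 + e3)) ?sqrrN; last by lra.
have := sqr_ge0 (e1 - e2); have := sqr_ge0 (e1 - e3); have := sqr_ge0 (e2 - e3).
by move: c1 c2 c3; rewrite !expr2; lra.
Qed.

(* An identity linear in (psi, D_v psi) which holds for characters extends to C^1 functions, since
   the partial sums of psi and of D_v psi converge simultaneously in L^2. *)
Lemma extend_from_characters (G f1 f2 : mP -> R) v : balanced v -> sqi mu G -> sqi mu f1 -> sqi mu f2 ->
  (forall K, ca G K + ca f1 K - ph K v * cb f2 K = 0 /\ cb G K + cb f1 K + ph K v * ca f2 K = 0) ->
  forall psi : P -> R, C1 psi ->
  I mu (fun z => G z * psi z) + I mu (fun z => f1 z * psi z) + I mu (fun z => f2 z * 'D_v psi z) = 0.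
Proof.
move=> bv Gs f1s f2s H psi cp; have bp := C1_bmf cp; have bD := C1_derive_bmf v cp.
have [S pS] := parseval2 (bmf_sqi mu bp) (bmf_sqi mu bD).
apply: (@eq0_geom _ _ (3 * (32 * vol R) * (n2 mu G + n2 mu f1 + n2 mu f2))) => n.
have [p1 p2] := pS n; set p := partial_sum _ _ in p1; set r := partial_sum _ _ in p2.
have bpn : bmf p by exact: bmf_TP.
have brn : bmf r by exact: bmf_TP.
have Z : I mu (fun z => G z * p z) + I mu (fun z => f1 z * p z) + I mu (fun z => f2 z * r z) = 0.
  rewrite !I_mul_TP// -!big_split/= big1// => K _; rewrite !I_cosH0 !I_sinH0.
  have [h1 h2] := H K; have [-> ->] := ca_derive K bv cp.
  transitivity ((vol R)^-1 * ca psi K * (ca G K + ca f1 K - ph K v * cb f2 K) +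
    (vol R)^-1 * cb psi K * (cb G K + cb f1 K + ph K v * ca f2 K)); first by ring.
  by rewrite h1 h2; ring.
have D h k b : sqi mu h -> bmf k -> bmf b ->
    I mu (fun z => h z * k z) - I mu (fun z => h z * b z) = - I mu (fun z => h z * (b z - k z)).
  move=> hs bk bb; have hi := sqi_intg hs.
  rewrite -IB; [|exact: intg_bmf hi bk|exact: intg_bmf hi bb].
  rewrite -IN; first by apply: eqIg => z; ring.
  by have := intgB (intg_bmf hi bb) (intg_bmf hi bk); congr (intg mu _); apply/funext => z; ring.
have d1 := D _ _ _ Gs bp bpn; have d2 := D _ _ _ f1s bp bpn; have d3 := D _ _ _ f2s bD brn.
have c1 := CS Gs (sqiB (bmf_sqi mu bpn) (bmf_sqi mu bp)).
have c2 := CS f1s (sqiB (bmf_sqi mu bpn) (bmf_sqi mu bp)).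
have c3 := CS f2s (sqiB (bmf_sqi mu brn) (bmf_sqi mu bD)).
have {}c1 := le_trans c1 (ler_wpM2l (n2_ge0 mu G) p1).
have {}c2 := le_trans c2 (ler_wpM2l (n2_ge0 mu f1) p1).
have {}c3 := le_trans c3 (ler_wpM2l (n2_ge0 mu f2) p2).
rewrite (_ : 3 * (32 * vol R) * _ / _ = 3 * (n2 mu G * (32 * vol R / 4 ^+ n) +
  n2 mu f1 * (32 * vol R / 4 ^+ n) + n2 mu f2 * (32 * vol R / 4 ^+ n))); last by ring.
exact: (sq3 Z d1 d2 d3 c1 c2 c3).
Qed.

Lemma weak_derivative_I w v f G : weak_derivative w v f G <-> sqi mu G /\
  forall phi, test_function phi ->
    I mu (fun z => G z * phi z) = - I mu (fun z => f z * 'D_v (fun z' => w z' * phi z') z).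
Proof. by split=> -[h1 h2]; (split; [exact/Lfun_sqi|exact: h2]). Qed.

Lemma weak_derivative1_I v f G : weak_derivative (cst 1) v f G <-> sqi mu G /\
  forall phi, test_function phi -> I mu (fun z => G z * phi z) = - I mu (fun z => f z * 'D_v phi z).
Proof.
have E phi : (fun z' => (cst 1 : P -> R) z' * phi z') = phi by apply/funext => w; rewrite mul1r.
split=> [/weak_derivative_I[h1 h2]|[h1 h2]].
  by split; [exact: h1|move=> phi tp; have := h2 phi tp; rewrite (E phi)].
by apply/weak_derivative_I; split; [exact: h1|move=> phi tp; rewrite (E phi); exact: h2].
Qed.

(** The weak identity tested with characters gives the coefficients of G, and Bessel's inequality
    bounds their sum. *)
Lemma forward1 v f G S : sqi mu f -> weak_derivative (cst 1) v f G -> uniq S ->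
  \sum_(K <- S) ph K v ^+ 2 * (ca f K ^+ 2 + cb f K ^+ 2) <= vol R * n2 mu G.
Proof.
move=> fs wG uS; have [Gs wGI] := (weak_derivative1_I v f G).1 wG.
apply: le_trans (bessel0 Gs uS); rewrite le_eqVlt; apply/orP; left; apply/eqP.
apply: eq_bigr => K _; have fi := sqi_intg fs.
have -> : ca G K = ph K v * cb f K.
  rewrite /ca (wGI _ (alg_test ltr01 (alg_cos _ K))).
  rewrite (@eqIg _ _ (fun z => - ph K v * (f z * sinK K z))); last by move=> z; rewrite derive_cosK; ring.
  by rewrite IZ; [rewrite /cb; ring|exact: intg_bmf fi (bs K)].
have -> : cb G K = - (ph K v * ca f K).
  rewrite /cb (wGI _ (alg_test ltr01 (alg_sin _ K))).
  rewrite (@eqIg _ _ (fun z => ph K v * (f z * cosK K z))); last by move=> z; rewrite derive_sinK; ring.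
  by rewrite IZ//; exact: intg_bmf fi (bc K).
by ring.
Qed.

Lemma ph_opp K v : ph (- K) v = - ph K v :> R. Proof. exact: phN. Qed.

(** G is synthesized from the expected coefficients; the weak identity then holds for characters,
    and [extend_from_characters] gives it for every test function. *)
Lemma backward1 v f (A : R) : balanced v -> sqi mu f ->
  (forall S : seq Z6, uniq S -> \sum_(K <- S) ph K v ^+ 2 * (ca f K ^+ 2 + cb f K ^+ 2) <= A) ->
  exists2 G, weak_derivative (cst 1) v f G & n2 mu G <= 2 * A / vol R.
Proof.
move=> bv fs fA; have V0 := vol_gt0 R; have Vn := lt0r_neq0 V0.
pose al K := (vol R)^-1 * (ph K v * cb f K); pose be K := - ((vol R)^-1 * (ph K v * ca f K)).
have abA S : uniq S -> \sum_(K <- S) (al K ^+ 2 + be K ^+ 2) <= (vol R)^-2 * A.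
  move=> uS; apply: le_trans (ler_wpM2l _ (fA _ uS)); last by rewrite invr_ge0 sqr_ge0.
  rewrite mulr_sumr le_eqVlt; apply/orP; left; apply/eqP; apply: eq_bigr => K _.
  by rewrite /al /be sqrrN !exprMn exprVn; ring.
have [S ex] := exhaustion abA; have le K : al K ^+ 2 + be K ^+ 2 <= al K ^+ 2 + be K ^+ 2 by [].
have [G Gs H] := series_cvg 0 ex le.
have GK K : ca G K = ph K v * cb f K /\ cb G K = - (ph K v * ca f K).
  have [] := series_coef ex le K Gs H; rewrite I_cosH0 I_sinH0 /al /be sub0r ph_opp cbN// caN => -> ->.
  by split; field.
exists G; last first.
  apply: le_trans (series_n2 ex abA Gs H) _.
  by rewrite le_eqVlt; apply/orP; left; apply/eqP; field.
apply/weak_derivative1_I; split=> // phi tp; have cp := C1_test tp.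
have f1s : sqi mu (cst 0 : mP -> R) by exact/bmf_sqi/(@bmf_cst _ mP R 0).
have c0 K : ca (cst 0 : mP -> R) K = 0 /\ cb (cst 0 : mP -> R) K = 0.
  have z0 (h : mP -> R) : bmf h -> I mu (fun z => (cst 0 : mP -> R) z * h z) = 0.
    move=> bh; have := IZ (mu := mu) 0 (bmf_intg mu bh); rewrite mul0r => E.
    by rewrite -[RHS]E.
  by split; apply: z0.
have : I mu (fun z => G z * phi z) + I mu (fun z => (cst 0 : mP -> R) z * phi z) + I mu (fun z => f z * 'D_v phi z) = 0.
  by apply: (extend_from_characters bv Gs f1s fs _ cp) => K; have [-> ->] := GK K; have [-> ->] := c0 K; split; ring.
have -> : I mu (fun z => (cst 0 : mP -> R) z * phi z) = 0.
  have := IZ (mu := mu) 0 (bmf_intg mu (C1_bmf cp)); rewrite mul0r => E0; by rewrite -[RHS]E0.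
by rewrite addr0 => /eqP; rewrite addr_eq0 => /eqP.
Qed.
End Parseval.

(** * Derivatives weighted by the distance *)

Section DistanceWeight.
Variable R : realType.
Notation P := (point6 R).
Notation mR := (measurableTypeR R).
Notation mP := (point6 mR).
Notation mu := (muT6 R).
Notation Null := ([set z : mP | sqD z = 0]).
Implicit Types (K L e : Z6) (z v : P) (f g q : mP -> R).

Definition dinv z : R := (dD z)^-1.
(** Smooth approximations of [dinv]: dD rho <= 1 uniformly in n, and the limit off the zeros of dD
    is [dinv]. *)
Definition rho (n : nat) z : R := rhoD (n.+1%:R^-1) z.

Let d0 n : 0 < (n.+1%:R^-1 : R). Proof. by rewrite invr_gt0. Qed.

Lemma dD_ge0 z : 0 <= dD z. Proof. by rewrite dD_sqrt sqrtr_ge0. Qed.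
Lemma rho_ge0 n z : 0 <= rho n z. Proof. by rewrite invr_ge0 sqrtr_ge0. Qed.
Lemma dD_rho n z : dD z * rho n z <= 1.
Proof.
have r0 := sqrt_regD_gt0 (d0 n) z.
rewrite /rho /rhoD ler_pdivrMr// mul1r dD_sqrt ler_wsqrtr// /regD lerDl sqr_ge0//.
Qed.
Lemma dD_le2 z : dD z <= 2.
Proof.
rewrite -(@ler_pXn2r _ 2) ?nnegrE ?dD_ge0// sqr_dD sqD_sin.
have h (t : R) : sin t ^+ 2 <= 1 by have := cos2Dsin2 t; have := sqr_ge0 (cos t); lra.
by have := h ((x3 z - x1 z) / 2); have := h ((x4 z - x2 z) / 2); rewrite !expr2; lra.
Qed.
Lemma dD_neq0 z : sqD z <> 0 -> dD z != 0.
Proof. by move=> s0; rewrite -sqrf_eq0 sqr_dD; apply/eqP. Qed.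

Lemma rho_cvg z : sqD z <> 0 -> rho n z @[n --> \oo] --> dinv z.
Proof.
move=> s0; have n0 : Num.sqrt (sqD z) != 0 by rewrite -dD_sqrt dD_neq0.
have c1 : (fun n : nat => regD (n.+1%:R^-1) z) @ \oo --> sqD z.
  rewrite -[X in _ --> X]addr0 /regD; apply: cvgD; first exact: cvg_cst.
  rewrite -[X in _ --> X](mulr0 0); under eq_fun do rewrite expr2.
  by apply: cvgM; exact: cvg_harmonic.
rewrite /dinv dD_sqrt /rho /rhoD; apply: cvgV => //.
by apply: (cvg_comp _ _ c1); exact: sqrt_continuous.
Qed.

Lemma alg_rho_n n : alg (n.+1%:R^-1 : R) (rho n). Proof. exact: alg_rho. Qed.
Lemma C1_rho n : C1 (rho n). Proof. exact: C1_alg (d0 n) (alg_rho_n n). Qed.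
Lemma bmf_rho n : bmf (rho n : mP -> R). Proof. exact: C1_bmf (C1_rho n). Qed.
Lemma bmf_dsqD v : bmf (dsqD v : mP -> R).
Proof. exact: alg_bmf (alg_dsqD _ v). Qed.
Lemma bmf_sqD : bmf (@sqD R : mP -> R).
Proof.
apply: (@alg_bmf R (@sqD R)).
apply: (eq_alg (f := fun z => (1 + (- (1 / 2)) * cosK e13 z) + (- (1 / 2)) * cosK e24 z)).
  by move=> z; rewrite /sqD; ring.
by apply: algD; [apply: algD; [exact: alg_cst|apply: algZ; exact: alg_cos]|apply: algZ; exact: alg_cos].
Qed.
Lemma bmf_dD : bmf (@dD R : mP -> R).
Proof.
split; last by exists 2 => z; rewrite ger0_norm ?dD_ge0 ?dD_le2.
apply: continuous_measurable6 => z; rewrite (_ : @dD R = Num.sqrt \o @sqD R); last first.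
  by apply/funext => w; rewrite dD_sqrt.
apply: (cvg_comp (@sqD R) Num.sqrt); last exact: sqrt_continuous.
exact: differentiable_continuous (differentiable_sqD z).
Qed.
Lemma measurable_dinv : measurable_fun setT (dinv : mP -> mR).
Proof.
apply: (measurable_fun_cvg (h := fun n (z : mP) => dD z * (rho n z * rho n z))) => [n|z _].
  exact: bmf_measurable (bmfM bmf_dD (bmfM (bmf_rho n) (bmf_rho n))).
have [s0|s0] := pselect (sqD z = 0).
  have dz : dD z = 0 by rewrite dD_sqrt s0 sqrtr0.
  rewrite /dinv dz invr0 (_ : (fun n => _) = cst 0); first exact: cvg_cst.
  by apply/funext => n; rewrite mul0r.
have := rho_cvg s0 => c; rewrite (_ : dinv z = dD z * (dinv z * dinv z)).
  by apply: cvgM; [exact: cvg_cst|exact: cvgM].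
by rewrite /dinv; field; exact: dD_neq0.
Qed.

Definition slope v : R := `|ph e13 v| + `|ph e24 v|.
Lemma slope_ge0 v : 0 <= slope v. Proof. by rewrite addr_ge0. Qed.

Lemma sin_half_le e z : e \in directions -> `|sin (ph e z / 2)| <= dD z.
Proof.
rewrite -(@ler_pXn2r _ 2) ?nnegrE ?dD_ge0// real_normK ?num_real// sqr_dD sqD_sin !inE.
by case/orP => /eqP ->; rewrite ?ph_e13 ?ph_e24; [rewrite lerDl|rewrite lerDr]; exact: sqr_ge0.
Qed.

(** The derivative of dD^2 vanishes to first order where dD does, because sin t = 2 sin (t / 2) cos
    (t / 2). *)
Lemma dsqD_le v z : `|dsqD v z| <= slope v * dD z.
Proof.
have H e : e \in directions -> `|sinK e z| <= 2 * dD z.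
  move=> ed; rewrite /sinK (_ : ph e z = ph e z / 2 + ph e z / 2); last by field.
  rewrite sinD (_ : _ + _ = 2 * (sin (ph e z / 2) * cos (ph e z / 2))); last by ring.
  rewrite normrM ger0_norm// ler_wpM2l// normrM -[leRHS]mulr1.
  by apply: ler_pM => //; [exact: sin_half_le|rewrite ler_norml cos_geN1 cos_le1].
have d1 : e13 \in directions by rewrite !inE eqxx.
have d2 : e24 \in directions by rewrite !inE eqxx orbT.
have h1 := ler_wpM2l (normr_ge0 (ph e13 v)) (H _ d1).
have h2 := ler_wpM2l (normr_ge0 (ph e24 v)) (H _ d2).
rewrite /dsqD -mulrDr normrM; apply: le_trans (ler_wpM2l (normr_ge0 _) (ler_normD _ _)) _.
rewrite (ger0_norm (_ : 0 <= 1 / 2 :> R)) ?divr_ge0// !normrM /slope.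
by move: h1 h2; move: (`|ph e13 v| * _) (`|ph e24 v| * `|sinK _ _|) => x y; lra.
Qed.

Lemma dD_dinv z : sqD z <> 0 -> dD z * dinv z = 1.
Proof. by move=> s0; rewrite divff// dD_neq0. Qed.
Lemma dD_dinv_le z : 0 <= dD z * dinv z <= 1.
Proof.
have [s0|/dD_dinv ->] := pselect (sqD z = 0); last by rewrite lexx ler01.
by rewrite (_ : dD z = 0) ?mul0r ?lexx ?ler01// dD_sqrt s0 sqrtr0.
Qed.
Lemma dinv_ge0 z : 0 <= dinv z. Proof. by rewrite invr_ge0 dD_ge0. Qed.

Lemma derive_dD_mul v (F : P -> R) z : sqD z <> 0 -> differentiable F z ->
  'D_v (fun z' => dD z' * F z') z = dD z * 'D_v F z + F z * (dsqD v z * dinv z / 2).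
Proof.
move=> s0 dF; have sp : 0 < sqD z by rewrite lt0r sqD_ge0 andbT; apply/eqP.
have H := is_derive_comp1 (is_derive1_sqrt sp) (differentiable_sqD z) (is_derive_sqD z v).
have iF : is_derive z v F ('D_v F z) by apply: DeriveDef => //; exact: diff_derivable.
have := is_deriveM H iF.
rewrite (_ : Num.sqrt \o @sqD R = @dD R); last by apply/funext => w; rewrite /= dD_sqrt.
move=> [_ E]; rewrite [LHS](_ : _ = 'D_v (@dD R * F) z)// E /GRing.scale/= /dinv dD_sqrt.
by field; rewrite -dD_sqrt dD_neq0.
Qed.

Lemma derive_rho n v z : 'D_v (rho n) z = - 1 / 2 * dsqD v z * (rho n z * (rho n z * rho n z)).
Proof. by rewrite (@derive_val _ _ _ _ _ _ _ (is_derive_rhoD (d0 n) z v)). Qed.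

Lemma intg_norm f (M : R) : intg mu f -> intg mu (fun z => M * `|f z|).
Proof. by move=> fi; apply: intgZ; have := integrable_abse fi; congr (_.-integrable _ _). Qed.

Lemma dct_mul f (T : nat -> mP -> R) (T' : mP -> R) (M : R) : sqi mu f ->
  (forall n, measurable_fun setT (T n)) -> measurable_fun setT T' ->
  (forall n z, `|T n z| <= M) -> (forall z, sqD z <> 0 -> T n z @[n --> \oo] --> T' z) ->
  I mu (fun z => f z * T n z) @[n --> \oo] --> I mu (fun z => f z * T' z).
Proof.
move=> [mf fi] mT mT' TM TT'; have [mN N0] := dD_null R.
apply: (@dct _ _ _ mu Null (fun n z => f z * T n z) _ _ mN N0 _ _ (intg_norm M (sqi_intg (conj mf fi)))).
- by move=> n; exact: measurable_funM.
- exact: measurable_funM.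
- by move=> n z; rewrite normrM mulrC ler_wpM2r.
- by move=> z sz; apply: cvgM; [exact: cvg_cst|exact: TT'].
Qed.

Lemma I_lim (x : nat -> R) (a b : R) : x n @[n --> \oo] --> a -> x n @[n --> \oo] --> b -> a = b.
Proof. by move=> ca_ cb_; rewrite -(cvg_lim (@norm_hausdorff _ R) ca_); exact: (cvg_lim (@norm_hausdorff _ R) cb_). Qed.

Lemma prod_le1 (a b c : R) : 0 <= a -> 0 <= b -> 0 <= c -> a * b <= 1 -> a * c <= 1 -> a * b * (a * c) <= 1.
Proof. by move=> a0 b0 c0 h1 h2; rewrite -[leRHS]mulr1 ler_pM// mulr_ge0. Qed.

(** Formally G / dD is the derivative of f. The weak identity is tested with rho_n chi and n tends
    to infinity; as chi vanishes with dD, the factors multiplying f and G stay bounded uniformly in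
    n, even the one with the derivative of rho_n. *)
Lemma forward_limit v f G (chi : P -> R) (B : R) : sqi mu f -> weak_derivative (@dD R) v f G -> 0 <= B ->
  (forall d : R, 0 < d -> alg d chi) -> (forall z, `|chi z| <= B * dD z) ->
  I mu (fun z => G z * (dinv z * chi z)) = - I mu (fun z => f z * 'D_v chi z).
Proof.
move=> fs /weak_derivative_I[Gs H] B0 ac chiB.
have cc : C1 chi by exact: C1_alg ltr01 (ac 1 ltr01).
have bchi := C1_bmf cc; have bDc := C1_derive_bmf v cc; have [_ [M DM]] := bDc.
have [dchi _ _] := cc; have s0 := slope_ge0 v.
(* The derivative of dD rho_n chi off the zeros of dD, in a form that is measurable everywhere. *)
pose T n z := dD z * (rho n z * 'D_v chi z + chi z * 'D_v (rho n) z) + rho n z * chi z * (dsqD v z * dinv z / 2).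
have mT n : measurable_fun setT (T n : mP -> mR).
  apply: measurable_funD; last first.
    apply: measurable_funM; first exact: bmf_measurable (bmfM (bmf_rho n) bchi).
    apply: measurable_funM; last exact: measurable_cst.
    by apply: measurable_funM; [exact: bmf_measurable (bmf_dsqD v)|exact: measurable_dinv].
  exact: bmf_measurable (bmfM bmf_dD (bmfD (bmfM (bmf_rho n) bDc) (bmfM bchi (C1_derive_bmf v (C1_rho n))))).
have TE n z : sqD z <> 0 -> 'D_v (fun z' => dD z' * (rho n z' * chi z')) z = T n z.
  move=> sz; have cr := C1M (C1_rho n) cc; have [dr _ _] := cr.
  by rewrite (derive_dD_mul v sz (dr z)) C1_derivableM//; exact: C1_rho.
have TM n z : `|T n z| <= M + (B * slope v / 2 + B * slope v / 2).
  have r0 := rho_ge0 n z; have z0 := dD_ge0 z; have dr := dD_rho n z; have drp : 0 <= dD z * rho n z by rewrite mulr_ge0.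
  rewrite /T mulrDr -addrA; apply: le_trans (ler_normD _ _) _; apply: lerD.
    by rewrite mulrA normrM (ger0_norm drp) -[leRHS]mul1r ler_pM.
  apply: le_trans (ler_normD _ _) _; apply: lerD.
    rewrite derive_rho (_ : _ * _ = dD z * (rho n z * (rho n z * rho n z)) * (- 1 / 2) * (chi z * dsqD v z)); last by ring.
    rewrite normrM; apply: le_trans (_ : dD z * (rho n z * (rho n z * rho n z)) / 2 * (B * dD z * (slope v * dD z)) <= _).
      apply: ler_pM => //.
        rewrite normrM ger0_norm ?mulr_ge0// ler_wpM2l ?mulr_ge0//.
        by rewrite (_ : - 1 / 2 = - (1 / 2) :> R) ?normrN ?ger0_norm//; lra.
      by rewrite normrM ler_pM// dsqD_le.
    rewrite (_ : _ * _ = B * slope v / 2 * (dD z * rho n z * (dD z * rho n z) * (dD z * rho n z))); last by ring.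
    rewrite -[leRHS]mulr1 ler_wpM2l ?divr_ge0 ?mulr_ge0//.
    by rewrite -[leRHS]mulr1 ler_pM ?mulr_ge0// prod_le1.
  rewrite !normrM (ger0_norm r0) (ger0_norm (dinv_ge0 z)) (ger0_norm (_ : 0 <= 2^-1))//.
  apply: le_trans (_ : rho n z * (B * dD z) * (slope v * dD z * dinv z / 2) <= _).
    by apply: ler_pM => //; rewrite ?mulr_ge0 ?dinv_ge0//; [exact: ler_wpM2l|
      rewrite ler_wpM2r// ler_wpM2r ?dinv_ge0// dsqD_le].
  have /andP[e0 e1] := dD_dinv_le z.
  rewrite (_ : _ * _ = B * slope v / 2 * (dD z * rho n z * (dD z * dinv z))); last by ring.
  by rewrite -[leRHS]mulr1 ler_wpM2l ?divr_ge0 ?mulr_ge0// prod_le1// dinv_ge0.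
have c1 : I mu (fun z => G z * (rho n z * chi z)) @[n --> \oo] --> I mu (fun z => G z * (dinv z * chi z)).
  apply: (dct_mul (M := B) Gs).
  - by move=> n; exact: bmf_measurable (bmfM (bmf_rho n) bchi).
  - by apply: measurable_funM; [exact: measurable_dinv|exact: bmf_measurable bchi].
  - move=> n z; rewrite normrM (ger0_norm (rho_ge0 n z)); apply: le_trans (ler_wpM2l (rho_ge0 n z) (chiB z)) _.
    by rewrite mulrCA -[leRHS]mulr1 ler_wpM2l// mulrC dD_rho.
  - by move=> z sz; apply: cvgM; [exact: rho_cvg|exact: cvg_cst].
have c2 : I mu (fun z => f z * T n z) @[n --> \oo] --> I mu (fun z => f z * 'D_v chi z).
  apply: (dct_mul (T := T) fs mT (bmf_measurable bDc) TM) => z sz.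
  have rc := rho_cvg sz; have dz := dD_neq0 sz.
  rewrite (_ : 'D_v chi z = dD z * (dinv z * 'D_v chi z + chi z * (- 1 / 2 * dsqD v z * (dinv z * (dinv z * dinv z))))
     + dinv z * chi z * (dsqD v z * dinv z / 2)); last by rewrite /dinv; field.
  rewrite /T; apply: cvgD; last by apply: cvgM; [apply: cvgM; [exact: rc|exact: cvg_cst]|exact: cvg_cst].
  apply: cvgM; first exact: cvg_cst.
  apply: cvgD; first by apply: cvgM; [exact: rc|exact: cvg_cst].
  apply: cvgM; first exact: cvg_cst.
  under eq_fun do rewrite derive_rho.
  by apply: cvgM; [exact: cvg_cst|apply: cvgM; [exact: rc|exact: cvgM]].
apply: (I_lim c1); have [mN N0] := dD_null R.
rewrite (_ : (fun n => _) = (fun n => - I mu (fun z => f z * T n z))); first exact: cvgN.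
apply/funext => n; rewrite H; last by apply: (alg_test (d0 n)); apply: algM; [exact: alg_rho_n|exact: ac].
congr (- _); apply/esym; apply: (I_ae mN N0) => [|z sz]; last by rewrite TE.
by apply: measurable_funM; [case: fs|exact: mT].
Qed.

(** Bounded, although 1 / dD is not. For G = dD D_v f its product with G is 2 sin (e / 2) D_v f. *)
Definition half_multiplier e z : R := 2 * sin (ph e z / 2) * dinv z.

Lemma half_multiplier_le e z : e \in directions -> `|half_multiplier e z| <= 2.
Proof.
move=> ed; rewrite /half_multiplier !normrM ger0_norm// (ger0_norm (dinv_ge0 z)) -mulrA -[leRHS]mulr1 ler_wpM2l//.
apply: le_trans (ler_wpM2r (dinv_ge0 z) (sin_half_le z ed)) _; by have /andP[] := dD_dinv_le z.
Qed.

Lemma bmf_half_multiplier e : e \in directions -> bmf (half_multiplier e : mP -> R).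
Proof.
move=> ed; split; last by exists 2 => z; exact: half_multiplier_le.
apply: measurable_funM; last exact: measurable_dinv.
have [m _] := bmf_sinH R (- e) 0; apply: measurable_funM; first exact: measurable_cst.
rewrite (_ : (fun z => _) = sinH (- e) 0)//.
by apply/funext => z; rewrite /sinH ph0 phN; congr sin; ring.
Qed.

Lemma n2_half_multiplier e f : e \in directions -> sqi mu f -> n2 mu (fun z => f z * half_multiplier e z) <= 4 * n2 mu f.
Proof.
move=> ed fs; have [_ gi] := sqi_bmf fs (bmf_half_multiplier ed); have [_ fi] := fs.
rewrite /n2 -IZ//; apply: I_le => //; first exact: intgZ.
move=> z; rewrite exprMn mulrC ler_wpM2r ?sqr_ge0//.
rewrite -(real_normK (num_real (half_multiplier e z))) (_ : 4 = 2 ^+ 2 :> R); last by ring.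
by rewrite ler_pXn2r ?nnegrE// half_multiplier_le.
Qed.

Lemma sin_diff e K z : sinK K z - sinK (K - e) z = 2 * sin (ph e z / 2) * cosH e K z.
Proof.
rewrite /sinK /cosH phB; set h := ph e z / 2.
rewrite (_ : ph K z - ph e z = (ph K z - h) - h); last by rewrite /h; field.
rewrite (_ : sin (ph K z) = sin ((ph K z - h) + h)); last by congr sin; ring.
by move: (ph K z - h) => x; rewrite sinD sinB; ring.
Qed.
Lemma cos_diff e K z : cosK K z - cosK (K - e) z = - (2 * sin (ph e z / 2) * sinH e K z).
Proof.
rewrite /cosK /sinH phB; set h := ph e z / 2.
rewrite (_ : ph K z - ph e z = (ph K z - h) - h); last by rewrite /h; field.
rewrite (_ : cos (ph K z) = cos ((ph K z - h) + h)); last by congr cos; ring.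
by move: (ph K z - h) => x; rewrite cosD cosB; ring.
Qed.

Definition diff_coef e v (a : Z6 -> R) K : R := ph K v * a K - ph (K - e) v * a (K - e).

(** Differences of coefficients at K and K - e are, up to sign, coefficients of 2 sin (e / 2) D_v f
    at the half-integer frequency K - e/2 ([sin_diff], [cos_diff]); Bessel's inequality holds at
    these frequencies too. *)
Lemma forwardD v f G e (S : seq Z6) : sqi mu f -> weak_derivative (@dD R) v f G -> e \in directions -> uniq S ->
  \sum_(K <- S) (diff_coef e v (ca f) K ^+ 2 + diff_coef e v (cb f) K ^+ 2) <= 4 * vol R * n2 mu G.
Proof.
move=> fs wG ed uS; have [Gs _] := (weak_derivative_I _ _ _ _).1 wG.
have bc K : bmf (cosK K : mP -> R) by exact/alg_bmf/alg_cos.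
have bs K : bmf (sinK K : mP -> R) by exact/alg_bmf/alg_sin.
have fi := sqi_intg fs.
have gs := sqi_bmf Gs (bmf_half_multiplier ed).
apply: (@le_trans _ _ (vol R * n2 mu (fun z => G z * half_multiplier e z))); last first.
  rewrite (mulrC 4) -mulrA ler_wpM2l ?n2_half_multiplier// ltW// vol_gt0//.
apply: le_trans (bessel e gs uS); rewrite le_eqVlt; apply/orP; left; apply/eqP.
apply: eq_bigr => K _; have bnd (c : R) z : `|c| <= 1 -> `|2 * sin (ph e z / 2) * c| <= 2 * dD z.
  move=> c1; rewrite !normrM ger0_norm// -[leRHS]mulr1 ler_pM ?mulr_ge0//.
  by rewrite ler_wpM2l// sin_half_le.
have E1 : I mu (fun z => G z * half_multiplier e z * cosH e K z) = - diff_coef e v (ca f) K.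
  rewrite (@eqIg _ _ (fun z => G z * (dinv z * (sinK K z - sinK (K - e) z)))); last first.
    by move=> z; rewrite sin_diff /half_multiplier; ring.
  have aA (d : R) : alg d (fun z => sinK K z - sinK (K - e) z).
    apply: (eq_alg (f := fun z => sinK K z + (-1) * sinK (K - e) z)); first by move=> z; ring.
    by apply: algD; [exact: alg_sin|apply: algZ; exact: alg_sin].
  rewrite (forward_limit (B := 2) fs wG)//; last first.
    by move=> z; rewrite sin_diff bnd// /cosH ler_norml cos_geN1 cos_le1.
  congr (- _); rewrite (@eqIg _ _ (fun z => ph K v * (f z * cosK K z) - ph (K - e) v * (f z * cosK (K - e) z))); last first.
    move=> z; rewrite [X in _ * X](_ : _ = ph K v * cosK K z - ph (K - e) v * cosK (K - e) z); first by ring.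
    by have [_ ->] := is_deriveB (is_derive_sinK K z v) (is_derive_sinK (K - e) z v).
  rewrite IB; [|exact/intgZ/(intg_bmf fi (bc K))|exact/intgZ/(intg_bmf fi (bc _))].
  by rewrite !IZ//; exact: intg_bmf.
have E2 : I mu (fun z => G z * half_multiplier e z * sinH e K z) = - diff_coef e v (cb f) K.
  rewrite (@eqIg _ _ (fun z => G z * (dinv z * (cosK (K - e) z - cosK K z)))); last first.
    by move=> z; rewrite -[cosK (K - e) z - _]opprB cos_diff /half_multiplier; ring.
  have aA (d : R) : alg d (fun z => cosK (K - e) z - cosK K z).
    apply: (eq_alg (f := fun z => cosK (K - e) z + (-1) * cosK K z)); first by move=> z; ring.
    by apply: algD; [exact: alg_cos|apply: algZ; exact: alg_cos].
  rewrite (forward_limit (B := 2) fs wG)//; last first.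
    by move=> z; rewrite -opprB cos_diff opprK bnd// /sinH ler_norml sin_geN1 sin_le1.
  congr (- _); rewrite (@eqIg _ _ (fun z => ph K v * (f z * sinK K z) - ph (K - e) v * (f z * sinK (K - e) z))); last first.
    move=> z; rewrite [X in _ * X](_ : _ = - ph (K - e) v * sinK (K - e) z - - ph K v * sinK K z); first by ring.
    by have [_ ->] := is_deriveB (is_derive_cosK (K - e) z v) (is_derive_cosK K z v).
  rewrite IB; [|exact/intgZ/(intg_bmf fi (bs K))|exact/intgZ/(intg_bmf fi (bs _))].
  by rewrite !IZ//; exact: intg_bmf.
by rewrite E1 E2 !sqrrN.
Qed.

Lemma I_comb f (S : seq (R * Z6)) : intg mu f ->
  I mu (fun z => f z * \sum_(j <- S) j.1 * cosK j.2 z) = \sum_(j <- S) j.1 * ca f j.2 /\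
  I mu (fun z => f z * \sum_(j <- S) j.1 * sinK j.2 z) = \sum_(j <- S) j.1 * cb f j.2.
Proof.
move=> fi; have bc K : bmf (cosK K : mP -> R) by exact/alg_bmf/alg_cos.
have bs K : bmf (sinK K : mP -> R) by exact/alg_bmf/alg_sin.
split.
- rewrite (@eqIg _ _ (fun z => \sum_(j <- S) j.1 * (f z * cosK j.2 z))); last first.
    by move=> z; rewrite mulr_sumr; apply: eq_bigr => j _; ring.
  have [_ ->] := I_sum S (fun j : R * Z6 => intgZ j.1 (intg_bmf fi (bc j.2))).
  by apply: eq_bigr => j _; rewrite IZ//; exact: intg_bmf.
- rewrite (@eqIg _ _ (fun z => \sum_(j <- S) j.1 * (f z * sinK j.2 z))); last first.
    by move=> z; rewrite mulr_sumr; apply: eq_bigr => j _; ring.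
  have [_ ->] := I_sum S (fun j : R * Z6 => intgZ j.1 (intg_bmf fi (bs j.2))).
  by apply: eq_bigr => j _; rewrite IZ//; exact: intg_bmf.
Qed.

Lemma ph_shift K e v : (ph (K + e) v = ph K v + ph e v :> R) * (ph (K - e) v = ph K v - ph e v :> R).
Proof. by split; [exact: phD|exact: phB]. Qed.

Lemma trig_shift K e z : (cosK (K + e) z = cosK K z * cosK e z - sinK K z * sinK e z :> R) *
  (cosK (K - e) z = cosK K z * cosK e z + sinK K z * sinK e z :> R) *
  (sinK (K + e) z = sinK K z * cosK e z + cosK K z * sinK e z :> R) *
  (sinK (K - e) z = sinK K z * cosK e z - cosK K z * sinK e z :> R).
Proof.
have h1 : cosK (K + e) z = cosK K z * cosK e z - sinK K z * sinK e z :> R by rewrite /cosK /sinK phD cosD.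
have h2 : cosK (K - e) z = cosK K z * cosK e z + sinK K z * sinK e z :> R by rewrite /cosK /sinK phB cosB.
have h3 : sinK (K + e) z = sinK K z * cosK e z + cosK K z * sinK e z :> R by rewrite /cosK /sinK phD sinD.
by have h4 : sinK (K - e) z = sinK K z * cosK e z - cosK K z * sinK e z :> R by rewrite /cosK /sinK phB sinB.
Qed.

(* dD^2 D_v acts on Fourier coefficients as a second difference. *)
Lemma second_difference f v K : intg mu f ->
  ca (fun z => f z * dsqD v z) K - ph K v * cb (fun z => f z * sqD z) K =
    4^-1 * (diff_coef e13 v (cb f) (K + e13) - diff_coef e13 v (cb f) K
          + diff_coef e24 v (cb f) (K + e24) - diff_coef e24 v (cb f) K) /\
  cb (fun z => f z * dsqD v z) K + ph K v * ca (fun z => f z * sqD z) K =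
    - (4^-1 * (diff_coef e13 v (ca f) (K + e13) - diff_coef e13 v (ca f) K
          + diff_coef e24 v (ca f) (K + e24) - diff_coef e24 v (ca f) K)).
Proof.
move=> fi; have bc : bmf (cosK K : mP -> R) by exact/alg_bmf/alg_cos.
have bs : bmf (sinK K : mP -> R) by exact/alg_bmf/alg_sin.
pose S (s : R) : seq (R * Z6) := [:: (s / 4 * ph (K + e13) v, K + e13); (s / 4 * ph (K - e13) v, K - e13);
  (s / 4 * ph (K + e24) v, K + e24); (s / 4 * ph (K - e24) v, K - e24); (- s * ph K v, K)].
have fds := intg_bmf fi (bmf_dsqD v); have fs := intg_bmf fi bmf_sqD.
split.
- have [_] := I_comb (S 1) fi; rewrite !big_cons big_nil /= => E.
  rewrite {1}/ca {1}/cb -IZ; last exact: intg_bmf.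
  rewrite -IB; [|exact: intg_bmf|exact/intgZ/intg_bmf].
  rewrite (@eqIg _ _ (fun z => f z * \sum_(j <- S 1) j.1 * sinK j.2 z)); last first.
    by move=> z; rewrite !big_cons big_nil /= !(trig_shift K e13) !(trig_shift K e24) !(ph_shift K e13 v) !(ph_shift K e24 v) /dsqD /sqD; field.
  rewrite E /diff_coef !addrK; move: (cb f (K + e13)) (cb f (K - e13)) (cb f (K + e24)) (cb f (K - e24)) (cb f K) => t1 t2 t3 t4 t5.
  move: (ph (K + e13) v) (ph (K - e13) v) (ph (K + e24) v) (ph (K - e24) v) (ph K v) => p1 p2 p3 p4 p5.
  by field.
- have [E _] := I_comb (S (-1)) fi; move: E; rewrite !big_cons big_nil /= => E.
  rewrite {1}/ca {1}/cb -IZ; last exact: intg_bmf.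
  rewrite -ID; [|exact: intg_bmf|exact/intgZ/intg_bmf].
  rewrite (@eqIg _ _ (fun z => f z * \sum_(j <- S (-1)) j.1 * cosK j.2 z)); last first.
    by move=> z; rewrite !big_cons big_nil /= !(trig_shift K e13) !(trig_shift K e24) !(ph_shift K e13 v) !(ph_shift K e24 v) /dsqD /sqD; field.
  rewrite E /diff_coef !addrK; move: (ca f (K + e13)) (ca f (K - e13)) (ca f (K + e24)) (ca f (K - e24)) (ca f K) => t1 t2 t3 t4 t5.
  move: (ph (K + e13) v) (ph (K - e13) v) (ph (K + e24) v) (ph (K - e24) v) (ph K v) => p1 p2 p3 p4 p5.
  by field.
Qed.

(** Constructs the function that plays the role of 2 sin (e / 2) D_v f from its coefficients at
    half-integer frequencies. *)
Lemma half_series f e v (A : R) : sqi mu f ->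
  (forall S : seq Z6, uniq S -> \sum_(K <- S) (diff_coef e v (ca f) K ^+ 2 + diff_coef e v (cb f) K ^+ 2) <= A) ->
  exists2 g, sqi mu g & n2 mu g <= 2 * A / vol R /\ forall K,
    I mu (fun z => g z * cosH e K z) = - diff_coef e v (ca f) K /\
    I mu (fun z => g z * sinH e K z) = - diff_coef e v (cb f) K.
Proof.
move=> fs fA; have V0 := vol_gt0 R; have Vn := lt0r_neq0 V0.
pose al K := - ((vol R)^-1 * diff_coef e v (ca f) K); pose be K := - ((vol R)^-1 * diff_coef e v (cb f) K).
have abA S : uniq S -> \sum_(K <- S) (al K ^+ 2 + be K ^+ 2) <= (vol R)^-2 * A.
  move=> uS; apply: le_trans (ler_wpM2l _ (fA _ uS)); last by rewrite invr_ge0 sqr_ge0.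
  rewrite mulr_sumr le_eqVlt; apply/orP; left; apply/eqP; apply: eq_bigr => K _.
  by rewrite /al /be !sqrrN !exprMn exprVn; ring.
have [S ex] := exhaustion abA; have le K : al K ^+ 2 + be K ^+ 2 <= al K ^+ 2 + be K ^+ 2 by [].
have [g gs H] := series_cvg e ex le; exists g => //; split.
  apply: le_trans (series_n2 ex abA gs H) _.
  by rewrite le_eqVlt; apply/orP; left; apply/eqP; field.
move=> K; have [-> ->] := series_coef ex le K gs H.
have E : e - K - e = - K by rewrite addrAC subrr add0r.
have E2 : e - K = - (K - e) by rewrite opprB.
rewrite /al /be /diff_coef E E2 !caN !cbN// !ph_opp.
by split; field.
Qed.

(** The hypothesis is the weak form of dD h = dD^2 D_v f, where f is multiplied by smooth functions
    only. Testing it with phi rho_n and letting n tend to infinity divides by dD. *)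
Lemma backward_limit v f h : balanced v -> sqi mu f -> sqi mu h ->
  (forall psi : P -> R, C1 psi -> I mu (fun z => h z * dD z * psi z) + I mu (fun z => f z * dsqD v z * psi z)
     + I mu (fun z => f z * sqD z * 'D_v psi z) = 0) ->
  weak_derivative (@dD R) v f h.
Proof.
move=> bv fs hs H; apply/weak_derivative_I; split=> // phi tp.
have cp := C1_test tp; have bp := C1_bmf cp; have bDp := C1_derive_bmf v cp.
have [dp _ _] := cp; have [_ [M1 pM]] := bp; have [_ [M2 DM]] := bDp.
have M10 : 0 <= M1 by apply: le_trans (pM 0).
have M20 : 0 <= M2 by apply: le_trans (DM 0).
have s0 := slope_ge0 v.
pose T n z := dsqD v z * (phi z * rho n z) + sqD z * (phi z * 'D_v (rho n) z + rho n z * 'D_v phi z).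
have bT n : bmf (T n : mP -> R).
  apply: bmfD; first exact: (bmfM (bmf_dsqD v) (bmfM bp (bmf_rho n))).
  apply: (bmfM bmf_sqD); apply: bmfD; first exact: (bmfM bp (C1_derive_bmf v (C1_rho n))).
  exact: (bmfM (bmf_rho n) bDp).
have TM n z : `|T n z| <= slope v * M1 + (M1 * slope v / 2 * 2 + 2 * M2).
  have r0 := rho_ge0 n z; have z0 := dD_ge0 z; have dr := dD_rho n z; have drp : 0 <= dD z * rho n z by rewrite mulr_ge0.
  have d2 := dD_le2 z.
  rewrite /T mulrDr; apply: le_trans (ler_normD _ _) _; apply: lerD.
    rewrite !normrM (ger0_norm r0); apply: le_trans (_ : slope v * dD z * (M1 * rho n z) <= _).
      by apply: ler_pM; rewrite ?mulr_ge0// ?dsqD_le// ler_wpM2r.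
    rewrite (_ : _ * _ = slope v * M1 * (dD z * rho n z)); last by ring.
    by rewrite -[leRHS]mulr1 ler_wpM2l// mulr_ge0.
  apply: le_trans (ler_normD _ _) _; apply: lerD.
    rewrite derive_rho -sqr_dD (_ : _ * _ = dD z ^+ 2 * (rho n z * (rho n z * rho n z)) * (- 1 / 2) * (phi z * dsqD v z)); last by ring.
    rewrite normrM; apply: le_trans (_ : dD z ^+ 2 * (rho n z * (rho n z * rho n z)) / 2 * (M1 * (slope v * dD z)) <= _).
      apply: ler_pM => //.
        rewrite normrM ger0_norm ?mulr_ge0 ?sqr_ge0// ler_wpM2l ?mulr_ge0 ?sqr_ge0//.
        by rewrite (_ : - 1 / 2 = - (1 / 2) :> R) ?normrN ?ger0_norm//; lra.
      by rewrite normrM ler_pM// dsqD_le.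
    rewrite (_ : _ * _ = M1 * slope v / 2 * (dD z * rho n z * (dD z * rho n z) * (dD z * rho n z))); last by ring.
    apply: ler_wpM2l; first by rewrite divr_ge0 ?mulr_ge0.
    apply: (@le_trans _ _ 1); last by lra.
    by rewrite -[leRHS]mulr1 ler_pM ?mulr_ge0// prod_le1.
  rewrite -sqr_dD expr2 (_ : _ * _ = dD z * (dD z * rho n z) * 'D_v phi z); last by ring.
  rewrite normrM ger0_norm ?mulr_ge0//; apply: ler_pM; rewrite ?mulr_ge0//.
  by rewrite -[leRHS]mulr1 ler_pM.
pose T' z := dD z * 'D_v phi z + phi z * (dsqD v z * dinv z / 2).
have mT' : measurable_fun setT (T' : mP -> mR).
  apply: measurable_funD; first exact: bmf_measurable (bmfM bmf_dD bDp).
  apply: measurable_funM; first exact: bmf_measurable bp.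
  apply: measurable_funM; last exact: measurable_cst.
  by apply: measurable_funM; [exact: bmf_measurable (bmf_dsqD v)|exact: measurable_dinv].
have c2 : I mu (fun z => f z * T n z) @[n --> \oo] --> I mu (fun z => f z * T' z).
  apply: (dct_mul (T := T) fs (fun n => bmf_measurable (bT n)) mT' TM) => z sz.
  have rc := rho_cvg sz; have dz := dD_neq0 sz.
  rewrite (_ : T' z = dsqD v z * (phi z * dinv z) + sqD z * (phi z * (- 1 / 2 * dsqD v z * (dinv z * (dinv z * dinv z)))
     + dinv z * 'D_v phi z)); last by rewrite /T' -sqr_dD /dinv; field.
  rewrite /T; apply: cvgD.
    by apply: cvgM; [exact: cvg_cst|apply: cvgM; [exact: cvg_cst|exact: rc]].
  apply: cvgM; first exact: cvg_cst.
  apply: cvgD; last by apply: cvgM; [exact: rc|exact: cvg_cst].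
  apply: cvgM; first exact: cvg_cst.
  under eq_fun do rewrite derive_rho.
  by apply: cvgM; [exact: cvg_cst|apply: cvgM; [exact: rc|exact: cvgM]].
have c1 : I mu (fun z => h z * (phi z * (dD z * rho n z))) @[n --> \oo] --> I mu (fun z => h z * phi z).
  apply: (dct_mul (M := M1) hs).
  - by move=> n; exact: bmf_measurable (bmfM bp (bmfM bmf_dD (bmf_rho n))).
  - exact: bmf_measurable bp.
  - move=> n z; rewrite normrM -[leRHS]mulr1 ler_pM// ger0_norm ?mulr_ge0 ?dD_ge0 ?rho_ge0//.
    exact: dD_rho.
  - move=> z sz; rewrite -[X in _ --> X]mulr1 -(dD_dinv sz).
    by apply: cvgM; [exact: cvg_cst|apply: cvgM; [exact: cvg_cst|exact: rho_cvg]].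
have -> : I mu (fun z => f z * 'D_v (fun z' => dD z' * phi z') z) = I mu (fun z => f z * T' z).
  have [mN N0] := dD_null R.
  apply/esym; apply: (I_ae mN N0) => [|z sz]; first by apply: measurable_funM => //; case: fs.
  by rewrite (derive_dD_mul v sz (dp z)).
apply: (I_lim c1); rewrite (_ : (fun n => _) = (fun n => - I mu (fun z => f z * T n z))); first exact: cvgN.
apply/funext => n; have cr := C1_rho n; have := H _ (C1M cp cr).
have i1 := intg_bmf (sqi_intg fs) (bmfM (bmf_dsqD v) (bmfM bp (bmf_rho n))).
have i2 := intg_bmf (sqi_intg fs) (bmfM bmf_sqD (bmfD (bmfM bp (C1_derive_bmf v cr)) (bmfM (bmf_rho n) bDp))).
rewrite -addrA => /eqP; rewrite addr_eq0 => /eqP E.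
rewrite (@eqIg _ _ (fun z => h z * dD z * (phi z * rho n z))) ?E; last by move=> z; ring.
congr (- _); rewrite (@eqIg _ (fun z => f z * T n z) (fun z => f z * (dsqD v z * (phi z * rho n z)) +
  f z * (sqD z * (phi z * 'D_v (rho n) z + rho n z * 'D_v phi z)))); last by move=> z; rewrite /T; ring.
rewrite ID//; congr (_ + _); apply: eqIg => z; first by ring.
by rewrite C1_derivableM//; ring.
Qed.

Lemma backwardD f v (A : R) : balanced v -> sqi mu f ->
  (forall e (S : seq Z6), e \in directions -> uniq S ->
     \sum_(K <- S) (diff_coef e v (ca f) K ^+ 2 + diff_coef e v (cb f) K ^+ 2) <= A) ->
  exists2 h, weak_derivative (@dD R) v f h & n2 mu h <= 2 * A / vol R.
Proof.
move=> bv fs fA; have d1 : e13 \in directions by rewrite !inE eqxx.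
have d2 : e24 \in directions by rewrite !inE eqxx orbT.
have [g1 g1s [n1 H1]] := half_series fs (fun S => fA e13 S d1).
have [g2 g2s [n2_ H2]] := half_series fs (fun S => fA e24 S d2).
have fi := sqi_intg fs.
have s1 := sqi_bmf g1s (bmf_half_multiplier d1); have s2 := sqi_bmf g2s (bmf_half_multiplier d2).
pose h z := 1 / 4 * (g1 z * half_multiplier e13 z + g2 z * half_multiplier e24 z).
have hs : sqi mu h by apply: sqiZ; exact: sqiD.
exists h; last first.
  rewrite /h n2Z; last exact: sqiD.
  have := n2D_le s1 s2; have := n2_half_multiplier d1 g1s; have := n2_half_multiplier d2 g2s.
  move: n1 n2_; move: (n2 mu g1) (n2 mu g2) (n2 mu _) (n2 mu _) (n2 mu _) (2 * A / vol R) => a b c x y w.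
  by rewrite (_ : (1 / 4) ^+ 2 = 1 / 16 :> R); [lra|field].
apply: (backward_limit bv fs hs).
have Gs : sqi mu (fun z => h z * dD z) by exact: sqi_bmf hs bmf_dD.
have hE z : h z * dD z = 1 / 4 * (g1 z * (2 * sin (ph e13 z / 2)) + g2 z * (2 * sin (ph e24 z / 2))).
  have r e : e \in directions -> half_multiplier e z * dD z = 2 * sin (ph e z / 2).
    move=> ed; have [z0|z0] := eqVneq (dD z) 0.
      have := sin_half_le z ed; rewrite z0 normr_le0 => /eqP ->; by rewrite !mulr0.
    by rewrite /half_multiplier /dinv; field.
  by rewrite /h -(r _ d1) -(r _ d2); ring.
apply: (extend_from_characters bv Gs (sqi_bmf fs (bmf_dsqD v)) (sqi_bmf fs bmf_sqD)) => K.
have [h1 h2] := second_difference v K fi.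
have bcH e L := bmf_cosH R e L; have bsH e L := bmf_sinH R e L.
have i1 := sqi_intg g1s; have i2 := sqi_intg g2s.
have lin (p1 q1 p2 q2 : mP -> R) : bmf p1 -> bmf q1 -> bmf p2 -> bmf q2 ->
    I mu (fun z => 1 / 4 * (g1 z * p1 z - g1 z * q1 z + (g2 z * p2 z - g2 z * q2 z))) =
    1 / 4 * (I mu (fun z => g1 z * p1 z) - I mu (fun z => g1 z * q1 z) +
      (I mu (fun z => g2 z * p2 z) - I mu (fun z => g2 z * q2 z))).
  move=> b1 b2 b3 b4; have j1 := intg_bmf i1 b1; have j2 := intg_bmf i1 b2.
  have j3 := intg_bmf i2 b3; have j4 := intg_bmf i2 b4.
  have k1 := intgB j1 j2; have k2 := intgB j3 j4.
  by rewrite IZ; [rewrite ID// !IB|exact: intgD k1 k2].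
split.
- rewrite -addrA h1 /ca (@eqIg _ _ (fun z => 1 / 4 * (g1 z * sinH e13 (K + e13) z - g1 z * sinH e13 K z +
    (g2 z * sinH e24 (K + e24) z - g2 z * sinH e24 K z)))); last first.
    move=> z; rewrite hE; have C e : 2 * sin (ph e z / 2) * cosK K z = sinH e (K + e) z - sinH e K z.
      rewrite /sinH /cosK phD (_ : ph K z + ph e z - ph e z / 2 = ph K z + ph e z / 2); last by field.
      by rewrite sinD sinB; ring.
    by rewrite -!mulrBr -!C; ring.
  rewrite (lin _ _ _ _ (bsH _ _) (bsH _ _) (bsH _ _) (bsH _ _)).
  have a1 := (H1 (K + e13)).2; have a2 := (H1 K).2; have a3 := (H2 (K + e24)).2; have a4 := (H2 K).2.
  rewrite a1 a2 a3 a4; move: (diff_coef _ _ _ _) (diff_coef _ _ _ _) (diff_coef _ _ _ _) (diff_coef _ _ _ _) => t1 t2 t3 t4.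
  by field.
- rewrite -addrA h2 /cb (@eqIg _ _ (fun z => 1 / 4 * (g1 z * cosH e13 K z - g1 z * cosH e13 (K + e13) z +
    (g2 z * cosH e24 K z - g2 z * cosH e24 (K + e24) z)))); last first.
    move=> z; rewrite hE; have C e : 2 * sin (ph e z / 2) * sinK K z = cosH e K z - cosH e (K + e) z.
      rewrite /cosH /sinK phD (_ : ph K z + ph e z - ph e z / 2 = ph K z + ph e z / 2); last by field.
      by rewrite cosB cosD; ring.
    by rewrite -!mulrBr -!C; ring.
  rewrite (lin _ _ _ _ (bcH _ _) (bcH _ _) (bcH _ _) (bcH _ _)).
  have a1 := (H1 (K + e13)).1; have a2 := (H1 K).1; have a3 := (H2 (K + e24)).1; have a4 := (H2 K).1.
  rewrite a1 a2 a3 a4; move: (diff_coef _ _ _ _) (diff_coef _ _ _ _) (diff_coef _ _ _ _) (diff_coef _ _ _ _) => t1 t2 t3 t4.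
  by field.
Qed.
End DistanceWeight.

(** * Comparison with the norm of Fourier coefficients *)

Section NormEquivalence.
Variable R : realType.
Notation P := (point6 R).
Notation mR := (measurableTypeR R).
Notation mP := (point6 mR).
Notation mu := (muT6 R).
Implicit Types (K L e : Z6) (z v w : P) (f g G : mP -> R).

Lemma balanced_basis v : v \in xbasis ++ ybasis -> balanced v.
Proof. by move=> vb F cF; exact: I_derive. Qed.
Lemma balancedD v w : balanced v -> balanced w -> balanced (v + w).
Proof.
move=> bv bw F cF; have E1 := bv F cF; have E2 := bw F cF.
have i1 := bmf_intg mu (C1_derive_bmf v cF); have i2 := bmf_intg mu (C1_derive_bmf w cF).
apply: (etrans _ (etrans (ID i1 i2) (etrans (f_equal2 +%R E1 E2) (addr0 0)))).
by apply: eqIg => z; exact: C1_deriveD.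
Qed.
Lemma balancedB v w : balanced v -> balanced w -> balanced (v - w).
Proof.
move=> bv bw F cF; have E1 := bv F cF; have E2 := bw F cF.
have i1 := bmf_intg mu (C1_derive_bmf v cF); have i2 := bmf_intg mu (C1_derive_bmf w cF).
apply: (etrans _ (etrans (IB i1 i2) (etrans (f_equal2 (fun a b => a - b) E1 E2) (subr0 0)))).
by apply: eqIg => z; exact: C1_deriveB.
Qed.

Lemma normL2_sqrt f : sqi mu f -> normL2 f = (Num.sqrt (n2 mu f))%:E.
Proof. by move=> fs; rewrite /normL2 (normL2E fs). Qed.

Lemma normD_ge0 (w : P -> R) v f : (0 <= normD w v f)%E.
Proof. by apply: le_ereal_inf_tmp => _ [G _ <-]; exact: Lnorm_ge0. Qed.

Lemma normD_lt (w : P -> R) v f (h : R) : (normD w v f < h%:E)%E ->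
  exists2 G, weak_derivative w v f G & n2 mu G <= h ^+ 2.
Proof.
move=> /ereal_inf_lt[_ [G wG <-]]; have [Gs _] := (weak_derivative_I _ _ _ _).1 wG.
rewrite normL2_sqrt// lte_fin => lt; exists G => //.
rewrite -[leLHS]sqr_sqrtr ?n2_ge0// ler_pXn2r// ?nnegrE ?sqrtr_ge0//; first exact: ltW.
exact: le_trans (sqrtr_ge0 _) (ltW lt).
Qed.

Lemma normD_le (w : P -> R) v f G (c : R) : weak_derivative w v f G -> n2 mu G <= c ->
  (normD w v f <= (Num.sqrt c)%:E)%E.
Proof.
move=> wG Gc; have [Gs _] := (weak_derivative_I _ _ _ _).1 wG.
apply: (@le_trans _ _ (normL2 G)); first by apply: ereal_inf_lbound; exists G.
by rewrite normL2_sqrt// lee_fin ler_wsqrtr.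
Qed.

Let expe2_ge0 (x : \bar R) : (0 <= x ^+ 2)%E.
Proof. by rewrite expe2; case: x => [r| |] //=; rewrite ?lee_fin ?sqr_ge0// -?expr2 ?sqr_ge0//; rewrite /mule/= ?lexx ?leey. Qed.

Lemma normD_le_grad (basis : seq P) v f : v \in basis -> (normD (cst 1%R) v f <= norm_grad basis f)%E.
Proof.
move=> vb; rewrite -[leLHS]gee0_abs ?normD_ge0// -sqrte_sqr /norm_grad lee_sqrt; last by apply: sume_ge0.
rewrite (big_rem v vb)/=; apply: leeDl.
by apply: sume_ge0 => i _; exact: expe2_ge0.
Qed.

Lemma norm_grad_le (basis : seq P) f (c : R) : (size basis <= 4)%N -> 0 <= c ->
  (forall v, v \in basis -> (normD (cst 1%R) v f <= c%:E)%E) -> (norm_grad basis f <= (2 * c)%:E)%E.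
Proof.
move=> s4 c0 H; have c2 : 0 <= 2 * c by rewrite mulr_ge0.
rewrite -[leRHS]gee0_abs ?lee_fin// -sqrte_sqr /norm_grad lee_sqrt// big_seq.
apply: le_trans (lee_sum (g := fun=> (c ^+ 2)%:E) _ _) _.
  move=> v vb; rewrite EFin_expe lee_sqr ?lee_fin ?normD_ge0//; exact: H.
rewrite -big_seq sumEFin -EFin_expe lee_fin big_const_seq count_predT iter_addr_0 -[leLHS]mulr_natl.
rewrite (_ : (2 * c) ^+ 2 = 4 * c ^+ 2); last by ring.
by rewrite ler_wpM2r ?sqr_ge0// ler_nat.
Qed.

(** The Boolean selects the pair (x1, x3) or (x2, x4): [vel] is the relative direction and [com] the
    common one; d_3 or d_4 is half the sum of the two derivatives ([mom_split]). *)
Definition vel (e : bool) : P := if e then ex3 - ex1 else ex4 - ex2.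
Definition com (e : bool) : P := if e then ex1 + ex3 else ex2 + ex4.
Definition mom (e : bool) : Z6 -> R := if e then kx3 else kx4.

Lemma mom_split b K : mom b K = 2^-1 * (ph K (vel b) + ph K (com b)).
Proof.
have [[b1 b2 b3 b4] _] := ph_basis R K.
by case: b; rewrite /mom /vel /com (raddfB (ph K)) (raddfD (ph K))/= ?b1 ?b2 ?b3 ?b4; field.
Qed.

Lemma difference_split e b a K : e \in directions ->
  difference e (mom b) a K = 2^-1 * (diff_coef e (vel b) a K + ph K (com b) * a K - ph (K - e) (com b) * a (K - e)).
Proof. by move=> ed; rewrite /difference /diff_coef !mom_split; ring. Qed.

Lemma densE kap a K : dens kap a K =
  a K ^+ 2 + ph K ey1 ^+ 2 * a K ^+ 2 + ph K ey2 ^+ 2 * a K ^+ 2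
  + ph K (com true) ^+ 2 * a K ^+ 2 + ph K (com false) ^+ 2 * a K ^+ 2
  + (kap * ph K ex1 ^+ 2 * a K ^+ 2 + kap * ph K ex2 ^+ 2 * a K ^+ 2
     + kap * ph K ex3 ^+ 2 * a K ^+ 2 + kap * ph K ex4 ^+ 2 * a K ^+ 2)
  + (difference e13 (mom true) a K ^+ 2 + difference e13 (mom false) a K ^+ 2
     + difference e24 (mom true) a K ^+ 2 + difference e24 (mom false) a K ^+ 2).
Proof.
have [[b1 b2 b3 b4] [b5 b6]] := ph_basis R K.
rewrite /dens /directions /momenta !big_cons !big_nil /weight /com !raddfD/= b1 b2 b3 b4 b5 b6.
move: (difference _ _ _ _) (difference _ _ _ _) (difference _ _ _ _) (difference _ _ _ _) => d1 d2 d3 d4.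
by ring.
Qed.

Lemma sum_shift e (S : seq Z6) (F : Z6 -> R) (A : R) : uniq S ->
  (forall S : seq Z6, uniq S -> \sum_(K <- S) F K <= A) -> \sum_(K <- S) F (K - e) <= A.
Proof.
move=> uS H; have uS' : uniq [seq K - e | K <- S] by rewrite map_inj_uniq//; exact: addIr.
by have := H _ uS'; rewrite big_map.
Qed.

Definition pair_sum f (c : Z6 -> R) (S : seq Z6) := \sum_(K <- S) c K * (ca f K ^+ 2 + cb f K ^+ 2).

Lemma forward_difference f e b (S : seq Z6) (X Y : R) : e \in directions -> uniq S ->
  \sum_(K <- S) (diff_coef e (vel b) (ca f) K ^+ 2 + diff_coef e (vel b) (cb f) K ^+ 2) <= X ->
  (forall S : seq Z6, uniq S -> pair_sum f (fun K => ph K (com b) ^+ 2) S <= Y) ->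
  \sum_(K <- S) (difference e (mom b) (ca f) K ^+ 2 + difference e (mom b) (cb f) K ^+ 2) <= X + 2 * Y.
Proof.
move=> ed uS HX HY; have H1 := HY _ uS.
have H2 := sum_shift e uS HY; rewrite /pair_sum in H1.
apply: (@le_trans _ _ (\sum_(K <- S) ((diff_coef e (vel b) (ca f) K ^+ 2 + diff_coef e (vel b) (cb f) K ^+ 2)
   + (ph K (com b) ^+ 2 * (ca f K ^+ 2 + cb f K ^+ 2))
   + (ph (K - e) (com b) ^+ 2 * (ca f (K - e) ^+ 2 + cb f (K - e) ^+ 2))))); last first.
  rewrite !big_split/=; move: HX H1 H2; rewrite !big_split/=.
  by move: (\sum_(_ <- _) _) (\sum_(_ <- _) _) (\sum_(_ <- _) _) (\sum_(_ <- _) _) => *; lra.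
apply: ler_sum => K _; rewrite !difference_split//.
have h (x y z : R) : (2^-1 * (x + y - z)) ^+ 2 <= x ^+ 2 + y ^+ 2 + z ^+ 2.
  have := sqr_ge0 (x - y); have := sqr_ge0 (x + z); have := sqr_ge0 (y + z).
  have := sqr_ge0 x; have := sqr_ge0 y; have := sqr_ge0 z.
  by rewrite exprMn (_ : 2^-1 ^+ 2 = 1 / 4 :> R); [rewrite !expr2; lra|field].
rewrite [ph K (com b) ^+ 2 * _]mulrDr [ph (K - e) (com b) ^+ 2 * _]mulrDr -!exprMn.
have := h (diff_coef e (vel b) (ca f) K) (ph K (com b) * ca f K) (ph (K - e) (com b) * ca f (K - e)).
have := h (diff_coef e (vel b) (cb f) K) (ph K (com b) * cb f K) (ph (K - e) (com b) * cb f (K - e)).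
by move: (_ ^+ 2) (_ ^+ 2) (_ ^+ 2) (_ ^+ 2) (_ ^+ 2) (_ ^+ 2) (_ ^+ 2) (_ ^+ 2) => *; lra.
Qed.

Let le7 (a b c d e g h : \bar R) (H : R) : (0 <= a)%E -> (0 <= b)%E -> (0 <= c)%E -> (0 <= d)%E ->
  (0 <= e)%E -> (0 <= g)%E -> (0 <= h)%E -> (a + b + c + d + e + g + h < H%:E)%E ->
  [/\ (a < H%:E)%E, (b < H%:E)%E, (c < H%:E)%E & (d < H%:E)%E] /\
  [/\ (e < H%:E)%E, (g < H%:E)%E & (h < H%:E)%E].
Proof.
have st (x y : \bar R) : (0 <= x)%E -> (0 <= y)%E -> (x + y < H%:E)%E -> (x < H%:E)%E /\ (y < H%:E)%E.
  by move=> x0 y0 l; split; apply: le_lt_trans l; [exact: leeDl|exact: leeDr].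
move=> a0 b0 c0 d0 e0 g0 h0.
have ab := adde_ge0 a0 b0; have ac := adde_ge0 ab c0; have ad := adde_ge0 ac d0.
have ae := adde_ge0 ad e0; have ag := adde_ge0 ae g0.
move=> l; have [l6 lh] := st _ _ ag h0 l; have [l5 lg] := st _ _ ae g0 l6.
have [l4 le] := st _ _ ad e0 l5; have [l3 ld] := st _ _ ac d0 l4.
by have [l2 lc] := st _ _ ab c0 l3; have [la lb] := st _ _ a0 b0 l2.
Qed.

Lemma balanced_dirs : [/\ balanced (ey1 : P), balanced (ey2 : P), forall b, balanced (com b) & forall b, balanced (vel b)] /\
  forall v, v \in xbasis -> balanced (v : P).
Proof.
have B v : v \in xbasis ++ ybasis -> balanced (v : P) by exact: balanced_basis.
split; [split|].
- by apply: B; rewrite !inE eqxx !orbT.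
- by apply: B; rewrite !inE eqxx !orbT.
- by case; apply: balancedD; apply: B; rewrite !inE eqxx ?orbT.
- by case; apply: balancedB; apply: B; rewrite !inE eqxx ?orbT.
- by move=> v vb; apply: B; rewrite mem_cat vb.
Qed.

Let sum13 (S : seq Z6) (V : R) (f0 f1 f2 f3 f4 f5 f6 f7 f8 f9 f10 f11 f12 : Z6 -> R) : 0 <= V ->
  \sum_(K <- S) f0 K <= V -> \sum_(K <- S) f1 K <= V -> \sum_(K <- S) f2 K <= V ->
  \sum_(K <- S) f3 K <= V -> \sum_(K <- S) f4 K <= V -> \sum_(K <- S) f5 K <= V ->
  \sum_(K <- S) f6 K <= V -> \sum_(K <- S) f7 K <= V -> \sum_(K <- S) f8 K <= V ->
  \sum_(K <- S) f9 K <= 6 * V -> \sum_(K <- S) f10 K <= 6 * V ->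
  \sum_(K <- S) f11 K <= 6 * V -> \sum_(K <- S) f12 K <= 6 * V ->
  \sum_(K <- S) (f0 K + f1 K + f2 K + f3 K + f4 K + (f5 K + f6 K + f7 K + f8 K)
    + (f9 K + f10 K + f11 K + f12 K)) <= 33 * V.
Proof.
move=> V0 h0 h1 h2 h3 h4 h5 h6 h7 h8 h9 h10 h11 h12.
rewrite 6!big_split/= big_split/= big_split/= big_split/= big_split/= big_split/= big_split/=; lra.
Qed.

(** Nine unweighted terms contribute one unit each, and each of the four differences contributes 4
    from [forwardD] plus twice an unweighted term: 9 + 4 . 6 = 33. *)
Lemma forward_norm kap f (H : R) (S : seq Z6) : 0 <= kap -> sqi mu f -> (normH1 kap f < H%:E)%E -> uniq S ->
  \sum_(K <- S) (dens kap (ca f) K + dens kap (cb f) K) <= 33 * vol R * H ^+ 2.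
Proof.
move=> k0 fs; have g0 (b : seq P) : (0 <= norm_grad b f)%E by exact: sqrte_ge0.
have l0 : (0 <= normL2 f)%E by exact: Lnorm_ge0.
have gk : (0 <= (Num.sqrt kap)%:E * norm_grad xbasis f)%E by rewrite mule_ge0 ?lee_fin ?sqrtr_ge0.
case/(le7 l0 (g0 _) (normD_ge0 _ _ _) (normD_ge0 _ _ _) (normD_ge0 _ _ _) (normD_ge0 _ _ _) gk).
move=> [hL hy hc1 hc2] [hv1 hv2 hx] uS; have V0 := vol_gt0 R.
have H0 : 0 <= H by rewrite -lee_fin (le_trans l0)// ltW.
pose V := vol R * H ^+ 2; have VV : 0 <= V by rewrite mulr_ge0 ?sqr_ge0// ltW.
have F1 v (S' : seq Z6) : (normD (cst 1%R) v f < H%:E)%E -> uniq S' -> pair_sum f (fun K => ph K v ^+ 2) S' <= V.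
  move=> /normD_lt[G wG GH] uS'; apply: le_trans (forward1 fs wG uS') _.
  by rewrite /V ler_wpM2l// ltW.
have F0 : pair_sum f (fun=> 1) S <= V.
  rewrite /pair_sum; under eq_bigr do rewrite mul1r.
  apply: le_trans (bessel0 fs uS) _; rewrite /V ler_wpM2l ?(ltW V0)//.
  move: hL; rewrite normL2_sqrt// lte_fin => lt.
  by rewrite -[leLHS]sqr_sqrtr ?n2_ge0// ler_pXn2r// ?nnegrE ?sqrtr_ge0// ltW.
have Fy v : v \in ybasis -> pair_sum f (fun K => ph K v ^+ 2) S <= V.
  by move=> vb; exact: F1 (le_lt_trans (normD_le_grad f vb) hy) uS.
have Fx v : v \in xbasis -> pair_sum f (fun K => kap * ph K v ^+ 2) S <= V.
  (* For kap = 0 the norm says nothing about the x-gradient, which may be infinite; but then the sum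
     vanishes because of its factor kap. *)
  move=> vb; move: k0; rewrite le_eqVlt => /predU1P[<-|kp].
    by rewrite /pair_sum big1// => K _; rewrite !mul0r.
  have sk : 0 < Num.sqrt kap by rewrite sqrtr_gt0.
  have hx' : (norm_grad xbasis f < ((Num.sqrt kap)^-1 * H)%:E)%E by rewrite EFinM lte_pdivlMl.
  have /normD_lt[G wG GH] := le_lt_trans (normD_le_grad f vb) hx'.
  rewrite /pair_sum; under eq_bigr do rewrite -mulrA.
  rewrite -mulr_sumr; apply: le_trans (ler_wpM2l (ltW kp) (forward1 fs wG uS)) _.
  rewrite mulrCA /V ler_wpM2l ?(ltW V0)//; apply: le_trans (ler_wpM2l (ltW kp) GH) _.
  by rewrite exprMn exprVn sqr_sqrtr ?(ltW kp)// mulrA divff ?mul1r// lt0r_neq0.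
have Fd e b : e \in directions ->
    \sum_(K <- S) (difference e (mom b) (ca f) K ^+ 2 + difference e (mom b) (cb f) K ^+ 2) <= 6 * V.
  move=> ed; have hc : (normD (cst 1%R) (com b) f < H%:E)%E by case: b; [exact: hc1|exact: hc2].
  have hv b' : (normD (@dD R) (vel b') f < H%:E)%E by case: b'; [exact: hv1|exact: hv2].
  have [G wG GH] := normD_lt (hv b).
  apply: le_trans (forward_difference ed uS (forwardD fs wG ed uS) (fun S' uS' => F1 _ S' hc uS')) _.
  have := ler_wpM2l (ltW V0) GH; rewrite -/V (mulrC 4) -mulrA mulrCA.
  by move: (vol R * _) => x; lra.
have d1 : e13 \in directions by rewrite !inE eqxx.
have d2 : e24 \in directions by rewrite !inE eqxx orbT.
rewrite (_ : 33 * vol R * H ^+ 2 = 33 * V); last by rewrite /V; ring.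
have Fc b : pair_sum f (fun K => ph K (com b) ^+ 2) S <= V by apply: F1; [case: b; [exact: hc1|exact: hc2]|exact: uS].
have b1 : ex1 \in (xbasis : seq P) by rewrite !inE eqxx.
have b2 : ex2 \in (xbasis : seq P) by rewrite !inE eqxx ?orbT.
have b3 : ex3 \in (xbasis : seq P) by rewrite !inE eqxx ?orbT.
have b4 : ex4 \in (xbasis : seq P) by rewrite !inE eqxx ?orbT.
have b5 : ey1 \in (ybasis : seq P) by rewrite !inE eqxx.
have b6 : ey2 \in (ybasis : seq P) by rewrite !inE eqxx ?orbT.
apply: le_trans (sum13 VV F0 (Fy _ b5) (Fy _ b6) (Fc true) (Fc false) (Fx _ b1) (Fx _ b2) (Fx _ b3) (Fx _ b4)
  (Fd _ true d1) (Fd _ false d1) (Fd _ true d2) (Fd _ false d2)).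
rewrite le_eqVlt; apply/orP; left; apply/eqP; apply: eq_bigr => K _; rewrite !densE.
move: (difference e13 (mom true) (ca f) K) (difference e13 (mom false) (ca f) K) (difference e24 (mom true) (ca f) K)
  (difference e24 (mom false) (ca f) K) (difference e13 (mom true) (cb f) K) (difference e13 (mom false) (cb f) K)
  (difference e24 (mom true) (cb f) K) (difference e24 (mom false) (cb f) K) (ca f K) (cb f K) (ph K ey1) (ph K ey2)
  (ph K (com true)) (ph K (com false)) (ph K ex1) (ph K ex2) (ph K ex3) (ph K ex4) => *; ring.
Qed.

Lemma pair_dens kap f (c : Z6 -> R) (A : R) (S : seq Z6) : 0 <= kap ->
  (forall S : seq Z6, uniq S -> \sum_(K <- S) (dens kap (ca f) K + dens kap (cb f) K) <= A) ->
  (forall a K, c K * a K ^+ 2 <= dens kap a K) -> uniq S -> pair_sum f c S <= A.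
Proof.
move=> k0 HA Hc uS; apply: le_trans (HA _ uS); apply: ler_sum => K _.
by rewrite mulrDr lerD.
Qed.

Lemma backward_norm kap f (A : R) : 0 <= kap -> sqi mu f ->
  (forall S : seq Z6, uniq S -> \sum_(K <- S) (dens kap (ca f) K + dens kap (cb f) K) <= A) ->
  (normH1 kap f <= (17 * Num.sqrt (2 * A / vol R))%:E)%E.
Proof.
move=> k0 fs HA; have V0 := vol_gt0 R; set B := Num.sqrt _; have B0 : 0 <= B by exact: sqrtr_ge0.
have A0 : 0 <= A by have := HA [::] isT; rewrite big_nil.
have [[by1 by2 bc bv] bx] := balanced_dirs.
have le (a : Z6 -> R) K : [/\ 1 * a K ^+ 2 <= dens kap a K, ph K ey1 ^+ 2 * a K ^+ 2 <= dens kap a K,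
    ph K ey2 ^+ 2 * a K ^+ 2 <= dens kap a K & forall b, ph K (com b) ^+ 2 * a K ^+ 2 <= dens kap a K] /\
    (forall v, v \in xbasis -> kap * ph K v ^+ 2 * a K ^+ 2 <= dens kap a K) /\
    forall e b, e \in directions -> difference e (mom b) a K ^+ 2 <= dens kap a K.
  rewrite densE; have n0 := sqr_ge0 (a K).
  have p0 v : 0 <= ph K v ^+ 2 * a K ^+ 2 by rewrite mulr_ge0 ?sqr_ge0.
  have pk v : 0 <= kap * ph K v ^+ 2 * a K ^+ 2 by rewrite mulr_ge0 ?sqr_ge0// mulr_ge0 ?sqr_ge0.
  have q0 e b : 0 <= difference e (mom b) a K ^+ 2 by exact: sqr_ge0.
  move: (q0 e13 true) (q0 e13 false) (q0 e24 true) (q0 e24 false) (pk ex1) (pk ex2) (pk ex3) (pk ex4)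
    (p0 ey1) (p0 ey2) (p0 (com true)) (p0 (com false)) n0.
  rewrite mul1r => h1 h2 h3 h4 h5 h6 h7 h8 h9 h10 h11 h12 h13.
  split; [split|split]; try lra.
  - by case; lra.
  - by move=> v; rewrite !inE => /or4P[] /eqP ->; lra.
  - by move=> e b; rewrite !inE => /orP[] /eqP ->; case: b; lra.
have H1 v : balanced v -> (forall a K, ph K v ^+ 2 * a K ^+ 2 <= dens kap a K) -> (normD (cst 1%R) v f <= B%:E)%E.
  move=> bal lev; have [|G wG GA] := @backward1 _ v f A bal fs; last exact: normD_le wG GA.
  by move=> S uS; exact: (pair_dens k0 HA lev uS).
have H0 : (normL2 f <= B%:E)%E.
  rewrite normL2_sqrt// lee_fin ler_wsqrtr//; apply: parseval_le => // S uS.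
  have l1 (a : Z6 -> R) K : 1 * a K ^+ 2 <= dens kap a K by have [[h _ _ _] _] := le a K.
  have := pair_dens (c := fun=> 1) k0 HA l1 uS.
  by rewrite /pair_sum; under eq_bigr do rewrite mul1r.
have Hc b : (normD (cst 1%R) (com b) f <= B%:E)%E.
  by apply: H1; [exact: bc|move=> a K; have [[_ _ _ h] _] := le a K; exact: h].
have Hy : (norm_grad ybasis f <= (2 * B)%:E)%E.
  apply: (norm_grad_le _ B0) => [|v]; first by [].
  rewrite !inE => /orP[] /eqP ->; apply: H1 => [|a K]; [exact: by1| |exact: by2|];
  by have [[_ h1 h2 _] _] := le a K.
have Hv b : (normD (@dD R) (vel b) f <= (5 * B)%:E)%E.
  (* 16 = 8 + 4 + 4: the relative derivative is twice a momentum minus the common one, and the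
     common one enters at K and at K - e. *)
  have [|G wG GA] := @backwardD _ f (vel b) (16 * A) (bv b) fs.
    move=> e S ed uS.
    have hc S' : uniq S' -> pair_sum f (fun K => ph K (com b) ^+ 2) S' <= A.
      by move=> uS'; apply: (pair_dens k0 HA _ uS') => a K; have [[_ _ _ h] _] := le a K.
    have h2 := hc _ uS; have h3 := sum_shift e uS hc.
    have h1 : \sum_(K <- S) (difference e (mom b) (ca f) K ^+ 2 + difference e (mom b) (cb f) K ^+ 2) <= A.
      apply: le_trans (HA _ uS); apply: ler_sum => K _.
      by apply: lerD; [have [_ [_ h]] := le (ca f) K|have [_ [_ h]] := le (cb f) K]; exact: h.
    apply: (@le_trans _ _ (\sum_(K <- S) (8 * (difference e (mom b) (ca f) K ^+ 2 + difference e (mom b) (cb f) K ^+ 2)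
       + 4 * (ph K (com b) ^+ 2 * (ca f K ^+ 2 + cb f K ^+ 2))
       + 4 * (ph (K - e) (com b) ^+ 2 * (ca f (K - e) ^+ 2 + cb f (K - e) ^+ 2))))); last first.
      rewrite big_split/= big_split/= -!mulr_sumr; rewrite /pair_sum in h2.
      by move: h1 h2 h3; move: (\sum_(_ <- _) _) (\sum_(_ <- _) _) (\sum_(_ <- _) _) => *; lra.
    apply: ler_sum => K _.
    have h (x y z d : R) : d = 2^-1 * (x + y - z) -> x ^+ 2 <= 8 * d ^+ 2 + 4 * y ^+ 2 + 4 * z ^+ 2.
      move=> ->; rewrite exprMn (_ : 2^-1 ^+ 2 = 1 / 4 :> R); last by field.
      have := sqr_ge0 (x + 2 * (y - z)); have := sqr_ge0 (y + z); rewrite !expr2; lra.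
    have := h _ _ _ _ (difference_split b (ca f) K ed); have := h _ _ _ _ (difference_split b (cb f) K ed).
    by rewrite !exprMn !mulrDr; lra.
  apply: le_trans (normD_le wG GA) _; rewrite lee_fin.
  rewrite (_ : 2 * (16 * A) / vol R = 4 ^+ 2 * (2 * A / vol R)); last by ring.
  rewrite sqrtrM ?sqr_ge0// sqrtr_sqr ger0_norm// -/B; lra.
have Hx : ((Num.sqrt kap)%:E * norm_grad xbasis f <= (2 * B)%:E)%E.
  move: (k0); rewrite le_eqVlt => /predU1P[kE|kp].
    by rewrite -kE sqrtr0 mul0e lee_fin mulr_ge0.
  have sk : 0 < Num.sqrt kap by rewrite sqrtr_gt0.
  apply: (@le_trans _ _ ((Num.sqrt kap)%:E * (2 * (B / Num.sqrt kap))%:E)%E); last first.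
    by rewrite -EFinM lee_fin le_eqVlt; apply/orP; left; apply/eqP; field; rewrite lt0r_neq0.
  apply: lee_wpmul2l; first by rewrite lee_fin ltW.
  have Bk : 0 <= B / Num.sqrt kap by rewrite divr_ge0// ltW.
  apply: (norm_grad_le _ Bk) => [|v vb]; first by [].
 have [|G wG GA] := @backward1 _ v f (A / kap) (bx v vb) fs.
    move=> S uS; rewrite ler_pdivlMr// mulr_suml.
    have lev (a : Z6 -> R) K : kap * ph K v ^+ 2 * a K ^+ 2 <= dens kap a K by have [_ [h _]] := le a K; exact: h.
    apply: le_trans (pair_dens k0 HA lev uS); rewrite le_eqVlt; apply/orP; left; apply/eqP.
    by apply: eq_bigr => K _; ring.
  apply: le_trans (normD_le wG GA) _; rewrite lee_fin.
  rewrite (_ : 2 * (A / kap) / vol R = (2 * A / vol R) * kap^-1); last by ring.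
  rewrite sqrtrM; last by rewrite divr_ge0 ?mulr_ge0// ltW.
  by rewrite (sqrtrV (ltW kp)).
rewrite /normH1.
(* One summand for each term of the norm; gradients cost a factor 2 by [norm_grad_le], and weighted
   derivatives a factor 4, rounded up to 5. *)
have -> : 17 * B = B + 2 * B + B + B + 5 * B + 5 * B + 2 * B by ring.
rewrite !EFinD.
exact: (leeD (leeD (leeD (leeD (leeD (leeD H0 Hy) (Hc true)) (Hc false)) (Hv true)) (Hv false)) Hx).
Qed.
End NormEquivalence.

(** * Fourier coefficients of a solution *)

Section Dynamics.
Variable R : realType.
Notation P := (point6 R).
Notation mR := (measurableTypeR R).
Notation mP := (point6 mR).
Notation mu := (muT6 R).
Implicit Types (K L e : Z6) (z v w : P) (f g G : mP -> R).

Let w10 : Z6 := vu (1, 0).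
Let w01 : Z6 := vu (0, 1).
Let p10 : Z6 := vp (1, 0).
Let p01 : Z6 := vp (0, 1).

(** Row K of the generator as coefficients and frequencies. The same list describes the adjoint
    applied to the cosine or the sine of frequency K. *)
Definition gen_list (kap nu : R) K : seq (R * Z6) :=
  [:: (- (2^-1 * kx1 K), K - w01); (2^-1 * kx1 K, K + w01); (- (2^-1 * kx2 K), K - w10); (2^-1 * kx2 K, K + w10);
      (- (2^-1 * kx3 K), K - p01); (2^-1 * kx3 K, K + p01); (- (2^-1 * kx4 K), K - p10); (2^-1 * kx4 K, K + p10);
      (- (kap * (kx1 K ^+ 2 + kx2 K ^+ 2 + kx3 K ^+ 2 + kx4 K ^+ 2) + nu * (ky1 K ^+ 2 + ky2 K ^+ 2)), K)].

Lemma genc_list kap nu a K : genc kap nu a K = \sum_(j <- gen_list kap nu K) j.1 * a j.2.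
Proof.
rewrite !big_cons big_nil /genc /Tc /Lc !au_shift !ap_shift /=.
have -> : vu (0, -1) = - w01 :> Z6 by [].
have -> : vu (-1, 0) = - w10 :> Z6 by [].
have -> : vp (0, -1) = - p01 :> Z6 by [].
have -> : vp (-1, 0) = - p10 :> Z6 by [].
rewrite !opprK -/w01 -/w10 -/p01 -/p10 /au /ap /=.
have -> : (-1)%:~R = -1 :> R by [].
have -> : 1%:~R = 1 :> R by [].
have -> : 0%:~R = 0 :> R by [].
move: (a _) (a _) (a _) (a _) (a _) (a _) (a _) (a _) (a _) (kx1 K) (kx2 K) (kx3 K) (kx4 K) (ky1 K) (ky2 K) => *.
by field.
Qed.

Lemma sum_gen_list kap nu K (F : Z6 -> R) : \sum_(j <- gen_list kap nu K) j.1 * F j.2 =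
  2^-1 * (kx1 K * (F (K + w01) - F (K - w01)) + kx2 K * (F (K + w10) - F (K - w10))
        + kx3 K * (F (K + p01) - F (K - p01)) + kx4 K * (F (K + p10) - F (K - p10)))
  - (kap * (kx1 K ^+ 2 + kx2 K ^+ 2 + kx3 K ^+ 2 + kx4 K ^+ 2) + nu * (ky1 K ^+ 2 + ky2 K ^+ 2)) * F K.
Proof.
rewrite !big_cons big_nil /=.
move: (F _) (F _) (F _) (F _) (F _) (F _) (F _) (F _) (F _) (kx1 K) (kx2 K) (kx3 K) (kx4 K) (ky1 K) (ky2 K) => *.
by field.
Qed.

Lemma velocities : [/\ @u1 R = sinK w01, @u2 R = sinK w10, @u3 R = sinK p01 & @u4 R = sinK p10].
Proof.
split; apply/funext => z; rewrite /u1 /u2 /u3 /u4 /sinK; congr sin;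
by rewrite /ph /w01 /w10 /p01 /p10 /vu /vp /kx1 /kx2 /kx3 /kx4 /ky1 /ky2 /= ?mulrN1z; ring.
Qed.

Let derive_u v (F : P -> R) z : differentiable F z -> forall L, ph L v = 0 :> R ->
  'D_v (fun z' => sinK L z' * F z') z = sinK L z * 'D_v F z.
Proof.
move=> dF L L0; rewrite (deriveM (diff_derivable (differentiable_sinK L z)) (diff_derivable dF)).
by rewrite derive_sinK L0 mul0r /GRing.scale/= mulr0 addr0.
Qed.

Let incompressible : [/\ ph w01 ex1 = 0 :> R, ph w10 ex2 = 0 :> R, ph p01 ex3 = 0 :> R & ph p10 ex4 = 0 :> R].
Proof.
have [[a1 _ _ _] _] := ph_basis R w01; have [[_ a2 _ _] _] := ph_basis R w10.
have [[_ _ a3 _] _] := ph_basis R p01; have [[_ _ _ a4] _] := ph_basis R p10.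
by split; rewrite ?a1 ?a2 ?a3 ?a4.
Qed.

Let derive2 v (F G : P -> R) (c : R) z : 'D_v F = (fun z => c * G z) -> derivable G z v ->
  'D_v ('D_v F) z = c * 'D_v G z.
Proof. by move=> -> dG; rewrite (deriveZ c dG). Qed.

Let derive2_cosK K v z : 'D_v ('D_v (cosK K)) z = - (ph K v ^+ 2 * cosK K z).
Proof.
rewrite (@derive2 v (cosK K) (sinK K) (- ph K v)); last exact: diff_derivable (differentiable_sinK K z).
  by rewrite derive_sinK; ring.
by apply/funext => w; rewrite derive_cosK.
Qed.
Let derive2_sinK K v z : 'D_v ('D_v (sinK K)) z = - (ph K v ^+ 2 * sinK K z).
Proof.
rewrite (@derive2 v (sinK K) (cosK K) (ph K v)); last exact: diff_derivable (differentiable_cosK K z).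
  by rewrite derive_cosK; ring.
by apply/funext => w; rewrite derive_sinK.
Qed.

(** Each component of u is independent of its own coordinate, and the sine from differentiating a
    cosine combines with the sine in u to cosines. The sine of frequency K gives the same real
    coefficients ([adjoint_sinK]), so [ca] and [cb] solve the same system. *)
Lemma adjoint_cosK kap nu K z : adjoint kap nu (cosK K) z = \sum_(j <- gen_list kap nu K) j.1 * cosK j.2 z.
Proof.
have [U1 U2 U3 U4] := velocities; have [I1 I2 I3 I4] := incompressible.
have [[b1 b2 b3 b4] [b5 b6]] := ph_basis R K.
rewrite (sum_gen_list kap nu K (fun L => cosK L z)) /adjoint U1 U2 U3 U4.
rewrite (derive_u (differentiable_cosK K z) I1) (derive_u (differentiable_cosK K z) I2).
rewrite (derive_u (differentiable_cosK K z) I3) (derive_u (differentiable_cosK K z) I4).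
rewrite (eq_bigr (fun v => - (ph K v ^+ 2 * cosK K z))); last by move=> v _; exact: derive2_cosK.
rewrite [in X in _ + X](eq_bigr (fun v => - (ph K v ^+ 2 * cosK K z))); last by move=> v _; exact: derive2_cosK.
rewrite /xbasis /ybasis !big_cons !big_nil !derive_cosK b1 b2 b3 b4 b5 b6.
rewrite !(trig_shift K w01) !(trig_shift K w10) !(trig_shift K p01) !(trig_shift K p10).
move: (cosK K z) (sinK K z) (cosK w01 z) (cosK w10 z) (cosK p01 z) (cosK p10 z) (sinK w01 z) (sinK w10 z) (sinK p01 z) (sinK p10 z)
  (kx1 K) (kx2 K) (kx3 K) (kx4 K) (ky1 K) (ky2 K) => *.
by field.
Qed.
Lemma adjoint_sinK kap nu K z : adjoint kap nu (sinK K) z = \sum_(j <- gen_list kap nu K) j.1 * sinK j.2 z.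
Proof.
have [U1 U2 U3 U4] := velocities; have [I1 I2 I3 I4] := incompressible.
have [[b1 b2 b3 b4] [b5 b6]] := ph_basis R K.
rewrite (sum_gen_list kap nu K (fun L => sinK L z)) /adjoint U1 U2 U3 U4.
rewrite (derive_u (differentiable_sinK K z) I1) (derive_u (differentiable_sinK K z) I2).
rewrite (derive_u (differentiable_sinK K z) I3) (derive_u (differentiable_sinK K z) I4).
rewrite (eq_bigr (fun v => - (ph K v ^+ 2 * sinK K z))); last by move=> v _; exact: derive2_sinK.
rewrite [in X in _ + X](eq_bigr (fun v => - (ph K v ^+ 2 * sinK K z))); last by move=> v _; exact: derive2_sinK.
rewrite /xbasis /ybasis !big_cons !big_nil !derive_sinK b1 b2 b3 b4 b5 b6.
rewrite !(trig_shift K w01) !(trig_shift K w10) !(trig_shift K p01) !(trig_shift K p10).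
move: (cosK K z) (sinK K z) (cosK w01 z) (cosK w10 z) (cosK p01 z) (cosK p10 z) (sinK w01 z) (sinK w10 z) (sinK p01 z) (sinK p10 z)
  (kx1 K) (kx2 K) (kx3 K) (kx4 K) (ky1 K) (ky2 K) => *.
by field.
Qed.

Lemma I_adjoint kap nu f K : sqi mu f ->
  I mu (fun z => f z * adjoint kap nu (cosK K) z) = genc kap nu (ca f) K /\
  I mu (fun z => f z * adjoint kap nu (sinK K) z) = genc kap nu (cb f) K.
Proof.
move=> fs; have [E1 E2] := I_comb (gen_list kap nu K) (sqi_intg fs); rewrite !genc_list -E1 -E2.
by split; apply: eqIg => z; rewrite ?adjoint_cosK ?adjoint_sinK.
Qed.

Section Solution.
Variables (kap nu : R) (f0 : P -> R) (f : R -> P -> R).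
Hypothesis sol : solution kap nu f0 f.

Let fs t : 0 <= t -> sqi mu (f t). Proof. by move=> t0; apply/Lfun_sqi; case: sol => h _ _ _; exact: h. Qed.

Lemma coef_ode K (t : R) : 0 < t ->
  is_derive t 1 (fun s => ca (f s) K) (genc kap nu (ca (f t)) K) /\
  is_derive t 1 (fun s => cb (f s) K) (genc kap nu (cb (f t)) K).
Proof.
move=> t0; have [_ _ _ ode] := sol; have [<- <-] := I_adjoint kap nu K (fs (ltW t0)).
split; [exact: (ode _ (alg_test ltr01 (alg_cos _ K)) t t0)|exact: (ode _ (alg_test ltr01 (alg_sin _ K)) t t0)].
Qed.

Let dist t s := n2 mu (fun z => f s z - f t z).

Let dist_cvg (t : R) : 0 <= t -> Num.sqrt (dist t s) @[s --> within [set s : R | 0 <= s] (nbhs t)] --> (0 : R).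
Proof.
move=> t0; have [_ ct _ _] := sol; have H : fine (normL2 (f s \- f t)) @[s --> within [set s : R | 0 <= s] (nbhs t)] --> (0 : R).
  exact: (fine_cvg (ct t t0)).
apply: cvg_trans H.
apply: near_eq_cvg; rewrite near_withinE; apply: nearW => s s0 /=.
have ds : sqi mu (fun z => f s z - f t z) by apply: sqiB; exact: fs.
by rewrite /dist (normL2_sqrt (f := f s \- f t) ds).
Qed.

Let squeeze_within (F D : R -> R) (c t : R) : 0 <= t ->
  D s @[s --> within [set s : R | 0 <= s] (nbhs t)] --> (0 : R) ->
  (forall s, 0 <= s -> `|F s - F t| <= c * D s) ->
  F s @[s --> within [set s : R | 0 <= s] (nbhs t)] --> F t.
Proof.
move=> t0 D0 H.
have c1 : F t - c * D s @[s --> within [set s : R | 0 <= s] (nbhs t)] --> F t.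
  rewrite -[X in _ --> X]subr0 -[X in _ - X](mulr0 c).
  by apply: cvgB; [exact: cvg_cst|apply: cvgM; [exact: cvg_cst|exact: D0]].
have c2 : F t + c * D s @[s --> within [set s : R | 0 <= s] (nbhs t)] --> F t.
  rewrite -[X in _ --> X]addr0 -[X in _ + X](mulr0 c).
  by apply: cvgD; [exact: cvg_cst|apply: cvgM; [exact: cvg_cst|exact: D0]].
apply: (squeeze_cvgr _ c1 c2); rewrite near_withinE; apply: nearW => s s0.
by have := H s s0; rewrite ler_norml => /andP[h1 h2]; apply/andP; split; lra.
Qed.

Let coef_dist (phi : mP -> R) t s : bmf phi -> 0 <= t -> 0 <= s ->
  `|I mu (fun z => f s z * phi z) - I mu (fun z => f t z * phi z)| <= Num.sqrt (n2 mu phi) * Num.sqrt (dist t s).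
Proof.
move=> bp t0 s0; have ss := fs s0; have ts := fs t0.
rewrite -IB; [|exact: intg_bmf (sqi_intg ss) bp|exact: intg_bmf (sqi_intg ts) bp].
rewrite (@eqIg _ _ (fun z => (f s z - f t z) * phi z)); last by move=> z; ring.
rewrite -sqrtrM ?n2_ge0// -sqrtr_sqr ler_wsqrtr// mulrC.
exact: CS (sqiB ss ts) (bmf_sqi mu bp).
Qed.

Lemma coef_continuous K (t : R) : 0 <= t ->
  ca (f s) K @[s --> within [set s : R | 0 <= s] (nbhs t)] --> ca (f t) K /\
  cb (f s) K @[s --> within [set s : R | 0 <= s] (nbhs t)] --> cb (f t) K.
Proof.
move=> t0; split.
- apply: (squeeze_within (F := fun s => ca (f s) K) t0 (dist_cvg t0)) => s s0.
  exact: (coef_dist (alg_bmf (alg_cos _ K)) t0 s0).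
- apply: (squeeze_within (F := fun s => cb (f s) K) t0 (dist_cvg t0)) => s s0.
  exact: (coef_dist (alg_bmf (alg_sin _ K)) t0 s0).
Qed.

Let n2_continuous (t : R) : 0 <= t ->
  n2 mu (f s) @[s --> within [set s : R | 0 <= s] (nbhs t)] --> n2 mu (f t).
Proof.
move=> t0; pose c := Num.sqrt (n2 mu (f t)).
apply: (squeeze_within (F := fun s => n2 mu (f s)) (c := 1)
  (D := fun s => Num.sqrt (dist t s) * Num.sqrt (dist t s) + 2 * c * Num.sqrt (dist t s)) t0).
  rewrite -[X in _ --> X]addr0 -[X in _ --> X + _](mulr0 0) -[X in _ --> _ + X](mulr0 (2 * c)).
  apply: cvgD; first by apply: cvgM; exact: dist_cvg.
  by apply: cvgM; [exact: cvg_cst|exact: dist_cvg].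
move=> s s0; have ss := fs s0; have ts := fs t0; have ds := sqiB ss ts.
rewrite -expr2 sqr_sqrtr ?n2_ge0// mul1r.
have := n2D ds ts; rewrite (_ : (fun x => _) = f s); last by apply/funext => z; ring.
rewrite -/(dist t s) => ->; have cs : `|I mu (fun x => (f s x - f t x) * f t x)| <= c * Num.sqrt (dist t s).
  by rewrite /c -sqrtrM ?n2_ge0// -sqrtr_sqr ler_wsqrtr// mulrC; exact: CS.
have d0 : 0 <= dist t s by exact: n2_ge0.
rewrite addrK; apply: le_trans (ler_normD _ _) _; rewrite ger0_norm// lerD2l normrM ger0_norm// -mulrA ler_wpM2l//.
Qed.

Lemma coef_bounded (t : R) : 0 <= t -> exists M : R, forall (s : R) (S : seq Z6), 0 <= s <= t -> uniq S ->
  \sum_(K <- S) (ca (f s) K ^+ 2 + cb (f s) K ^+ 2) <= M.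
Proof.
(* The positive part of s; composing with it extends the curve continuously to the whole line before
   the extreme value theorem is used. *)
move=> t0; pose pos (s : R) := 2^-1 * (s + `|s|).
have pos0 s : 0 <= pos s by rewrite /pos mulr_ge0//; have := ler_norm (- s); rewrite normrN; lra.
have posE s : 0 <= s -> pos s = s by move=> s0; rewrite /pos ger0_norm//; field.
have cpos (s : R) : pos x @[x --> s] --> pos s.
  by apply: cvgM; [exact: cvg_cst|apply: cvgD; [exact: cvg_id|apply: cvg_norm; exact: cvg_id]].
have cF : continuous (fun s : R => n2 mu (f (pos s))).
  move=> s; have := n2_continuous (pos0 s); apply: cvg_comp.
  move=> A HA; have H2 : nbhs s (pos @^-1` (fun x => 0 <= x -> A x)) := cpos s _ HA.
  change (nbhs s (pos @^-1` A)); apply: filterS H2 => x /= h; apply: (h _); exact: pos0.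
have [c _ Hc] := EVT_max t0 (continuous_subspaceT cF).
exists (vol R * n2 mu (f (pos c))) => s S /andP[s0 st] uS.
apply: le_trans (bessel0 (fs s0) uS) _; rewrite ler_wpM2l ?(ltW (vol_gt0 R))//.
by have := Hc s; rewrite in_itv/= s0 st posE// => /(_ isT).
Qed.
End Solution.

(** For [K.1] = 0 the character depends on y alone, and Fubini's theorem integrates f over x
    first. *)
Lemma zero_average_coef f K : sqi mu f -> zero_x_average f -> K.1 = 0 -> ca f K = 0 /\ cb f K = 0.
Proof.
move=> fs fz K1.
have main (c : mR * mR -> R) : bmf (fun z : mP => c z.2) -> I mu (fun z => f z * c z.2) = 0.
  move=> bcz; have Fi : intg mu (fun z => f z * c z.2) by exact: intg_bmf (sqi_intg fs) bcz.
  have fi := sqi_intg fs.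
  have E := @integral21_prod_meas1 _ _ _ _ _ (muT4 R) (muT2 R) _ Fi.
  have EI := EFin_I Fi.
  have inj (x y : R) : x%:E = y%:E -> x = y by case.
  apply: inj; rewrite [LHS]EI; rewrite -[LHS]E.
  transitivity (\int[muT2 R]_y (cst 0%E : mR * mR -> \bar R) y)%E; last by rewrite integral0.
  apply: ae_eq_integral => //.
    exact: (measurable_fubini_G (m1 := muT4 R) (m2 := muT2 R) Fi).
  have ai := ae_integrable2 (m1 := muT4 R) (m2 := muT2 R) fi.
  apply: filterS2 ai fz => y iy zy _.
  rewrite /fubini_G /=.
  have iy' : intg (muT4 R) (fun x => f (x, y)) by exact: iy.
  have := EFin_I (intgZ (c y) iy'); rewrite IZ// (_ : I (muT4 R) _ = 0) ?mulr0; last exact: zy.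
  by move=> E3; apply: (etrans _ (esym E3)); apply: eq_integral => x _; rewrite /= mulrC.
have cK z : cosK K z = cos (ky1 K * z.2.1 + ky2 K * z.2.2).
  by rewrite /cosK /ph /kx1 /kx2 /kx3 /kx4 K1 /= !mul0r !add0r.
have sK z : sinK K z = sin (ky1 K * z.2.1 + ky2 K * z.2.2).
  by rewrite /sinK /ph /kx1 /kx2 /kx3 /kx4 K1 /= !mul0r !add0r.
split.
- rewrite /ca (@eqIg _ _ (fun z => f z * cos (ky1 K * z.2.1 + ky2 K * z.2.2))); last by move=> z; rewrite cK.
  apply: (main (fun y => cos (ky1 K * y.1 + ky2 K * y.2))).
  rewrite (_ : (fun z : mP => _) = cosK K); first exact/alg_bmf/alg_cos.
  by apply/funext => z; exact/esym/cK.
- rewrite /cb (@eqIg _ _ (fun z => f z * sin (ky1 K * z.2.1 + ky2 K * z.2.2))); last by move=> z; rewrite sK.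
  apply: (main (fun y => sin (ky1 K * y.1 + ky2 K * y.2))).
  rewrite (_ : (fun z : mP => _) = sinK K); first exact/alg_bmf/alg_sin.
  by apply/funext => z; exact/esym/sK.
Qed.
End Dynamics.

Theorem theorem2p1 (R : realType) :
  exists nu0 : R, 1 < nu0 /\
  forall nu : R, nu0 < nu ->
  exists lambda C : R, 0 < lambda /\ 1 <= C /\
  forall kappa : R, 0 <= kappa ->
  forall (f0 : point6 R -> R) (f : R -> point6 R -> R),
    solution kappa nu f0 f ->
    (forall t : R, 0 <= t -> zero_x_average (f t)) ->
  forall t : R, 0 <= t ->
    (normH1 kappa (f t) <= (C * expR (- (lambda * t)))%:E * normH1 kappa f0)%E.
Proof.
have K1 : 1 <= Kc R by exact: Kc_ge1.
(* [Kc R ^+ 8] is the threshold of the functional; adding 1 makes it larger than 1. *)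
exists (Kc R ^+ 8 + 1); split; first by have := exprn_ege1 8 K1; lra.
move=> nu hnu; have nuK : Kc R ^+ 8 <= nu by lra.
have [C1 C11 decay] := sequence_decay nuK.
have l0 := lam0_gt0 nuK; have V0 := vol_gt0 R.
(* 132 = 2 . 2 . 33: cosine and sine sums, the factor 2 in [backward_norm], and the constant of
   [forward_norm]. *)
pose D := Num.sqrt (132 * C1); have D1 : 1 <= D.
  by rewrite -[1]sqrtr1 ler_wsqrtr//; lra.
(* Squares decay at the rate [lam0 nu / 2], hence the norm at half of it. *)
exists (lam0 nu / 4), (17 * D); split; first by rewrite divr_gt0.
split; first by lra.
move=> kap k0 f0 f sol fz t t0.
have [fL _ f00 _] := sol.
have fs s : 0 <= s -> sqi (muT6 R) (f s) by move=> s0; apply/Lfun_sqi; exact: fL.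
have c0 : 0 < 17 * D * expR (- (lam0 nu / 4 * t)) by rewrite mulr_gt0 ?expR_gt0//; lra.
(* A number above the norm replaces the norm, because the infimum in [normD] yields a weak
   derivative only below a strict bound. *)
have step (H : R) : (normH1 kap f0 < H%:E)%E ->
    (normH1 kap (f t) <= (17 * D * expR (- (lam0 nu / 4 * t)) * H)%:E)%E.
  move=> hH; rewrite -f00 in hH.
  have FW S := forward_norm k0 (fs 0 (lexx 0)) hH (S := S).
  have H0 : 0 <= H.
    rewrite -lee_fin; apply: le_trans (ltW hH).
    rewrite /normH1 !adde_ge0 ?normD_ge0 ?sqrte_ge0 ?Lnorm_ge0//.
    by rewrite mule_ge0 ?lee_fin ?sqrtr_ge0 ?sqrte_ge0.
  pose B := C1 * expR (- (lam0 nu / 2) * t) * (33 * vol R * H ^+ 2).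
  have dn a K := @dens_ge0 R kap a K k0.
  have da S : uniq S -> \sum_(K <- S) dens kap (ca (f t)) K <= B.
    move=> uS; apply: (decay kap k0 (fun s => ca (f s)) _ _ _ _ _ _ t t0 S uS).
    - by move=> s s0 K Kz; exact: (zero_average_coef (fs s s0) (fz s s0) Kz).1.
    - by move=> K s s0; exact: (coef_continuous sol K s0).1.
    - by move=> K s s0; exact: (coef_ode sol K s0).1.
    - move=> s s0; have [M HM] := coef_bounded sol s0; exists M => r S' rs uS'.
      by apply: le_trans (HM r S' rs uS'); apply: ler_sum => K _; rewrite lerDl sqr_ge0.
    - by move=> S' uS'; apply: le_trans (FW S' uS'); apply: ler_sum => K _; rewrite lerDl.
  have db S : uniq S -> \sum_(K <- S) dens kap (cb (f t)) K <= B.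
    move=> uS; apply: (decay kap k0 (fun s => cb (f s)) _ _ _ _ _ _ t t0 S uS).
    - by move=> s s0 K Kz; exact: (zero_average_coef (fs s s0) (fz s s0) Kz).2.
    - by move=> K s s0; exact: (coef_continuous sol K s0).2.
    - by move=> K s s0; exact: (coef_ode sol K s0).2.
    - move=> s s0; have [M HM] := coef_bounded sol s0; exists M => r S' rs uS'.
      by apply: le_trans (HM r S' rs uS'); apply: ler_sum => K _; rewrite lerDr sqr_ge0.
    - by move=> S' uS'; apply: le_trans (FW S' uS'); apply: ler_sum => K _; rewrite lerDr.
  have dab S : uniq S -> \sum_(K <- S) (dens kap (ca (f t)) K + dens kap (cb (f t)) K) <= 2 * B.
    by move=> uS; rewrite big_split/=; have := da S uS; have := db S uS; lra.
  apply: le_trans (backward_norm k0 (fs t t0) dab) _; rewrite lee_fin.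
  have -> : 2 * (2 * B) / vol R = 132 * C1 * expR (- (lam0 nu / 2) * t) * H ^+ 2.
    by rewrite /B; field; rewrite lt0r_neq0.
  have -> : expR (- (lam0 nu / 2) * t) = expR (- (lam0 nu / 4 * t)) ^+ 2.
    by rewrite expr2 -expRD; congr expR; field.
  rewrite -mulrA -exprMn sqrtrM; last by rewrite mulr_ge0//; lra.
  rewrite sqrtr_sqr ger0_norm; last by rewrite mulr_ge0 ?expR_ge0.
  by rewrite -/D !mulrA.
case E : (normH1 kap f0) => [r| |].
(* H approaches the initial norm; the quantity added to it becomes e after multiplication by the
   constant. *)
- apply/lee_addgt0Pr => e e0; rewrite -EFinM -EFinD.
  have := step (r + e / (17 * D * expR (- (lam0 nu / 4 * t)))).
  rewrite E lte_fin ltrDl divr_gt0// => /(_ isT); rewrite mulrDr mulrCA divff ?mulr1//.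
  exact: lt0r_neq0.
- by rewrite mulry gtr0_sg// mul1e leey.
- exfalso; have : (0 <= normH1 kap f0)%E.
    rewrite /normH1 !adde_ge0 ?normD_ge0 ?sqrte_ge0 ?Lnorm_ge0//.
    by rewrite mule_ge0 ?lee_fin ?sqrtr_ge0 ?sqrte_ge0.
  by rewrite E.
Qed.
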